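(* Let $\mathcal L$ be a lamination by Riemann surfaces of a compact space $X$ having no vanishing cycle. Then $\mathcal L$ is projective if and only if it possesses a divisor meeting all the leaves.
   Context: Compact spaces are Hausdorff. A lamination by Riemann surfaces $\mathcal L$ of a space $X$ is a maximal atlas of homeomorphisms $\varphi:U\to \mathbb D\times T$ from open sets $U$ covering $X$ onto the product of the unit disc $\mathbb D\subset\mathbb{C}$ with a topological space $T$, such that the changes of charts have the form $(z,t)\mapsto(z'(z,t),t'(t))$ with $z'$ holomorphic in $z$. The leaves are the Riemann surfaces obtained by gluing the plaques $\mathbb D\times\{t\}$. Holomorphic functions on open sets of $X$ are the continuous complex functions holomorphic along the leaves. Vanishing cycle: a loop contained in a leaf, not homotopic to a point in its leaf, which is a uniform limit of loops contained in nearby leaves that are homotopic to a point in their leaf. Projective: $\mathcal L$ is projective if the continuous maps $\pi:X\to\mathbb{C}P^N$ ($N$ arbitrary) whose restriction to every leaf is a holomorphic immersion separate the points of $X$. Divisor: a closed subset $\mathcal D\subset X$ together with a function $m:\mathcal D\to\mathbb{N}^*$ such that in a neighbourhood $\mathcal V$ of every point of $\mathcal D$ there is a holomorphic function $f:\mathcal V\to\mathbb{C}$, vanishing identically on no leaf of $\mathcal V$, with $\mathcal D\cap\mathcal V=f^{-1}(0)$ and such that the multiplicity of vanishing of $f$ along the leaf at each $t\in\mathcal D\cap\mathcal V$ equals $m(t)$. *)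

(* Defs.v *)
From HB Require Import structures.
From mathcomp Require Import all_boot all_order all_algebra generic_quotient.
From mathcomp Require Import complex.
From mathcomp Require Import all_classical all_reals all_analysis.
Import Order.TTheory GRing.Theory Num.Theory.
Import numFieldNormedType.Exports.

Set Implicit Arguments.
Unset Strict Implicit.
Unset Printing Implicit Defensive.

Local Open Scope classical_set_scope.
Local Open Scope ring_scope.

(* The regular algebra [^o] is what carries the topology and the normed module
   structure (over [R[i]]) on the complex numbers. *)
Notation Cplx R := (R[i]^o).

Definition disc (R : realType) : set (Cplx R) := [set z | `|z| < 1].

(* A homeomorphism from an open set onto [disc R * tr].  Both directions are
   total, relevant only on [ch_dom] and [disc R * tr] respectively; the only chart
   lost this way is the one with empty domain over an empty transversal. *)
Record chart (R : realType) (X : topologicalType) := Chart {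
  ch_dom : set X ;
  ch_tr : topologicalType ;
  ch_map : X -> Cplx R * ch_tr ;
  ch_inv : Cplx R * ch_tr -> X ;
  ch_dom_open : open ch_dom ;
  ch_map_in : forall x, ch_dom x -> disc (ch_map x).1 ;
  ch_inv_in : forall p, disc p.1 -> ch_dom (ch_inv p) ;
  ch_mapK : forall x, ch_dom x -> ch_inv (ch_map x) = x ;
  ch_invK : forall p, disc p.1 -> ch_map (ch_inv p) = p ;
  ch_map_cont : {within ch_dom, continuous ch_map} ;
  ch_inv_cont : {within [set p | disc p.1], continuous ch_inv} }.

Arguments ch_map {R X} c x : rename.
Arguments ch_inv {R X} c p : rename.

Section Laminations.
Context {R : realType} {X : topologicalType}.
Implicit Types (c : chart R X) (A : chart R X -> Prop).

Definition transition c c' (p : Cplx R * ch_tr c) : Cplx R * ch_tr c' :=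
  ch_map c' (ch_inv c p).
Arguments transition : clear implicits.

(* The change of charts has the form (z, t) |-> (z'(z, t), t'(t)), z'
   holomorphic in z.  As the overlap of two charts may meet a plaque in several
   components, t' is only required to depend on t alone locally. *)
Definition compatible c c' : Prop :=
  forall p : Cplx R * ch_tr c, disc p.1 -> ch_dom c' (ch_inv c p) ->
    derivable (fun z : Cplx R => (transition c c' (z, p.2)).1 : Cplx R) p.1 1 /\
    exists t' : ch_tr c -> ch_tr c',
      \forall q \near p, (transition c c' q).2 = t' q.2.

Definition is_atlas A : Prop :=
  (forall x, exists2 c, A c & ch_dom c x) /\
  (forall c c', A c -> A c' -> compatible c c').

End Laminations.

(* Sets of charts are bare predicates because [chart] lives in too large a
   universe for [set]. *)
Record lamination (R : realType) (X : topologicalType) := Lamination {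
  atlas :> chart R X -> Prop ;
  atlasP : is_atlas atlas ;
  atlas_max : forall A : chart R X -> Prop,
    is_atlas A -> (forall c, atlas c -> A c) -> forall c, A c -> atlas c }.

(* The disjoint union of the leaves: the points of X, with the topology obtained
   by gluing the plaques, i.e. the final topology for the plaques. *)
Definition leafspace (R : realType) (X : topologicalType)
  (L : lamination R X) : Type := X.

Section Leafspace.
Context {R : realType} {X : topologicalType} (L : lamination R X).

HB.instance Definition _ := Choice.copy (leafspace L) X.

Definition leaf_open (W : set (leafspace L)) : Prop :=
  forall c, L c -> forall t : ch_tr c,
    open [set z : Cplx R | disc z /\ W (ch_inv c (z, t))].

Lemma disc_open : open (@disc R).
Proof.
rewrite (_ : @disc R = ball (0 : Cplx R) 1); first exact: ball_open.
by apply/seteqP; split => z; rewrite /disc -ball_normE /= sub0r normrN.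
Qed.

Lemma leaf_openT : leaf_open setT.
Proof.
move=> c _ t; rewrite (_ : [set z | _] = @disc R); first exact: disc_open.
by apply/seteqP; split => z //= -[].
Qed.

Lemma leaf_openI : setI_closed leaf_open.
Proof.
move=> U V oU oV c Lc t.
have := openI (oU c Lc t) (oV c Lc t); congr open.
by apply/seteqP; split=> z /= => [[[? ?] [_ ?]]|[? [? ?]]].
Qed.

Lemma leaf_open_bigU (I : Type) (f : I -> set (leafspace L)) :
  (forall i, leaf_open (f i)) -> leaf_open (\bigcup_i f i).
Proof.
move=> of_ c Lc t.
have := @bigcup_open _ I setT _ (fun i _ => of_ i c Lc t); congr open.
by apply/seteqP; split => z /= => [[i _ [? ?]]|[? [i _ ?]]];
  [split=> //; exists i | exists i].
Qed.

HB.instance Definition _ := @isOpenTopological.Build (leafspace L)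
  leaf_open leaf_openT leaf_openI leaf_open_bigU.

(* The leaf through x of the lamination induced by L on the open set V. *)
Definition leaf_in (V : set X) (x : X) : set X :=
  @connected_component (leafspace L) V x.

Definition leaf (x : X) : set X := leaf_in [set: X] x.

End Leafspace.

Section VanishingCycles.
Context {R : realType} {X : topologicalType} (L : lamination R X).

(* Continuity for the leaf topology forces the image to lie in a single leaf. *)
Definition leaf_loop (g : R -> X) : Prop :=
  {within `[0, 1], continuous (g : R -> leafspace L)} /\ g 0 = g 1.

Definition leaf_null_homotopic (g : R -> X) : Prop :=
  exists (H : R * R -> X) (x : X),
    [/\ {within `[0, 1] `*` `[0, 1], continuous (H : R * R -> leafspace L)},
        forall s : R, s \in `[0, 1] -> H (s, 0) = g s,
        forall s : R, s \in `[0, 1] -> H (s, 1) = x &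
        forall u : R, u \in `[0, 1] -> H (0, u) = H (1, u)].

(* Uniform closeness is for the unique uniformity of a compact Hausdorff space,
   whose entourages are the neighbourhoods of the diagonal.  As X need not be
   metrizable, limits are taken along nets, not only sequences. *)
Definition uniform_limit_of (P : set (R -> X)) (g : R -> X) : Prop :=
  forall W : set (X * X), (forall x : X, nbhs (x, x) W) ->
    exists2 h, P h & forall s : R, s \in `[0, 1] -> W (g s, h s).

Definition vanishing_cycle (g : R -> X) : Prop :=
  [/\ leaf_loop g, ~ leaf_null_homotopic g &
      uniform_limit_of [set h | leaf_loop h /\ leaf_null_homotopic h] g].

End VanishingCycles.

Section ProjectiveSpace.
Context (R : realType) (N : nat).

Definition nzvec := set_type [set v : 'rV[Cplx R]_N.+1 | v != 0].

HB.instance Definition _ := Topological.on nzvec.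

Definition colinear (v w : nzvec) : bool :=
  `[< exists2 a : R[i], a != 0 & val v = a *: val w >].

Lemma colinear_refl : reflexive colinear.
Proof. by move=> v; apply/asboolP; exists 1; rewrite ?oner_neq0 ?scale1r. Qed.

Lemma colinear_sym : symmetric colinear.
Proof.
suff H v w : colinear v w -> colinear w v by move=> v w; apply/idP/idP; exact: H.
move=> /asboolP[a a0 vw]; apply/asboolP; exists a^-1; first by rewrite invr_eq0.
by rewrite vw scalerA mulVf ?scale1r.
Qed.

Lemma colinear_trans : transitive colinear.
Proof.
move=> w v u /asboolP[a a0 vw] /asboolP[b b0 wu]; apply/asboolP.
by exists (a * b); rewrite ?mulf_neq0// vw wu scalerA.
Qed.

Canonical colinear_equiv :=
  EquivRel colinear colinear_refl colinear_sym colinear_trans.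

Definition CP : Type :=
  quotient_topology {eq_quot colinear_equiv}%qT.

HB.instance Definition _ := Topological.on CP.

(* Homogeneous coordinates, well defined up to a common nonzero factor. *)
Definition hcoord (p : CP) : 'rV[Cplx R]_N.+1 := val (repr p).

Definition affine_dom (i : 'I_N.+1) : set CP := [set p | hcoord p 0 i != 0].

Definition affine (i : 'I_N.+1) (p : CP) : 'rV[Cplx R]_N :=
  \row_j (hcoord p 0 (lift i j) / hcoord p 0 i).

End ProjectiveSpace.

Section Projective.
Context {R : realType} {X : topologicalType} (L : lamination R X).

(* Holomorphic with nonzero derivative along the plaques, as read in every affine
   chart of the target containing the image point. *)
Definition leafwise_immersion (N : nat) (f : X -> CP R N) : Prop :=
  forall c, L c -> forall (t : ch_tr c) (z : Cplx R) (i : 'I_N.+1),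
    disc z -> affine_dom i (f (ch_inv c (z, t))) ->
    let u (w : Cplx R) := affine i (f (ch_inv c (w, t))) in
    derivable u z 1 /\ 'D_1 u z != 0.

Definition projective : Prop :=
  forall x y : X, x <> y ->
    exists (N : nat) (f : X -> CP R N),
      [/\ continuous f, leafwise_immersion f & f x <> f y].

End Projective.

Section Divisors.
Context {R : realType} {X : topologicalType} (L : lamination R X).

Definition holomorphic_on (V : set X) (f : X -> Cplx R) : Prop :=
  {within V, continuous f} /\
  forall c, L c -> forall (t : ch_tr c) (z : Cplx R),
    disc z -> V (ch_inv c (z, t)) ->
    derivable (fun w : Cplx R => f (ch_inv c (w, t))) z 1.

Definition order_of_vanishing (g : Cplx R -> Cplx R) (z : Cplx R) (k : nat) :
    Prop :=
  exists h : Cplx R -> Cplx R,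
    [/\ \forall w \near z, derivable h w 1, h z != 0 &
        \forall w \near z, g w = (w - z) ^+ k * h w].

Definition leaf_multiplicity (f : X -> Cplx R) (x : X) (k : nat) : Prop :=
  forall c, L c -> ch_dom c x ->
    order_of_vanishing (fun w => f (ch_inv c (w, (ch_map c x).2)))
      (ch_map c x).1 k.

(* Only the values of m on D are relevant. *)
Definition is_divisor (D : set X) (m : X -> nat) : Prop :=
  [/\ closed D,
      forall x, D x -> (0 < m x)%N &
      forall x, D x -> exists (V : set X) (f : X -> Cplx R),
        [/\ open V /\ V x,
            holomorphic_on V f,
            forall y, V y -> ~ (leaf_in L V y `<=` [set y' | f y' = 0]),
            D `&` V = [set y | V y /\ f y = 0] &
            forall y, D y -> V y -> leaf_multiplicity f y (m y)]].

End Divisors.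

(* Main.v *)
(* Both conditions are equivalent to the existence of a positive line bundle E on X.

   From a positive line bundle one gets sections of E^d, for d large, by Hormander's
   method without any L^2 theory.  On finitely many flow boxes where the local frames peak,
   cut off local sections and solve the dbar equation on each plaque by the Cauchy
   transform; patching these solutions leaves an error that is exponentially small in d,
   so that a Neumann series corrects it.

   Such sections, with prescribed 1-jets and decay off a given neighbourhood, embed X.  They
   also give a divisor meeting all the leaves: replacing v by v^k + c u, with u a section having a
   simple zero on the plaques of the next box, makes v nonzero there while keeping, by
   Rouche's theorem, the zeros already obtained on the previous boxes.

   Conversely the pullback of O(1) by a leafwise immersion is positive, and the line bundle
   of a divisor D meeting all the leaves carries a positive metric: it is positive near D,
   and the set where it is positive can be pushed along the leaves by taking maxima with
   explicit local metrics, until it exhausts X by compactness. *)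
Require Import Defs.
From mathcomp Require Import all_boot all_order all_algebra.
From mathcomp Require Import complex.
From mathcomp Require Import all_classical all_reals all_analysis.
From mathcomp Require Import ring lra.
(* [lra] examines every hypothesis, which is slow in a large context. *)
Ltac keep_comparisons := repeat match goal with H : ?T |- _ =>
  lazymatch type of T with Prop => idtac end;
  lazymatch T with
  | is_true (@Order.le _ _ _ _) => fail
  | is_true (@Order.lt _ _ _ _) => fail
  | is_true (andb _ _) => fail
  | @eq ?A _ _ => lazymatch A with context [complex.complex] => clear H end
  | _ => clear H
  end end.
Ltac flra := solve [keep_comparisons; lra | lra].

Import Order.TTheory GRing.Theory Num.Theory.
Import numFieldNormedType.Exports.
Set Implicit Arguments.
Unset Strict Implicit.
Unset Printing Implicit Defensive.
Local Open Scope classical_set_scope.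
Local Open Scope ring_scope.
Local Open Scope complex_scope.
Local Notation Re := complex.Re.
Local Notation Im := complex.Im.

(** * Modulus and conjugation with values fit for real linear arithmetic *)

Section Modulus.
Context {R : realType}.
Local Notation C := (Cplx R).
Implicit Types (z w : C) (x e : R).

(** The transversals are bare topological spaces, so regularity is asked along the plaques only, and
    mere continuity across them. Integrals are limits of grid sums along an ultrafilter, and
    derivatives are two-point ones, for which continuity of the derivative is automatic.

    The bundle is kept in a discontinuous unitary trivialisation: a section is a function on [X]
    whose modulus is its norm, a frame [th] of the dual turns a section [s] of degree [d] into the
    holomorphic function [s * th ^ d], and positivity says that some [th] has modulus 1 at [x] and
    more than 1 around [x] on its plaque.

    The unknowns of the Neumann series are the corrected local sections over the shells where the
    cut-offs vary. Their dbar errors, redistributed by a partition of unity living in the cores of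
    the boxes, are solved for there: the solution has size [Q ^ d], as [nm th <= Q] on cores, and is
    then divided by at least [A ^ d], as [nm th >= A > Q] on shells. Hence the iteration contracts
    for large [d]. *)

Definition nm (z : C) : R := Re `|z|.

Lemma normE z : `|z| = (nm z)%:C.
Proof. by rewrite RRe_real ?normr_real. Qed.

Lemma nmM z w : nm (z * w) = nm z * nm w.
Proof. by apply: complexI; rewrite rmorphM /= -!normE normrM. Qed.

Lemma nmD z w : nm (z + w) <= nm z + nm w.
Proof. by rewrite -lecR rmorphD /= -!normE ler_normD. Qed.

Lemma nmN z : nm (- z) = nm z. Proof. by rewrite /nm normrN. Qed.

Lemma nmB z w : nm (z - w) <= nm z + nm w.
Proof. by rewrite -(nmN w) nmD. Qed.

Lemma nmC z w : nm (z - w) = nm (w - z). Proof. by rewrite -nmN opprB. Qed.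

Lemma nm_ge0 z : 0 <= nm z. Proof. by rewrite -lecR -normE normr_ge0. Qed.

Lemma nm0 : nm 0 = 0. Proof. by rewrite /nm normr0. Qed.

Lemma nm1 : nm 1 = 1. Proof. by rewrite /nm normr1. Qed.

Lemma nm_eq0 z : (nm z == 0) = (z == 0).
Proof.
apply/eqP/eqP => [h|->]; last exact: nm0.
by apply/eqP; rewrite -normr_eq0 normE h.
Qed.

Lemma nm_gt0 z : (0 < nm z) = (z != 0).
Proof. by rewrite lt_neqAle nm_ge0 andbT eq_sym nm_eq0. Qed.

Lemma nmV z : nm z^-1 = (nm z)^-1.
Proof. by apply: complexI; rewrite fmorphV /= -!normE normfV. Qed.

Lemma nmX z n : nm (z ^+ n) = nm z ^+ n.
Proof. by apply: complexI; rewrite rmorphXn /= -!normE normrX. Qed.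

Lemma nm_real x : nm (x%:C : C) = `|x|.
Proof. by rewrite /nm normc_def /= expr0n /= addr0 sqrtr_sqr. Qed.

Definition cj (z : C) : C := z^*.

Lemma nm_cj z : nm (cj z) = nm z.
Proof. by case: z => a b; rewrite /cj /nm !normc_def /= sqrrN. Qed.

Lemma cjD z w : cj (z + w) = cj z + cj w.
Proof.
by case: z w => [a b] [c d]; apply/eqP; rewrite /cj eq_complex /= opprD !eqxx.
Qed.

Lemma cjN z : cj (- z) = - cj z. Proof. by case: z. Qed.

Lemma cjB z w : cj (z - w) = cj z - cj w. Proof. by rewrite cjD cjN. Qed.

Lemma cjM z w : cj (z * w) = cj z * cj w.
Proof.
case: z w => [a b] [c d]; apply/eqP; rewrite /cj eq_complex /=.
by apply/andP; split; apply/eqP; ring.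
Qed.

Lemma cjK z : cj (cj z) = z. Proof. by case: z => a b; rewrite /cj /= opprK. Qed.

Lemma cj_real x : cj (x%:C) = x%:C. Proof. by rewrite /cj /= oppr0. Qed.

Lemma cj0 : cj 0 = 0. Proof. exact: cj_real. Qed.

Lemma cj1 : cj 1 = 1. Proof. exact: cj_real. Qed.

Lemma cj_i : cj 'i = - 'i.
Proof. by rewrite /cj; apply/eqP; rewrite eq_complex /= oppr0 !eqxx. Qed.

Lemma nm_i : nm ('i : C) = 1.
Proof. by rewrite /nm normc_def /= expr0n add0r expr1n sqrtr1. Qed.

Lemma nm_sum (I : Type) (r : seq I) (P : pred I) (F : I -> C) :
  nm (\sum_(i <- r | P i) F i) <= \sum_(i <- r | P i) nm (F i).
Proof.
elim/big_rec2 : _ => [|i y1 y2 _ h]; first by rewrite nm0.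
by rewrite (le_trans (nmD _ _))// lerD2l.
Qed.

Lemma nm_split z w : nm z <= nm w + nm (z - w).
Proof. by rewrite -{1}(subrK w z) addrC (le_trans (nmD _ _))// addrC. Qed.

Lemma nm_dist z w : `|nm z - nm w| <= nm (z - w).
Proof.
rewrite ler_norml; have := nm_split z w; have := nm_split w z.
by rewrite nmC => h1 h2; apply/andP; split; flra.
Qed.

Lemma nm_tri z y w : nm (z - w) <= nm (z - y) + nm (y - w).
Proof. by rewrite -[z - w](_ : z - y + (y - w) = _) ?nmD// addrA subrK. Qed.

Lemma nm_sqr z : (nm z ^+ 2)%:C = z * cj z :> C.
Proof.
rewrite rmorphXn /= -normE -add_Re2_Im2; rewrite /cj; case: z => a b /=.
by apply/eqP; rewrite eq_complex /=; apply/andP; split; apply/eqP; ring.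
Qed.

Lemma Re_nm z : `|Re z| <= nm z.
Proof.
rewrite -sqrtr_sqr /nm normc_def /= ler_wsqrtr// lerDl sqr_ge0 //.
Qed.

Lemma Im_nm z : `|Im z| <= nm z.
Proof. by rewrite -sqrtr_sqr /nm normc_def /= ler_wsqrtr// lerDr sqr_ge0. Qed.

Lemma nm_ReIm z : nm z <= `|Re z| + `|Im z|.
Proof.
have -> : z = (Re z)%:C + 'i * (Im z)%:C by rewrite -complexE.
rewrite (le_trans (nmD _ _))// nmM nm_i mul1r !nm_real lerD //=.
all: by rewrite ?mul0r ?mul1r ?subr0 ?addr0 ?add0r ?mulr0.
Qed.

(** Balls of [R[i]^o] have radii in [R[i]]; a positive element there is real, so real radii
    suffice. *)
Lemma nbhs_nm z (A : set C) :
  nbhs z A <-> exists2 e : R, 0 < e & forall w, nm (w - z) < e -> A w.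
Proof.
split.
  move=> /nbhs_ballP[e /= e0 h].
  have er : e \is Num.real by rewrite realE ltW.
  have E : e = (Re e)%:C by rewrite RRe_real.
  exists (Re e); first by rewrite -ltcR -E.
  by move=> w hw; apply: h; rewrite -ball_normE /= distrC normE E ltcR.
move=> [e e0 h]; apply/nbhs_ballP; exists (e%:C) => /=; first by rewrite ltcR.
by move=> w; rewrite -ball_normE /= distrC normE ltcR => /h.
Qed.

Lemma nbhs_nm_lt z e : 0 < e -> nbhs z [set w | nm (w - z) < e].
Proof. by move=> e0; apply/nbhs_nm; exists e. Qed.

Lemma cvgC (T : Type) (F : set_system T) (FF : Filter F) (f : T -> C) z :
  f @ F --> z <-> forall e : R, 0 < e -> \forall x \near F, nm (f x - z) < e.
Proof.
split=> [h e e0|h A /nbhs_nm[e e0 hA]].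
  by have := h _ (nbhs_nm_lt z e0).
by apply: filterS (h e e0) => x /hA.
Qed.

Lemma cvgR (T : Type) (F : set_system T) (FF : Filter F) (f : T -> R) (l : R) :
  f @ F --> l <-> forall e : R, 0 < e -> \forall x \near F, `|f x - l| < e.
Proof.
rewrite cvgrPdist_lt; split=> h e /h; apply: filterS => x; rewrite distrC //.
Qed.

Lemma nm_continuous : continuous (nm : C -> R).
Proof.
move=> z; apply: (cvgR (nbhs_filter (z : C)) _ _).2 => e e0; apply: (nbhs_nm _ _).2; exists e => // w hw.
by rewrite (le_lt_trans (nm_dist _ _)).
Qed.

Lemma realC_continuous : continuous ((fun x => x%:C) : R -> C).
Proof.
move=> x; apply/cvgC => e e0; apply: filterS (nbhsx_ballx x e e0) => y.
by rewrite /ball /= -rmorphB /= nm_real distrC.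
Qed.

Lemma disc_nm z : disc z <-> nm z < 1.
Proof. by rewrite /disc /= normE -(ltcR (nm z) 1). Qed.

(** The disc is a closed part of the continuous image of a square of [R * R]. *)
Lemma nm_ball_compact c (r : R) : compact [set z : C | nm (z - c) <= r].
Proof.
pose f (p : R * R) : C := c + (p.1%:C + 'i * p.2%:C).
have cf : continuous f.
  move=> p; apply: (@cvgD _ _ _ _ _ (fun=> c) (fun p => p.1%:C + 'i * p.2%:C)); first exact: cvg_cst.
  apply: (@cvgD _ _ _ _ _ (fun p : R * R => p.1%:C : C) (fun p => 'i * p.2%:C)).
    by apply: (@continuous_comp _ _ _ (@fst R R)); [exact: cvg_fst | exact: realC_continuous].
  apply: (@cvgM _ _ _ _ (fun=> 'i : C) (fun p : R * R => p.2%:C : C)); first exact: cvg_cst.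
  by apply: (@continuous_comp _ _ _ (@snd R R)); [exact: cvg_snd | exact: realC_continuous].
have cK : compact (f @` (`[-r, r]%classic `*` `[-r, r]%classic)).
  apply: continuous_compact; first exact: continuous_subspaceT.
  by apply: compact_setX; exact: segment_compact.
apply: (subclosed_compact _ cK).
  have -> : [set z | nm (z - c) <= r] = (fun z => nm (z - c)) @^-1` [set x | x <= r].
    by [].
  apply: (@preimage_closed _ _ (fun z : C => nm (z - c)) [set x : R | x <= r]); last exact: closed_le.
  move=> z _; apply: (cvgR (nbhs_filter (z : C)) _ _).2 => e e0.
  apply: (nbhs_nm _ _).2; exists e => // w hw.
  rewrite (le_lt_trans (nm_dist _ _))//.
  by rewrite (_ : w - c - (z - c) = w - z) //; ring.
move=> z /= hz; exists (Re (z - c), Im (z - c)).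
  split; rewrite /= in_itv /= -ler_norml.
    exact: le_trans (Re_nm _) hz.
  exact: le_trans (Im_nm _) hz.
by rewrite /f /= -complexE addrC subrK.
Qed.

End Modulus.

(** * Averages over the unit square along an ultrafilter *)

Section Mean.
Context {R : realType}.
Local Notation C := (Cplx R).
Implicit Types (F G : R -> R -> C) (M e : R).

Definition ultra_nat : set_system nat :=
  projT1 (cid (@ultraFilterLemma nat \oo eventually_filter)).

Lemma ultra_natP : UltraFilter ultra_nat /\ \oo `<=` ultra_nat.
Proof. exact: projT2 (cid (@ultraFilterLemma nat \oo eventually_filter)). Qed.

#[global] Instance ultra_nat_ultra : UltraFilter ultra_nat := ultra_natP.1.
#[global] Instance ultra_nat_proper : ProperFilter ultra_nat := ultra_proper.

Definition grid (n i : nat) : R := i%:R / (2 ^ n)%:R.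

Lemma grid_itv n i : (i <= 2 ^ n)%N -> 0 <= grid n i <= 1.
Proof.
move=> h; rewrite /grid divr_ge0//= ler_pdivrMr ?mul1r ?ler_nat// ltr0n expn_gt0//.
Qed.

(** Left-endpoint sums. Both variables are kept because the Cauchy transform is a double integral;
    single integrals ignore one of them. *)
Definition avg F (n : nat) : C :=
  ((2 ^ n)%:R ^- 2) * \sum_(i < 2 ^ n) \sum_(j < 2 ^ n) F (grid n i) (grid n j).

(* Limit of grid averages along an ultrafilter: linear and monotone on all
   bounded functions, which avoids every integrability condition. *)
Definition mean F : C := lim (avg F @ ultra_nat).

Definition bnd01 F M := forall s t, 0 <= s <= 1 -> 0 <= t <= 1 -> nm (F s t) <= M.

Lemma pow2_neq0 n : (2 ^ n)%:R != 0 :> C.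
Proof. by rewrite pnatr_eq0 -lt0n expn_gt0. Qed.

Lemma nm_nat n : nm (n%:R : C) = n%:R.
Proof. by rewrite -(rmorph_nat (real_complex R)) nm_real normr_nat. Qed.

Lemma avg_bnd F M n : bnd01 F M -> nm (avg F n) <= M.
Proof.
move=> h; rewrite /avg nmM nmV nmX nm_nat.
have p : (0 : R) < (2 ^ n)%:R by rewrite ltr0n expn_gt0.
rewrite ler_pdivrMl ?exprn_gt0// (le_trans (nm_sum _ _ _))//.
apply: (@le_trans _ _ (\sum_(i < 2 ^ n) \sum_(j < 2 ^ n) M)).
  apply: ler_sum => i _; rewrite (le_trans (nm_sum _ _ _))//; apply: ler_sum => j _.
  by apply: h; apply: grid_itv; apply: ltnW.
by rewrite !sumr_const !card_ord -mulrnA -[M *+ _]mulr_natl natrM expr2.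
Qed.

Lemma avgD F G n : avg (fun s t => F s t + G s t) n = avg F n + avg G n.
Proof.
rewrite /avg -mulrDr -big_split /=; congr (_ * _); apply: eq_bigr => i _.
by rewrite -big_split.
Qed.

Lemma avgZ c F n : avg (fun s t => c * F s t) n = c * avg F n.
Proof.
rewrite /avg [RHS]mulrCA; congr (_ * _); rewrite mulr_sumr; apply: eq_bigr => i _.
by rewrite mulr_sumr.
Qed.

Lemma avg_cst (c : C) n : avg (fun _ _ => c) n = c.
Proof.
rewrite /avg !sumr_const !card_ord -mulrnA -[c *+ _]mulr_natl natrM mulrA -expr2 mulVf ?mul1r ?expf_neq0 ?pow2_neq0//.
Qed.

Lemma avgB F G n : avg (fun s t => F s t - G s t) n = avg F n - avg G n.
Proof.
rewrite -[- avg G n]mulN1r -avgZ -avgD; congr (avg _ n).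
by apply/funext => s; apply/funext => t; rewrite mulN1r.
Qed.

Lemma avg_eq F G n :
  (forall s t, 0 <= s <= 1 -> 0 <= t <= 1 -> F s t = G s t) -> avg F n = avg G n.
Proof.
move=> h; rewrite /avg; congr (_ * _); apply: eq_bigr => i _; apply: eq_bigr => j _.
by apply: h; apply: grid_itv; apply: ltnW.
Qed.

Lemma fmap_ultra (T T' : Type) (f : T -> T') (F : set_system T) :
  UltraFilter F -> UltraFilter (f @ F).
Proof.
move=> UF; apply: Build_UltraFilter => G PG sFG; apply/seteqP; split => // A GA.
have [//|h] := in_ultra_setVsetC (f @^-1` A) UF.
have GnA : G (~` A) by apply: sFG.
by have /filter_ex[x []] : G (A `&` ~` A) by apply: filterI.
Qed.

(** The averages stay in a compact disc, where the image ultrafilter must converge. *)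
Lemma mean_lim F M : bnd01 F M -> avg F @ ultra_nat --> mean F.
Proof.
move=> h; have := @nm_ball_compact R 0 M.
rewrite compact_ultra => /(_ (avg F @ ultra_nat) (fmap_ultra _ _))[].
  have : ultra_nat [set n | nm (avg F n - 0) <= M].
    by apply: filterE => n /=; rewrite subr0; exact: (avg_bnd n h).
  by [].
by move=> z [_ /cvgP].
Qed.

Lemma mean_unique F M z : bnd01 F M ->
  (forall e : R, 0 < e -> exists n0, forall n, (n0 <= n)%N -> nm (avg F n - z) <= e) ->
  mean F = z.
Proof.
move=> b h; have cF := mean_lim b.
apply: (@cvg_unique _ (@norm_hausdorff _ C) _ _ _ _ cF).
apply/cvgC => e e0; have [n0 hn] := h (e / 2) (divr_gt0 e0 (ltr0Sn _ _)).
apply: ultra_natP.2; exists n0 => // n /hn/le_lt_trans; apply.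
by rewrite ltr_pdivrMr// mulr_natr mulr2n ltrDl.
Qed.

Lemma mean_le F M : bnd01 F M -> nm (mean F) <= M.
Proof.
move=> h; rewrite leNgt; apply/negP => lt.
have e0 : 0 < nm (mean F) - M by rewrite subr_gt0.
have /cvgC := mean_lim h; move=> /(_ _ e0) /filter_ex[n].
have := avg_bnd n h; have := nm_split (mean F) (avg F n); rewrite nmC; flra.
Qed.

Lemma bnd01D F G M M' : bnd01 F M -> bnd01 G M' ->
  bnd01 (fun s t => F s t + G s t) (M + M').
Proof. by move=> h h' s t hs ht; rewrite (le_trans (nmD _ _))// lerD ?h ?h'. Qed.

Lemma bnd01Z c F M : bnd01 F M -> bnd01 (fun s t => c * F s t) (nm c * M).
Proof. by move=> h s t hs ht; rewrite nmM ler_wpM2l ?nm_ge0 ?h. Qed.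

Lemma bnd01B F G M M' : bnd01 F M -> bnd01 G M' ->
  bnd01 (fun s t => F s t - G s t) (M + M').
Proof. by move=> h h' s t hs ht; rewrite (le_trans (nmB _ _))// lerD ?h ?h'. Qed.

Lemma meanD F G M M' : bnd01 F M -> bnd01 G M' ->
  mean (fun s t => F s t + G s t) = mean F + mean G.
Proof.
move=> hF hG; have h : avg F + avg G @ ultra_nat --> mean F + mean G.
  by apply: cvgD; [exact: mean_lim hF|exact: mean_lim hG].
have := mean_lim (bnd01D hF hG).
rewrite (_ : avg (fun s t => F s t + G s t) = avg F + avg G).
  by move=> h'; exact: (@cvg_unique _ (@norm_hausdorff _ C) _ _ _ _ h' h).
by apply/funext => n; rewrite avgD.
Qed.

Lemma meanZ c F M : bnd01 F M -> mean (fun s t => c * F s t) = c * mean F.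
Proof.
move=> hF; have h : (fun=> c) * avg F @ ultra_nat --> c * mean F.
  by apply: cvgM; [exact: cvg_cst|exact: mean_lim hF].
have := mean_lim (bnd01Z c hF).
rewrite (_ : avg (fun s t => c * F s t) = (fun=> c) * avg F).
  by move=> h'; exact: (@cvg_unique _ (@norm_hausdorff _ C) _ _ _ _ h' h).
by apply/funext => n; rewrite avgZ.
Qed.

Lemma meanB F G M M' : bnd01 F M -> bnd01 G M' ->
  mean (fun s t => F s t - G s t) = mean F - mean G.
Proof.
move=> hF hG; have h : avg F - avg G @ ultra_nat --> mean F - mean G.
  by apply: cvgB; [exact: mean_lim hF|exact: mean_lim hG].
have := mean_lim (bnd01B hF hG).
rewrite (_ : avg (fun s t => F s t - G s t) = avg F - avg G).
  by move=> h'; exact: (@cvg_unique _ (@norm_hausdorff _ C) _ _ _ _ h' h).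
by apply/funext => n; rewrite avgB.
Qed.

Lemma mean_eq F G :
  (forall s t, 0 <= s <= 1 -> 0 <= t <= 1 -> F s t = G s t) -> mean F = mean G.
Proof. by move=> h; rewrite /mean (_ : avg F = avg G)//; apply/funext => n; exact: avg_eq. Qed.

Lemma mean_cst (c : C) : mean (fun _ _ => c) = c.
Proof.
apply: (@mean_unique _ (nm c)) => [s t _ _//|e e0]; exists 0%N => n _.
by rewrite avg_cst subrr nm0 ltW.
Qed.

Lemma mean_close F G M M' e : bnd01 F M -> bnd01 G M' ->
  (forall s t, 0 <= s <= 1 -> 0 <= t <= 1 -> nm (F s t - G s t) <= e) ->
  nm (mean F - mean G) <= e.
Proof. by move=> hF hG h; rewrite -(meanB hF hG); exact: mean_le. Qed.

(** The source of most identities between means: the two averages are compared at the same level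
    [n], and neither has to converge along the whole sequence. *)
Lemma mean_asym F G M M' : bnd01 F M -> bnd01 G M' ->
  (forall e : R, 0 < e -> exists n0, forall n, (n0 <= n)%N ->
    nm (avg F n - avg G n) <= e) -> mean F = mean G.
Proof.
move=> hF hG h; apply/eqP; rewrite -subr_eq0 -(meanB hF hG); apply/eqP.
apply: (mean_unique (bnd01B hF hG)) => e e0; have [n0 hn] := h e e0.
by exists n0 => n /hn; rewrite avgB subr0.
Qed.

Lemma pow2_small e : 0 < e -> exists n0, forall n, (n0 <= n)%N -> ((2 ^ n)%:R : R)^-1 < e.
Proof.
move=> e0; exists (Num.truncn e^-1).+1 => n hn.
have e1 : 0 < e^-1 by rewrite invr_gt0.
rewrite -[ltRHS]invrK ltf_pV2 ?posrE ?ltr0n ?expn_gt0//.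
have : (e^-1 < n%:R :> R).
  by apply: (lt_le_trans (truncnS_gt _)); rewrite ler_nat.
move=> /lt_trans; apply; rewrite ltr_nat; exact: ltn_expl.
Qed.

Lemma avg_swap F n : avg (fun s t => F t s) n = avg F n.
Proof. by rewrite /avg exchange_big. Qed.

Lemma mean_swap F : mean (fun s t => F t s) = mean F.
Proof. by rewrite /mean (_ : avg _ = avg F)//; apply/funext => n; exact: avg_swap. Qed.

(** Derivability in the first variable, uniform in both: the strength that a telescoping sum
    consumes. *)
Definition diff01 F G := forall e : R, 0 < e -> exists2 d : R, 0 < d &
  forall s s' t, 0 <= s <= 1 -> 0 <= s' <= 1 -> 0 <= t <= 1 -> `|s' - s| < d ->
  nm (F s' t - F s t - (s' - s)%:C * G s t) <= e * `|s' - s|.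

Lemma gridS n i : grid n i.+1 - grid n i = (2 ^ n)%:R^-1.
Proof. by rewrite /grid -mulrBl -natrB// subSnn mul1r. Qed.

(** Once the step [1 / 2 ^ n] is below the uniform modulus, each value of [G] is within [e] of a
    difference quotient of [F], and these quotients telescope. *)
Lemma mean_ftc F G M M' : bnd01 F M -> bnd01 G M' -> diff01 F G ->
  mean G = mean (fun _ t => F 1 t - F 0 t).
Proof.
move=> hF hG d; have i0 : 0 <= (0 : R) <= 1 by rewrite lexx ler01.
have i1 : 0 <= (1 : R) <= 1 by rewrite lexx ler01.
have hB : bnd01 (fun _ t => F 1 t - F 0 t) (M + M).
  by move=> s t _ ht; rewrite (le_trans (nmB _ _))// lerD ?hF.
apply: (mean_asym hG hB) => e e0.
have [dl dl0 hd] := d e e0; have [n0 hn] := pow2_small dl0.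
exists n0 => n /hn ln; rewrite -avgB.
pose N : R := (2 ^ n)%:R.
have N0 : 0 < N by rewrite ltr0n expn_gt0.
have E : avg (fun _ t => F 1 t - F 0 t) n =
    avg (fun s t => N%:C * (F (s + N^-1) t - F s t)) n.
  rewrite /avg; congr (_ * _); rewrite [LHS]exchange_big [RHS]exchange_big /=.
  apply: eq_bigr => j _; rewrite sumr_const card_ord -mulr_sumr.
  rewrite -[_ *+ (2 ^ n)]mulr_natl /N rmorph_nat; congr (_ * _).
  rewrite (eq_bigr (fun i : 'I_(2 ^ n) => F (grid n i.+1) (grid n j) - F (grid n i) (grid n j))).
    rewrite -(big_mkord xpredT (fun i => F (grid n i.+1) (grid n j) - F (grid n i) (grid n j))).
    by rewrite telescope_sumr// /grid mul0r divff// pnatr_eq0 -lt0n expn_gt0.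
  by move=> i _; rewrite -(gridS n i) addrCA subrr addr0.
rewrite avgB E -avgB.
rewrite (_ : avg _ n = ((2 ^ n)%:R ^- 2) * \sum_(i < 2 ^ n) \sum_(j < 2 ^ n)
   (G (grid n i) (grid n j) - N%:C * (F (grid n i.+1) (grid n j) - F (grid n i) (grid n j)))); last first.
  rewrite /avg; congr (_ * _); apply: eq_bigr => i _; apply: eq_bigr => j _.
  by rewrite -(gridS n i) addrCA subrr addr0.
rewrite nmM nmV nmX nm_nat ler_pdivrMl ?exprn_gt0// (le_trans (nm_sum _ _ _))//.
apply: (@le_trans _ _ (\sum_(i < 2 ^ n) \sum_(j < 2 ^ n) e)); last first.
  by rewrite !sumr_const !card_ord -mulrnA -[e *+ _]mulr_natl natrM expr2.
apply: ler_sum => i _; rewrite (le_trans (nm_sum _ _ _))//; apply: ler_sum => j _.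
have gi := grid_itv (ltnW (ltn_ord i)); have gi1 := grid_itv (ltn_ord i).
have gj := grid_itv (ltnW (ltn_ord j)).
have := hd _ _ _ gi gi1 gj; rewrite gridS ger0_norm ?invr_ge0 ?ler0n// => /(_ ln).
set a := F _ _ - F _ _; set g := G _ _ => h'.
have NC : N%:C != 0 :> C by rewrite -[0]/(real_complex R 0) (inj_eq (@complexI R)) gt_eqF.
have -> : g - N%:C * a = - (N%:C * (a - (N^-1)%:C * g)).
  by rewrite fmorphV; field.
by rewrite nmN nmM nm_real (ger0_norm (ltW N0)) -ler_pdivlMl// (mulrC (N^-1 : R)).
Qed.

(** Reflection turns left-endpoint sums into right-endpoint sums; they differ by one column out of
    [2 ^ n], of size at most [M + M]. *)
Lemma mean_rev F M : bnd01 F M -> mean (fun s t => F (1 - s) t) = mean F.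
Proof.
move=> hF; have hR : bnd01 (fun s t => F (1 - s) t) M.
  by move=> s t hs ht; apply: hF => //; flra.
apply: (mean_asym hR hF) => e e0.
have M0 : 0 <= M by apply: le_trans (hF 0 0 _ _); rewrite ?nm_ge0 ?lexx ?ler01.
have e1 : 0 < e / (M + M + 1) by apply: divr_gt0 => //; flra.
have [n0 hn] := pow2_small e1; exists n0 => n /hn ln.
pose N : R := (2 ^ n)%:R.
have N0 : 0 < N by rewrite ltr0n expn_gt0.
rewrite -avgB; have -> : avg (fun s t => F (1 - s) t - F s t) n =
   ((2 ^ n)%:R ^- 2) * \sum_(j < 2 ^ n) (F 1 (grid n j) - F 0 (grid n j)).
  rewrite /avg; congr (_ * _); rewrite exchange_big /=; apply: eq_bigr => j _.
  rewrite sumrB (reindex_inj rev_ord_inj) /=.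
  rewrite (eq_bigr (fun i : 'I_(2 ^ n) => F (grid n i.+1) (grid n j))); last first.
    move=> i _; congr (F _ _); rewrite /grid natrB// mulrBl divff ?gt_eqF//.
    by rewrite opprB addrC subrK.
  rewrite -sumrB.
  rewrite -(big_mkord xpredT (fun i => F (grid n i.+1) (grid n j) - F (grid n i) (grid n j))).
  by rewrite telescope_sumr// /grid mul0r divff// pnatr_eq0 -lt0n expn_gt0.
rewrite nmM nmV nmX nm_nat ler_pdivrMl ?exprn_gt0// (le_trans (nm_sum _ _ _))//.
apply: (@le_trans _ _ (\sum_(j < 2 ^ n) (M + M))).
  apply: ler_sum => j _; have gj := grid_itv (ltnW (ltn_ord j)).
  by rewrite (le_trans (nmB _ _))// lerD// hF// ?lexx ?ler01.
rewrite sumr_const card_ord -[_ *+ _]mulr_natl -/N expr2 -mulrA ler_pM2l//.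
move: ln; rewrite -/N ltr_pdivlMr; last flra.
rewrite -ltr_pdivlMl ?invr_gt0// invrK; flra.
Qed.

(** The two halves sampled on grid [n] make up the grid of step [1 / 2 ^ n.+1]. Its even points
    cancel against one copy of the coarse sum; its odd points are compared with the other copy by
    uniform continuity. *)
Lemma mean_bisect F M : bnd01 F M ->
  (forall e : R, 0 < e -> exists2 d : R, 0 < d & forall s s' t,
     0 <= s <= 1 -> 0 <= s' <= 1 -> 0 <= t <= 1 -> `|s' - s| < d ->
     nm (F s' t - F s t) <= e) ->
  2 * mean F = mean (fun s t => F (s / 2) t) + mean (fun s t => F ((s + 1) / 2) t).
Proof.
move=> hF uF.
have h1 : bnd01 (fun s t => F (s / 2) t) M by move=> s t hs ht; apply: hF => //; flra.
have h2 : bnd01 (fun s t => F ((s + 1) / 2) t) M by move=> s t hs ht; apply: hF => //; flra.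
rewrite -(meanD h1 h2) -(meanZ _ hF).
apply: (mean_asym (bnd01Z _ hF) (bnd01D h1 h2)) => e e0.
have e2 : 0 < e / 2 by flra.
have [d d0 hd] := uF _ e2; have [n0 hn] := pow2_small d0; exists n0 => n /hn ln.
pose N : R := (2 ^ n)%:R.
have N0 : 0 < N by rewrite ltr0n expn_gt0.
rewrite -avgB /avg exchange_big /=.
have N2 : (2 : R) != 0 by rewrite pnatr_eq0.
have E (j : 'I_(2 ^ n)) : \sum_(i < 2 ^ n) (2 * F (grid n i) (grid n j) -
      (F (grid n i / 2) (grid n j) + F ((grid n i + 1) / 2) (grid n j))) =
    \sum_(i < 2 ^ n) (F (grid n i) (grid n j) - F (grid n i + (2 * N)^-1) (grid n j)).
  rewrite !sumrB; rewrite (eq_bigr (fun i : 'I_(2 ^ n) => F (grid n i) (grid n j) + F (grid n i) (grid n j))); last first.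
    by move=> i _; ring.
  rewrite big_split /= -addrA; congr (_ + _); apply/eqP.
  rewrite subr_eq addrC -subr_eq opprK; apply/eqP.
  pose f (i : nat) := F (i%:R / (2 * N)) (grid n j).
  have e1 (i : nat) : F (grid n i) (grid n j) = f i.*2.
    rewrite /f /grid -/N -muln2 natrM; congr (F _ _); field.
    by rewrite gt_eqF.
  have e2' (i : nat) : F (grid n i + (2 * N)^-1) (grid n j) = f i.*2.+1.
    rewrite /f /grid -/N -[i.*2.+1]addn1 natrD -muln2 natrM; congr (F _ _); field.
    by rewrite gt_eqF.
  under eq_bigr do rewrite e1; rewrite [in RHS]big_split /=.
  under [X in _ + X = _]eq_bigr do rewrite e2'.
  have e3 (i : nat) : F (grid n i / 2) (grid n j) = f i.
    rewrite /f /grid -/N; congr (F _ _); field.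
    by rewrite gt_eqF.
  have e4 (i : nat) : F ((grid n i + 1) / 2) (grid n j) = f (2 ^ n + i)%N.
    rewrite /f /grid natrD -/N; congr (F _ _); field.
    by rewrite gt_eqF.
  under [X in _ = X + _]eq_bigr do rewrite e3.
  under [X in _ = _ + X]eq_bigr do rewrite e4.
  rewrite -(big_mkord xpredT f) -(big_mkord xpredT (fun i => f (2 ^ n + i)%N)).
  rewrite -(big_mkord xpredT (fun i => f i.*2)) -(big_mkord xpredT (fun i => f i.*2.+1)).
  have -> : \sum_(0 <= i < 2 ^ n) f (2 ^ n + i)%N = \sum_(2 ^ n <= i < (2 ^ n).*2) f i.
    have := big_addn 0 (2 ^ n).*2 (2 ^ n) xpredT f; rewrite add0n -addnn addnK => ->.
    by apply: eq_bigr => i _; rewrite addnC.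
  rewrite -big_cat_nat ?leq_addr -?addnn ?leq_addr//=.
  elim: (2 ^ n)%N => [|k IH]; first by rewrite !big_nil addr0.
  rewrite addnn doubleS !big_nat_recr//= -addnn -IH addnn; ring.
rewrite (eq_bigr _ (fun j _ => E j)).
rewrite nmM nmV nmX nm_nat ler_pdivrMl ?exprn_gt0// (le_trans (nm_sum _ _ _))//.
apply: (@le_trans _ _ (\sum_(i < 2 ^ n) \sum_(j < 2 ^ n) e)); last first.
  by rewrite !sumr_const !card_ord -mulrnA -[e *+ _]mulr_natl natrM expr2.
apply: ler_sum => j _; rewrite (le_trans (nm_sum _ _ _))//; apply: ler_sum => i _.
have gi := grid_itv (ltnW (ltn_ord i)); have gi1 := grid_itv (ltn_ord i).
have gj := grid_itv (ltnW (ltn_ord j)).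
have N3 : 0 < (2 * N)^-1 <= N^-1.
  by rewrite invr_gt0 mulr_gt0//= lef_pV2 ?posrE ?mulr_gt0// ler_peMl ?ler1n// ltW.
rewrite nmC (@le_trans _ _ (e / 2))//; last flra.
apply: hd => //.
  by move: gi1 (gridS n i); rewrite -/N => ? ?; flra.
rewrite addrAC subrr add0r ger0_norm; last by case/andP: N3 => /ltW.
by case/andP: N3 => _ /le_lt_trans; apply.
Qed.

End Mean.
(** * Complex analysis in one variable *)

Section StrictDerivative.
Context {R : realType}.
Local Notation C := (Cplx R).
Implicit Types (u v f g : C -> C) (z w a b c d : C) (e : R) (K : set C).

(** A Lebesgue number argument, with the radii as the filter of the covering form of compactness.
    Radii are halved so that both points fall near the same centre. *)
Lemma unif_compact K (Q : C -> C -> Prop) : compact K ->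
  (forall x, K x -> exists2 d : R, 0 < d & forall y y',
     nm (y - x) < d -> nm (y' - x) < d -> Q y y') ->
  exists2 d : R, 0 < d & forall y y', K y -> nm (y' - y) < d -> Q y y'.
Proof.
move=> /compact_near_coveringP cK h.
have := cK R (0^'+) (fun (d : R) y => forall y', nm (y' - y) < d -> Q y y') _.
case.
  move=> x Kx; have [d d0 hd] := h x Kx.
  have d2 : 0 < d / 2 by flra.
  exists ([set y | nm (y - x) < d / 2], [set r : R | r < d / 2]) => /=.
    split; first by apply: nbhs_nm_lt.
    exact: nbhs_right_lt.
  move=> [y r] /= [hy hr] y' hy'; apply: hd; first flra.
  by have := nm_tri y' y x; flra.
move=> /= d d0 hd; exists (d / 2); first flra.
move=> y y' Ky hy; apply: (hd (d / 2) _ _ y Ky y' hy); last flra.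
by rewrite /ball /= sub0r normrN ger0_norm; flra.
Qed.

Definition cnm u z := forall e, 0 < e -> exists2 d : R, 0 < d &
  forall w, nm (w - z) < d -> nm (u w - u z) < e.

Lemma cnmP u z : {for z, continuous u} <-> cnm u z.
Proof.
split=> [/cvgC h e /h|h]; first by move=> /nbhs_nm.
by apply: (cvgC (nbhs_filter (z : C)) _ _).2 => e /h H; apply: (nbhs_nm _ _).2.
Qed.

Lemma cnm_near u z (A : set C) : cnm u z -> nbhs (u z) A -> nbhs z (u @^-1` A).
Proof. by move=> /cnmP; apply. Qed.

Lemma unif_cont K u : compact K -> (forall x, K x -> cnm u x) ->
  forall e, 0 < e -> exists2 d : R, 0 < d &
    forall y y', K y -> nm (y' - y) < d -> nm (u y' - u y) < e.
Proof.
move=> cK h e e0; have e2 : 0 < e / 2 by flra.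
apply: (unif_compact (Q := fun y y' => nm (u y' - u y) < e) cK) => x Kx.
have [d d0 hd] := h x Kx _ e2; exists d => // y y' /hd hy /hd hy'.
by have := nm_tri (u y') (u x) (u y); rewrite (nmC (u x)); flra.
Qed.

Lemma cnm_bounded K u : compact K -> (forall x, K x -> cnm u x) ->
  exists2 M : R, 0 < M & forall x, K x -> nm (u x) <= M.
Proof.
move=> cK h.
have cu : compact ((fun x => nm (u x)) @` K).
  apply: continuous_compact => //; apply: continuous_in_subspaceT => x /set_mem Kx.
  apply: (@continuous_comp _ _ _ u nm); last exact: nm_continuous.
  exact/cnmP/h.
have [M [Mr hM]] := compact_bounded cu.
exists (`|M| + 1); first by have := normr_ge0 M; flra.
move=> x Kx; rewrite -[leLHS]ger0_norm ?nm_ge0//.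
by apply: hM; [have := ler_norm M; flra|exists x].
Qed.

(* Strict (two-point) differentiability, with Wirtinger derivatives [a = du/dz] and
   [b = du/dzbar]. *)
Definition sder u z a b := forall e, 0 < e -> exists2 d : R, 0 < d &
  forall x y, nm (x - z) < d -> nm (y - z) < d ->
    nm (u x - u y - a * (x - y) - b * cj (x - y)) <= e * nm (x - y).

(** The ordinary complex derivative, equivalent to [derivable]. On a disc it is upgraded to [sder]
    by Goursat and Cauchy. *)
Definition pder u z a := forall e, 0 < e -> exists2 d : R, 0 < d &
  forall w, nm (w - z) < d -> nm (u w - u z - a * (w - z)) <= e * nm (w - z).

Lemma sder_pder u z a : sder u z a 0 -> pder u z a.
Proof.
move=> h e /h[d d0 hd]; exists d => // w hw.
by have := hd w z hw; rewrite subrr nm0 mul0r subr0; apply.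
Qed.

Lemma sder_lip u z a b : sder u z a b -> exists M d : R, [/\ 0 < M, 0 < d &
  forall x y, nm (x - z) < d -> nm (y - z) < d -> nm (u x - u y) <= M * nm (x - y)].
Proof.
move=> h; have [d d0 hd] := h 1 ltr01.
exists (1 + nm a + nm b), d; split=> //.
  by rewrite ltr_pwDl ?nm_ge0// ltr_pwDl ?nm_ge0.
move=> x y hx hy; have := hd x y hx hy.
have := nm_split (u x - u y) (a * (x - y) + b * cj (x - y)).
rewrite opprD addrA => h1 h2.
have := nmD (a * (x - y)) (b * cj (x - y)); rewrite !nmM nm_cj => h3.
by rewrite !mulrDl; flra.
Qed.

Lemma pder_lip u z a : pder u z a -> exists M d : R, [/\ 0 < M, 0 < d &
  forall x, nm (x - z) < d -> nm (u x - u z) <= M * nm (x - z)].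
Proof.
move=> h; have [d d0 hd] := h 1 ltr01.
exists (1 + nm a), d; split=> //; first by rewrite ltr_pwDl ?nm_ge0.
move=> x hx; have := hd x hx.
have := nm_split (u x - u z) (a * (x - z)); rewrite nmM => h1 h2.
by rewrite mulrDl; flra.
Qed.

Lemma lip_cnm u z (M d : R) : 0 < M -> 0 < d ->
  (forall x, nm (x - z) < d -> nm (u x - u z) <= M * nm (x - z)) -> cnm u z.
Proof.
move=> M0 d0 h e e0; exists (Num.min d (e / M)).
  by rewrite lt_min d0 divr_gt0.
move=> w; rewrite lt_min => /andP[/h h1 h2]; apply: le_lt_trans h1 _.
by rewrite mulrC -ltr_pdivlMr.
Qed.

Lemma sder_cnm u z a b : sder u z a b -> cnm u z.
Proof.
move=> /sder_lip[M [d [M0 d0 h]]]; apply: (lip_cnm M0 d0) => x hx.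
by apply: h => //; rewrite subrr nm0.
Qed.

Lemma pder_cnm u z a : pder u z a -> cnm u z.
Proof. by move=> /pder_lip[M [d [M0 d0 h]]]; apply: (lip_cnm M0 d0) => x hx; exact: h. Qed.

Lemma sder_near u v z a b : (\forall w \near z, u w = v w) -> sder u z a b -> sder v z a b.
Proof.
move=> /nbhs_nm[d d0 hd] h e /h[d' d'0 hd'].
exists (Num.min d d'); first by rewrite lt_min d0.
move=> x y; rewrite !lt_min => /andP[x1 x2] /andP[y1 y2].
by rewrite -!hd//; exact: hd'.
Qed.

Lemma sder_ext u v z a b : (forall w, u w = v w) -> sder u z a b -> sder v z a b.
Proof. by move=> /funext ->. Qed.

Lemma pder_near u v z a : (\forall w \near z, u w = v w) -> pder u z a -> pder v z a.
Proof.
move=> /nbhs_nm[d d0 hd] h e /h[d' d'0 hd'].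
exists (Num.min d d'); first by rewrite lt_min d0.
move=> x; rewrite !lt_min => /andP[x1 x2].
by rewrite -!hd//; [exact: hd'|rewrite subrr nm0].
Qed.

Lemma sder_eq u z a b a' b' : sder u z a b -> a = a' -> b = b' -> sder u z a' b'.
Proof. by move=> h <- <-. Qed.

Lemma sder_cst c z : sder (fun=> c) z 0 0.
Proof.
move=> e e0; exists 1 => // x y _ _.
by rewrite !mul0r !subr0 subrr nm0 mulr_ge0 ?nm_ge0 ?ltW.
Qed.

Lemma sder_id z : sder id z 1 0.
Proof.
move=> e e0; exists 1 => // x y _ _.
by rewrite mul0r subr0 mul1r subrr nm0 mulr_ge0 ?nm_ge0 ?ltW.
Qed.

Lemma sder_conj z : sder cj z 0 1.
Proof.
move=> e e0; exists 1 => // x y _ _.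
by rewrite mul0r subr0 mul1r cjB subrr nm0 mulr_ge0 ?nm_ge0 ?ltW.
Qed.

Lemma sderD u v z a b c d : sder u z a b -> sder v z c d ->
  sder (fun w => u w + v w) z (a + c) (b + d).
Proof.
move=> hu hv e e0; have e2 : 0 < e / 2 by flra.
have [d1 d10 h1] := hu _ e2; have [d2 d20 h2] := hv _ e2.
exists (Num.min d1 d2); first by rewrite lt_min d10.
move=> x y; rewrite !lt_min => /andP[x1 x2] /andP[y1 y2].
have := h1 x y x1 y1; have := h2 x y x2 y2 => k2 k1.
have -> : u x + v x - (u y + v y) - (a + c) * (x - y) - (b + d) * cj (x - y) =
  (u x - u y - a * (x - y) - b * cj (x - y)) + (v x - v y - c * (x - y) - d * cj (x - y)).
  by ring.
by rewrite (le_trans (nmD _ _))//; flra.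
Qed.

Lemma sderM u v z a b c d : sder u z a b -> sder v z c d ->
  sder (fun w => u w * v w) z (a * v z + u z * c) (b * v z + u z * d).
Proof.
move=> hu hv e e0.
have [M [d0 [M0 d00 lv]]] := sder_lip hv.
(* [k] dominates every factor in the four-term decomposition below, so that each term receives a
   quarter of [e]. *)
pose k := 1 + nm (u z) + nm (v z) + nm a + nm b + M.
have [k0 kv ku kab kM] : [/\ 0 < k, 1 + nm (v z) <= k, nm (u z) <= k, nm a + nm b <= k & M <= k].
  move: M0 (nm_ge0 (u z)) (nm_ge0 (v z)) (nm_ge0 a) (nm_ge0 b).
  rewrite /k; move: (nm (u z)) (nm (v z)) (nm a) (nm b) M {lv k d00} => *; split; flra.
have e1 : 0 < e / (4 * k) by rewrite divr_gt0// mulr_gt0.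
have [d1 d10 h1] := hu _ e1; have [d2 d20 h2] := hv _ e1.
have [d3 d30 h3] := sder_cnm hu e1; have [d4 d40 h4] := sder_cnm hv e1.
have [d5 d50 h5] := sder_cnm hv ltr01.
exists (Num.min d0 (Num.min d1 (Num.min d2 (Num.min d3 (Num.min d4 d5))))).
  by rewrite !lt_min d00 d10 d20 d30 d40.
move=> x y; rewrite !lt_min => /and5P[x0 x1 x2 x3 /andP[x4 x5]] /and5P[y0 y1 y2 y3 /andP[y4 y5]].
set s := x - y.
have -> : u x * v x - u y * v y - (a * v z + u z * c) * s - (b * v z + u z * d) * cj s =
  (u x - u y - a * s - b * cj s) * v x + (a * s + b * cj s) * (v x - v z)
  + u z * (v x - v y - c * s - d * cj s) + (u y - u z) * (v x - v y) by ring.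
set E := e / (4 * k) in e1 h1 h2 h3 h4.
have kE : k * E = e / 4 by rewrite /E; field; rewrite gt_eqF.
have n0 : 0 <= nm s := nm_ge0 _.
have t1 : nm ((u x - u y - a * s - b * cj s) * v x) <= k * E * nm s.
  rewrite nmM mulrC -mulrA ler_pM ?nm_ge0//; last exact: h1.
  apply: le_trans kv; rewrite (le_trans (nm_split (v x) (v z)))// addrC lerD2r.
  exact/ltW/h5.
have t2 : nm ((a * s + b * cj s) * (v x - v z)) <= k * E * nm s.
  rewrite nmM (le_trans (ler_wpM2r (nm_ge0 _) (nmD _ _)))// !nmM nm_cj -mulrDl.
  rewrite mulrAC ler_wpM2r// ler_pM ?nm_ge0 ?addr_ge0 ?nm_ge0//.
  exact/ltW/h4.
have t3 : nm (u z * (v x - v y - c * s - d * cj s)) <= k * E * nm s.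
  rewrite nmM -mulrA ler_pM ?nm_ge0//.
  exact: h2.
have t4 : nm ((u y - u z) * (v x - v y)) <= k * E * nm s.
  rewrite nmM mulrAC [X in _ <= X]mulrC ler_pM ?nm_ge0//; first exact/ltW/h3.
  by rewrite (le_trans (lv _ _ x0 y0))// ler_wpM2r.
move: t1 t2 t3 t4; rewrite kE => t1 t2 t3 t4.
rewrite (le_trans (nmD _ _))// (le_trans (lerD (nmD _ _) (lexx _)))//.
rewrite (le_trans (lerD (lerD (nmD _ _) (lexx _)) (lexx _)))//.
rewrite (le_trans (lerD (lerD (lerD t1 t2) t3) t4))// -mulrDl -mulrDl -mulrDl.
by rewrite ler_wpM2r//; flra.
Qed.

Lemma sderZ c u z a b : sder u z a b -> sder (fun w => c * u w) z (c * a) (c * b).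
Proof.
move=> h; have := sderM (sder_cst c z) h.
by rewrite !mul0r !add0r.
Qed.

Lemma sderN u z a b : sder u z a b -> sder (fun w => - u w) z (- a) (- b).
Proof.
move=> /(sderZ (-1)); rewrite !mulN1r; apply: sder_ext => w.
by rewrite mulN1r.
Qed.

Lemma sderB u v z a b c d : sder u z a b -> sder v z c d ->
  sder (fun w => u w - v w) z (a - c) (b - d).
Proof. by move=> hu hv; apply: sderD => //; exact: sderN. Qed.

Lemma sder_sum (I : Type) (r : seq I) (F A B : I -> C -> C) z :
  (forall i, sder (F i) z (A i z) (B i z)) ->
  sder (fun w => \sum_(i <- r) F i w) z (\sum_(i <- r) A i z) (\sum_(i <- r) B i z).
Proof.
move=> h; elim: r => [|i r IH].
  rewrite !big_nil; apply: sder_ext (sder_cst 0 z) => w.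
  by rewrite big_nil.
rewrite !big_cons; apply: sder_ext (sderD (h i) IH) => w.
by rewrite big_cons.
Qed.

Lemma sder_comp f u z a b c d : sder u z a b -> sder f (u z) c d ->
  sder (fun w => f (u w)) z (c * a + d * cj b) (c * b + d * cj a).
Proof.
move=> hu hf e e0.
have [M [d0 [M0 d00 lu]]] := sder_lip hu.
pose k := 1 + M + nm c + nm d.
have k0 : 0 < k by rewrite /k; have := nm_ge0 c; have := nm_ge0 d; flra.
have e1 : 0 < e / (2 * k) by rewrite divr_gt0// mulr_gt0.
have [d1 d10 h1] := hu _ e1; have [d2 d20 h2] := hf _ e1.
have [d3 d30 h3] := sder_cnm hu d20.
exists (Num.min d0 (Num.min d1 d3)); first by rewrite !lt_min d00 d10.
move=> x y; rewrite !lt_min => /and3P[x0 x1 x2] /and3P[y0 y1 y2].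
have p := h2 _ _ (h3 x x2) (h3 y y2); have q := h1 x y x1 y1; have r := lu x y x0 y0.
set s := x - y in p q r *; set t := u x - u y in p q r *.
have -> : f (u x) - f (u y) - (c * a + d * cj b) * s - (c * b + d * cj a) * cj s =
  (f (u x) - f (u y) - c * t - d * cj t) +
  (c * (t - a * s - b * cj s) + d * cj (t - a * s - b * cj s)).
  by rewrite (cjB (t - a * s)) (cjB t) (cjM a) (cjM b) cjK; ring.
set E := e / (2 * k) in e1 h1 h2 p q.
have kE : k * E = e / 2 by rewrite /E; field; rewrite gt_eqF.
rewrite (le_trans (nmD _ _))// (le_trans (lerD (lexx _) (nmD _ _)))// !nmM nm_cj -mulrDl.
have n0 : 0 <= nm s := nm_ge0 _.
have t1 : E * nm t <= k * E * nm s.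
  rewrite (mulrC k) -[E * k * _]mulrA ler_pM2l// (le_trans r)// ler_wpM2r//.
  by rewrite /k; have := nm_ge0 c; have := nm_ge0 d; flra.
have t2 : (nm c + nm d) * nm (t - a * s - b * cj s) <= k * E * nm s.
  rewrite -mulrA ler_pM ?addr_ge0 ?nm_ge0//.
  by rewrite /k; flra.
move: t1 t2; rewrite kE; flra.
Qed.

Lemma sder_inv z : z != 0 -> sder (fun w => w^-1) z (- z ^- 2) 0.
Proof.
move=> z0 e e0; have n0 : 0 < nm z by rewrite nm_gt0.
(* The first radius keeps [x] and [y] at distance at least [nm z / 2] from 0; with the second the
   explicit remainder is at most [5 / 8] of [e * nm (x - y)]. *)
exists (Num.min (nm z / 2) (e * nm z ^+ 3 / 16)).
  by rewrite lt_min !divr_gt0// mulr_gt0 ?exprn_gt0.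
move=> x y; rewrite !lt_min => /andP[x1 x2] /andP[y1 y2].
have nx : nm z / 2 <= nm x by have := nm_split z x; rewrite (nmC z); flra.
have ny : nm z / 2 <= nm y by have := nm_split z y; rewrite (nmC z); flra.
have x0 : x != 0 by rewrite -nm_gt0; flra.
have y0 : y != 0 by rewrite -nm_gt0; flra.
have -> : x^-1 - y^-1 - - z ^- 2 * (x - y) - 0 * cj (x - y) =
  ((x * (y - z) + z * (x - z)) * (z ^- 2 * (x^-1 * y^-1))) * (x - y).
  by field; rewrite x0 y0 z0.
rewrite nmM ler_wpM2r ?nm_ge0// !nmM !nmV nmX.
have k1 : nm (x * (y - z) + z * (x - z)) <= 5 / 2 * nm z * (e * nm z ^+ 3 / 16).
  rewrite (le_trans (nmD _ _))// !nmM.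
  have nx2 : nm x <= 3 / 2 * nm z by have := nm_split x z; flra.
  have k2 : nm x * nm (y - z) <= 3 / 2 * nm z * (e * nm z ^+ 3 / 16).
    by rewrite ler_pM ?nm_ge0// ltW.
  have k3 : nm z * nm (x - z) <= nm z * (e * nm z ^+ 3 / 16).
    by rewrite ler_wpM2l ?nm_ge0// ltW.
  move: k2 k3; rewrite -!mulrA; set t := nm z * (e * _); move: t => t; flra.
have k4 : (nm x)^-1 * (nm y)^-1 <= 4 / nm z ^+ 2.
  have -> : 4 / nm z ^+ 2 = (nm z / 2)^-1 * (nm z / 2)^-1 by field; rewrite gt_eqF.
  by rewrite ler_pM ?invr_ge0 ?nm_ge0// lef_pV2 ?posrE// ?divr_gt0 ?nm_gt0.
apply: (@le_trans _ _ ((5 / 2 * nm z * (e * nm z ^+ 3 / 16)) * (nm z ^- 2 * (4 / nm z ^+ 2)))).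
  rewrite ler_pM ?nm_ge0 ?mulr_ge0 ?invr_ge0 ?exprn_ge0 ?nm_ge0//.
  by rewrite ler_wpM2l ?invr_ge0 ?exprn_ge0 ?nm_ge0.
rewrite [leLHS](_ : _ = e * (5 / 8)); last by field; rewrite gt_eqF.
by rewrite ger_pMr//; flra.
Qed.

(** A real linear map [A s + B cj s] that vanishes on the unit circle is zero: the directions 1 and
    ['i] give [A + B = 0] and [A - B = 0]. *)
Lemma sder_uniq u z a b a' b' : sder u z a b -> sder u z a' b' -> a = a' /\ b = b'.
Proof.
move=> h h'; have {}h := sderB h h'.
set A := a - a' in h; set B := b - b' in h.
have key (s : C) : nm s = 1 -> A * s + B * cj s = 0.
  move=> ns; apply/eqP; rewrite -nm_eq0 eq_le nm_ge0 andbT.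
  apply/ler_addgt0Pl => e e0; rewrite addr0; have [d d0 hd] := h e e0.
  have d2 : 0 < d / 2 by flra.
  have := hd (z + (d / 2)%:C * s) z; rewrite subrr nm0 => /(_ _ d0).
  rewrite (addrC z) addrK nmM nm_real ns mulr1 (ger0_norm (ltW d2)) => /(_ ltac:(flra)).
  rewrite !subrr cjM cj_real.
  rewrite (_ : _ - _ = - ((d / 2)%:C * (A * s + B * cj s))); last by ring.
  by rewrite nmN nmM nm_real (ger0_norm (ltW d2)) (mulrC e) ler_pM2l.
have k1 := key 1 nm1; have ki := key 'i nm_i.
rewrite cj1 !mulr1 in k1.
have AB : A = - B by apply/eqP; rewrite -addr_eq0 k1.
move: ki; rewrite cj_i AB mulNr mulrN -opprD => /eqP; rewrite oppr_eq0 -mulr2n mulrn_eq0 /= mulf_eq0.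
rewrite -(nm_eq0 'i) nm_i oner_eq0 orbF => /eqP B0.
move: AB; rewrite B0 oppr0 => A0; split; apply/eqP; rewrite -subr_eq0; apply/eqP => //.
Qed.

End StrictDerivative.

(** * Differentiation under the mean, and the parametrised circle *)

Section MeanDerivatives.
Context {R : realType}.
Local Notation C := (Cplx R).
Implicit Types (u f : C -> C) (z w a b : C) (e : R).

(** Linearity and monotonicity of [mean] transport a uniform remainder estimate; no convergence
    theorem is involved. *)
Lemma sder_mean (F : R -> R -> C -> C) (A B : R -> R -> C) z (M MA MB d0 : R) :
  0 < d0 -> (forall w, nm (w - z) < d0 -> bnd01 (fun s t => F s t w) M) ->
  bnd01 A MA -> bnd01 B MB ->
  (forall e, 0 < e -> exists2 d : R, 0 < d & forall s t x y,
    0 <= s <= 1 -> 0 <= t <= 1 -> nm (x - z) < d -> nm (y - z) < d ->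
    nm (F s t x - F s t y - A s t * (x - y) - B s t * cj (x - y)) <= e * nm (x - y)) ->
  sder (fun w => mean (fun s t => F s t w)) z (mean A) (mean B).
Proof.
move=> d00 bF bA bB h e e0; have [d dp hd] := h e e0.
exists (Num.min d0 d); first by rewrite lt_min d00.
move=> x y; rewrite !lt_min => /andP[x0 x1] /andP[y0 y1].
rewrite (mulrC (mean A)) (mulrC (mean B)) -(meanB (bF _ x0) (bF _ y0)).
rewrite -(meanZ (x - y) bA) -(meanZ (cj (x - y)) bB).
rewrite -(meanB (bnd01B (bF _ x0) (bF _ y0)) (bnd01Z _ bA)).
rewrite -(meanB (bnd01B (bnd01B (bF _ x0) (bF _ y0)) (bnd01Z _ bA)) (bnd01Z _ bB)).
apply: mean_le => s t hs ht.
by rewrite -(mulrC (A s t)) -(mulrC (B s t)); exact: hd.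
Qed.

Lemma derive_pder u z : derivable u z 1 -> pder u z ('D_1 u z).
Proof.
move=> h.
have : (fun h : C => h^-1 *: ((u \o shift z) (h *: (1 : C)) - u z)) @ (0 : C)^' --> 'D_1 u z by exact: h.
move: ('D_1 u z) => a /(cvgC (dnbhs_filter (0 : C)) _ _).1 k e e0.
have := k _ e0; rewrite near_withinE => /nbhs_nm[d d0 hd]; exists d => // w hw.
have [->|wz] := eqVneq w z; first by rewrite !subrr mulr0 subr0 nm0 mulr0.
have wz0 : w - z != 0 by rewrite subr_eq0.
have := hd (w - z); rewrite subr0 => /(_ hw wz0).
rewrite /= [(w - z) *: 1](_ : _ = w - z); last exact: mulr1.
rewrite subrK => /ltW {}k.
rewrite -ler_pdivrMr ?nm_gt0// -nmV -nmM; move: k; congr (nm _ <= _).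
by rewrite /GRing.scale /=; field.
Qed.

Lemma derivable_pder u z : derivable u z 1 <-> exists a, pder u z a.
Proof.
split=> [h|[a h]]; first by exists ('D_1 u z); exact: derive_pder.
apply/cvg_ex; exists a; apply/cvgC => e e0; have e2 : 0 < e / 2 by flra.
have [d d0 hd] := h _ e2; rewrite near_withinE; apply: (nbhs_nm _ _).2.
exists d => // w; rewrite subr0 => hw w0.
rewrite /= [w *: 1](_ : _ = w); last exact: mulr1.
have := hd (w + z); rewrite addrK => /(_ hw) k.
apply: (@le_lt_trans _ _ (e / 2)); last flra.
rewrite -(ler_pM2r (_ : 0 < nm w)) ?nm_gt0// -nmM; move: k; congr (nm _ <= _).
by rewrite /GRing.scale /=; field.
Qed.

Lemma pder_uniq u z a b : pder u z a -> pder u z b -> a = b.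
Proof.
move=> ha hb; apply/eqP; rewrite -subr_eq0 -nm_eq0 eq_le nm_ge0 andbT.
apply/ler_addgt0Pl => e e0; rewrite addr0; have e2 : 0 < e / 2 by flra.
have [d d0 hd] := ha _ e2; have [d' d'0 hd'] := hb _ e2.
pose m := Num.min d d' / 2; have m0 : 0 < m by rewrite /m divr_gt0// lt_min d0.
have mm : m < Num.min d d' by rewrite /m; move: m0; rewrite /m; flra.
move: mm; rewrite lt_min => /andP[md md'].
have := hd (z + m%:C); have := hd' (z + m%:C).
rewrite (addrC z) addrK nm_real (ger0_norm (ltW m0)) => /(_ md') k' /(_ md) k.
rewrite -(ler_pM2r m0) -{1}(ger0_norm (ltW m0)) -nm_real -nmM.
rewrite (_ : _ * _ = (u (m%:C + z) - u z - b * m%:C) - (u (m%:C + z) - u z - a * m%:C)); last by ring.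
by rewrite (le_trans (nmB _ _))//; flra.
Qed.

Lemma pder_derive u z a : pder u z a -> derivable u z 1 /\ 'D_1 u z = a.
Proof.
move=> h; have d : derivable u z 1 by apply/derivable_pder; exists a.
by split=> //; apply: (@pder_uniq u z) => //; exact: derive_pder.
Qed.

Lemma cD_subproof : {D : (C -> C) -> C -> C | forall u z, D u z = 'D_1 u z}.
Proof. by exists (fun u z => 'D_1 u z). Qed.

(* Sealed: conversion problems on the limit defining ['D_1] do not terminate in
   reasonable time. *)
Definition cD : (C -> C) -> C -> C := sval cD_subproof.

Lemma cDE u z : cD u z = 'D_1 u z. Proof. exact: (svalP cD_subproof). Qed.

Lemma pder_cD u z a : pder u z a -> cD u z = a.
Proof. by move=> /pder_derive[_ <-]; exact: cDE. Qed.

Lemma real_is_derive (f : R -> R) (x l e : R) : is_derive x 1 f l -> 0 < e ->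
  exists2 d : R, 0 < d & forall h, `|h| < d -> `|f (h + x) - f x - l * h| <= e * `|h|.
Proof.
move=> [df <-] e0.
have : (fun h : R => h^-1 *: ((f \o shift x) (h *: (1 : R)) - f x)) @ (0 : R)^' --> 'D_1 f x by exact: df.
move: ('D_1 f x) => a /(cvgR (dnbhs_filter (0 : R)) _ _).1 /(_ _ e0).
rewrite near_withinE => /nbhs_ballP[d /= d0 hd]; exists d => // h hh.
have [->|h0] := eqVneq h 0; first by rewrite add0r mulr0 subr0 subrr normr0 mulr0.
have := hd h; rewrite /ball /= sub0r normrN => /(_ hh h0).
rewrite /= [h *: 1](_ : _ = h); last exact: mulr1.
move=> /ltW k.
rewrite -ler_pdivrMr ?normr_gt0// -normfV -normrM; move: k; congr (`|_| <= _).
by rewrite /GRing.scale /=; field.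
Qed.

(** The point [exp (2 pi i t)], with [t] in the unit interval to match [mean]. *)
Definition ee (t : R) : C := cos (2 * pi * t) +i* sin (2 * pi * t).

Lemma nm_ee t : nm (ee t) = 1.
Proof. by rewrite /nm /ee normc_def /= cos2Dsin2 sqrtr1. Qed.

Lemma ee0 : ee 0 = 1.
Proof. by rewrite /ee mulr0 cos0 sin0. Qed.

Lemma ee1 : ee 1 = 1.
Proof. by rewrite /ee mulr1 mulr_natl cos2pi sin2pi. Qed.

Lemma eeD s t : ee (s + t) = ee s * ee t.
Proof.
rewrite /ee mulrDr cosD sinD; apply/eqP; rewrite eq_complex /=.
by apply/andP; split; apply/eqP; ring.
Qed.

(** The number [2 pi i]: the derivative of [ee] is [tau * ee]. *)
Definition tau : C := (2 * pi)%:C * 'i.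

Lemma tau_neq0 : tau != 0.
Proof. by rewrite -nm_gt0 /tau nmM nm_real nm_i mulr1 normr_gt0 gt_eqF// mulr_gt0// pi_gt0. Qed.

(** By the addition formula the estimate at 0 holds at every [t] with the same modulus. *)
Lemma ee_diff e : 0 < e -> exists2 d : R, 0 < d & forall t t', `|t' - t| < d ->
  nm (ee t' - ee t - (t' - t)%:C * (tau * ee t)) <= e * `|t' - t|.
Proof.
move=> e0; have p0 : 0 < 2 * pi :> R by rewrite mulr_gt0// pi_gt0.
have e1 : 0 < e / (2 * (2 * pi)) by rewrite divr_gt0// mulr_gt0.
have [d1 d10 h1] := real_is_derive (is_derive_cos 0) e1.
have [d2 d20 h2] := real_is_derive (is_derive_sin 0) e1.
exists (Num.min d1 d2 / (2 * pi)); first by rewrite divr_gt0// lt_min d10.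
move=> t t'; rewrite ltr_pdivlMr// lt_min => /andP[k1 k2].
set h := t' - t in k1 k2 *.
have -> : t' = t + h by rewrite /h addrC subrK.
rewrite eeD (_ : _ - _ = ee t * (ee h - 1 - h%:C * tau)); last by ring.
rewrite nmM nm_ee mul1r (le_trans (nm_ReIm _))//.
have hp : `|2 * pi * h| = `|h| * (2 * pi) by rewrite normrM (ger0_norm (ltW p0)) mulrC.
have := h1 (2 * pi * h); have := h2 (2 * pi * h); rewrite hp => /(_ k2) + /(_ k1).
rewrite addr0 sin0 cos0 oppr0 mul0r !subr0 mul1r.
have E : e / (2 * (2 * pi)) * (`|h| * (2 * pi)) = e * `|h| / 2.
  by move: p0; set P := 2 * pi => p0; field; rewrite gt_eqF.
rewrite E => i2 i1.
rewrite /ee /tau /=; move: i1 i2; rewrite !(mul0r, mulr0, mul1r, mulr1, subr0, sub0r, addr0, add0r, oppr0, opprK).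
rewrite (mulrC h) => i1 i2; flra.
Qed.

End MeanDerivatives.

(** * Path integrals along segments *)

Section Goursat.
Context {R : realType}.
Local Notation C := (Cplx R).
Implicit Types (f F : C -> C) (a b c z w : C) (e : R).

Definition pt a b (s : R) : C := a + s%:C * (b - a).

Definition seg f a b : C := (b - a) * mean (fun s _ => f (pt a b s)).

Definition tri f a b c : C := seg f a b + seg f b c + seg f c a.

Lemma nm_pt a b c (r s : R) : 0 <= s <= 1 -> nm (a - c) <= r -> nm (b - c) <= r ->
  nm (pt a b s - c) <= r.
Proof.
move=> /andP[s0 s1] ha hb.
have -> : pt a b s - c = (1 - s)%:C * (a - c) + s%:C * (b - c).
  by rewrite /pt rmorphB /=; ring.
have s2 : 0 <= 1 - s by rewrite subr_ge0.
rewrite (le_trans (nmD _ _))// !nmM !nm_real !ger0_norm//.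
have := ler_wpM2l s2 ha; have := ler_wpM2l s0 hb.
by rewrite mulrBl mul1r; flra.
Qed.

Lemma pt_diff a b (s s' : R) : pt a b s' - pt a b s = (s' - s)%:C * (b - a).
Proof. by rewrite /pt rmorphB /=; ring. Qed.

Lemma bnd_seg f a b c (r M : R) : nm (a - c) <= r -> nm (b - c) <= r ->
  (forall w, nm (w - c) <= r -> nm (f w) <= M) ->
  bnd01 (fun s _ => f (pt a b s)) M.
Proof. by move=> ha hb hf s t hs _; apply: hf; exact: nm_pt. Qed.

Section Disc.
Variables (f : C -> C) (c : C) (r : R).
Hypothesis cf : forall z, nm (z - c) <= r -> cnm f z.

Let bf : exists M : R, forall w, nm (w - c) <= r -> nm (f w) <= M.
Proof.
have [M _ hM] := cnm_bounded (@nm_ball_compact R c r) (fun x => @cf x).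
by exists M.
Qed.

Let uf e : 0 < e -> exists2 d : R, 0 < d & forall z w, nm (z - c) <= r ->
  nm (w - z) < d -> nm (f w - f z) < e.
Proof. exact: (unif_cont (@nm_ball_compact R c r) (fun x => @cf x)). Qed.

Lemma seg_rev a b : nm (a - c) <= r -> nm (b - c) <= r -> seg f b a = - seg f a b.
Proof.
move=> ha hb; have [M hM] := bf.
rewrite /seg -mulNr opprB -(mean_rev (bnd_seg hb ha hM)); congr (_ * _).
by apply: mean_eq => s t _ _; congr f; rewrite /pt rmorphB /=; ring.
Qed.

Lemma seg_bisect a b : nm (a - c) <= r -> nm (b - c) <= r ->
  seg f a b = seg f a ((a + b) / 2) + seg f ((a + b) / 2) b.
Proof.
move=> ha hb; have [M hM] := bf; set m := (a + b) / 2.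
have N2 : (2 : C) != 0 by rewrite pnatr_eq0.
have ma : m - a = (b - a) / 2 by rewrite /m; field.
have bm : b - m = (b - a) / 2 by rewrite /m; field.
rewrite /seg ma bm -mulrDr.
have -> : mean (fun s _ => f (pt a m s)) = mean (fun s _ => f (pt a b (s / 2))).
  apply: mean_eq => s t _ _; congr f; rewrite /pt ma rmorphM fmorphV /= rmorph_nat.
  by field.
have -> : mean (fun s _ => f (pt m b s)) = mean (fun s _ => f (pt a b ((s + 1) / 2))).
  apply: mean_eq => s t _ _; congr f; rewrite /pt bm /m rmorphM fmorphV rmorphD /= rmorph_nat.
  by field.
rewrite -(mean_bisect (bnd_seg ha hb hM)); first by field.
move=> e e0; have [d d0 hd] := uf e0.
have k0 : 0 < 1 + nm (b - a) by rewrite ltr_pwDl ?nm_ge0.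
exists (d / (1 + nm (b - a))); first by rewrite divr_gt0.
move=> s s' t hs hs' _; rewrite ltr_pdivlMr// mulrDr mulr1 => lt.
apply/ltW/hd; first exact: nm_pt.
rewrite pt_diff nmM nm_real; have := normr_ge0 (s' - s); flra.
Qed.

Lemma tri_bisect a b d : nm (a - c) <= r -> nm (b - c) <= r -> nm (d - c) <= r ->
  let x := (a + b) / 2 in let y := (b + d) / 2 in let z := (d + a) / 2 in
  tri f a b d = tri f a x z + tri f x b y + tri f y d z + tri f x y z.
Proof.
move=> ha hb hd x y z.
have mid p q : nm (p - c) <= r -> nm (q - c) <= r -> nm ((p + q) / 2 - c) <= r.
  move=> hp hq.
  have -> : (p + q) / 2 - c = ((p - c) + (q - c)) / 2.
    by have N2 : (2 : C) != 0 := pow2_neq0 1; field.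
  by rewrite nmM nmV nm_nat ler_pdivrMr// (le_trans (nmD _ _))//; flra.
have hx : nm (x - c) <= r by exact: mid.
have hy : nm (y - c) <= r by exact: mid.
have hz : nm (z - c) <= r by exact: mid.
rewrite /tri (seg_bisect ha hb) (seg_bisect hb hd) (seg_bisect hd ha) -/x -/y -/z.
rewrite (seg_rev hz hx) (seg_rev hx hy) (seg_rev hy hz); ring.
Qed.

End Disc.

Lemma seg_cst (k : C) a b : seg (fun=> k) a b = (b - a) * k.
Proof. by rewrite /seg mean_cst. Qed.

Lemma seg_aff (k z a b : C) : seg (fun w => k * (w - z)) a b =
  k / 2 * ((b - z) ^+ 2 - (a - z) ^+ 2).
Proof.
pose P (s : R) := k / 2 * (pt a b s - z) ^+ 2.
have N2 : (2 : C) != 0 by rewrite pnatr_eq0.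
pose r := nm a + nm b + nm z.
have hp s : 0 <= s <= 1 -> nm (pt a b s - z) <= r.
  have ? := nm_ge0 a; have ? := nm_ge0 b; have ? := nm_ge0 z.
  by move=> hs; apply: nm_pt => //; rewrite (le_trans (nmB _ _))// /r; flra.
have r0 : 0 <= r by rewrite /r !addr_ge0 ?nm_ge0.
have bP : bnd01 (fun s _ => P s) (nm (k / 2) * r ^+ 2).
  by move=> s t hs _; rewrite /P nmM nmX ler_wpM2l ?nm_ge0// lerXn2r ?nnegrE ?nm_ge0 ?hp.
have bQ : bnd01 (fun s _ => (b - a) * (k * (pt a b s - z))) (nm (b - a) * (nm k * r)).
  by move=> s t hs _; rewrite !nmM !ler_wpM2l ?nm_ge0 ?hp.
have bQ' : bnd01 (fun s _ => k * (pt a b s - z)) (nm k * r).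
  by move=> s t hs _; rewrite nmM ler_wpM2l ?nm_ge0 ?hp.
have h : diff01 (fun s _ => P s) (fun s _ => (b - a) * (k * (pt a b s - z))).
  move=> e e0; pose m := nm (k / 2 * (b - a) ^+ 2).
  have m0 : 0 < 1 + m by rewrite ltr_pwDl ?nm_ge0.
  exists (e / (1 + m)); first by rewrite divr_gt0.
  move=> s s' t _ _ _; rewrite ltr_pdivlMr// => lt.
  have -> : P s' - P s - (s' - s)%:C * ((b - a) * (k * (pt a b s - z))) =
     (k / 2 * (b - a) ^+ 2) * ((s' - s)%:C * (s' - s)%:C).
    rewrite /P; have -> : pt a b s' = pt a b s + (s' - s)%:C * (b - a).
      by rewrite -pt_diff addrC subrK.
    by field.
  rewrite nmM -/m nmM nm_real mulrA ler_wpM2r//.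
  by move: lt; rewrite mulrDr mulr1 mulrC => lt; have := normr_ge0 (s' - s); flra.
rewrite /seg -(meanZ _ bQ') (mean_ftc bP bQ h).
rewrite (mean_eq (G := fun _ _ => k / 2 * ((b - z) ^+ 2 - (a - z) ^+ 2))) ?mean_cst//.
move=> s t _ _; rewrite /P /pt mul0r addr0 mul1r [a + _]addrC subrK; ring.
Qed.

End Goursat.

(** * Goursat's theorem and primitives on discs *)

Section Primitive.
Context {R : realType}.
Local Notation C := (Cplx R).
Implicit Types (F : C -> C) (a b d z w : C) (e : R).

(** Dependent choice, for the sequence of nested triangles. *)
Lemma iter_choice (T : Type) (P : T -> Prop) (Q : T -> T -> Prop) (x0 : T) :
  P x0 -> (forall x, P x -> exists2 y, P y & Q x y) ->
  exists u : nat -> T, [/\ u 0%N = x0, forall n, P (u n) & forall n, Q (u n) (u n.+1)].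
Proof.
move=> P0 h.
have /choice[g hg] x : exists y, P x -> P y /\ Q x y.
  by case: (pselect (P x)) => [/h[y Py Qy]|nP]; [exists y|exists x].
exists (fun n => iter n g x0); have Pn n : P (iter n g x0) by elim: n => //= n /hg[].
by split=> // n /=; have [] := hg _ (Pn n).
Qed.

Section Disc.
Variables (f : C -> C) (c : C) (r : R).
Hypothesis df : forall z, nm (z - c) <= r -> exists a, pder f z a.

Let cf z : nm (z - c) <= r -> cnm f z.
Proof. by move=> /df[a] /pder_cnm. Qed.

(** The bound [D] on the sides travels with the triangle, so that it is exactly halved at each step,
    degenerate triangles included. *)
Definition bad_tri e (T : (C * C * C) * R) := let: (a, b, d, D) := T in
  [/\ 0 <= D, [/\ nm (a - c) <= r, nm (b - c) <= r & nm (d - c) <= r],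
   [/\ nm (b - a) <= D, nm (d - b) <= D & nm (a - d) <= D] &
   e * D ^+ 2 < nm (tri f a b d)].

Definition sub_tri (T T' : (C * C * C) * R) :=
  nm (T'.1.1.1 - T.1.1.1) <= T.2 /\ T'.2 = T.2 / 2.

(** The integral is the sum over the four triangles cut out by the midpoints, so one of them keeps
    more than a quarter of the bound [e * D ^ 2], and [D ^ 2] is divided by 4 as well. *)
Lemma bad_step e T : bad_tri e T -> exists2 T', bad_tri e T' & sub_tri T T'.
Proof.
case: T => [[[a b] d] D] [D0 [ha hb hd] [ab bd da] lt].
set x := (a + b) / 2; set y := (b + d) / 2; set z := (d + a) / 2.
have N2 : (2 : C) != 0 := pow2_neq0 1.
have D2 : 0 <= D / 2 by flra.
have half (u : C) : nm u <= D -> nm (u / 2) <= D / 2.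
  by move=> h; rewrite nmM nmV nm_nat ler_wpM2r.
have Dr : D / 2 <= D by flra.
have mid p q : nm (p - c) <= r -> nm (q - c) <= r -> nm ((p + q) / 2 - c) <= r.
  move=> hp hq.
  have -> : (p + q) / 2 - c = ((p - c) + (q - c)) / 2 by field.
  by rewrite nmM nmV nm_nat ler_pdivrMr// (le_trans (nmD _ _))//; flra.
have hx : nm (x - c) <= r by exact: mid.
have hy : nm (y - c) <= r by exact: mid.
have hz : nm (z - c) <= r by exact: mid.
have xa : nm (x - a) <= D / 2 by rewrite (_ : x - a = (b - a) / 2) ?half// /x; field.
have bx : nm (b - x) <= D / 2 by rewrite (_ : b - x = (b - a) / 2) ?half// /x; field.
have yb : nm (y - b) <= D / 2 by rewrite (_ : y - b = (d - b) / 2) ?half// /y; field.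
have dy : nm (d - y) <= D / 2 by rewrite (_ : d - y = (d - b) / 2) ?half// /y; field.
have zd : nm (z - d) <= D / 2 by rewrite (_ : z - d = (a - d) / 2) ?half// /z; field.
have az : nm (a - z) <= D / 2 by rewrite (_ : a - z = (a - d) / 2) ?half// /z; field.
have zx : nm (z - x) <= D / 2.
  by rewrite (_ : z - x = (d - b) / 2) ?half// /z /x; field.
have xy : nm (x - y) <= D / 2.
  by rewrite (_ : x - y = (a - d) / 2) ?half// /y /x; field.
have yz : nm (y - z) <= D / 2.
  by rewrite (_ : y - z = (b - a) / 2) ?half// /y /z; field.
have q : e * (D / 2) ^+ 2 = e * D ^+ 2 / 4 by field.
have [h1|h1] := ltP (e * (D / 2) ^+ 2) (nm (tri f a x z)).
  by exists (a, x, z, D / 2); split=> //=; rewrite subrr nm0.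
have [h2|h2] := ltP (e * (D / 2) ^+ 2) (nm (tri f x b y)).
  by exists (x, b, y, D / 2); split=> //=; exact: (le_trans xa Dr).
have [h3|h3] := ltP (e * (D / 2) ^+ 2) (nm (tri f y d z)).
  exists (y, d, z, D / 2); first by split=> //; split=> //; rewrite nmC.
  split=> //=; rewrite (_ : y - a = (y - b) + (b - x) + (x - a)); last by ring.
  have := nmD (y - b + (b - x)) (x - a); have := nmD (y - b) (b - x).
  have -> : nm (y - b + (b - x) + (x - a)) = nm ((y - z) - (a - z)) by congr nm; ring.
  by have := nmB (y - z) (a - z); move: yz az; clear; flra.
have [h4|h4] := ltP (e * (D / 2) ^+ 2) (nm (tri f x y z)).
  exists (x, y, z, D / 2); first by split=> //; split=> //; rewrite nmC.
  by split=> //=; exact: (le_trans xa Dr).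
exfalso; move: lt; rewrite (tri_bisect cf ha hb hd) -/x -/y -/z.
have := nmD (tri f a x z + tri f x b y + tri f y d z) (tri f x y z).
have := nmD (tri f a x z + tri f x b y) (tri f y d z).
have := nmD (tri f a x z) (tri f x b y).
by move: h1 h2 h3 h4; rewrite q; clear; flra.
Qed.

Lemma seg_near z al e (rho : R) a b : pder f z al -> 0 < e -> 0 <= rho ->
  (forall w, nm (w - z) <= rho -> nm (f w - f z - al * (w - z)) <= e * nm (w - z)) ->
  nm (a - z) <= rho -> nm (b - z) <= rho ->
  nm (seg f a b - (b - a) * f z - al / 2 * ((b - z) ^+ 2 - (a - z) ^+ 2)) <=
  nm (b - a) * (e * rho).
Proof.
move=> hal e0 rho0 h ha hb.
rewrite -seg_aff -(seg_cst (f z)) /seg -2!mulrBr nmM ler_wpM2l ?nm_ge0//.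
have b1 : bnd01 (fun s _ => f (pt a b s)) (e * rho + (nm (f z) + nm al * rho)).
  move=> s t hs _; have hp := nm_pt hs ha hb.
  rewrite (le_trans (nm_split _ (f z + al * (pt a b s - z))))// opprD addrA [leLHS]addrC lerD//.
    by rewrite (le_trans (h _ hp))// ler_pM2l.
  by rewrite (le_trans (nmD _ _))// lerD2l nmM ler_wpM2l ?nm_ge0.
have b2 : bnd01 (fun _ _ : R => f z) (nm (f z)) by [].
have b3 : bnd01 (fun s _ => al * (pt a b s - z)) (nm al * rho).
  by move=> s t hs _; rewrite nmM ler_wpM2l ?nm_ge0// nm_pt.
rewrite -(meanB b1 b2) -(meanB (bnd01B b1 b2) b3); apply: mean_le => s t hs _.
have hp := nm_pt hs ha hb.
by rewrite (le_trans (h _ hp))// ler_pM2l.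
Qed.

(** The first vertices of nested bad triangles converge along [ultra_nat] to a point [z]. The affine
    part of [f] at [z] integrates to zero around a triangle, and the remainder is at most
    [e * D ^ 2], against badness. *)
Lemma goursat a b d : nm (a - c) <= r -> nm (b - c) <= r -> nm (d - c) <= r ->
  tri f a b d = 0.
Proof.
move=> ha hb hd; apply/eqP; rewrite -nm_eq0 eq_le nm_ge0 andbT.
pose D0 := nm (b - a) + nm (d - b) + nm (a - d).
have [p1 p2 p3] : [/\ 0 <= nm (b - a), 0 <= nm (d - b) & 0 <= nm (a - d)] by rewrite !nm_ge0.
have D00 : 0 <= D0 by rewrite /D0; flra.
suff h e : 0 < e -> nm (tri f a b d) <= e * D0 ^+ 2.
  apply/ler_addgt0Pl => e e0; rewrite addr0.
  have k0 : 0 < 1 + D0 ^+ 2 by rewrite ltr_pwDl// sqr_ge0.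
  rewrite (le_trans (h _ (divr_gt0 e0 k0)))// mulrAC ler_pdivrMr//.
  by rewrite ler_pM2l// ler_wpDl.
move=> e0; rewrite leNgt; apply/negP => lt.
have b0 : bad_tri e (a, b, d, D0) by split=> //; split; rewrite /D0; flra.
have [T [T0 badT subT]] := iter_choice b0 (@bad_step e).
pose D n := D0 / 2 ^+ n.
have TD n : (T n).2 = D n.
  elim: n => [|n IH]; first by rewrite T0 /D expr0 divr1.
  by rewrite (subT n).2 IH /D exprS; field; rewrite expf_neq0.
have Dn0 n : 0 <= D n by rewrite /D divr_ge0// exprn_ge0.
pose A n := (T n).1.1.1.
have AD n k : nm (A (n + k)%N - A n) <= 2 * D n - 2 * D (n + k)%N.
  elim: k => [|k IH]; first by rewrite addn0 !subrr nm0.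
  have := nm_tri (A (n + k.+1)%N) (A (n + k)%N) (A n).
  have := (subT (n + k)%N).1; rewrite TD -addnS => ? ?.
  have : D (n + k.+1)%N = D (n + k)%N / 2.
    by rewrite /D addnS exprS; field; rewrite expf_neq0.
  rewrite /A in IH *; flra.
have := @nm_ball_compact R c r; rewrite compact_ultra => /(_ (A @ ultra_nat) (fmap_ultra _ _))[].
  have : ultra_nat [set n | nm (A n - c) <= r].
    by apply: filterE => n /=; have := badT n; rewrite /A; case: (T n) => [[[? ?] ?] ?] [_ []].
  by [].
suff hz0 (z : C) : nm (z - c) <= r -> A @ ultra_nat --> z -> False by move=> z [/= zr Az]; exact: (hz0 z).
move=> zr Az; have zA n : nm (A n - z) <= 2 * D n.
  apply/ler_addgt0Pl => e' e'0; have /cvgC /(_ _ e'0) hn := Az.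
  have hk : \forall k \near ultra_nat, nm (A k - A n) <= 2 * D n.
    apply: ultra_natP.2; exists n => // k /= nk.
    by have := AD n (k - n)%N; rewrite subnKC//; have := Dn0 k; flra.
  have [k [/= h1 h2]] := filter_ex (filterI hn hk).
  by have := nm_tri (A n) (A k) z; rewrite (nmC (A n) (A k)); move: h1 h2; clear; flra.
(* The vertices of the chosen triangle lie within [3 * D n] of [z], so each of the three sides
   contributes at most [D n * (e / 9 * (3 * D n))]. *)
have [al hal] := df zr; have e9 : 0 < e / 9 by flra.
have [dl dl0 hdl] := hal _ e9.
have D1 : 0 < 3 * D0 + 1 by flra.
have [n hn] : exists n, 3 * D n < dl.
  have k0 : 0 < dl / (3 * D0 + 1) by rewrite divr_gt0.
  have [n0 hn] := pow2_small k0; exists n0; have := hn n0 (leqnn _).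
  rewrite natrX ltr_pdivlMr// /D => h.
  have i0 : 0 < (2 ^+ n0 : R)^-1 by rewrite invr_gt0 exprn_gt0.
  by move: h; rewrite mulrDr mulr1 mulrC; move: (2 ^+ n0)^-1 i0 => i; clear; flra.
have := badT n; have := zA n; have := TD n; rewrite /A; case: (T n) => [[[a' b'] d'] D'] /= -> za.
move=> [_ [ha' hb' hd'] [ab bd da]]; apply/negP; rewrite -leNgt.
have r0 : 0 <= 3 * D n by have := Dn0 n; clear; flra.
have zb : nm (b' - z) <= 3 * D n by have := nm_tri b' a' z; move: ab za; clear; flra.
have zd : nm (d' - z) <= 3 * D n by have := nm_tri d' a' z; rewrite (nmC d' a'); move: da za; clear; flra.
have za' : nm (a' - z) <= 3 * D n by have := Dn0 n; move: za; clear; flra.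
have hz w : nm (w - z) <= 3 * D n -> nm (f w - f z - al * (w - z)) <= e / 9 * nm (w - z).
  by move=> hw; apply: hdl; exact: le_lt_trans hw hn.
have s1 := seg_near hal e9 r0 hz za' zb.
have s2 := seg_near hal e9 r0 hz zb zd.
have s3 := seg_near hal e9 r0 hz zd za'.
have E : e / 9 * (3 * D n) = e * D n / 3 by field.
rewrite E in s1 s2 s3.
have eD : 0 <= e * D n / 3 by rewrite divr_ge0// mulr_ge0// ltW.
have t1 := le_trans s1 (ler_wpM2r eD ab).
have t2 := le_trans s2 (ler_wpM2r eD bd).
have t3 := le_trans s3 (ler_wpM2r eD da).
rewrite /tri (_ : seg f a' b' + seg f b' d' + seg f d' a' =
  (seg f a' b' - (b' - a') * f z - al / 2 * ((b' - z) ^+ 2 - (a' - z) ^+ 2)) +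
  (seg f b' d' - (d' - b') * f z - al / 2 * ((d' - z) ^+ 2 - (b' - z) ^+ 2)) +
  (seg f d' a' - (a' - d') * f z - al / 2 * ((a' - z) ^+ 2 - (d' - z) ^+ 2))); last by ring.
rewrite (le_trans (nmD _ _))// (le_trans (lerD (nmD _ _) (lexx _)))//.
have -> : e * D n ^+ 2 = D n * (e * D n / 3) + D n * (e * D n / 3) + D n * (e * D n / 3) by field.
by apply: lerD => //; apply: lerD.
Qed.

(** Here regularity is gained: pointwise derivability of [f] makes the primitive strictly derivable,
    because by Goursat [F x - F y] is the integral over the segment from [y] to [x], on which [f] is
    uniformly close to [f z]. *)
Lemma primitive : exists F, forall z, nm (z - c) < r -> sder F z (f z) 0.
Proof.
exists (seg f c) => z hz e e0; have [d d0 hd] := cf (ltW hz) e0.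
have r0 : 0 <= r by rewrite (le_trans (nm_ge0 (z - c)))// ltW.
exists (Num.min d (r - nm (z - c))); first by rewrite lt_min d0 subr_gt0.
move=> x y; rewrite !lt_min => /andP[x1 x2] /andP[y1 y2].
have hc : nm (c - c) <= r by rewrite subrr nm0.
have hx : nm (x - c) <= r by have := nm_tri x z c; flra.
have hy : nm (y - c) <= r by have := nm_tri y z c; flra.
have := goursat hc hy hx; rewrite /tri (seg_rev cf hc hx) => /eqP; rewrite subr_eq0 => /eqP <-.
have [M _ hM] := cnm_bounded (@nm_ball_compact R c r) (fun x => @cf x).
rewrite mul0r subr0 (addrC (seg f c y)) addrK (mulrC (f z)) -[X in _ - _ * X](mean_cst (f z)).
rewrite -mulrBr -(meanB (bnd_seg hy hx hM) (M' := nm (f z))) // nmM mulrC ler_wpM2r ?nm_ge0//.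
apply: mean_le => s t hs _; apply/ltW/hd.
have yx : exists2 m : R, m < d & nm (y - z) <= m /\ nm (x - z) <= m.
  exists (Num.max (nm (y - z)) (nm (x - z))); first by rewrite gt_max y1.
  by rewrite !le_max !lexx orbT.
by case: yx => m md [ym xm]; apply: le_lt_trans md; exact: nm_pt.
Qed.

End Disc.

End Primitive.

(** * Means over circles *)

Section Cauchy.
Context {R : realType}.
Local Notation C := (Cplx R).
Implicit Types (f F G g : C -> C) (c z w u : C) (r rho e : R) (K : set C).

Lemma unif_sder K G g : compact K -> (forall z, K z -> sder G z (g z) 0) ->
  (forall z, K z -> cnm g z) -> forall e, 0 < e -> exists2 d : R, 0 < d &
  forall y y', K y -> nm (y' - y) < d -> nm (G y' - G y - g y * (y' - y)) <= e * nm (y' - y).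
Proof.
move=> cK hG hg e e0; have e2 : 0 < e / 2 by flra.
have [d1 d10 h1] := unif_cont cK hg e2.
apply: (unif_compact (Q := fun y y' => nm (G y' - G y - g y * (y' - y)) <= e * nm (y' - y)) cK).
move=> x Kx; have [d2 d20 h2] := hG x Kx _ e2.
exists (Num.min d1 d2); first by rewrite lt_min d10.
move=> y y'; rewrite !lt_min => /andP[y1 y2] /andP[y'1 y'2].
have k1 := h1 x y Kx y1; have := h2 y' y y'2 y2; rewrite mul0r subr0 => k2.
rewrite (_ : _ - _ = (G y' - G y - g x * (y' - y)) - (g y - g x) * (y' - y)); last by ring.
rewrite (le_trans (nmB _ _))// nmM.
have := ler_wpM2r (nm_ge0 (y' - y)) (ltW k1); flra.
Qed.

Lemma mean_path K G g (p p' : R -> C) M : compact K ->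
  (forall z, K z -> sder G z (g z) 0) -> (forall z, K z -> cnm g z) ->
  (forall t, 0 <= t <= 1 -> K (p t)) -> (forall t, 0 <= t <= 1 -> nm (p' t) <= M) ->
  (forall e, 0 < e -> exists2 d : R, 0 < d & forall t t', `|t' - t| < d ->
     nm (p t' - p t - (t' - t)%:C * p' t) <= e * `|t' - t|) ->
  mean (fun t _ => g (p t) * p' t) = G (p 1) - G (p 0).
Proof.
move=> cK hG hg pK bp dp.
have M0 : 0 <= M by apply: le_trans (bp 0 _); rewrite ?nm_ge0 ?lexx ?ler01.
have [MG _ hMG] := cnm_bounded cK (fun z Kz => sder_cnm (hG z Kz)).
have [Mg Mg0 hMg] := cnm_bounded cK hg.
have b1 : bnd01 (fun t _ => G (p t)) MG by move=> t s ht _; exact/hMG/pK.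
have b2 : bnd01 (fun t _ => g (p t) * p' t) (Mg * M).
  by move=> t s ht _; rewrite nmM ler_pM ?nm_ge0 ?hMg ?bp//; exact: pK.
rewrite (mean_ftc b1 b2); first by rewrite mean_cst.
move=> e e0; pose e1 := Num.min 1 (e / (2 * Mg)).
have e10 : 0 < e1 by rewrite /e1 lt_min ltr01 divr_gt0// mulr_gt0.
have e3 : 0 < e / (2 * (M + 1)) by rewrite divr_gt0// mulr_gt0// ltr_wpDl.
have [d1 d10 h1] := dp _ e10; have [d2 d20 h2] := unif_sder cK hG hg e3.
exists (Num.min d1 (d2 / (M + 1))); first by rewrite lt_min d10 divr_gt0// ltr_wpDl.
move=> s s' t hs hs' _; rewrite lt_min => /andP[k1 k2].
have p1 := h1 s s' k1.
have p2 : nm (p s' - p s) <= (M + 1) * `|s' - s|.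
  rewrite (le_trans (nm_split _ ((s' - s)%:C * p' s)))// nmM nm_real mulrDl mul1r mulrC.
  rewrite lerD ?ler_wpM2r ?bp// (le_trans p1)// ler_piMl// /e1.
  by rewrite ge_min lexx.
have p3 : nm (p s' - p s) < d2.
  by rewrite (le_lt_trans p2)// mulrC -ltr_pdivlMr// ltr_wpDl.
have p4 := h2 _ _ (pK s hs) p3.
rewrite (_ : _ - _ = (G (p s') - G (p s) - g (p s) * (p s' - p s)) +
   g (p s) * (p s' - p s - (s' - s)%:C * p' s)); last by ring.
rewrite (le_trans (nmD _ _))// nmM.
have q1 : e / (2 * (M + 1)) * nm (p s' - p s) <= e / 2 * `|s' - s|.
  apply: (le_trans (ler_wpM2l (ltW e3) p2)).
  rewrite mulrA ler_wpM2r// le_eqVlt; apply/orP; left; apply/eqP; field.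
  by rewrite gt_eqF// ltr_wpDl.
have q2 : nm (g (p s)) * nm (p s' - p s - (s' - s)%:C * p' s) <= e / 2 * `|s' - s|.
  apply: (@le_trans _ _ (Mg * (e1 * `|s' - s|))).
    by rewrite ler_pM ?nm_ge0 ?hMg//; exact: pK.
  rewrite mulrA ler_wpM2r// mulrC -ler_pdivlMr// /e1 ge_min; apply/orP; right.
  by rewrite le_eqVlt; apply/orP; left; apply/eqP; field; rewrite gt_eqF.
flra.
Qed.

(** The case of zero derivative in [mean_ftc]; it serves to run homotopies over the unit
    interval. *)
Lemma const01 (h : R -> C) M : (forall s, 0 <= s <= 1 -> nm (h s) <= M) ->
  (forall e, 0 < e -> exists2 d : R, 0 < d & forall s s', 0 <= s <= 1 -> 0 <= s' <= 1 ->
     `|s' - s| < d -> nm (h s' - h s) <= e * `|s' - s|) -> h 1 = h 0.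
Proof.
move=> bh dh.
have b1 : bnd01 (fun s _ => h s) M by move=> s t hs _; exact: bh.
have b2 : bnd01 (fun _ _ : R => 0 : C) 0 by move=> s t _ _; rewrite nm0.
have := mean_ftc b1 b2; rewrite !mean_cst => E; apply/eqP; rewrite -subr_eq0 -E//.
move=> e /dh[d d0 hd]; exists d => // s s' t hs hs' _ lt.
by rewrite mulr0 subr0; exact: hd.
Qed.

Definition circ c rho (t : R) : C := c + rho%:C * ee t.

Lemma nm_circ c rho t : 0 <= rho -> nm (circ c rho t - c) = rho.
Proof. by move=> r0; rewrite /circ addrC addKr nmM nm_ee mulr1 nm_real ger0_norm. Qed.

Lemma circ_ge c rho z t : 0 <= rho -> rho - nm (z - c) <= nm (circ c rho t - z).
Proof.
by move=> r0; have := nm_tri (circ c rho t) z c; rewrite nm_circ// lerBlDr.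
Qed.

Lemma circ_neq c rho z t : nm (z - c) < rho -> circ c rho t - z != 0.
Proof.
move=> h; have r0 : 0 <= rho by rewrite (le_trans (nm_ge0 _) (ltW h)).
by rewrite -nm_gt0; have := @circ_ge c rho z t r0; move: h; flra.
Qed.

Lemma circ_diff c rho e : 0 <= rho -> 0 < e -> exists2 d : R, 0 < d & forall t t', `|t' - t| < d ->
  nm (circ c rho t' - circ c rho t - (t' - t)%:C * (tau * (circ c rho t - c))) <= e * `|t' - t|.
Proof.
move=> r0 e0; have k0 : 0 < e / (rho + 1) by rewrite divr_gt0// ltr_wpDl.
have [d d0 hd] := ee_diff k0; exists d => // t t' /hd h.
rewrite (_ : _ - _ = rho%:C * (ee t' - ee t - (t' - t)%:C * (tau * ee t))); last by rewrite /circ; ring.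
rewrite nmM nm_real ger0_norm//; apply: (le_trans (ler_wpM2l r0 h)).
rewrite mulrA ler_wpM2r// mulrA ler_pdivrMr ?ltr_wpDl// mulrC ler_pM2l//; flra.
Qed.

Lemma closed_nm_ge u (d : R) : closed [set w : C | d <= nm (w - u)].
Proof.
apply: (@preimage_closed _ _ (fun w : C => nm (w - u)) [set x : R | d <= x]); last exact: closed_ge.
move=> z _; apply: (cvgR (nbhs_filter (z : C)) _ _).2 => e e0.
apply: (nbhs_nm _ _).2; exists e => // w hw; rewrite (le_lt_trans (nm_dist _ _))//.
by rewrite (_ : w - u - (z - u) = w - z) //; ring.
Qed.

Lemma annulus_compact u (d r : R) : compact [set w : C | d <= nm (w - u) <= r].
Proof.
apply: (subclosed_compact _ (@nm_ball_compact R u r)).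
  rewrite (_ : [set _ | _] = [set w : C | d <= nm (w - u)] `&` [set w : C | nm (w - u) <= r]).
    apply: closedI; first exact: closed_nm_ge.
    by apply: compact_closed; [exact: norm_hausdorff|exact: nm_ball_compact].
  by apply/seteqP; split=> w /=; [move=> /andP[]|move=> [-> ->]].
by move=> w /= /andP[].
Qed.

Lemma sder_inv2 u : u != 0 -> sder (fun w : C => w ^- 2) u (- (2 * u ^- 3)) 0.
Proof.
move=> u0; have := sderM (sder_inv u0) (sder_inv u0).
rewrite mul0r mulr0 addr0 (_ : _ + _ = - (2 * u ^- 3)); last by field.
by apply: sder_ext => w; rewrite -invfM.
Qed.

Lemma cnm_inv u m : u != 0 -> cnm (fun w : C => w ^- m) u.
Proof.
move=> u0; suff [a [b h]] : exists a b, sder (fun w : C => w ^- m) u a b by exact: sder_cnm h.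
elim: m => [|m [a [b h]]].
  by exists 0, 0; apply: sder_ext (sder_cst 1 u) => w; rewrite expr0 invr1.
exists (- u ^- 2 * u ^- m + u^-1 * a), (0 * u ^- m + u^-1 * b).
by apply: sder_ext (sderM (sder_inv u0) h) => w; rewrite exprS invfM.
Qed.

Lemma invX_le (d x : R) m : 0 < d -> d <= x -> x ^- m <= d ^- m.
Proof.
move=> d0 dx; have x0 : 0 < x := lt_le_trans d0 dx.
by rewrite lef_pV2 ?posrE ?exprn_gt0// lerXn2r ?nnegrE ?(ltW x0) ?(ltW d0).
Qed.

Lemma mean_circ0 c rho : 0 <= rho -> mean (fun t _ => circ c rho t - c) = 0.
Proof.
move=> r0.
have E : mean (fun t _ => 1 * (tau * (circ c rho t - c))) = circ c rho 1 - circ c rho 0.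
  apply: (@mean_path [set z | nm (z - c) <= rho] id (fun=> 1) (circ c rho)
    (fun t => tau * (circ c rho t - c)) (nm tau * rho) (@nm_ball_compact R c rho)).
  - by move=> z _; exact: sder_id.
  - by move=> z _ e e0; exists 1 => // w _; rewrite subrr nm0.
  - by move=> t _; rewrite /= nm_circ.
  - by move=> t _; rewrite nmM nm_circ.
  - by move=> e e0; exact: circ_diff.
have b : bnd01 (fun t _ => circ c rho t - c) rho by move=> t s _ _; rewrite nm_circ.
apply/eqP; have := E; rewrite {2 3}/circ ee0 ee1 subrr.
rewrite (mean_eq (G := fun t _ => tau * (circ c rho t - c))); last by move=> *; rewrite mul1r.
by rewrite (meanZ _ b) => /eqP; rewrite mulf_eq0 (negbTE tau_neq0).
Qed.

(** The pole is moved from the centre to [z] along a segment. The derivative of the mean with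
    respect to the pole is a mean of [(w - c) / (w - z) ^ 2], zero because [(w - z) ^- 2] has a
    primitive on an annulus about the pole; with the pole at the centre the integrand is 1. *)
Lemma mean_kernel c rho z : nm (z - c) < rho ->
  mean (fun t _ => (circ c rho t - c) / (circ c rho t - z)) = 1.
Proof.
move=> hz; have r0 : 0 <= rho by rewrite (le_trans (nm_ge0 _) (ltW hz)).
set dl := rho - nm (z - c); have dl0 : 0 < dl by rewrite subr_gt0.
pose zm (m : R) := c + m%:C * (z - c).
have hzm m : 0 <= m <= 1 -> nm (zm m - c) <= nm (z - c).
  move=> /andP[m0 m1]; rewrite /zm addrC addKr nmM nm_real ger0_norm//.
  by rewrite ler_piMl ?nm_ge0.
have ge m t : 0 <= m <= 1 -> dl <= nm (circ c rho t - zm m).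
  by move=> /hzm h; have := @circ_ge c rho (zm m) t r0; rewrite /dl; move: h; flra.
have ne m t : 0 <= m <= 1 -> circ c rho t - zm m != 0.
  by move=> /(ge m t); rewrite -nm_gt0; apply: lt_le_trans.
have K2 m : 0 <= m <= 1 -> mean (fun t _ => (circ c rho t - c) / (circ c rho t - zm m) ^+ 2) = 0.
  move=> hm; pose K := [set w : C | dl <= nm (w - zm m) <= 2 * rho].
  have K0 w : K w -> w - zm m != 0.
    by move=> /andP[h _]; rewrite -nm_gt0 (lt_le_trans dl0).
  have E : mean (fun t _ => (circ c rho t - zm m) ^- 2 * (tau * (circ c rho t - c))) =
     - (circ c rho 1 - zm m)^-1 - - (circ c rho 0 - zm m)^-1.
    apply: (@mean_path K (fun w => - (w - zm m)^-1) (fun w => (w - zm m) ^- 2) (circ c rho)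
      (fun t => tau * (circ c rho t - c)) (nm tau * rho)).
    - exact: annulus_compact.
    - move=> w /K0 w0.
      by apply: sder_eq (sderN (sder_comp (sderB (sder_id w) (sder_cst (zm m) w)) (sder_inv w0))) _ _; ring.
    - move=> w /K0 w0; apply/cnmP.
      apply: (@continuous_comp C C C (fun w => w - zm m) (fun u => u ^- 2)).
        exact/cnmP/(sder_cnm (sderB (sder_id w) (sder_cst (zm m) w))).
      exact/cnmP/cnm_inv.
    - move=> t _; rewrite /K /= ge//=.
      have := nm_tri (circ c rho t) c (zm m); rewrite nm_circ// (nmC c) => h.
      by have := hzm _ hm; move: hz h; flra.
    - by move=> t _; rewrite nmM nm_circ.
    - by move=> e e0; exact: circ_diff.
  have b : bnd01 (fun t _ => (circ c rho t - c) / (circ c rho t - zm m) ^+ 2) (rho / dl ^+ 2).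
    move=> t s _ _; rewrite nmM nmV nmX nm_circ// ler_wpM2l//.
    by apply: invX_le => //; exact: ge.
  apply/eqP; have := E; rewrite /circ ee0 ee1 subrr.
  rewrite (mean_eq (G := fun t _ => tau * ((circ c rho t - c) / (circ c rho t - zm m) ^+ 2))); last first.
    by move=> *; rewrite /circ; ring.
  by rewrite (meanZ _ b) => /eqP; rewrite mulf_eq0 (negbTE tau_neq0).
pose k m := mean (fun t _ => (circ c rho t - c) / (circ c rho t - zm m)).
have b m : 0 <= m <= 1 -> bnd01 (fun t _ => (circ c rho t - c) / (circ c rho t - zm m)) (rho / dl).
  move=> hm t s _ _; rewrite nmM nmV nm_circ// ler_wpM2l//.
  by rewrite lef_pV2 ?posrE ?ge ?nm_gt0 ?ne.
have <- : k 1 = mean (fun t _ => (circ c rho t - c) / (circ c rho t - z)).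
  by apply: mean_eq => t s _ _; rewrite (_ : zm 1 = z)// /zm mul1r addrC subrK.
have -> : (1 : C) = k 0.
  rewrite /k (mean_eq (G := fun _ _ => 1)) ?mean_cst// => t s _ _.
  by rewrite /zm mul0r addr0 divff// -nm_gt0 nm_circ// (le_lt_trans (nm_ge0 (z - c))).
apply: (@const01 k (rho / dl)) => [m hm|e e0]; first by apply: mean_le; exact: b.
(* The coefficient of the quadratic remainder of the kernel in the displacement of the pole; [dl] is
   a lower bound for the distance from the circle to all poles used. *)
pose B := rho * nm (z - c) ^+ 2 / dl ^+ 3.
have B0 : 0 <= B by rewrite /B divr_ge0 ?mulr_ge0 ?exprn_ge0 ?nm_ge0 ?(ltW dl0).
exists (e / (1 + B)); first by rewrite divr_gt0// ltr_pwDl.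
move=> s s' hs hs'; rewrite ltr_pdivlMr ?ltr_pwDl// => lt.
have b2 : bnd01 (fun t _ => (circ c rho t - c) / (circ c rho t - zm s) ^+ 2) (rho / dl ^+ 2).
  move=> t x _ _; rewrite nmM nmV nmX nm_circ// ler_wpM2l//.
  by apply: invX_le => //; exact: ge.
rewrite -(meanB (b s' hs') (b s hs)).
have := K2 s hs => /(congr1 (fun x => (s' - s)%:C * (z - c) * x)); rewrite mulr0 -(meanZ _ b2) => E.
rewrite -[mean _]subr0 -E -(meanB (bnd01B (b s' hs') (b s hs)) (bnd01Z _ b2)).
apply: mean_le => t x _ _.
have n1 := ne s t hs; have n2 := ne s' t hs'.
have -> : (circ c rho t - c) / (circ c rho t - zm s') - (circ c rho t - c) / (circ c rho t - zm s) -
  (s' - s)%:C * (z - c) * ((circ c rho t - c) / (circ c rho t - zm s) ^+ 2) =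
  (circ c rho t - c) * (((s' - s)%:C * (z - c)) ^+ 2 * ((circ c rho t - zm s') * (circ c rho t - zm s) ^+ 2)^-1).
  have -> : zm s' = zm s + (s' - s)%:C * (z - c) by rewrite /zm rmorphB /=; ring.
  field; rewrite n1 /=; move: n2; congr (_ != 0).
  by rewrite /zm; ring.
rewrite nmM nm_circ// nmM nmV nmX (nmM (s' - s)%:C) (nmM (circ c rho t - zm s')) nmX nm_real.
apply: (@le_trans _ _ (rho * ((`|s' - s| * nm (z - c)) ^+ 2 * (dl * dl ^+ 2)^-1))).
  rewrite ler_wpM2l// ler_wpM2l ?sqr_ge0// lef_pV2 ?posrE ?mulr_gt0 ?exprn_gt0 ?nm_gt0//.
  by rewrite ler_pM ?ge ?exprn_ge0 ?(ltW dl0)// lerXn2r ?nnegrE ?nm_ge0 ?(ltW dl0) ?ge.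
rewrite (_ : _ * _ = B * `|s' - s| * `|s' - s|); last by rewrite /B; field; rewrite gt_eqF.
by rewrite ler_wpM2r//; move: lt; rewrite mulrDr mulr1 mulrC; have := normr_ge0 (s' - s); flra.
Qed.

End Cauchy.

(** * Cauchy's formula and its consequences *)

Section Holomorphic.
Context {R : realType}.
Local Notation C := (Cplx R).
Implicit Types (f F G g : C -> C) (c z w u : C) (r rho e : R).

Lemma kernel_sder G g (p : R -> C) M c rho z :
  (forall u, u != 0 -> sder G u (g u) 0) -> (forall u, u != 0 -> cnm g u) ->
  (forall t, 0 <= t <= 1 -> nm (p t) <= M) -> nm (z - c) < rho ->
  sder (fun x => mean (fun t _ => p t * G (circ c rho t - x))) z
    (- mean (fun t _ => p t * g (circ c rho t - z))) 0.
Proof.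
move=> hG hg bp hz; have r0 : 0 <= rho by rewrite (le_trans (nm_ge0 _) (ltW hz)).
have M0 : 0 <= M by apply: le_trans (bp 0 _); rewrite ?nm_ge0 ?lexx ?ler01.
set dl := (rho - nm (z - c)) / 2.
have dl0 : 0 < dl by rewrite /dl divr_gt0// subr_gt0.
pose K := [set u : C | dl <= nm (u - 0) <= 2 * rho].
have cK : compact K by exact: annulus_compact.
have K0 u : K u -> u != 0.
  by move=> /andP[]; rewrite subr0 -nm_gt0 => h _; apply: lt_le_trans h.
have Kw x t : nm (x - z) < dl -> K (circ c rho t - x).
  move=> hx; rewrite /K /= subr0.
  have h1 := nm_tri x z c; have h2 := @circ_ge _ c rho x t r0.
  have h3 := nm_tri (circ c rho t) c x; rewrite nm_circ// (nmC c x) in h3.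
  by apply/andP; split; move: hx h1 h2 h3 hz; rewrite /dl; flra.
have sG u : K u -> sder G u (g u) 0 by move=> /K0; exact: hG.
have cg u : K u -> cnm g u by move=> /K0; exact: hg.
have [MG _ hMG] := cnm_bounded cK (fun u Ku => sder_cnm (sG u Ku)).
have [Mg _ hMg] := cnm_bounded cK cg.
have z0 : nm (z - z) < dl by rewrite subrr nm0.
have bA : bnd01 (fun t _ => p t * g (circ c rho t - z)) (M * Mg).
  by move=> t s ht _; rewrite nmM ler_pM ?nm_ge0 ?bp//; apply: hMg; exact: Kw.
have bA' := bnd01Z (-1) bA.
have -> : - mean (fun t _ => p t * g (circ c rho t - z)) =
    mean (fun t _ => - 1 * (p t * g (circ c rho t - z))) by rewrite (meanZ _ bA) mulN1r.
have -> : (0 : C) = mean (fun _ _ => 0) by rewrite mean_cst.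
apply: (@sder_mean _ (fun t _ x => p t * G (circ c rho t - x)) _ (fun _ _ => 0) z (M * MG) _ 0 dl) bA' _ _ => //.
- by move=> x hx t s ht _; rewrite nmM ler_pM ?nm_ge0 ?bp//; apply: hMG; exact: Kw.
- by move=> s t _ _; rewrite nm0.
move=> e e0; have e1 : 0 < e / (2 * (M + 1)) by rewrite divr_gt0// mulr_gt0// ltr_wpDl.
have [d1 d10 h1] := unif_sder cK sG cg e1; have [d2 d20 h2] := unif_cont cK cg e1.
exists (Num.min dl (Num.min (d1 / 2) d2)); first by rewrite !lt_min dl0 d20 divr_gt0.
move=> t s x y ht _; rewrite !lt_min => /and3P[x1 x2 x3] /and3P[y1 y2 y3].
set v := circ c rho t.
have k1 : nm (G (v - x) - G (v - y) - g (v - y) * (y - x)) <= e / (2 * (M + 1)) * nm (x - y).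
  have E : v - x - (v - y) = y - x by ring.
  have := h1 (v - y) (v - x) (Kw y t y1); rewrite E nmC; apply.
  by have := nm_tri x z y; rewrite (nmC z y); flra.
have k2 : nm (g (v - y) - g (v - z)) <= e / (2 * (M + 1)).
  apply/ltW/h2; first exact: Kw.
  by rewrite (_ : _ - _ = z - y); [rewrite nmC|ring].
rewrite (_ : _ - _ = p t * ((G (v - x) - G (v - y) - g (v - y) * (y - x)) - (g (v - y) - g (v - z)) * (x - y))); last by ring.
have q : nm ((G (v - x) - G (v - y) - g (v - y) * (y - x)) - (g (v - y) - g (v - z)) * (x - y)) <=
  e / (M + 1) * nm (x - y).
  rewrite (le_trans (nmB _ _))// nmM (le_trans (lerD k1 (ler_wpM2r (nm_ge0 _) k2)))//.
  rewrite -mulrDl ler_wpM2r ?nm_ge0// le_eqVlt; apply/orP; left; apply/eqP; field.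
  by rewrite gt_eqF// ltr_wpDl.
rewrite nmM; apply: (le_trans (ler_pM (nm_ge0 _) (nm_ge0 _) (bp t ht) q)).
rewrite mulrA ler_wpM2r ?nm_ge0// mulrA ler_pdivrMr ?ltr_wpDl// mulrC ler_pM2l//; flra.
Qed.

(** The strict estimate at [z] also bounds the quotients based at each nearby [x], hence the
    derivative [a x] itself. *)
Lemma sder_der_cnm f a z : (\forall x \near z, sder f x (a x) 0) -> cnm a z.
Proof.
move=> /nbhs_nm[d0 d00 h] e e0; have e2 : 0 < e / 4 by flra.
have [d1 d10 h1] := h z ltac:(by rewrite subrr nm0) _ e2.
exists (Num.min d0 (d1 / 2)); first by rewrite lt_min d00 divr_gt0.
move=> x; rewrite lt_min => /andP[x0 x1].
have [d2 d20 h2] := h x x0 _ e2.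
pose m := Num.min (d1 / 2) d2 / 2.
have m0 : 0 < m by rewrite /m divr_gt0// lt_min d20 divr_gt0.
have : m < Num.min (d1 / 2) d2 by move: m0; rewrite /m => m0; flra.
rewrite lt_min => /andP[m1 m2].
have nmm : nm (x + m%:C - x) = m by rewrite addrC addKr nm_real ger0_norm// ltW.
have k1 := h1 (x + m%:C) x; have k2 := h2 (x + m%:C) x.
rewrite nmm subrr nm0 !mul0r !subr0 in k1 k2.
have q2 := k2 m2 d20.
have q1 : nm (f (x + m%:C) - f x - a z * (x + m%:C - x)) <= e / 4 * m.
  apply: k1; last flra.
  by have := nm_tri (x + m%:C) x z; rewrite nmm; flra.
suff : nm (a x - a z) <= e / 2 by flra.
rewrite -(ler_pM2r m0) -{1}nmm -nmM.
rewrite (_ : _ * _ = (f (x + m%:C) - f x - a z * (x + m%:C - x)) -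
  (f (x + m%:C) - f x - a x * (x + m%:C - x))); last by ring.
by rewrite (le_trans (nmB _ _))//; flra.
Qed.

(** The circle is contracted to [z] with ratio [s]. The derivative in [s] is the mean of
    [f * (w - c)], zero because [f] has the primitive [F]; at [s = 0] the formula is
    [mean_kernel]. *)
Lemma cauchy_prim F f c r rho z : (forall w, nm (w - c) <= r -> sder F w (f w) 0) ->
  (forall w, nm (w - c) <= r -> cnm f w) -> rho <= r -> nm (z - c) < rho ->
  F z = mean (fun t _ => F (circ c rho t) * ((circ c rho t - c) / (circ c rho t - z))).
Proof.
move=> hF cf rr hz; have r0 : 0 <= rho by rewrite (le_trans (nm_ge0 _) (ltW hz)).
set dl := rho - nm (z - c); have dl0 : 0 < dl by rewrite subr_gt0.
pose K := [set w : C | nm (w - c) <= r]; have cK : compact K := @nm_ball_compact R c r.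
have [MF MF0 hMF] := cnm_bounded cK (fun u Ku => sder_cnm (hF u Ku)).
have [Mf Mf0 hMf] := cnm_bounded cK cf.
have ne t : circ c rho t - z != 0 by exact: circ_neq.
have ge t : dl <= nm (circ c rho t - z) by exact: circ_ge.
pose q t : C := (circ c rho t - c) / (circ c rho t - z).
have bq t : nm (q t) <= rho / dl.
  by rewrite /q nmM nmV nm_circ// ler_wpM2l//; exact: (invX_le 1 dl0 (ge t)).
have Kp s t : 0 <= s <= 1 -> K (pt z (circ c rho t) s).
  move=> hs; apply: nm_pt => //; last by rewrite nm_circ.
  by rewrite (le_trans _ rr)// ltW.
have K0 s : 0 <= s <= 1 -> mean (fun t _ => f (pt z (circ c rho t) s) * (circ c rho t - c)) = 0.
  move=> hs; have [->|s0] := eqVneq s 0.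
    rewrite (mean_eq (G := fun t _ => f z * (circ c rho t - c))); last first.
      by move=> *; rewrite /pt mul0r addr0.
    rewrite (@meanZ _ _ _ rho) ?mean_circ0 ?mulr0// => t x _ _.
    by rewrite nm_circ.
  have s0' : s%:C != 0 :> C by rewrite -[0]/(real_complex R 0) (inj_eq (@complexI R)).
  have E : mean (fun t _ => f (pt z (circ c rho t) s) * (s%:C * (tau * (circ c rho t - c)))) =
     F (pt z (circ c rho 1) s) - F (pt z (circ c rho 0) s).
    apply: (@mean_path _ K F f (fun t => pt z (circ c rho t) s)
      (fun t => s%:C * (tau * (circ c rho t - c))) (`|s| * (nm tau * rho))) => //.
    - by move=> t _; exact: Kp.
    - by move=> t _; rewrite 2!nmM nm_real nm_circ.
    - move=> e e0; have e1 : 0 < e / (`|s| + 1) by rewrite divr_gt0// ltr_wpDl.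
      have [d d0 hd] := circ_diff c r0 e1; exists d => // t t' /hd h.
      rewrite (_ : _ - _ = s%:C * (circ c rho t' - circ c rho t - (t' - t)%:C * (tau * (circ c rho t - c)))); last by rewrite /pt; ring.
      rewrite nmM nm_real; apply: (le_trans (ler_wpM2l (normr_ge0 _) h)).
      rewrite mulrA ler_wpM2r// mulrA ler_pdivrMr ?ltr_wpDl// mulrC ler_pM2l//; flra.
  have b : bnd01 (fun t _ => f (pt z (circ c rho t) s) * (circ c rho t - c)) (Mf * rho).
    by move=> t x _ _; rewrite nmM nm_circ// ler_wpM2r// hMf//; exact: Kp.
  apply/eqP; have := E; rewrite /circ ee0 ee1 subrr.
  rewrite (mean_eq (G := fun t _ => (s%:C * tau) * (f (pt z (circ c rho t) s) * (circ c rho t - c)))); last first.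
    by move=> *; rewrite /circ; ring.
  rewrite (meanZ _ b) => /eqP; rewrite mulf_eq0 mulf_eq0 (negbTE tau_neq0) (negbTE s0') //.
pose h s := mean (fun t _ => F (pt z (circ c rho t) s) * q t).
have b s : 0 <= s <= 1 -> bnd01 (fun t _ => F (pt z (circ c rho t) s) * q t) (MF * (rho / dl)).
  by move=> hs t x _ _; rewrite nmM ler_pM ?nm_ge0// hMF//; exact: Kp.
have -> : mean (fun t _ => F (circ c rho t) * ((circ c rho t - c) / (circ c rho t - z))) = h 1.
  by apply: mean_eq => t s _ _; rewrite /pt mul1r (addrC z) subrK.
have -> : F z = h 0.
  rewrite /h (mean_eq (G := fun t _ => F z * q t)); last by move=> *; rewrite /pt mul0r addr0.
  rewrite (@meanZ _ _ _ (rho / dl)); first by rewrite /q mean_kernel// mulr1.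
  by move=> t s _ _.
apply/esym/(@const01 _ h (MF * (rho / dl))) => [s hs|e e0]; first by apply: mean_le; exact: b.
have e1 : 0 < e / (rho + 1) by rewrite divr_gt0// ltr_wpDl.
have [d d0 hd] := unif_sder cK hF cf e1.
have k0 : 0 < 2 * rho + 1 by rewrite ltr_wpDl// mulr_ge0.
exists (d / (2 * rho + 1)); first by rewrite divr_gt0.
move=> s s' hs hs'; rewrite ltr_pdivlMr// => lt.
have b2 : bnd01 (fun t _ => f (pt z (circ c rho t) s) * (circ c rho t - c)) (Mf * rho).
  by move=> t x _ _; rewrite nmM nm_circ// ler_wpM2r// hMf//; exact: Kp.
rewrite -(meanB (b s' hs') (b s hs)).
have := K0 s hs => /(congr1 (fun x => (s' - s)%:C * x)); rewrite mulr0 -(meanZ _ b2) => E.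
rewrite -[mean _]subr0 -E -(meanB (bnd01B (b s' hs') (b s hs)) (bnd01Z _ b2)).
apply: mean_le => t x _ _.
have pd : pt z (circ c rho t) s' - pt z (circ c rho t) s = (s' - s)%:C * (circ c rho t - z) by exact: pt_diff.
have := hd _ (pt z (circ c rho t) s') (Kp s t hs); rewrite pd nmM nm_real => k.
have lt2 : `|s' - s| * nm (circ c rho t - z) < d.
  apply: le_lt_trans lt; rewrite ler_wpM2l//.
  by have := nm_tri (circ c rho t) c z; rewrite nm_circ// (nmC c z); move: hz; flra.
have {}k := k lt2.
rewrite (_ : _ - _ = (F (pt z (circ c rho t) s') - F (pt z (circ c rho t) s) -
   f (pt z (circ c rho t) s) * ((s' - s)%:C * (circ c rho t - z))) * q t); last first.
  by rewrite /q; field.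
rewrite nmM /q nmM nmV nm_circ//.
have n0 : 0 < nm (circ c rho t - z) by rewrite nm_gt0.
apply: (le_trans (ler_wpM2r _ k)); first by rewrite divr_ge0// ltW.
rewrite [leLHS](_ : _ = e * `|s' - s| * (rho / (rho + 1))); last first.
  by field; rewrite !gt_eqF// ltr_wpDl.
rewrite ler_piMr ?mulr_ge0 ?(ltW e0)// ler_pdivrMr ?ltr_wpDl// mul1r; flra.
Qed.

Definition holb f c r := forall z, nm (z - c) < r -> exists a, pder f z a.

(** The Cauchy integral of [f w / (w - z) ^ m] over the circle, divided by [2 pi i]; the factor
    [w - c] comes from [dw]. *)
Definition ckernel f c rho z m : C :=
  mean (fun t _ => f (circ c rho t) * (circ c rho t - c) * (circ c rho t - z) ^- m).

Lemma ckernel_sder f c rho z M : (forall t, nm (f (circ c rho t)) <= M) -> nm (z - c) < rho ->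
  sder (fun x => ckernel f c rho x 1) z (ckernel f c rho z 2) 0 /\
  sder (fun x => ckernel f c rho x 2) z (2 * ckernel f c rho z 3) 0.
Proof.
move=> bf hz; have r0 : 0 <= rho by rewrite (le_trans (nm_ge0 _) (ltW hz)).
have bp t : 0 <= t <= 1 -> nm (f (circ c rho t) * (circ c rho t - c)) <= M * rho.
  by move=> _; rewrite nmM nm_circ// ler_wpM2r.
set dl := rho - nm (z - c); have dl0 : 0 < dl by rewrite subr_gt0.
have bk m : bnd01 (fun t _ => f (circ c rho t) * (circ c rho t - c) * (circ c rho t - z) ^- m) (M * rho * dl ^- m).
  move=> t s ht _; rewrite nmM nmV nmX ler_pM ?nm_ge0 ?invr_ge0 ?exprn_ge0 ?nm_ge0 ?bp//.
  by apply: invX_le => //; exact: circ_ge.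
split.
  have h := kernel_sder (@sder_inv _) (g := fun u => - u ^- 2) _ bp hz.
  apply: sder_eq (sder_ext _ (h _)) _ _ => //.
    move=> u u0; have c2 := cnm_inv 2 u0; move=> e /c2[d d0 hd]; exists d => // w /hd.
    by rewrite -opprD nmN.
  rewrite (mean_eq (G := fun t _ => -1 * (f (circ c rho t) * (circ c rho t - c) * (circ c rho t - z) ^- 2))).
    by rewrite (meanZ _ (bk 2)) mulN1r opprK.
  by move=> *; ring.
have h := kernel_sder (@sder_inv2 _) (g := fun u => - (2 * u ^- 3)) _ bp hz.
apply: sder_eq (h _) _ _ => //.
  move=> u u0; suff [a [b k]] : exists a b, sder (fun u : C => - (2 * u ^- 3)) u a b by exact: sder_cnm k.
  have i1 := sder_inv u0; have i2 := sder_inv2 u0.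
  eexists; eexists; apply: sder_ext (sderZ (-2) (sderM i1 i2)) => w.
  by rewrite -invfM mulNr.
rewrite (mean_eq (G := fun t _ => -2 * (f (circ c rho t) * (circ c rho t - c) * (circ c rho t - z) ^- 3))).
  by rewrite (meanZ _ (bk 3)) -/(ckernel f c rho z 3); ring.
by move=> *; ring.
Qed.

Lemma holb_cnm f c r z : holb f c r -> nm (z - c) < r -> cnm f z.
Proof. by move=> h /h[a /pder_cnm]. Qed.

Lemma holb_le f c r r' : r' <= r -> holb f c r -> holb f c r'.
Proof. by move=> rr h z hz; apply: h; exact: lt_le_trans rr. Qed.

Lemma holb_bounded f c r rho : holb f c r -> rho < r ->
  exists2 M : R, 0 < M & forall z, nm (z - c) <= rho -> nm (f z) <= M.
Proof.
move=> h rr; apply: (@cnm_bounded _ [set z | nm (z - c) <= rho]); first exact: nm_ball_compact.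
by move=> z hz; apply: (holb_cnm h); exact: le_lt_trans rr.
Qed.

Lemma near_ball c z (r : R) : nm (z - c) < r -> \forall x \near z, nm (x - c) < r.
Proof.
move=> h; apply/nbhs_nm; exists (r - nm (z - c)); first by rewrite subr_gt0.
by move=> w hw; have := nm_tri w z c; flra.
Qed.

(** On a smaller disc [f] has a primitive [F], to which Cauchy's formula applies since [f] is
    continuous. So [F] is the kernel of exponent 1, its derivative [f] is the kernel of exponent 2,
    and the latter is strictly derivable. *)
Lemma holb_strict f c r z : holb f c r -> nm (z - c) < r ->
  exists2 a : C -> C, (forall x, nm (x - c) < r -> sder f x (a x) 0) & True.
Proof.
move=> hf _; suff h x : nm (x - c) < r -> exists a, sder f x a 0.
  have /choice[a ha] x : exists a, nm (x - c) < r -> sder f x a 0.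
    by case: (ltP (nm (x - c)) r) => [/h[a ha]|_]; [exists a|exists 0].
  by exists a.
move=> hx; pose r1 := (nm (x - c) + r) / 2.
have x1 : nm (x - c) < r1 by rewrite /r1; flra.
have r1r : r1 < r by rewrite /r1; flra.
have [F hF] : exists F, forall z, nm (z - c) < r1 -> sder F z (f z) 0.
  by apply: primitive => w hw; apply: hf; exact: le_lt_trans r1r.
pose r2 := (nm (x - c) + r1) / 2.
have x2 : nm (x - c) < r2 by rewrite /r2; flra.
have r21 : r2 < r1 by rewrite /r2; flra.
have r20 : 0 <= r2 by rewrite (le_trans (nm_ge0 _) (ltW x2)).
have hF2 w : nm (w - c) <= r2 -> sder F w (f w) 0.
  by move=> hw; apply: hF; exact: le_lt_trans r21.
have cf w : nm (w - c) <= r2 -> cnm f w.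
  by move=> hw; apply: (holb_cnm hf); apply: le_lt_trans hw _; flra.
have [M M0 hM] : exists2 M : R, 0 < M & forall w, nm (w - c) <= r2 -> nm (F w) <= M.
  apply: (@cnm_bounded _ [set w | nm (w - c) <= r2]); first exact: nm_ball_compact.
  by move=> w /hF2/sder_cnm.
have bF t : nm (F (circ c r2 t)) <= M by apply: hM; rewrite nm_circ.
have E w : nm (w - c) < r2 -> f w = ckernel F c r2 w 2.
  move=> hw; have [k1 _] := ckernel_sder bF hw.
  have k2 : sder F w (ckernel F c r2 w 2) 0.
    apply: sder_near k1; apply: filterS (near_ball hw) => y hy.
    rewrite [RHS](cauchy_prim hF2 cf (lexx r2) hy) /ckernel.
    by apply: mean_eq => t s _ _; rewrite expr1 mulrA.
  by have [->] := sder_uniq (hF2 w (ltW hw)) k2.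
have [_ k] := ckernel_sder bF x2; exists (2 * ckernel F c r2 x 3).
apply: sder_near k; apply: filterS (near_ball x2) => y hy.
by rewrite E.
Qed.

Lemma hol_sder f c r z : holb f c r -> nm (z - c) < r -> sder f z (cD f z) 0.
Proof.
move=> hf hz; have [a ha _] := holb_strict hf hz.
by rewrite (pder_cD (sder_pder (ha z hz))); exact: ha.
Qed.

Lemma cauchy f c r rho z : holb f c r -> rho < r -> nm (z - c) < rho ->
  f z = ckernel f c rho z 1.
Proof.
move=> hf rr hz; have hz' := lt_trans hz rr; pose r1 := (rho + r) / 2.
rewrite (@cauchy_prim f (cD f) c rho rho z) //.
- by apply: mean_eq => t s _ _; rewrite expr1 mulrA.
- by move=> w hw; apply: hol_sder hf _; exact: le_lt_trans rr.
move=> w hw; apply: sder_der_cnm; have hw' := le_lt_trans hw rr.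
by apply: filterS (near_ball hw') => x hx; exact: (hol_sder hf).
Qed.

Lemma cauchy_D f c r rho z : holb f c r -> rho < r -> nm (z - c) < rho ->
  cD f z = ckernel f c rho z 2.
Proof.
move=> hf rr hz; have r0 : 0 <= rho by rewrite (le_trans (nm_ge0 _) (ltW hz)).
have [M _ hM] := holb_bounded hf rr.
have bf t : nm (f (circ c rho t)) <= M by apply: hM; rewrite nm_circ.
have [k _] := ckernel_sder bf hz.
apply: (sder_uniq (hol_sder hf (lt_trans hz rr)) _).1.
apply: sder_near k; apply: filterS (near_ball hz) => y hy.
exact/esym/(cauchy hf rr hy).
Qed.

Lemma ckernel_le f c rho z m M : (forall t, nm (f (circ c rho t)) <= M) -> nm (z - c) < rho ->
  nm (ckernel f c rho z m) <= M * rho * (rho - nm (z - c)) ^- m.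
Proof.
move=> bf hz; have r0 : 0 <= rho by rewrite (le_trans (nm_ge0 _) (ltW hz)).
apply: mean_le => t s _ _; rewrite !nmM nmV nmX nm_circ//.
have dl0 : 0 < rho - nm (z - c) by rewrite subr_gt0.
rewrite ler_pM ?mulr_ge0 ?nm_ge0 ?invr_ge0 ?exprn_ge0 ?nm_ge0 ?ler_wpM2r//.
by apply: invX_le => //; exact: circ_ge.
Qed.

Lemma ckernel_holb f c rho M : (forall t, nm (f (circ c rho t)) <= M) ->
  holb (fun z => ckernel f c rho z 1) c rho /\ holb (fun z => ckernel f c rho z 2) c rho.
Proof.
move=> bf; split=> z hz; have [k1 k2] := ckernel_sder bf hz.
  by exists (ckernel f c rho z 2); exact: sder_pder.
by exists (2 * ckernel f c rho z 3); exact: sder_pder.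
Qed.

Lemma holb_near f g c r z : holb g c r -> nm (z - c) < r -> (\forall x \near z, g x = f x) ->
  exists a, pder f z a.
Proof. by move=> hg /hg[a ha] E; exists a; exact: pder_near ha. Qed.

Lemma holb_D f c r : holb f c r -> holb (cD f) c r.
Proof.
move=> hf z hz; pose rho := (nm (z - c) + r) / 2.
have rr : rho < r by rewrite /rho; flra.
have hz' : nm (z - c) < rho by rewrite /rho; flra.
have r0 : 0 <= rho by rewrite (le_trans (nm_ge0 _) (ltW hz')).
have [M _ hM] := holb_bounded hf rr.
have bf t : nm (f (circ c rho t)) <= M by apply: hM; rewrite nm_circ.
have [_ k] := ckernel_holb bf; apply: (holb_near k hz').
by apply: filterS (near_ball hz') => y hy; rewrite (cauchy_D hf rr hy).
Qed.

(** Cauchy's formula passes to the uniform limit. No continuity of [f] has to be known beforehand,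
    since [mean] accepts every bounded function. *)
Lemma holb_limit f c r :
  (forall e, 0 < e -> exists2 g, holb g c r & forall z, nm (z - c) < r -> nm (f z - g z) <= e) ->
  holb f c r.
Proof.
move=> h z hz.
have [rho rr hz'] : exists2 rho, rho < r & nm (z - c) < rho.
  by exists ((nm (z - c) + r) / 2); flra.
have r0 : 0 <= rho by rewrite (le_trans (nm_ge0 _) (ltW hz')).
have wr t : nm (circ c rho t - c) < r by rewrite nm_circ.
have [g1 hg1 fg1] := h 1 ltr01; have [M1 _ hM1] := holb_bounded hg1 rr.
have bf t : nm (f (circ c rho t)) <= M1 + 1.
  rewrite (le_trans (nm_split _ (g1 (circ c rho t))))// lerD ?fg1// hM1//.
  by rewrite nm_circ.
have [k _] := ckernel_holb bf; apply: (holb_near k hz').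
apply: filterS (near_ball hz') => y hy; apply/eqP; rewrite -subr_eq0 -nm_eq0 eq_le nm_ge0 andbT.
set dl := rho - nm (y - c); have dl0 : 0 < dl by rewrite subr_gt0.
have B0 : 0 <= rho * dl ^- 1 by rewrite mulr_ge0 ?invr_ge0 ?exprn_ge0 ?(ltW dl0).
apply/ler_addgt0Pl => e e0; rewrite addr0.
have e1 : 0 < e / (1 + rho * dl ^- 1) by rewrite divr_gt0// ltr_pwDl.
have [g hg fg] := h _ e1; have [M _ hM] := holb_bounded hg rr.
have bg t : nm (g (circ c rho t)) <= M by apply: hM; rewrite nm_circ.
have q1 : nm (f y - g y) <= e / (1 + rho * dl ^- 1) by apply: fg; exact: lt_trans rr.
have q2 : nm (ckernel f c rho y 1 - ckernel g c rho y 1) <= e / (1 + rho * dl ^- 1) * (rho * dl ^- 1).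
  have bK (u : C -> C) B : (forall t, nm (u (circ c rho t)) <= B) -> bnd01
    (fun t _ => u (circ c rho t) * (circ c rho t - c) * (circ c rho t - y) ^- 1) (B * rho * dl ^- 1).
    move=> bu t s _ _; rewrite !nmM nmV nmX nm_circ//.
    rewrite ler_pM ?mulr_ge0 ?nm_ge0 ?invr_ge0 ?exprn_ge0 ?nm_ge0 ?ler_wpM2r//.
    by apply: invX_le => //; exact: circ_ge.
  rewrite /ckernel -(meanB (bK _ _ bf) (bK _ _ bg)); apply: mean_le => t s _ _.
  rewrite -mulrBl -mulrBl !nmM nmV nmX nm_circ// -mulrA.
  rewrite ler_pM ?mulr_ge0 ?nm_ge0 ?invr_ge0 ?exprn_ge0 ?nm_ge0 ?fg//.
  by rewrite ler_wpM2l//; apply: invX_le => //; exact: circ_ge.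
have E (B : R) : 0 <= B -> e = e / (1 + B) + e / (1 + B) * B.
  by move=> B1; field; rewrite gt_eqF// ltr_pwDl.
rewrite [leRHS](E _ B0).
rewrite (_ : _ - _ = (ckernel f c rho y 1 - ckernel g c rho y 1) - (f y - g y)); last first.
  by rewrite (cauchy hg rr hy); ring.
by rewrite (le_trans (nmB _ _))// addrC lerD.
Qed.

End Holomorphic.

(** * Zeros of holomorphic functions and dependence on parameters *)

Section LocalStructure.
Context {R : realType}.
Local Notation C := (Cplx R).
Implicit Types (f F G g : C -> C) (a c z w u : C) (r rho e : R).

Lemma pderM f g z a b : pder f z a -> pder g z b ->
  pder (fun w => f w * g w) z (a * g z + f z * b).
Proof.
move=> hf hg e e0; have [M [d0 [M0 d00 lg]]] := pder_lip hg.
pose k := 1 + nm (f z) + nm (g z) + nm a.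
have [k0 kf kg ka] : [/\ 0 < k, nm (f z) <= k, 1 + nm (g z) <= k & nm a <= k].
  move: (nm_ge0 (f z)) (nm_ge0 (g z)) (nm_ge0 a); rewrite /k.
  by move: (nm (f z)) (nm (g z)) (nm a) => *; split; flra.
have e1 : 0 < e / (3 * k) by rewrite divr_gt0// mulr_gt0.
have [d1 d10 h1] := hf _ e1; have [d2 d20 h2] := hg _ e1.
have [d3 d30 h3] := pder_cnm hg e1; have [d4 d40 h4] := pder_cnm hg ltr01.
exists (Num.min d1 (Num.min d2 (Num.min d3 d4))); first by rewrite !lt_min d10 d20 d30.
move=> w; rewrite !lt_min => /and4P[w1 w2 w3 w4].
set E := e / (3 * k) in e1 h1 h2 h3.
have kE : k * E = e / 3 by rewrite /E; field; rewrite gt_eqF.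
rewrite (_ : _ - _ = (f w - f z - a * (w - z)) * g w + a * (g w - g z) * (w - z)
  + f z * (g w - g z - b * (w - z))); last by ring.
have n0 := nm_ge0 (w - z).
have t1 : nm ((f w - f z - a * (w - z)) * g w) <= k * E * nm (w - z).
  rewrite nmM mulrC -mulrA ler_pM ?nm_ge0 ?h1//.
  apply: le_trans kg; rewrite (le_trans (nm_split (g w) (g z)))// addrC lerD2r.
  exact/ltW/h4.
have t2 : nm (a * (g w - g z) * (w - z)) <= k * E * nm (w - z).
  by rewrite 2!nmM ler_wpM2r// ler_pM ?nm_ge0//; exact/ltW/h3.
have t3 : nm (f z * (g w - g z - b * (w - z))) <= k * E * nm (w - z).
  by rewrite nmM -mulrA ler_pM ?nm_ge0 ?h2.
rewrite (le_trans (nmD _ _))// (le_trans (lerD (nmD _ _) (lexx _)))//.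
rewrite (le_trans (lerD (lerD t1 t2) t3))// kE -!mulrDl ler_wpM2r//; flra.
Qed.

(** On smaller discs the quotient agrees with the Cauchy integral of [f w / (w - c)], which is
    holomorphic at [c] too. *)
Lemma hol_factor f c r : 0 < r -> holb f c r -> exists2 g, holb g c r &
  forall z, nm (z - c) < r -> f z = f c + (z - c) * g z.
Proof.
move=> r0 hf; pose g z := if z == c then cD f c else (f z - f c) / (z - c).
have cc s : 0 < s -> nm (c - c) < s by rewrite subrr nm0.
exists g; last first.
  move=> z _; rewrite /g; case: eqVneq => [->|zc]; first by rewrite subrr mul0r addr0.
  by have zc0 : z - c != 0 by [rewrite subr_eq0]; field.
move=> z hz.
have [rho rr hz'] : exists2 rho, rho < r & nm (z - c) < rho.
  by exists ((nm (z - c) + r) / 2); flra.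
have rho0 : 0 < rho by rewrite (le_lt_trans (nm_ge0 _) hz').
have [M _ hM] := holb_bounded hf rr.
have bf t : nm (f (circ c rho t) / (circ c rho t - c)) <= M / rho.
  by rewrite nmM nmV nm_circ ?(ltW rho0)// ler_wpM2r ?invr_ge0 ?(ltW rho0)// hM// nm_circ// ltW.
have bf' t : nm (f (circ c rho t)) <= M by rewrite hM// nm_circ// ltW.
have [k _] := @ckernel_holb _ (fun w => f w / (w - c)) c rho _ bf.
apply: (holb_near k hz'); apply: filterS (near_ball hz') => y hy.
have nc t : circ c rho t - c != 0 by exact/circ_neq/cc.
have ny t : circ c rho t - y != 0 by exact/circ_neq.
rewrite /g; case: eqVneq => [yc|yc].
  rewrite yc (cauchy_D hf rr (cc _ rho0)) /ckernel; apply: mean_eq => t s _ _.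
  by have := nc t => n; field.
have yc0 : y - c != 0 by rewrite subr_eq0.
apply: (mulIf yc0); rewrite divfK//.
rewrite (cauchy hf rr hy) (cauchy hf rr (cc _ rho0)) mulrC /ckernel.
have bk w : nm (w - c) < rho -> bnd01 (fun t _ => f (circ c rho t) * (circ c rho t - c) * (circ c rho t - w) ^- 1)
    (M * rho * (rho - nm (w - c)) ^- 1).
  move=> hw t s _ _; rewrite !nmM nmV nmX nm_circ ?(ltW rho0)//.
  rewrite ler_pM ?mulr_ge0 ?nm_ge0 ?invr_ge0 ?exprn_ge0 ?nm_ge0 ?(ltW rho0)//.
    by rewrite ler_wpM2r// ltW.
  by apply: invX_le; rewrite ?subr_gt0//; apply: circ_ge; exact: ltW.
have bk' : bnd01 (fun t _ => f (circ c rho t) / (circ c rho t - c) * (circ c rho t - c) * (circ c rho t - y) ^- 1)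
    (M * (rho - nm (y - c)) ^- 1).
  move=> t s _ _; rewrite divfK// nmM nmV nmX ler_pM ?nm_ge0 ?invr_ge0 ?exprn_ge0 ?nm_ge0//.
  by apply: invX_le; rewrite ?subr_gt0//; apply: circ_ge; exact: ltW.
rewrite -(meanZ _ bk') -(meanB (bk _ hy) (bk _ (cc _ rho0))); apply: mean_eq => t s _ _.
by have := nc t => n1; have := ny t => n2; field; rewrite n1.
Qed.

Lemma exprn_small (q B e : R) : 0 <= q < 1 -> 0 < e -> exists k, q ^+ k * B < e.
Proof.
move=> /andP[q0 q1] e0; have qn : `|q| < 1 by rewrite ger0_norm.
have e1 : 0 < e / (`|B| + 1) by rewrite divr_gt0// ltr_wpDl.
have /(cvgR _ _ _).1 /(_ _ e1) [k _ hk] := cvg_expr qn.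
exists k; have := hk k (leqnn k); rewrite /= subr0 ger0_norm ?exprn_ge0//.
rewrite ltr_pdivlMr ?ltr_wpDl//; apply: le_lt_trans.
by rewrite ler_wpM2l ?exprn_ge0//; have := ler_norm B; flra.
Qed.

(** If the order is infinite, [f = (z - c) ^ k * g] for every [k], with [nm g <= M / rho ^ k] on the
    circle of radius [rho]; Cauchy's formula then bounds [f z] by a constant times
    [(nm (z - c) / rho) ^ k]. *)
Lemma hol_order f c r : 0 < r -> holb f c r ->
  (forall z, nm (z - c) < r -> f z = 0) \/
  exists k g, [/\ holb g c r, g c != 0 & forall z, nm (z - c) < r -> f z = (z - c) ^+ k * g z].
Proof.
move=> r0 hf; case: (pselect (exists k g, [/\ holb g c r, g c != 0 &
    forall z, nm (z - c) < r -> f z = (z - c) ^+ k * g z])) => [?|no]; [by right|left].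
have H k : exists2 g, holb g c r & forall z, nm (z - c) < r -> f z = (z - c) ^+ k * g z.
  elim: k => [|k [g hg fg]]; first by exists f => // z _; rewrite expr0 mul1r.
  have g0 : g c = 0 by apply: contrapT => /eqP g0; apply: no; exists k, g.
  have [g' hg' gg'] := hol_factor r0 hg; exists g' => // z hz.
  by rewrite fg// gg'// g0 add0r mulrA exprSr.
move=> z hz; apply/eqP; rewrite -nm_eq0 eq_le nm_ge0 andbT.
apply/ler_addgt0Pl => e e0; rewrite addr0.
have [rho rr hz'] : exists2 rho, rho < r & nm (z - c) < rho.
  by exists ((nm (z - c) + r) / 2); flra.
have rho0 : 0 < rho by rewrite (le_lt_trans (nm_ge0 _) hz').
have [M _ hM] := holb_bounded hf rr.
have q01 : 0 <= nm (z - c) / rho < 1.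
  by rewrite divr_ge0 ?nm_ge0 ?(ltW rho0)//= ltr_pdivrMr// mul1r.
have [k hk] := exprn_small (M * rho * (rho - nm (z - c)) ^- 1) q01 e0.
have [g hg fg] := H k; apply: le_trans (ltW hk).
have bg t : nm (g (circ c rho t)) <= M / rho ^+ k.
  rewrite ler_pdivlMr ?exprn_gt0// -[X in _ * X ^+ _](@nm_circ _ c rho t) ?(ltW rho0)//.
  by rewrite -nmX -nmM mulrC -fg ?hM// nm_circ ?(ltW rho0).
rewrite fg// nmM nmX (cauchy hg rr hz').
apply: (le_trans (ler_wpM2l _ (ckernel_le 1 bg hz'))); first by rewrite exprn_ge0 ?nm_ge0.
rewrite expr_div_n le_eqVlt; apply/orP; left; apply/eqP.
by field; rewrite !gt_eqF ?exprn_gt0 ?subr_gt0.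
Qed.

(** The minimum modulus principle. Without a zero, [1 / f] would be holomorphic in the open disc and
    larger at the centre than on a circle of radius [s] slightly below [rho], where by uniform
    continuity [f] is still larger than at the centre. *)
Lemma hol_zero_exists f c r rho m : holb f c r -> 0 < rho -> rho < r ->
  nm (f c) < m -> (forall t, m <= nm (f (circ c rho t))) ->
  exists2 z, nm (z - c) < rho & f z = 0.
Proof.
move=> hf r0 rr fc fm; apply: contrapT => no.
have m0 : 0 < m by rewrite (le_lt_trans (nm_ge0 _) fc).
have cr : nm (c - c) < r by rewrite subrr nm0 (lt_trans r0).
have [al hal _] := holb_strict hf cr.
pose g z := if nm (z - c) < rho then (f z)^-1 else 0.
have fz0 z : nm (z - c) < rho -> f z != 0 by move=> hz; apply/eqP => f0; apply: no; exists z.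
have hg : holb g c rho.
  move=> z hz; exists (- f z ^- 2 * al z); have zr := lt_trans hz rr.
  have h := sder_comp (hal z zr) (sder_inv (fz0 z hz)).
  have {}h := sder_eq h (_ : _ = - f z ^- 2 * al z) (_ : _ = 0).
  apply: pder_near (sder_pder (h _ _)); [|by rewrite mul0r addr0|by rewrite mulr0 mul0r addr0].
  by apply: filterS (near_ball hz) => y hy; rewrite /g hy.
have fc0 : 0 < nm (f c) by rewrite nm_gt0 fz0// subrr nm0.
have [e e0 he] : exists2 e, 0 < e & nm (f c) < m - e by exists ((m - nm (f c)) / 2); flra.
have [d d0 hd] := unif_cont (@nm_ball_compact R c rho) (fun w hw => holb_cnm hf (le_lt_trans hw rr)) e0.
pose s := Num.max (rho - d / 2) (rho / 2).
have [s1 s0 sd] : [/\ s < rho, 0 < s & rho - s < d].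
  rewrite /s gt_max lt_max; split; [apply/andP; split; flra|apply/orP; right; flra|].
  by have : rho - d / 2 <= Num.max (rho - d / 2) (rho / 2) by [rewrite le_max lexx]; flra.
have fs t : m - e <= nm (f (circ c s t)).
  have := hd (circ c rho t) (circ c s t); rewrite /= nm_circ ?(ltW r0)// => /(_ (lexx _)).
  have -> : circ c s t - circ c rho t = (s - rho)%:C * ee t by rewrite /circ rmorphB /=; ring.
  rewrite nmM nm_ee mulr1 nm_real distrC ger0_norm ?subr_ge0 ?(ltW s1)// => /(_ sd) h.
  have := fm t; have := nm_split (f (circ c rho t)) (f (circ c s t)).
  by rewrite (nmC (f (circ c rho t)) (f (circ c s t))); move: h; flra.
have bg t : nm (g (circ c s t)) <= (m - e)^-1.
  rewrite /g nm_circ ?(ltW s0)// s1 nmV lef_pV2 ?posrE//; first by rewrite (lt_le_trans _ (fs t))// (lt_trans fc0).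
  by rewrite (lt_trans fc0).
have cs : nm (c - c) < s by rewrite subrr nm0.
have := ckernel_le 1 bg cs; rewrite -(cauchy hg s1 cs) subrr nm0 subr0 expr1.
rewrite mulfK ?gt_eqF// /g subrr nm0 r0 nmV lef_pV2 ?posrE//; last by rewrite (lt_trans fc0).
by rewrite leNgt he.
Qed.

Lemma tube (T : topologicalType) (K : set C) (P : C -> T -> Prop) (t0 : T) :
  compact K -> (forall w, K w -> \forall p \near (w, t0), P p.1 p.2) ->
  \forall t \near t0, forall w, K w -> P w t.
Proof.
move=> /compact_near_coveringP cK h.
have := cK T (nbhs t0) (fun t w => P w t) _; apply=> w Kw.
exact: h.
Qed.

(** The tube lemma makes [f w t - f w t0] small on a whole circle at once, and Cauchy's formula for
    the derivative of this difference does the rest; nothing is asked of the parameter space. *)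
Lemma hol_param_D (T : topologicalType) (f : C -> T -> C) c (t0 : T) r : 0 < r ->
  (\forall t \near t0, holb (f^~ t) c r) ->
  (forall z e, nm (z - c) < r -> 0 < e ->
     \forall p \near (z, t0), nm (f p.1 p.2 - f z t0) < e) ->
  forall e, 0 < e -> \forall p \near (c, t0),
    nm (cD (f^~ p.2) p.1 - cD (f^~ t0) c) < e.
Proof.
move=> r0 hol cf e e0; have h0 := nbhs_singleton hol.
have [rho rho0 rr] : exists2 rho, 0 < rho & rho < r by exists (r / 2); flra.
(* Chosen so that [2 * e' * rho * (rho / 2) ^- 2], the Cauchy bound on the half disc, equals
   [e / 2]. *)
have e1 : 0 < e / 2 * (rho / 2) ^+ 2 / rho / 2 by rewrite !divr_gt0// !mulr_gt0// exprn_gt0// divr_gt0.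
set e' := e / 2 * (rho / 2) ^+ 2 / rho / 2 in e1.
have ht : \forall t \near t0, forall w, nm (w - c) <= rho -> nm (f w t - f w t0) < 2 * e'.
  apply: (tube (P := fun w t => nm (f w t - f w t0) < 2 * e')); first exact: nm_ball_compact.
  move=> w hw; have hw' := le_lt_trans hw rr.
  have h1 := cf w e' hw' e1.
  have h2 : \forall p \near (w, t0), nm (f p.1 t0 - f w t0) < e'.
    have [d d0 hd] := holb_cnm h0 hw' e1.
    exists ([set x | nm (x - w) < d], setT); first by split; [exact: nbhs_nm_lt|exact: filterT].
    by move=> [x t] [/= hx _]; exact: hd.
  apply: filterS2 h1 h2 => p; have := nm_tri (f p.1 p.2) (f w t0) (f p.1 t0).
  by rewrite (nmC (f w t0) (f p.1 t0)); flra.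
have hc : \forall z \near c, nm (z - c) < rho / 2 /\ nm (cD (f^~ t0) z - cD (f^~ t0) c) < e / 2.
  have c0 : nm (c - c) < r by rewrite subrr nm0.
  have e2 : 0 < e / 2 by flra.
  have [d d0 hd] := holb_cnm (holb_D h0) c0 e2.
  apply/nbhs_nm; exists (Num.min (rho / 2) d); first by rewrite lt_min d0 andbT; flra.
  by move=> w; rewrite lt_min => /andP[? /hd].
exists ([set z | nm (z - c) < rho / 2 /\ nm (cD (f^~ t0) z - cD (f^~ t0) c) < e / 2],
  [set t | holb (f^~ t) c r /\ forall w, nm (w - c) <= rho -> nm (f w t - f w t0) < 2 * e']).
  by split; [exact: hc|exact: filterI hol ht].
move=> [z t] [/= [hz hz'] [h1 h2]].
have hz2 : nm (z - c) < rho by flra.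
have E : cD (f^~ t) z - cD (f^~ t0) z = ckernel (fun w => f w t - f w t0) c rho z 2.
  have [M _ hM] := holb_bounded h1 rr; have [M' _ hM'] := holb_bounded h0 rr.
  have bk (u : C -> C) B : (forall w, nm (w - c) <= rho -> nm (u w) <= B) -> bnd01 (fun x _ =>
     u (circ c rho x) * (circ c rho x - c) * (circ c rho x - z) ^- 2) (B * rho * (rho - nm (z - c)) ^- 2).
    move=> bu x y _ _; rewrite 2!nmM nmV nmX nm_circ ?(ltW rho0)//.
    rewrite ler_pM ?mulr_ge0 ?nm_ge0 ?invr_ge0 ?exprn_ge0 ?nm_ge0 ?(ltW rho0)//.
      by rewrite ler_wpM2r ?(ltW rho0)// bu// nm_circ// ltW.
    by apply: invX_le; rewrite ?subr_gt0//; apply: circ_ge; exact: ltW.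
  rewrite (cauchy_D h1 rr hz2) (cauchy_D h0 rr hz2) /ckernel.
  rewrite -(meanB (bk _ _ hM) (bk _ _ hM')); apply: mean_eq => x y _ _.
  by rewrite -mulrBl -mulrBl.
have bd x : nm (f (circ c rho x) t - f (circ c rho x) t0) <= 2 * e'.
  by apply/ltW/h2; rewrite nm_circ// ltW.
have := @ckernel_le _ (fun w => f w t - f w t0) c rho z 2 _ bd hz2; rewrite -E => k.
have k2 : 2 * e' * rho * (rho - nm (z - c)) ^- 2 <= e / 2.
  have q : rho / 2 <= rho - nm (z - c) by clear -hz; flra.
  have q0 : 0 < rho / 2 by rewrite divr_gt0.
  apply: (le_trans (ler_wpM2l _ (invX_le 2 q0 q))); first by apply: mulr_ge0; [apply: mulr_ge0 => //; exact: ltW e1|exact: ltW].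
  by rewrite /e' le_eqVlt; apply/orP; left; apply/eqP; field; rewrite gt_eqF.
have k3 := le_trans k k2.
have := nm_tri (cD (f^~ t) z) (cD (f^~ t0) z) (cD (f^~ t0) c) => k4.
by rewrite (le_lt_trans k4)// [ltRHS]splitr ler_ltD.
Qed.

End LocalStructure.

(** * The Cauchy transform solves the dbar equation in the disc *)

Section CauchyTransform.
Context {R : realType}.
Local Notation C := (Cplx R).
Implicit Types (u v f F : C -> C) (a c z w : C) (r e : R).

Lemma unif_sder2 (K : set C) F A B : compact K -> (forall z, K z -> sder F z (A z) (B z)) ->
  (forall z, K z -> cnm A z) -> (forall z, K z -> cnm B z) -> forall e, 0 < e ->
  exists2 d : R, 0 < d & forall y y', K y -> nm (y' - y) < d ->
    nm (F y' - F y - A y * (y' - y) - B y * cj (y' - y)) <= e * nm (y' - y).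
Proof.
move=> cK hF hA hB e e0; have e3 : 0 < e / 3 by flra.
have [d1 d10 h1] := unif_cont cK hA e3; have [d3 d30 h3] := unif_cont cK hB e3.
apply: (unif_compact (Q := fun y y' =>
  nm (F y' - F y - A y * (y' - y) - B y * cj (y' - y)) <= e * nm (y' - y)) cK).
move=> x Kx; have [d2 d20 h2] := hF x Kx _ e3.
exists (Num.min d1 (Num.min d2 d3)); first by rewrite !lt_min d10 d20.
move=> y y'; rewrite !lt_min => /and3P[y1 y2 y3] /and3P[y'1 y'2 y'3].
have k1 := h1 x y Kx y1; have k3 := h3 x y Kx y3; have k2 := h2 y' y y'2 y2.
set s := y' - y in k2 *.
rewrite (_ : _ - _ = (F y' - F y - A x * s - B x * cj s) - (A y - A x) * s - (B y - B x) * cj s); last by ring.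
rewrite (le_trans (nmB _ _))// (le_trans (lerD (nmB _ _) (lexx _)))// !nmM nm_cj.
have n0 := nm_ge0 s.
have := ler_wpM2r n0 (ltW k1); have := ler_wpM2r n0 (ltW k3); flra.
Qed.

(* The Cauchy transform (1/pi) \int F(w)/(z-w) in polar coordinates centred at z,
   for F supported in the unit disc and z in the unit disc: the radius 3 is then
   large enough. *)
Definition ctransform F z : C :=
  6 * mean (fun s t => F (z - (3 * s)%:C * ee t) * cj (ee t)).

Lemma nm_cj_ee (t : R) : nm (cj (ee t)) = 1. Proof. by rewrite nm_cj nm_ee. Qed.

Lemma ct_bnd F M z : (forall w, nm (F w) <= M) ->
  bnd01 (fun s t => F (z - (3 * s)%:C * ee t) * cj (ee t)) M.
Proof. by move=> h s t _ _; rewrite nmM nm_cj_ee mulr1. Qed.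

(** The constant 6 is 3 for the radius times [2 pi] for the angle, divided by [pi]; the weight in
    polar coordinates has modulus 1. *)
Lemma ctransform_le F M z : (forall w, nm (F w) <= M) -> nm (ctransform F z) <= 6 * M.
Proof.
by move=> h; rewrite /ctransform nmM nm_nat ler_wpM2l//; apply: mean_le; exact: ct_bnd.
Qed.

Lemma ctransform_close F G MF MG e z : (forall w, nm (F w) <= MF) -> (forall w, nm (G w) <= MG) ->
  (forall w, nm (F w - G w) <= e) -> nm (ctransform F z - ctransform G z) <= 6 * e.
Proof.
move=> hF hG h; rewrite /ctransform -mulrBr nmM nm_nat ler_wpM2l//.
apply: (mean_close (ct_bnd z hF) (ct_bnd z hG)) => s t _ _.
by rewrite -mulrBl nmM nm_cj_ee mulr1.
Qed.

(** Differentiation under the mean leaves the identity [6 * mean Y = F z], for [X] and [Y] below.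
    Integrating the radial derivative shows that [3 * (X + Y)] has mean [F z], integrating the
    angular one that [X] and [Y] have the same mean. *)
Lemma ctransform_dbar F A B M z : (forall w, sder F w (A w) (B w)) ->
  (forall w, cnm A w) -> (forall w, cnm B w) -> (forall w, nm (F w) <= M) ->
  (forall w, 1 <= nm w -> F w = 0) -> nm z < 1 ->
  exists a, sder (ctransform F) z a (F z).
Proof.
move=> dF cA cB bF sF z1.
pose p (x : C) (s t : R) := x - (3 * s)%:C * ee t.
have nmp x s t : 0 <= s <= 1 -> nm (p x s t - x) <= 3.
  move=> /andP[s0 s1]; rewrite /p addrC addKr nmN nmM nm_ee mulr1 nm_real ger0_norm; flra.
pose K := [set w : C | nm (w - z) <= 4]; have cK : compact K := @nm_ball_compact R z 4.
have Kp x s t : nm (x - z) <= 1 -> 0 <= s <= 1 -> K (p x s t).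
  by move=> hx /(nmp x s t) h; rewrite /K /=; have := nm_tri (p x s t) x z; flra.
have [MA MA0 hMA] := cnm_bounded cK (fun w _ => cA w).
have [MB MB0 hMB] := cnm_bounded cK (fun w _ => cB w).
have zz : nm (z - z) <= 1 by rewrite subrr nm0.
have bA : bnd01 (fun s t => A (p z s t) * cj (ee t)) MA.
  by move=> s t hs _; rewrite nmM nm_cj_ee mulr1 hMA//; exact: Kp.
have bB : bnd01 (fun s t => B (p z s t) * cj (ee t)) MB.
  by move=> s t hs _; rewrite nmM nm_cj_ee mulr1 hMB//; exact: Kp.
have d1 : sder (fun x => mean (fun s t => F (p x s t) * cj (ee t))) z
   (mean (fun s t => A (p z s t) * cj (ee t))) (mean (fun s t => B (p z s t) * cj (ee t))).
  apply: (@sder_mean _ (fun s t x => F (p x s t) * cj (ee t)) _ _ z M MA MB 1) => //.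
    by move=> x _; exact: ct_bnd.
  move=> e e0; have [d d0 hd] := unif_sder2 cK (fun w _ => dF w) (fun w _ => cA w) (fun w _ => cB w) (divr_gt0 e0 (ltr0Sn _ 2)).
  have e3 : 0 < e / 3 by flra.
  have [d3 d30 h3] := unif_cont cK (fun w _ => cA w) e3.
  have [d4 d40 h4] := unif_cont cK (fun w _ => cB w) e3.
  exists (Num.min 1 (Num.min (d / 2) (Num.min d3 d4))); first by rewrite !lt_min d30 d40 ltr01 divr_gt0.
  move=> s t x y hs _; rewrite !lt_min => /and4P[x1 x2 x3 x4] /and4P[y1 y2 y3 y4].
  have pd x' y' : p x' s t - p y' s t = x' - y' by rewrite /p; ring.
  have k := hd (p y s t) (p x s t) (Kp _ _ _ (ltW y1) hs); rewrite pd in k.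
  have xy : nm (x - y) < d by have := nm_tri x z y; rewrite (nmC z y); flra.
  have {}k := k xy.
  have k3 := h3 (p z s t) (p y s t) (Kp _ _ _ zz hs); rewrite pd in k3; have {}k3 := k3 y3.
  have k4 := h4 (p z s t) (p y s t) (Kp _ _ _ zz hs); rewrite pd in k4; have {}k4 := k4 y4.
  rewrite (_ : _ - _ = ((F (p x s t) - F (p y s t) - A (p y s t) * (x - y) - B (p y s t) * cj (x - y))
    + (A (p y s t) - A (p z s t)) * (x - y) + (B (p y s t) - B (p z s t)) * cj (x - y)) * cj (ee t)); last by ring.
  rewrite nmM nm_cj_ee mulr1 (le_trans (nmD _ _))// (le_trans (lerD (nmD _ _) (lexx _)))// !nmM nm_cj.
  have n0 := nm_ge0 (x - y).
  by have := ler_wpM2r n0 (ltW k3); have := ler_wpM2r n0 (ltW k4); move: k; clear; flra.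
exists (6 * mean (fun s t => A (p z s t) * cj (ee t))).
apply: sder_eq (sderZ 6 d1) (erefl _) _.
(* In polar coordinates 2 B conj(e) is an s-derivative of F plus a
   theta-derivative of (F - F z)/s. *)
pose X s t := A (p z s t) * ee t; pose Y s t := B (p z s t) * cj (ee t).
have bX : bnd01 X MA by move=> s t hs _; rewrite nmM nm_ee mulr1 hMA//; exact: Kp.
have bF' : bnd01 (fun s t => F (p z s t)) M by [].
have bXY := bnd01Z (-3) (bnd01D bX bB).
have m1 : mean (fun s t => -3 * (X s t + Y s t)) = - F z.
  rewrite (mean_ftc bF' bXY).
    (* At [s = 1] the point is at distance 3 from [z], hence outside the unit disc, where [F]
       vanishes. *)
    rewrite (mean_eq (G := fun _ _ => - F z)) ?mean_cst// => s t _ _.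
    rewrite {2}/p mulr0 mul0r subr0 sF ?add0r// /p mulr1.
    have := nm_split ((3%:R : R)%:C * ee t) z; rewrite nmM nm_ee mulr1 nm_real ger0_norm// (nmC _ z).
    by move: z1; flra.
  move=> e e0; have e3 : 0 < e / 3 by flra.
  have [d d0 hd] := unif_sder2 cK (fun w _ => dF w) (fun w _ => cA w) (fun w _ => cB w) e3.
  exists (d / 3); first by flra.
  move=> s s' t hs hs' _ lt.
  have pd : p z s' t - p z s t = - ((3 * (s' - s))%:C * ee t).
    by rewrite /p !rmorphM rmorphB /=; ring.
  have n1 : nm (p z s' t - p z s t) = 3 * `|s' - s|.
    by rewrite pd nmN nmM nm_ee mulr1 nm_real normrM ger0_norm.
  have := hd (p z s t) (p z s' t) (Kp _ _ _ zz hs); rewrite n1 => /(_ ltac:(flra)).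
  rewrite pd cjN cjM cj_real rmorphM rmorph_nat => k.
  rewrite (_ : _ - _ = F (p z s' t) - F (p z s t) - A (p z s t) * - (3 * (s' - s)%:C * ee t)
    - B (p z s t) * - (3 * (s' - s)%:C * cj (ee t))); last by rewrite /X /Y; ring.
  by rewrite (le_trans k)// mulrA ler_wpM2r//; flra.
have m2 : mean (fun s t => X s t - Y s t) = 0.
  have [MF [dF0 [MF0 dF00 hMF]]] := sder_lip (dF z).
  (* The value at [s = 0] is the limit of the quotient, which keeps the derivability in [t] uniform
     down to the origin. The three terms of [BH] serve for [s] small, for [s] away from 0 and for
     [s = 0]. *)
  pose H t s := if s == 0 then -3 * (A z * ee t + B z * cj (ee t))
                else (F (p z s t) - F z) / s%:C.
  pose BH := 3 * MF + (2 * M) / (dF0 / 4) + 3 * (nm (A z) + nm (B z)).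
  have M0 : 0 <= M by rewrite (le_trans _ (bF z)) ?nm_ge0.
  have bH : bnd01 H BH.
    move=> t s _ /andP[s0 s1]; rewrite /H /BH; case: eqVneq => [_|sn].
      rewrite nmM nmN nm_nat (le_trans (ler_wpM2l _ (nmD _ _)))// !nmM nm_ee nm_cj_ee !mulr1.
      rewrite lerDr addr_ge0 ?mulr_ge0 ?invr_ge0 ?(ltW MF0)//.
      by rewrite divr_ge0// ltW.
    have s00 : 0 < s by rewrite lt_def sn.
    rewrite nmM nmV nm_real ger0_norm// ler_pdivrMr//.
    have pz : nm (p z s t - z) = 3 * s.
      by rewrite /p addrC addKr nmN nmM nm_ee mulr1 nm_real ger0_norm// mulr_ge0.
    have q1 : 0 <= 3 * (nm (A z) + nm (B z)) by rewrite mulr_ge0 ?addr_ge0 ?nm_ge0.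
    have dF4 : 0 < dF0 / 4 by rewrite divr_gt0.
    have q2 : 0 <= (2 * M) / (dF0 / 4) by rewrite divr_ge0 ?mulr_ge0// ltW.
    have q3 : 0 <= 3 * MF by rewrite mulr_ge0 ?ltW.
    have [lt|ge] := ltP (3 * s) dF0.
      have := hMF (p z s t) z; rewrite pz subrr nm0 => /(_ lt dF00) k.
      by rewrite (le_trans k)// mulrA (mulrC MF) ler_wpM2r//; flra.
    rewrite (le_trans (nmB _ _))// (le_trans (lerD (bF _) (bF _)))//.
    apply: (@le_trans _ _ ((2 * M) / (dF0 / 4) * s)); last by rewrite ler_wpM2r//; flra.
    rewrite mulrAC ler_pdivlMr ?divr_gt0//.
    have -> : M + M = 2 * M by ring.
    by rewrite ler_wpM2l ?mulr_ge0//; flra.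
  have bD : bnd01 (fun t s => -3 * tau * (X s t - Y s t)) (nm (-3 * tau) * (MA + MB)).
    by move=> t s ht hs; have := bnd01Z (-3 * tau) (bnd01B bX bB); apply.
  have E : mean (fun t s => -3 * tau * (X s t - Y s t)) = 0.
    rewrite (mean_ftc bH bD).
      rewrite (mean_eq (G := fun _ _ => 0)) ?mean_cst// => t s _ _.
      by rewrite /H /p ee0 ee1 subrr.
    move=> e e0.
    pose Q := 3 * (1 + MA + MB) + 1.
    have Q0 : 0 < Q by rewrite /Q; flra.
    have eQ : 0 < e / (2 * Q) by rewrite divr_gt0// mulr_gt0.
    have eT : 0 < e / (6 * (nm tau + 1)) by rewrite divr_gt0// mulr_gt0// ltr_wpDl ?nm_ge0.
    have [d2 d20 h2] := unif_sder2 cK (fun w _ => dF w) (fun w _ => cA w) (fun w _ => cB w) eT.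
    have [d3 d30 h3] := ee_diff eQ.
    have [d4 d40 h4] := @ee_diff R 1 ltr01.
    have T0 : 0 < nm (@tau R) + 1 by rewrite ltr_wpDl ?nm_ge0.
    have [d5 d50 d5p] : exists2 d5 : R, 0 < d5 & 3 * ((nm (@tau R) + 1) * d5) < d2.
      exists (d2 / (4 * (nm (@tau R) + 1))); first by rewrite divr_gt0// mulr_gt0.
      rewrite (_ : _ * _ = d2 * (3 / 4)); last by field; rewrite gt_eqF.
      by rewrite gtr_pMr//; flra.
    exists (Num.min d5 (Num.min d3 d4)); first by rewrite !lt_min d30 d40 d50.
    move=> t t' s _ _ hs; rewrite !lt_min => /and3P[t5 t3 t4].
    set h := (t' - t)%:C; have nh : nm h = `|t' - t| by rewrite nm_real.
    set D := ee t' - ee t.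
    have k3 : nm (D - h * (tau * ee t)) <= e / (2 * Q) * `|t' - t| by exact: h3.
    have nD : nm D <= (nm (@tau R) + 1) * `|t' - t|.
      rewrite (le_trans (nm_split _ (h * (tau * ee t))))// mulrDl lerD ?h4//.
      by rewrite 2!nmM nh nm_ee mulr1 mulrC.
    have cjh : cj (D - h * (tau * ee t)) = cj D + h * (tau * cj (ee t)).
      rewrite cjB (cjM h) (cjM tau) /h cj_real (_ : cj tau = - tau); first by ring.
      by rewrite /tau cjM cj_real cj_i; ring.
    case/andP: (hs) => s0 s1.
    have key : nm (-3 * (A (p z s t) * (D - h * (tau * ee t)) + B (p z s t) * cj (D - h * (tau * ee t)))) <= e / 2 * `|t' - t|.
      rewrite nmM nmN nm_nat (le_trans (ler_wpM2l _ (nmD _ _)))// !nmM nm_cj -mulrDl mulrA.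
      apply: (@le_trans _ _ (Q * (e / (2 * Q) * `|t' - t|))).
        rewrite ler_pM ?mulr_ge0 ?addr_ge0 ?nm_ge0//.
        have := hMA _ (Kp z s t zz hs); have := hMB _ (Kp z s t zz hs); rewrite /Q; clear; flra.
      by rewrite mulrA ler_wpM2r// le_eqVlt; apply/orP; left; apply/eqP; field; rewrite gt_eqF.
    rewrite /H; case: eqVneq => [s00|sn].
      have p0 : p z s t = z by rewrite /p s00 mulr0 mul0r subr0.
      rewrite (_ : _ - _ = -3 * (A (p z s t) * (D - h * (tau * ee t)) + B (p z s t) * cj (D - h * (tau * ee t)))); last first.
        by rewrite cjh /X /Y p0 /D cjB; ring.
      by rewrite (le_trans key)// ler_wpM2r//; move: e0; clear; flra.
    have s00 : 0 < s by rewrite lt_def sn.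
    have sC : s%:C != 0 :> C by rewrite -[0]/(real_complex R 0) (inj_eq (@complexI R)).
    have pd : p z s t' - p z s t = - ((3 * s)%:C * D) by rewrite /p /D; ring.
    have np : nm (p z s t' - p z s t) = 3 * s * nm D.
      by rewrite pd nmN nmM nm_real ger0_norm// mulr_ge0.
    have k2 : nm (F (p z s t') - F (p z s t) - A (p z s t) * - ((3 * s)%:C * D)
       - B (p z s t) * cj (- ((3 * s)%:C * D))) <= e / (6 * (nm (@tau R) + 1)) * (3 * s * nm D).
      rewrite -np -pd; apply: h2; first exact: Kp.
      rewrite np; apply: le_lt_trans d5p; rewrite -mulrA ler_wpM2l//.
      rewrite (le_trans (ler_piMl (nm_ge0 D) s1))// (le_trans nD)// ler_wpM2l ?(ltW T0)//.
      exact: ltW.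
    rewrite (_ : _ - _ = (F (p z s t') - F (p z s t) - A (p z s t) * - ((3 * s)%:C * D)
       - B (p z s t) * cj (- ((3 * s)%:C * D))) / s%:C +
       -3 * (A (p z s t) * (D - h * (tau * ee t)) + B (p z s t) * cj (D - h * (tau * ee t)))); last first.
      rewrite cjh cjN cjM cj_real rmorphM rmorph_nat /X /Y; field.
      exact: sC.
    rewrite (le_trans (nmD _ _))// nmM nmV nm_real (ger0_norm s0).
    have : e / (6 * (nm (@tau R) + 1)) * (3 * s * nm D) / s <= e / 2 * `|t' - t|.
      rewrite (_ : _ / s = e / (2 * (nm (@tau R) + 1)) * nm D); last by field; rewrite gt_eqF.
      apply: (le_trans (ler_wpM2l _ nD)); first by rewrite divr_ge0 ?mulr_ge0 ?(ltW T0) ?(ltW e0).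
      by rewrite mulrA ler_wpM2r// le_eqVlt; apply/orP; left; apply/eqP; field; rewrite gt_eqF.
    have k2' := ler_wpM2r (_ : 0 <= s^-1) k2; rewrite invr_ge0 s0 in k2'.
    by have {}k2' := k2' isT; move: key k2'; clear; flra.
  have bXY' := bnd01B bX bB.
  have bXYs : bnd01 (fun t s => X s t - Y s t) (MA + MB) by move=> t s ht hs; exact: bXY'.
  move: E; rewrite (meanZ _ bXYs) (mean_swap (fun s t => X s t - Y s t)) => /eqP.
  rewrite mulf_eq0 mulf_eq0 (negbTE (@tau_neq0 R)) oppr_eq0 orbF pnatr_eq0 /=.
  by move=> /eqP.
have bXD := bnd01D bX bB.
move: m1; rewrite (meanZ _ bXD) (meanD bX bB) => m1.
move: m2; rewrite (meanB bX bB) => /eqP; rewrite subr_eq0 => /eqP E.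
rewrite E in m1; rewrite -/(Y) in m1 *.
by apply: oppr_inj; rewrite -m1 /Y; ring.
Qed.

End CauchyTransform.

(** * Bump and cut-off functions in the plane *)

Section Bumps.
Context {R : realType}.
Local Notation C := (Cplx R).
Implicit Types (u f : C -> C) (a z w : C) (s e : R).

(** Same argument as [sder_der_cnm]; the directions 1 and ['i] separate the two coefficients. *)
Lemma sder_coef_cnm f (A B : C -> C) z : (\forall x \near z, sder f x (A x) (B x)) ->
  cnm A z /\ cnm B z.
Proof.
move=> /nbhs_nm[d0 d00 h].
have H e : 0 < e -> exists2 d : R, 0 < d & forall x, nm (x - z) < d ->
    nm (A x - A z + (B x - B z)) <= e /\ nm (A x - A z - (B x - B z)) <= e.
  move=> e0; have e2 : 0 < e / 2 by flra.
  have [d1 d10 h1] := h z ltac:(by rewrite subrr nm0) _ e2.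
  exists (Num.min d0 (d1 / 2)); first by rewrite lt_min d00 divr_gt0.
  move=> x; rewrite lt_min => /andP[x0 x1].
  have [d2 d20 h2] := h x x0 _ e2.
  have [m m0 [m1 m2]] : exists2 m : R, 0 < m & m < d1 / 2 /\ m < d2.
    exists (Num.min (d1 / 2) d2 / 2); first by rewrite divr_gt0// lt_min d20 divr_gt0.
    have p : 0 < Num.min (d1 / 2) d2 by rewrite lt_min d20 divr_gt0.
    have : Num.min (d1 / 2) d2 / 2 < Num.min (d1 / 2) d2 by move: p; set k := Num.min _ _; flra.
    by rewrite lt_min => /andP[].
  have key (k : C) : nm k = 1 -> nm ((A x - A z) * k + (B x - B z) * cj k) <= e.
    move=> nk; have nmm : nm (x + m%:C * k - x) = m.
      by rewrite addrC addKr nmM nm_real nk mulr1 ger0_norm// ltW.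
    have k1 := h1 (x + m%:C * k) x; have k2 := h2 (x + m%:C * k) x.
    rewrite nmm subrr nm0 in k1 k2; have q2 := k2 m2 d20.
    have q1 : nm (f (x + m%:C * k) - f x - A z * (x + m%:C * k - x) - B z * cj (x + m%:C * k - x)) <= e / 2 * m.
      apply: k1; last flra.
      by have := nm_tri (x + m%:C * k) x z; rewrite nmm; flra.
    rewrite (addrC x) addrK cjM cj_real in q1 q2.
    rewrite -(ler_pM2r m0) -{1}(ger0_norm (ltW m0)) -nm_real -nmM.
    rewrite (_ : _ * _ = (f (m%:C * k + x) - f x - A z * (m%:C * k) - B z * (m%:C * cj k)) -
       (f (m%:C * k + x) - f x - A x * (m%:C * k) - B x * (m%:C * cj k))); last by ring.
    by rewrite (le_trans (nmB _ _))//; flra.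
  split; first by have := key 1 nm1; rewrite cj1 !mulr1.
  have := key 'i nm_i; rewrite cj_i mulrN -mulNr -mulrDl nmM nm_i mulr1.
  by [].
have half (p q : C) e : nm (p + q) <= e -> nm (p - q) <= e -> nm p <= e /\ nm q <= e.
  move=> h1 h2; have N2 : (2 : C) != 0 := pow2_neq0 1.
  split.
    rewrite (_ : p = ((p + q) + (p - q)) / 2); last by field.
    by rewrite nmM nmV nm_nat ler_pdivrMr// (le_trans (nmD _ _))//; flra.
  rewrite (_ : q = ((p + q) - (p - q)) / 2); last by field.
  by rewrite nmM nmV nm_nat ler_pdivrMr// (le_trans (nmB _ _))//; flra.
split=> e e0; have e2 : 0 < e / 2 by flra.
- have [d dp hd] := H _ e2; exists d => // x /hd[h1 h2].
  by have [k _] := half _ _ _ h1 h2; flra.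
have [d dp hd] := H _ e2; exists d => // x /hd[h1 h2].
by have [_ k] := half _ _ _ h1 h2; flra.
Qed.

(** Convexity squeezes an increment between the slopes [p'] at its two ends, so continuity of [p']
    alone gives strict derivability. Each Wirtinger derivative is half of [p'] because [Re z] is the
    half sum of [z] and [cj z]. *)
Lemma sder_convex (p p' : R -> R) w : (forall x y, p' y * (x - y) <= p x - p y) ->
  {for Re w, continuous p'} ->
  sder (fun z : C => (p (Re z))%:C : C) w ((p' (Re w) / 2)%:C) ((p' (Re w) / 2)%:C).
Proof.
move=> cp /(cvgR (nbhs_filter (Re w)) _ _).1 cp' e e0.
have [d /= d0 hd] := (nbhs_ballP _ _).1 (cp' e e0).
exists d => // x y hx hy.
have rx : `|p' (Re x) - p' (Re w)| < e.
  by apply: hd; rewrite /ball /= distrC -raddfB (le_lt_trans (Re_nm _)).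
have ry : `|p' (Re y) - p' (Re w)| < e.
  by apply: hd; rewrite /ball /= distrC -raddfB (le_lt_trans (Re_nm _)).
have E : (x - y) + cj (x - y) = (2 * Re (x - y))%:C.
  by case: (x - y) => a b; apply/eqP; rewrite /cj eq_complex /= subrr eqxx andbT; apply/eqP; ring.
have -> : (p (Re x))%:C - (p (Re y))%:C - (p' (Re w) / 2)%:C * (x - y) - (p' (Re w) / 2)%:C * cj (x - y)
    = (p (Re x) - p (Re y) - p' (Re w) * (Re x - Re y))%:C :> C.
  rewrite -addrA -opprD -mulrDr E -rmorphM -!rmorphB /=; congr (_%:C).
  by rewrite raddfB /=; field.
rewrite nm_real; apply: (@le_trans _ _ (e * `|Re x - Re y|)); last first.
  by rewrite ler_wpM2l ?(ltW e0)// -raddfB Re_nm.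
have h1 := cp (Re x) (Re y); have h2 := cp (Re y) (Re x).
move: h1 h2 rx ry; move: (Re x) (Re y) (Re w) => X Y W.
rewrite !ltr_norml => h1 h2 /andP[rx1 rx2] /andP[ry1 ry2].
have [XY|XY] := leP Y X.
  have D0 : 0 <= X - Y by rewrite subr_ge0.
  rewrite (ger0_norm D0).
  have k1 := ler_wpM2r D0 (ltW rx2); have k2 := ler_wpM2r D0 (ltW ry1).
  rewrite ler_norml; apply/andP; split; flra.
have D0 : 0 <= Y - X by rewrite subr_ge0 ltW.
rewrite distrC (distrC X) (ger0_norm D0).
have k1 := ler_wpM2r D0 (ltW ry2); have k2 := ler_wpM2r D0 (ltW rx1).
rewrite ler_norml; apply/andP; split; flra.
Qed.

(** Powers of the positive part are smooth enough: the cube is used where two derivatives are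
    needed, the square where one is. *)
Definition pos (x : R) := Num.max 0 x.

Lemma pos_ge0 x : 0 <= pos x. Proof. by rewrite /pos le_max lexx. Qed.

Lemma pos_geid x : x <= pos x. Proof. by rewrite /pos le_max lexx orbT. Qed.

Lemma pos_eq0 x : x <= 0 -> pos x = 0. Proof. by move=> h; apply/max_idPl. Qed.

Lemma pos_id x : 0 <= x -> pos x = x. Proof. by move=> h; apply/max_idPr. Qed.

Lemma pos_continuous : continuous pos.
Proof.
move=> x; apply: (cvgR (nbhs_filter x) _ _).2 => e e0.
apply: filterS (nbhsx_ballx x e e0) => y; rewrite /ball /= distrC; apply: le_lt_trans.
rewrite /pos; case: (leP 0 y); case: (leP 0 x) => hx hy //; rewrite ?subr0 ?sub0r ?subrr ?normr0 ?normrN//.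
  by rewrite ger0_norm// ger0_norm; flra.
by rewrite ger0_norm// distrC ger0_norm; flra.
Qed.

Lemma pos2_convex x y : 2 * pos y * (x - y) <= pos x ^+ 2 - pos y ^+ 2.
Proof.
have [y0|y0] := leP y 0; first by rewrite (pos_eq0 y0) mulr0 mul0r expr0n subr0 sqr_ge0.
rewrite (pos_id (ltW y0)); have := pos_geid x; move: (pos x) => X hX.
have k : 2 * y * x <= 2 * y * X by rewrite ler_wpM2l// mulr_ge0// ltW.
by have := sqr_ge0 (X - y); rewrite sqrrB; flra.
Qed.

Lemma pos3_convex x y : 3 * pos y ^+ 2 * (x - y) <= pos x ^+ 3 - pos y ^+ 3.
Proof.
have [y0|y0] := leP y 0; first by rewrite (pos_eq0 y0) expr0n mulr0 mul0r expr0n subr0 exprn_ge0 ?pos_ge0.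
rewrite (pos_id (ltW y0)); have := pos_geid x; have := pos_ge0 x; move: (pos x) => X X0 hX.
have k : 3 * y ^+ 2 * x <= 3 * y ^+ 2 * X by rewrite ler_wpM2l// mulr_ge0// sqr_ge0.
have : 0 <= (X - y) ^+ 2 * (X + 2 * y) by rewrite mulr_ge0 ?sqr_ge0 ?addr_ge0 ?mulr_ge0 ?(ltW y0).
rewrite -subr_ge0 in k.
rewrite (_ : _ * (X + 2 * y) = X ^+ 3 - y ^+ 3 - 3 * y ^+ 2 * (X - y)); last by ring.
by move=> q; flra.
Qed.

Definition rad sg s a z : R := sg * (s ^+ 2 - nm (z - a) ^+ 2).

Definition posn n sg s a z : C := (pos (rad sg s a z) ^+ n)%:C.

Lemma sder_rad sg s a z : sder (fun w => (rad sg s a w)%:C) z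
  (- (sg%:C * cj (z - a))) (- (sg%:C * (z - a))).
Proof.
have d1 := sderB (sder_id z) (sder_cst a z).
have d2 := sder_comp d1 (sder_conj (z - a)).
apply: sder_ext (sder_eq (sderZ sg%:C (sderB (sder_cst (s ^+ 2)%:C z) (sderM d1 d2))) _ _).
- by move=> w; rewrite /rad (rmorphM (real_complex R) sg) (rmorphB (real_complex R)) /= nm_sqr.
- by rewrite !(cjB, cj0, cj1); ring.
- by rewrite !(cjB, cj0, cj1); ring.
Qed.

Lemma posn2_sder sg s a z : sder (posn 2 sg s a) z
  (- ((2 * sg)%:C * posn 1 sg s a z * cj (z - a))) (- ((2 * sg)%:C * posn 1 sg s a z * (z - a))).
Proof.
have cp : {for Re ((rad sg s a z)%:C), continuous (fun y => 2 * pos y)}.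
  by apply: cvgM; [exact: cvg_cst|exact: pos_continuous].
have h := sder_comp (sder_rad sg s a z) (sder_convex (w := (rad sg s a z)%:C) pos2_convex cp).
apply: sder_eq h _ _; rewrite /posn /= expr1 (_ : 2 * pos _ / 2 = pos (rad sg s a z)); try by field.
- by rewrite !cjN !cjM cj_real rmorphM /= rmorph_nat; ring.
by rewrite !cjN !cjM cj_real cjK rmorphM /= rmorph_nat; ring.
Qed.

Lemma posn3_sder sg s a z : sder (posn 3 sg s a) z
  (- ((3 * sg)%:C * posn 2 sg s a z * cj (z - a))) (- ((3 * sg)%:C * posn 2 sg s a z * (z - a))).
Proof.
have cp : {for Re ((rad sg s a z)%:C), continuous (fun y => 3 * pos y ^+ 2)}.
  apply: cvgM; first exact: cvg_cst.
  by rewrite (_ : (fun y => pos y ^+ 2) = (fun y => pos y * pos y))//; apply: cvgM; exact: pos_continuous.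
have h := sder_comp (sder_rad sg s a z) (sder_convex (w := (rad sg s a z)%:C) pos3_convex cp).
have N2 : (2 : C) != 0 := pow2_neq0 1.
apply: sder_eq h _ _; rewrite /posn /=.
- by rewrite !cjN !cjM cj_real !rmorphM fmorphV /= !rmorph_nat; field.
by rewrite !cjN !cjM cj_real cjK !rmorphM fmorphV /= !rmorph_nat; field.
Qed.

Lemma rad_le0 s a z : 0 <= s -> s <= nm (z - a) -> rad 1 s a z <= 0.
Proof. by move=> s0 h; rewrite /rad mul1r subr_le0 lerXn2r ?nnegrE ?nm_ge0. Qed.

Lemma radN_le0 s a z : 0 <= s -> nm (z - a) <= s -> rad (-1) s a z <= 0.
Proof. by move=> s0 h; rewrite /rad mulN1r oppr_le0 subr_ge0 lerXn2r ?nnegrE ?nm_ge0. Qed.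

Definition bump s a z : C := posn 2 1 s a z.

Lemma bump_sder s a z : exists A B, sder (bump s a) z A B.
Proof. by eexists; eexists; exact: posn2_sder. Qed.

Lemma bump_eq0 s a z : 0 <= s -> s <= nm (z - a) -> bump s a z = 0.
Proof. by move=> s0 h; rewrite /bump /posn (pos_eq0 (rad_le0 s0 h)) expr0n. Qed.

Lemma bump_ge0 s a z : 0 <= Re (bump s a z) /\ bump s a z = (Re (bump s a z))%:C.
Proof. by rewrite /bump /posn /=; split=> //; rewrite sqr_ge0. Qed.

Lemma bump_gt0 s a z : nm (z - a) < s -> 0 < Re (bump s a z).
Proof.
move=> h; rewrite /bump /posn /= exprn_gt0//.
apply: lt_le_trans (pos_geid _).
by rewrite /rad mul1r subr_gt0 ltr_pXn2r ?nnegrE ?nm_ge0 ?(le_trans _ (ltW h)) ?nm_ge0.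
Qed.

Section Cutoff.
Variables (s1 s2 : R) (a : C).
Hypotheses (s10 : 0 <= s1) (s12 : s1 < s2).

Let P z := posn 3 1 s2 a z.
Let Q z := posn 3 (-1) s1 a z.
Let Pb z : C := - (3 * posn 2 1 s2 a z * (z - a)).
Let Qb z : C := 3 * posn 2 (-1) s1 a z * (z - a).

(** [P] is positive inside radius [s2] and [Q] outside radius [s1], so that [s1 < s2] keeps the
    denominator away from 0. Both are cubes: the dbar derivative must itself be derivable to enter
    the Cauchy transform. *)
Definition cutoff z : C := P z / (P z + Q z).

Definition cutoff_dbar z : C := (Pb z * Q z - P z * Qb z) / ((P z + Q z) * (P z + Q z)).

Let s20 : 0 <= s2. Proof. exact: le_trans (ltW s12). Qed.

Let PQ0 z : P z + Q z != 0.
Proof.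
rewrite /P /Q /posn -rmorphD -[0]/(real_complex R 0) (inj_eq (@complexI R)) gt_eqF//.
have [h|h] := ltP (nm (z - a)) s2.
  rewrite ltr_pwDl ?exprn_ge0 ?pos_ge0// exprn_gt0// (lt_le_trans _ (pos_geid _))//.
  by rewrite /rad mul1r subr_gt0 ltr_pXn2r ?nnegrE ?nm_ge0.
rewrite ltr_wpDl ?exprn_ge0 ?pos_ge0// exprn_gt0// (lt_le_trans _ (pos_geid _))//.
by rewrite /rad mulN1r oppr_gt0 subr_lt0 ltr_pXn2r ?nnegrE ?nm_ge0// (lt_le_trans s12).
Qed.

Let dP z : exists A, sder P z A (Pb z).
Proof. by eexists; apply: sder_eq (posn3_sder 1 s2 a z) (erefl _) _; rewrite mulr1 rmorph_nat. Qed.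

Let dQ z : exists A, sder Q z A (Qb z).
Proof.
eexists; apply: sder_eq (posn3_sder (-1) s1 a z) (erefl _) _.
by rewrite rmorphM rmorphN1 rmorph_nat /Qb; ring.
Qed.

Lemma cutoff_sder z : exists A, sder cutoff z A (cutoff_dbar z).
Proof.
have [A hA] := dP z; have [B hB] := dQ z.
have hD := sder_comp (sderD hA hB) (sder_inv (PQ0 z)).
eexists; apply: sder_eq (sderM hA hD) (erefl _) _.
rewrite /cutoff_dbar; move: (PQ0 z) (cj (A + B)).
move: (P z) (Q z) (Pb z) (Qb z) => p q pb qb n k; rewrite mul0r addr0.
by field.
Qed.

Lemma cutoff_dbar_sder z : exists A B, sder cutoff_dbar z A B.
Proof.
have [A hA] := dP z; have [B hB] := dQ z.
have d1 := sderB (sder_id z) (sder_cst a z).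
have hPb := sderN (sderM (sderZ 3 (posn2_sder 1 s2 a z)) d1).
have hQb := sderM (sderZ 3 (posn2_sder (-1) s1 a z)) d1.
have hS := sderD hA hB; have hS2 := sderM hS hS.
have n : (P z + Q z) * (P z + Q z) != 0 by rewrite mulf_neq0.
eexists; eexists.
exact: (sderM (sderB (sderM hPb hB) (sderM hA hQb)) (sder_comp hS2 (sder_inv n))).
Qed.

Lemma cutoff1 z : nm (z - a) <= s1 -> cutoff z = 1.
Proof.
move=> h; have := PQ0 z; rewrite /cutoff.
have -> : Q z = 0 by rewrite /Q /posn (pos_eq0 (radN_le0 s10 h)) expr0n.
by rewrite addr0 => n; rewrite divff.
Qed.

Lemma cutoff0 z : s2 <= nm (z - a) -> cutoff z = 0.
Proof.
move=> h; rewrite /cutoff (_ : P z = 0) ?mul0r//.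
by rewrite /P /posn (pos_eq0 (rad_le0 s20 h)) expr0n.
Qed.

Lemma cutoff_dbar0 z : nm (z - a) <= s1 \/ s2 <= nm (z - a) -> cutoff_dbar z = 0.
Proof.
case=> h; rewrite /cutoff_dbar.
  have -> : Q z = 0 by rewrite /Q /posn (pos_eq0 (radN_le0 s10 h)) expr0n.
  have -> : Qb z = 0 by rewrite /Qb /posn (pos_eq0 (radN_le0 s10 h)) expr0n !(mulr0, mul0r).
  by rewrite !(mulr0, mul0r) subr0 mul0r.
have -> : P z = 0 by rewrite /P /posn (pos_eq0 (rad_le0 s20 h)) expr0n.
have -> : Pb z = 0 by rewrite /Pb /posn (pos_eq0 (rad_le0 s20 h)) expr0n !(mulr0, mul0r) oppr0.
by rewrite !(mulr0, mul0r) subr0 mul0r.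
Qed.

Lemma cutoff_le1 z : nm (cutoff z) <= 1.
Proof.
have [p q] : 0 <= pos (rad 1 s2 a z) ^+ 3 /\ 0 <= pos (rad (-1) s1 a z) ^+ 3.
  by rewrite !exprn_ge0 ?pos_ge0.
have := PQ0 z; rewrite /cutoff nmM nmV /P /Q /posn -rmorphD.
rewrite -[0]/(real_complex R 0) (inj_eq (@complexI R)) !nm_real => n.
rewrite !ger0_norm ?addr_ge0// ler_pdivrMr ?mul1r ?lerDl//.
by rewrite lt_def n addr_ge0.
Qed.

Lemma cutoff_dbar_bounded : exists2 M : R, 0 < M & forall z, nm (cutoff_dbar z) <= M.
Proof.
have [M M0 hM] : exists2 M : R, 0 < M & forall z, nm (z - a) <= s2 -> nm (cutoff_dbar z) <= M.
  apply: (@cnm_bounded _ [set z | nm (z - a) <= s2]); first exact: nm_ball_compact.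
  by move=> z _; have [A [B h]] := cutoff_dbar_sder z; exact: sder_cnm h.
exists M => // z; have [h|h] := leP (nm (z - a)) s2; first exact: hM.
by rewrite cutoff_dbar0 ?nm0 ?(ltW M0)//; right; exact: ltW.
Qed.

End Cutoff.

End Bumps.
(** * Holomorphic functions along the leaves *)

Section Lamination.
Context {R : realType} {X : topologicalType} (L : lamination R X).
Local Notation C := (Cplx R).
Implicit Types (c : chart R X) (x y : X) (f g : X -> C) (V : set X).

Lemma within_near (S T : topologicalType) (A : set S) (f : S -> T) (x : S) (P : set T) :
  {within A, continuous f} -> A x -> nbhs (f x) P -> \forall y \near x, A y -> P (f y).
Proof. by move=> /subspace_continuousP cf Ax /(cf x Ax). Qed.

(** With [tc] and [pl]: the leaf coordinate, the transversal coordinate and the parametrised plaques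
    of a chart. They are total, and meaningful on the domain, respectively for [nm w < 1]. *)
Definition zc c x : C := (ch_map c x).1.
Definition tc c x : ch_tr c := (ch_map c x).2.
Definition pl c (t : ch_tr c) (w : C) : X := ch_inv c (w, t).
Arguments pl : clear implicits.

Lemma ch_mapE c x : ch_map c x = (zc c x, tc c x). Proof. by rewrite -surjective_pairing. Qed.

Lemma pl_id c x : ch_dom c x -> pl c (tc c x) (zc c x) = x.
Proof. by move=> h; rewrite /pl -ch_mapE; exact: ch_mapK. Qed.

Lemma pl_dom c t w : nm w < 1 -> ch_dom c (pl c t w).
Proof. by move=> h; apply: ch_inv_in; exact/disc_nm. Qed.

Lemma zc_pl c t w : nm w < 1 -> zc c (pl c t w) = w.
Proof. by move=> h; rewrite /zc ch_invK//; exact/disc_nm. Qed.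

Lemma tc_pl c t w : nm w < 1 -> tc c (pl c t w) = t.
Proof. by move=> h; rewrite /tc ch_invK//; exact/disc_nm. Qed.

Lemma zc_lt c x : ch_dom c x -> nm (zc c x) < 1.
Proof. by move=> h; apply/disc_nm; exact: ch_map_in. Qed.

Lemma near_dom c x : ch_dom c x -> \forall y \near x, ch_dom c y.
Proof. by move=> h; apply: open_nbhs_nbhs; split=> //; exact: ch_dom_open. Qed.

Lemma near_map c x (Q : set (C * ch_tr c)) : ch_dom c x ->
  nbhs (zc c x, tc c x) Q -> \forall y \near x, Q (zc c y, tc c y).
Proof.
move=> h; rewrite -ch_mapE => hQ.
apply: filterS2 (within_near (@ch_map_cont _ _ c) h hQ) (near_dom h) => y k /k.
by rewrite ch_mapE.
Qed.

Lemma near_disc (z : C) : nm z < 1 -> \forall w \near z, nm w < 1.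
Proof.
move=> h; have h0 : nm (z - 0) < 1 by rewrite subr0.
by apply: filterS (near_ball h0) => w; rewrite subr0.
Qed.

Lemma near_inv c z t (P : set X) : nm z < 1 -> nbhs (pl c t z) P ->
  \forall p \near (z, t), nm p.1 < 1 /\ P (pl c p.2 p.1).
Proof.
move=> hz hP; have dz : [set p : C * ch_tr c | disc p.1] (z, t) by exact/disc_nm.
have h1 := within_near (@ch_inv_cont _ _ c) dz hP.
have h2 : \forall p \near (z, t), nm p.1 < 1.
  exists ([set w | nm w < 1], setT); first by split; [exact: near_disc|exact: filterT].
  by move=> [w s] [].
apply: filterS2 h1 h2 => -[w s] /= k hw; split=> //; apply: k; exact/disc_nm.
Qed.

Lemma near_plaque c z t (P : set X) : nm z < 1 -> nbhs (pl c t z) P ->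
  \forall w \near z, nm w < 1 /\ P (pl c t w).
Proof.
move=> hz /(near_inv hz)[[A B] /= [nA nB] h]; apply: filterS nA => w Aw.
by apply: (h (w, t)); split=> //; exact: nbhs_singleton.
Qed.

Lemma near_plaque_at c x (P : set X) : ch_dom c x -> nbhs x P ->
  \forall w \near zc c x, nm w < 1 /\ P (pl c (tc c x) w).
Proof. by move=> h hP; apply: near_plaque; [exact: zc_lt|rewrite pl_id]. Qed.

Lemma tr_near c c' x : L c -> L c' -> ch_dom c x -> ch_dom c' x ->
  exists t' : ch_tr c -> ch_tr c', \forall y \near x, tc c' y = t' (tc c y).
Proof.
move=> Lc Lc' h h'; have [_ cp] := atlasP L.
have k : ch_dom c' (ch_inv c (zc c x, tc c x)) by rewrite -/(pl c (tc c x) (zc c x)) pl_id.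
have [_ [t' ht]] := cp c c' Lc Lc' (zc c x, tc c x) (ch_map_in h) k.
exists t'; apply: filterS2 (near_map h ht) (near_dom h) => y /= <- hy.
by rewrite /transition -/(pl c (tc c y) (zc c y)) pl_id.
Qed.

(** Since the transversal part of a change of charts depends locally on [t] alone, the plaque of [c]
    through [x] stays near [x] in the plaque of [c'] through [x]. *)
Lemma on_plaque c c' x : L c -> L c' -> ch_dom c x -> ch_dom c' x ->
  \forall w \near zc c x, [/\ nm w < 1, ch_dom c' (pl c (tc c x) w),
    tc c' (pl c (tc c x) w) = tc c' x &
    pl c (tc c x) w = pl c' (tc c' x) (zc c' (pl c (tc c x) w))].
Proof.
move=> Lc Lc' h h'; have [t' ht] := tr_near Lc Lc' h h'.
have hI : \forall y \near x, tc c' y = t' (tc c y) /\ ch_dom c' y.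
  by apply: filterI => //; exact: near_dom.
have h2 := near_plaque_at h hI.
apply: filterS h2 => w [hw [k1 k2]].
have E : tc c' (pl c (tc c x) w) = tc c' x by rewrite k1 tc_pl// (nbhs_singleton ht).
by split=> //; rewrite -E pl_id.
Qed.

Definition lder c f x : C := cD (fun w => f (pl c (tc c x) w)) (zc c x).

Definition jac c c' x : C := lder c (zc c') x.

(** Strict Wirtinger derivatives along the plaque, read in [c]. A change of chart multiplies them by
    [jac] and its conjugate. *)
Definition lwd c f x (a b : C) := sder (fun w => f (pl c (tc c x) w)) (zc c x) a b.

Lemma pder_near_holb (u : C -> C) z : (\forall w \near z, exists a, pder u w a) ->
  exists2 r : R, 0 < r & holb u z r.
Proof. by move=> /nbhs_nm[r r0 h]; exists r. Qed.

Lemma pder_near_sder (u : C -> C) z : (\forall w \near z, exists a, pder u w a) ->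
  sder u z (cD u z) 0.
Proof. by move=> /pder_near_holb[r r0 h]; apply: (hol_sder h); rewrite subrr nm0. Qed.

Lemma jac_lwd c c' x : L c -> L c' -> ch_dom c x -> ch_dom c' x ->
  lwd c (zc c') x (jac c c' x) 0.
Proof.
move=> Lc Lc' h h'; apply: pder_near_sder; have [_ cp] := atlasP L.
apply: filterS (on_plaque Lc Lc' h h') => w [hw dw _ _].
by have [/derivable_pder d _] := cp c c' Lc Lc' (w, tc c x) ((disc_nm w).2 hw) dw.
Qed.

Lemma lwd_change c c' f x a b : L c -> L c' -> ch_dom c x -> ch_dom c' x ->
  lwd c' f x a b -> lwd c f x (a * jac c c' x) (b * cj (jac c c' x)).
Proof.
move=> Lc Lc' h h' d; have j := jac_lwd Lc Lc' h h'.
have d' : sder (fun w => f (pl c' (tc c' x) w)) (zc c' (pl c (tc c x) (zc c x))) a b by rewrite pl_id.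
apply: sder_near (sder_eq (sder_comp j d') _ _).
- by apply: filterS (on_plaque Lc Lc' h h') => w [_ _ _ <-].
- by rewrite cj0 mulr0 addr0.
- by rewrite mulr0 add0r.
Qed.

(** A condition at the single point [x]; it amounts to holomorphy when it holds throughout an open
    set, as in [hol_on]. *)
Definition hol_at f x :=
  {for x, continuous f} /\ forall c, L c -> ch_dom c x -> exists a, lwd c f x a 0.

Definition hol_on V f := forall x, V x -> hol_at f x.

Lemma hol_atI c f x a : {for x, continuous f} -> L c -> ch_dom c x -> lwd c f x a 0 -> hol_at f x.
Proof.
move=> cf Lc h d; split=> // c' Lc' h'; exists (a * jac c' c x).
by have := lwd_change Lc' Lc h' h d; rewrite mul0r.
Qed.

Lemma chart_ex x : exists2 c, L c & ch_dom c x. Proof. exact: (atlasP L).1. Qed.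

Lemma lwd_near c f g x a b : ch_dom c x -> (\forall y \near x, f y = g y) ->
  lwd c f x a b -> lwd c g x a b.
Proof.
move=> h E; apply: sder_near; apply: filterS (near_plaque_at h E) => w [_ ->] //.
Qed.

Lemma cont_near (T : topologicalType) (f g : X -> T) x : (\forall y \near x, f y = g y) ->
  {for x, continuous f} -> {for x, continuous g}.
Proof.
move=> E cf P; rewrite -(nbhs_singleton E) => /cf h.
have {}h : \forall y \near x, P (f y) by exact: h.
by have : \forall y \near x, P (g y) by apply: filterS2 h E => y hy <-.
Qed.

Lemma hol_at_near f g x : (\forall y \near x, f y = g y) -> hol_at f x -> hol_at g x.
Proof.
move=> E [cf df]; split; first exact: cont_near E cf.
by move=> c Lc h; have [a d] := df c Lc h; exists a; exact: lwd_near E d.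
Qed.

Lemma hol_at_cst (k : C) x : hol_at (fun=> k) x.
Proof.
by split=> [|c _ _]; [exact: cst_continuous|exists 0; exact: sder_cst].
Qed.

Lemma contP f x : {for x, continuous f} <->
  forall e : R, 0 < e -> \forall y \near x, nm (f y - f x) < e.
Proof. exact: cvgC. Qed.

Lemma contD f g x : {for x, continuous f} -> {for x, continuous g} ->
  {for x, continuous (fun y => f y + g y)}.
Proof.
move=> /contP h /contP k; apply/contP => e e0; have e2 : 0 < e / 2 by flra.
apply: filterS2 (h _ e2) (k _ e2) => y h1 h2.
by rewrite opprD addrACA (le_lt_trans (nmD _ _))//; flra.
Qed.

Lemma contM f g x : {for x, continuous f} -> {for x, continuous g} ->
  {for x, continuous (fun y => f y * g y)}.
Proof.
move=> /contP h /contP k; apply/contP => e e0.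
pose B := nm (f x) + nm (g x) + 1.
have B0 : 0 < B by rewrite /B; have := nm_ge0 (f x); have := nm_ge0 (g x); flra.
have e1 : 0 < Num.min 1 (e / (2 * B)) by rewrite lt_min ltr01 divr_gt0// mulr_gt0.
apply: filterS2 (h _ e1) (k _ e1) => y; rewrite !lt_min => /andP[_ h2] /andP[k1 k2].
have -> : f y * g y - f x * g x = (f y - f x) * g y + f x * (g y - g x) by ring.
have gy : nm (g y) <= nm (g x) + 1 by have := nm_split (g y) (g x); flra.
rewrite (le_lt_trans (nmD _ _))// !nmM.
apply: (@le_lt_trans _ _ (e / (2 * B) * (nm (g x) + 1) + nm (f x) * (e / (2 * B)))).
  by rewrite lerD// ler_pM ?nm_ge0// ltW.
rewrite (_ : _ + _ = e / 2 * ((nm (f x) + nm (g x) + 1) / B)); last by field; rewrite gt_eqF.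
by rewrite divff ?gt_eqF// mulr1; flra.
Qed.

Lemma cont_comp (u : C -> C) f x : {for x, continuous f} -> cnm u (f x) ->
  {for x, continuous (fun y => u (f y))}.
Proof.
move=> /contP h k; apply/contP => e /k[d d0 hd].
by apply: filterS (h _ d0) => y /hd.
Qed.

Lemma hol_atD f g x : hol_at f x -> hol_at g x -> hol_at (fun y => f y + g y) x.
Proof.
move=> [cf df] [cg dg]; split=> [|c Lc h]; first exact: contD.
have [a d] := df c Lc h; have [b d'] := dg c Lc h.
by exists (a + b); apply: sder_eq (sderD d d') _ _; rewrite ?addr0.
Qed.

Lemma hol_atM f g x : hol_at f x -> hol_at g x -> hol_at (fun y => f y * g y) x.
Proof.
move=> [cf df] [cg dg]; split=> [|c Lc h]; first exact: contM.
have [a d] := df c Lc h; have [b d'] := dg c Lc h.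
by eexists; apply: sder_eq (sderM d d') (erefl _) _; rewrite mul0r mulr0 addr0.
Qed.

Lemma hol_atN f x : hol_at f x -> hol_at (fun y => - f y) x.
Proof.
move=> h; apply: hol_at_near (hol_atM (hol_at_cst (-1) x) h).
by apply: nearW => y; rewrite mulN1r.
Qed.

Lemma hol_atB f g x : hol_at f x -> hol_at g x -> hol_at (fun y => f y - g y) x.
Proof. by move=> h k; exact: hol_atD h (hol_atN k). Qed.

Lemma hol_atV f x : f x != 0 -> hol_at f x -> hol_at (fun y => (f y)^-1) x.
Proof.
move=> n [cf df]; split=> [|c Lc h].
  by apply: (cont_comp cf); exact: sder_cnm (sder_inv n).
have [a d] := df c Lc h; have n' : f (pl c (tc c x) (zc c x)) != 0 by rewrite pl_id.
by eexists; apply: sder_eq (sder_comp d (sder_inv n')) (erefl _) _; rewrite mulr0 mul0r addr0.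
Qed.

Lemma hol_atX f x n : hol_at f x -> hol_at (fun y => f y ^+ n) x.
Proof.
move=> h; elim: n => [|n IH].
  by apply: hol_at_near (hol_at_cst 1 x); apply: nearW => y; rewrite expr0.
by apply: hol_at_near (hol_atM h IH); apply: nearW => y; rewrite exprS.
Qed.

Lemma hol_at_div f g x : g x != 0 -> hol_at f x -> hol_at g x -> hol_at (fun y => f y / g y) x.
Proof. by move=> n hf hg; exact: hol_atM hf (hol_atV n hg). Qed.

Lemma hol_at_sum (I : Type) (r : seq I) (F : I -> X -> C) x :
  (forall i, hol_at (F i) x) -> hol_at (fun y => \sum_(i <- r) F i y) x.
Proof.
move=> h; elim: r => [|i r IH].
  by apply: hol_at_near (hol_at_cst 0 x); apply: nearW => y; rewrite big_nil.
by apply: hol_at_near (hol_atD (h i) IH); apply: nearW => y; rewrite big_cons.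
Qed.

Lemma zc_continuous c x : ch_dom c x -> {for x, continuous (zc c)}.
Proof.
move=> h P hP; have hQ : nbhs (zc c x, tc c x) [set p : C * ch_tr c | P p.1].
  by exists (P, setT); [split=> //; exact: filterT|case=> w s []].
exact: near_map h hQ.
Qed.

Lemma tc_continuous c x : ch_dom c x -> {for x, continuous (tc c)}.
Proof.
move=> h P hP; have hQ : nbhs (zc c x, tc c x) [set p : C * ch_tr c | P p.2].
  by exists (setT, P); [split=> //; exact: filterT|case=> w s []].
exact: near_map h hQ.
Qed.

Lemma lwd_zc c x : ch_dom c x -> lwd c (zc c) x 1 0.
Proof.
move=> h; apply: sder_near (sder_id _); apply: filterS (near_disc (zc_lt h)) => w hw.
by rewrite zc_pl.
Qed.

Lemma hol_zc c : L c -> hol_on (ch_dom c) (zc c).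
Proof. by move=> Lc x h; exact: (hol_atI (zc_continuous h) Lc h (lwd_zc h)). Qed.

Lemma holomorphic_hol_on V f : open V -> holomorphic_on L V f -> hol_on V f.
Proof.
move=> oV [cf df] x Vx; have nV : nbhs x V by exact: open_nbhs_nbhs.
split=> [P hP|c Lc h].
  by apply: filterS2 (within_near cf Vx hP) nV => y k /k.
eexists; apply: pder_near_sder; apply: filterS (near_plaque_at h nV) => w [hw Vw].
exact/derivable_pder/(df c Lc (tc c x) w ((disc_nm w).2 hw) Vw).
Qed.

Lemma hol_on_holomorphic V f : hol_on V f -> holomorphic_on L V f.
Proof.
move=> h; split; first by apply: continuous_in_subspaceT => x /set_mem /h[].
move=> c Lc t z /disc_nm hz Vz; have [_ d] := h _ Vz.
have [a] := d c Lc (pl_dom t hz); rewrite /lwd tc_pl// zc_pl// => /sder_pder k.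
by apply/derivable_pder; exists a.
Qed.

Lemma hol_on_holb V f c t a (r : R) : hol_on V f -> L c ->
  (forall w, nm (w - a) < r -> nm w < 1 /\ V (pl c t w)) ->
  holb (fun w => f (pl c t w)) a r.
Proof.
move=> h Lc k w /k[hw Vw]; have [_ d] := h _ Vw.
have [b] := d c Lc (pl_dom t hw); rewrite /lwd tc_pl// zc_pl// => /sder_pder q.
by exists b.
Qed.

Lemma near_prod_ball (T : topologicalType) (z : C) (t : T) (P : set (C * T)) :
  nbhs (z, t) P -> exists2 r : R, 0 < r &
    \forall s \near t, forall w, nm (w - z) < r -> P (w, s).
Proof.
move=> [[A B] /= [/nbhs_nm[r r0 hA] nB] h]; exists r => //.
by apply: filterS nB => s Bs w /hA Aw; exact: (h (w, s)).
Qed.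

Lemma cont_plaque f c t z : {for (pl c t z), continuous f} -> nm z < 1 -> forall e : R, 0 < e ->
  \forall p \near (z, t), nm (f (pl c p.2 p.1) - f (pl c t z)) < e.
Proof.
move=> cf hz e e0; have hP := cf _ (nbhs_nm_lt _ e0).
by apply: filterS (near_inv hz hP) => p [].
Qed.

(** Along the leaf this is the holomorphy of a derivative; continuity across the leaves is what
    [hol_param_D] provides. *)
Lemma lder_hol V f c : open V -> hol_on V f -> L c -> hol_on (V `&` ch_dom c) (lder c f).
Proof.
move=> oV h Lc x [Vx hx]; have nV : nbhs x V by exact: open_nbhs_nbhs.
have nV' : nbhs (pl c (tc c x) (zc c x)) V by rewrite pl_id.
have [r r0 hr] := near_prod_ball (near_inv (zc_lt hx) nV').
have hb : \forall t \near tc c x, holb (fun w => f (pl c t w)) (zc c x) r.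
  by apply: filterS hr => t k; apply: hol_on_holb h Lc _.
have hV := nbhs_singleton hr.
have key e : 0 < e -> \forall p \near (zc c x, tc c x),
    nm (cD (fun w => f (pl c p.2 w)) p.1 - lder c f x) < e.
  apply: (@hol_param_D _ _ (fun w t => f (pl c t w)) (zc c x) (tc c x) r r0 hb) => z e' hz.
  have [hz1 Vz] := hV z hz; apply: cont_plaque => //.
  by have [] := h _ Vz.
apply: (@hol_atI c _ _ (cD (cD (fun w => f (pl c (tc c x) w))) (zc c x))) => //.
  apply: (cvgC (nbhs_filter x) _ _).2 => e /key k.
  exact: near_map hx k.
have hb0 := nbhs_singleton hb; have z0 : nm (zc c x - zc c x) < r by rewrite subrr nm0.
apply: sder_near (hol_sder (holb_D hb0) z0).
apply: filterS (near_disc (zc_lt hx)) => w hw.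
by rewrite /lder zc_pl// tc_pl.
Qed.

Lemma jac_hol c c' : L c -> L c' -> hol_on (ch_dom c' `&` ch_dom c) (jac c c').
Proof. by move=> Lc Lc'; exact: (lder_hol (@ch_dom_open _ _ c') (hol_zc Lc') Lc). Qed.

Lemma jac_comp c c' c'' x : L c -> L c' -> L c'' -> ch_dom c x -> ch_dom c' x ->
  ch_dom c'' x -> jac c c'' x = jac c' c'' x * jac c c' x.
Proof.
move=> Lc Lc' Lc'' h h' h''.
have [-> _] := sder_uniq (jac_lwd Lc Lc'' h h'') (lwd_change Lc Lc' h h' (jac_lwd Lc' Lc'' h' h'')).
by [].
Qed.

Lemma jac_id c x : L c -> ch_dom c x -> jac c c x = 1.
Proof. by move=> Lc h; have [->] := sder_uniq (jac_lwd Lc Lc h h) (lwd_zc h). Qed.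

Lemma jac_neq0 c c' x : L c -> L c' -> ch_dom c x -> ch_dom c' x -> jac c c' x != 0.
Proof.
move=> Lc Lc' h h'; apply/eqP => j0; have := jac_comp Lc Lc' Lc h h' h.
by rewrite jac_id// j0 mulr0 => /eqP; rewrite oner_eq0.
Qed.

(** One chart per point is enough, although [leaf_open] tests the plaques of all charts, because
    changes of charts are continuous along plaques. *)
Lemma leaf_openP (P : set X) :
  (forall x, P x -> exists c, [/\ L c, ch_dom c x &
     \forall w \near zc c x, P (pl c (tc c x) w)]) -> leaf_open (L := L) P.
Proof.
move=> h c Lc t; rewrite openE => z [/disc_nm hz Pz].
have [c' [Lc' h' near']] := h _ Pz; set x := pl c t z in Pz h' near'.
have hx : ch_dom c x by exact: pl_dom.
have j := jac_lwd Lc Lc' hx h'.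
have nP : nbhs (zc c' (pl c (tc c x) (zc c x))) [set w | P (pl c' (tc c' x) w)] by rewrite pl_id.
have cz := cnm_near (sder_cnm j) nP.
have : \forall w \near zc c x, disc w /\ P (ch_inv c (w, tc c x)).
  apply: filterS2 cz (on_plaque Lc Lc' hx h') => w /= h1 [hw _ _ E].
  by split; [exact/disc_nm|rewrite -/(pl c (tc c x) w) E].
by rewrite /x zc_pl// tc_pl.
Qed.

(** Leaves being connected components, a property that is leafwise open together with its negation
    is constant on each leaf. This replaces chains of plaques. *)
Lemma leaf_ind (P : set X) x y : leaf_open (L := L) P -> leaf_open (L := L) (~` P) -> P x ->
  leaf L x y -> P y.
Proof.
move=> oP oQ Px [A [Ax _ cA] Ay].
have E := cA (A `&` P) (ex_intro _ x (conj Ax Px)).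
suff : A `&` P = A by move=> /seteqP[_ /(_ y Ay)[]].
apply: E; first by exists P.
by exists P => //; rewrite -[P]setCK; exact: (@open_closedC (leafspace L)).
Qed.

(** The straight segment in the plaque is continuous for the leaf topology; asking it to stay in [V]
    handles the leaves of the lamination induced on [V]. *)
Lemma plaque_conn V c t (a z : C) : L c ->
  (forall s : R, 0 <= s <= 1 -> nm (pt a z s) < 1 /\ V (pl c t (pt a z s))) ->
  leaf_in L V (pl c t a) (pl c t z).
Proof.
move=> Lc h; pose g s := pl c t (pt a z s) : leafspace L.
have cg : {within `[0, 1]%classic, continuous g}.
  apply: continuous_in_subspaceT => s /set_mem; rewrite /= in_itv /= => hs.
  have [hw _] := h s hs; move=> W; rewrite nbhsE /= => -[U [oU Us] UW].
  have oz := oU c Lc t.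
  have nz : nbhs (pt a z s) [set w : C | disc w /\ U (ch_inv c (w, t))].
    by apply: open_nbhs_nbhs; split=> //; split=> //; exact/disc_nm.
  have cp : {for s, continuous (fun s => pt a z s)}.
    apply: (cvgC (nbhs_filter s) _ _).2 => e e0.
    have k0 : 0 < e / (1 + nm (z - a)) by rewrite divr_gt0// ltr_pwDl ?nm_ge0.
    apply: filterS (nbhsx_ballx s _ k0) => s'; rewrite /ball /= => hs'.
    rewrite pt_diff nmM nm_real distrC; apply: (@le_lt_trans _ _ (`|s - s'| * (1 + nm (z - a)))).
      by rewrite ler_wpM2l//; have := nm_ge0 (z - a); flra.
    by rewrite -ltr_pdivlMr// ltr_pwDl ?nm_ge0.
  by apply: (@filterS _ (nbhs s) _ _ _ _ (cp _ nz)) => s' [_ /UW].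
have cI := connected_continuous_connected (@segment_connected R 0 1) cg.
exists (g @` `[0, 1]%classic).
  split=> //.
  - exists 0; rewrite /= ?in_itv /= ?lexx ?ler01//.
    by rewrite /g /pt mul0r addr0.
  - by move=> _ [s hs <-]; have [] := h s _; rewrite /= in_itv /= in hs.
exists 1; rewrite /= ?in_itv /= ?lexx ?ler01//.
by rewrite /g /pt mul1r addrC subrK.
Qed.

End Lamination.
Arguments pl {R X} c t w.

(** * Leafwise differentiable functions and uniform limits *)

Section LeafwiseC1.
Context {R : realType} {X : topologicalType} (L : lamination R X).
Local Notation C := (Cplx R).
Implicit Types (c : chart R X) (x y : X) (f g : X -> C) (V : set X).

Lemma lwdM c f g x a b a' b' : ch_dom c x -> lwd c f x a b -> lwd c g x a' b' ->
  lwd c (fun y => f y * g y) x (a * g x + f x * a') (b * g x + f x * b').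
Proof. by move=> h d d'; apply: sder_eq (sderM d d') _ _; rewrite pl_id. Qed.

Lemma lwdB c f g x a b a' b' : lwd c f x a b -> lwd c g x a' b' ->
  lwd c (fun y => f y - g y) x (a - a') (b - b').
Proof. exact: sderB. Qed.

Lemma lwd_zc_comp c (u : C -> C) x a b : ch_dom c x -> sder u (zc c x) a b ->
  lwd c (fun y => u (zc c y)) x a b.
Proof.
move=> h d; have d' : sder u (zc c (pl c (tc c x) (zc c x))) a b by rewrite pl_id.
by apply: sder_eq (sder_comp (lwd_zc h) d') _ _; rewrite ?cj0 ?cj1 !mulr0 mulr1 ?addr0 ?add0r.
Qed.

Lemma contB f g x : {for x, continuous f} -> {for x, continuous g} ->
  {for x, continuous (fun y => f y - g y)}.
Proof.
move=> /contP h /contP k; apply/contP => e e0; have e2 : 0 < e / 2 by flra.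
apply: filterS2 (h _ e2) (k _ e2) => y h1 h2.
rewrite (_ : _ - _ = (f y - f x) - (g y - g x)); last by ring.
by rewrite (le_lt_trans (nmB _ _))//; flra.
Qed.

(** Continuity of the derivatives along a plaque follows from strictness; none is asked across the
    plaques. *)
Definition c1_at f x := {for x, continuous f} /\
  forall c, L c -> ch_dom c x -> exists A B, lwd c f x A B.

Lemma hol_c1 f x : hol_at L f x -> c1_at f x.
Proof. by move=> [cf df]; split=> // c Lc h; have [A d] := df c Lc h; exists A, 0. Qed.

Lemma c1_near f g x : (\forall y \near x, f y = g y) -> c1_at f x -> c1_at g x.
Proof.
move=> E [cf df]; split; first exact: cont_near E cf.
by move=> c Lc h; have [A [B d]] := df c Lc h; exists A, B; exact: lwd_near E d.
Qed.

Lemma c1_cst (k : C) x : c1_at (fun=> k) x.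
Proof. exact/hol_c1/hol_at_cst. Qed.

Lemma c1M f g x : c1_at f x -> c1_at g x -> c1_at (fun y => f y * g y) x.
Proof.
move=> [cf df] [cg dg]; split=> [|c Lc h]; first exact: contM.
have [A [B d]] := df c Lc h; have [A' [B' d']] := dg c Lc h.
by eexists; eexists; exact: (sderM d d').
Qed.

Lemma c1D f g x : c1_at f x -> c1_at g x -> c1_at (fun y => f y + g y) x.
Proof.
move=> [cf df] [cg dg]; split=> [|c Lc h]; first exact: contD.
have [A [B d]] := df c Lc h; have [A' [B' d']] := dg c Lc h.
by eexists; eexists; exact: (sderD d d').
Qed.

Lemma c1_sum (I : Type) (r : seq I) (F : I -> X -> C) x :
  (forall i, c1_at (F i) x) -> c1_at (fun y => \sum_(i <- r) F i y) x.
Proof.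
move=> h; elim: r => [|i r IH].
  by apply: c1_near (c1_cst 0 x); apply: nearW => y; rewrite big_nil.
by apply: c1_near (c1D (h i) IH); apply: nearW => y; rewrite big_cons.
Qed.

Lemma c1_comp (u : C -> C) f x A B : c1_at f x -> sder u (f x) A B ->
  c1_at (fun y => u (f y)) x.
Proof.
move=> [cf df] d; split=> [|c Lc h]; first by apply: (cont_comp cf); exact: sder_cnm d.
have [A' [B' d']] := df c Lc h.
have d2 : sder u (f (pl c (tc c x) (zc c x))) A B by rewrite pl_id.
by eexists; eexists; exact: (sder_comp d' d2).
Qed.

Lemma c1_cont f x : c1_at f x -> forall e : R, 0 < e -> \forall y \near x, nm (f y - f x) < e.
Proof. by move=> [/contP]. Qed.

Lemma hol_at_limit f x V : open V -> V x ->
  (forall e : R, 0 < e -> exists2 g, hol_on L V g & forall y, V y -> nm (f y - g y) <= e) ->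
  hol_at L f x.
Proof.
move=> oV Vx h; have nV : nbhs x V by exact: open_nbhs_nbhs.
have [c Lc hc] := chart_ex L x; have nV' := near_plaque_at hc nV.
have [r r0 hr] := (nbhs_nm _ _).1 nV'.
have hb : holb (fun w => f (pl c (tc c x) w)) (zc c x) r.
  apply: holb_limit => e /h[g hg fg]; exists (fun w => g (pl c (tc c x) w)).
    exact: hol_on_holb hg Lc hr.
  by move=> w /hr[_ Vw]; exact: fg.
have x0 : nm (zc c x - zc c x) < r by rewrite subrr nm0.
apply: (hol_atI _ Lc hc (hol_sder hb x0)); apply/contP => e e0.
have e3 : 0 < e / 4 by flra.
have [g hg fg] := h _ e3; have [/contP cg _] := hg _ Vx.
apply: filterS2 (cg _ e3) nV => y h1 Vy.
rewrite (_ : f y - f x = (f y - g y) + (g y - g x) - (f x - g x)); last by ring.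
have := fg y Vy; have := fg x Vx.
have := nmB ((f y - g y) + (g y - g x)) (f x - g x); have := nmD (f y - g y) (g y - g x).
by flra.
Qed.

Lemma compact_cont_bounded (A : set X) f : compact [set: X] -> closed A ->
  (forall x, A x -> {for x, continuous f}) -> exists2 M : R, 0 < M & forall x, A x -> nm (f x) <= M.
Proof.
move=> cX cA cf; have cK : compact A by exact: subclosed_compact cA cX _.
have cu : compact ((fun x => nm (f x)) @` A).
  apply: continuous_compact => //; apply: continuous_in_subspaceT => x /set_mem Ax.
  apply: (cvgR (nbhs_filter x) _ _).2 => e e0; have /contP /(_ _ e0) := cf x Ax.
  by apply: filterS => y; apply: le_lt_trans; exact: nm_dist.
have [M [_ hM]] := compact_bounded cu.
exists (`|M| + 1); first by have := normr_ge0 M; flra.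
move=> x Ax; rewrite -[leLHS]ger0_norm ?nm_ge0//.
by apply: hM; [have := ler_norm M; flra|exists x].
Qed.

End LeafwiseC1.
(** * Solving the leafwise dbar equation by a Neumann series *)

Section Neumann.
Context {R : realType} {X : topologicalType} (L : lamination R X).
Local Notation C := (Cplx R).
Variables (K : finType) (ch : K -> chart R X) (a : K -> C) (r0 r1 r2 : K -> R).
Variables (S : forall k, set (ch_tr (ch k))) (U : K -> set X).
Variables (th eta : K -> X -> C) (Q A : K -> R).

Local Notation z k x := (zc (ch k) x).
Local Notation t k x := (tc (ch k) x).
Local Notation rad k x := (nm (zc (ch k) x - a k)).

Definition in_box k x := [/\ ch_dom (ch k) x, rad k x <= r2 k & S (t k x)].

(** Around the centre [a k] of a plaque, the core [rad <= r0] carries the partition of unity and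
    satisfies [nm th <= Q]; the cut-off varies only where [r1 < rad < r2], and there [nm th >= A].
    The gap [Q < A] produces the decay [(Q / A) ^ d]. Some [eta k] may be identically zero: such
    boxes carry data but no source. *)
Record box_axioms : Prop := BoxAxioms {
  bx_compact : compact [set: X];
  bx_L : forall k, L (ch k);
  bx_r01 : forall k, 0 <= r0 k <= r1 k;
  bx_r12 : forall k, r1 k < r2 k;
  bx_disc : forall k, nm (a k) + r2 k < 1;
  bx_open : forall k, open (U k);
  bx_dom : forall k, U k `<=` ch_dom (ch k);
  bx_boxU : forall k x, in_box k x -> U k x;
  bx_closed : forall k, closed [set x | in_box k x];
  bx_th0 : forall k x, th k x != 0;
  bx_thh : forall k l, hol_on L (U k `&` U l) (fun x => th k x / th l x);
  bx_thc : forall k x, U k x -> {for x, continuous (fun y => nm (th k y))};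
  bx_eta_supp : forall k x, eta k x != 0 -> in_box k x /\ rad k x <= r0 k;
  bx_eta_sum : forall x, \sum_k eta k x = 1;
  bx_eta_c1 : forall k x, c1_at L (eta k) x;
  bx_eta_le : forall k x, nm (eta k x) <= 1;
  bx_Q : forall k x, in_box k x -> rad k x <= r0 k -> nm (th k x) <= Q k;
  bx_A : forall k x, in_box k x -> r1 k <= rad k x -> A k <= nm (th k x);
  bx_QA : forall k, 0 < Q k < A k }.

Hypothesis H : box_axioms.

(** Radii at the thirds of the shell: the dbar of the cut-off is supported in a closed part of the
    open shell, which lets it be extended by zero. *)
Let s1 k := (2 * r1 k + r2 k) / 3.
Let s2 k := (r1 k + 2 * r2 k) / 3.

Let ss k : [/\ 0 <= s1 k, r1 k < s1 k, s1 k < s2 k & s2 k < r2 k].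
Proof.
have /andP[h0 h1] := bx_r01 H k; have h2 := bx_r12 H k.
by rewrite /s1 /s2; split; flra.
Qed.

Definition kap k x : C := cutoff (s1 k) (s2 k) (a k) (z k x).
Definition bk k x : C := cutoff_dbar (s1 k) (s2 k) (a k) (z k x).

Definition in_shell k x := in_box k x /\ r1 k < rad k x < r2 k.
Definition in_supp k x := in_box k x /\ s1 k <= rad k x <= s2 k.
Definition in_core k x := in_box k x /\ rad k x <= r0 k.

Lemma rad_cont k x : ch_dom (ch k) x -> {for x, continuous (fun y => rad k y)}.
Proof.
move=> h; apply: (cvgR (nbhs_filter x) _ _).2 => e e0.
have /contP /(_ _ e0) := zc_continuous h; apply: filterS => y hy.
rewrite (le_lt_trans (nm_dist _ _))//.
by rewrite (_ : z k y - a k - (z k x - a k) = z k y - z k x) //; ring.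
Qed.

Lemma closed_in_box k (lo hi : R) :
  closed [set x | in_box k x /\ lo <= rad k x <= hi].
Proof.
rewrite -[X in closed X]setCK closedC openE => x nx.
have [bx|nb] := pselect (in_box k x); last first.
  have oN : open (~` [set x | in_box k x]) by rewrite openC; exact: bx_closed.
  by apply: filterS (open_nbhs_nbhs (conj oN nb)) => y ny [].
have cx := rad_cont (bx_dom H (bx_boxU H bx)).
have {}nx : ~ (lo <= rad k x <= hi) by move=> h; apply: nx.
have [h|h] := ltP (rad k x) lo.
  have k0 : 0 < lo - rad k x by rewrite subr_gt0.
  have := (cvgR (nbhs_filter x) _ _).1 cx _ k0; apply: filterS => y.
  by rewrite ltr_norml => /andP[_ hy] [_ /andP[lo1 _]]; flra.
have {nx}h2 : hi < rad k x by rewrite ltNge; apply/negP => h'; apply: nx; rewrite h h'.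
have k0 : 0 < rad k x - hi by rewrite subr_gt0.
have := (cvgR (nbhs_filter x) _ _).1 cx _ k0; apply: filterS => y.
by rewrite ltr_norml => /andP[hy _] [_ /andP[_ lo1]]; flra.
Qed.

Lemma closed_supp k : closed [set x | in_supp k x].
Proof. exact: closed_in_box. Qed.

Lemma closed_core k : closed [set x | in_core k x].
Proof.
have := @closed_in_box k 0 (r0 k); rewrite (_ : [set x | _ /\ _] = [set x | in_core k x])//.
by apply/seteqP; split=> x /= [bx]; [move=> /andP[]|rewrite nm_ge0].
Qed.

Lemma near_notin (P : X -> Prop) x : closed [set x | P x] -> ~ P x -> \forall y \near x, ~ P y.
Proof.
move=> cP nP; have oP : open (~` [set x | P x]) by rewrite openC.
exact: (open_nbhs_nbhs (conj oP nP)).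
Qed.

Lemma supp_shell k x : in_supp k x -> in_shell k x.
Proof. by move=> [bx /andP[h1 h2]]; split=> //; have [_ ? _ ?] := ss k; flra. Qed.

Lemma core_nsupp k x : in_core k x -> kap k x = 1 /\ bk k x = 0.
Proof.
move=> [bx h]; have /andP[_ h1] := bx_r01 H k; have [h0 h2 h3 _] := ss k.
have hs : rad k x <= s1 k by flra.
by split; [exact: cutoff1|apply: cutoff_dbar0 => //; left].
Qed.

(** The dbar error made by cutting off [M k]. Only the values of [M k] over the shell matter. *)
Definition G (M : K -> X -> C) k x : C :=
  if `[< in_supp k x >] then bk k x * M k x else 0.

Section Degree.
Variable d : nat.

(** [M k] is a section in the unitary trivialisation: its norm is bounded by [m], while holomorphy
    is read after multiplication by [th k ^ d]. Vanishing off [S] makes the extension by zero across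
    the transversal boundary harmless. *)
Definition adm (M : K -> X -> C) (m : R) := forall k,
  [/\ forall x, ch_dom (ch k) x -> ~ S (t k x) -> M k x = 0,
      forall x, U k x -> r1 k < rad k x < r2 k -> hol_at L (fun y => M k y * th k y ^+ d) x &
      forall x, in_shell k x -> nm (M k x) <= m].

(** The share of the total error allotted to box [l], written in its frame and its chart; a
    coefficient of a form of type (0,1) transforms by the conjugate Jacobian. *)
Definition Phi M l x : C :=
  eta l x * \sum_k (G M k x * th l x ^+ d * cj (jac (ch l) (ch k) x)).

Lemma near_shell k x : U k x -> r1 k < rad k x < r2 k ->
  \forall y \near x, U k y /\ r1 k < rad k y < r2 k.
Proof.
move=> Ux /andP[h1 h2]; have cx := rad_cont (bx_dom H Ux).
have k0 : 0 < Num.min (rad k x - r1 k) (r2 k - rad k x) by rewrite lt_min !subr_gt0 h1.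
have nU : nbhs x (U k) by apply: open_nbhs_nbhs; split=> //; exact: bx_open.
apply: filterS2 ((cvgR (nbhs_filter x) _ _).1 cx _ k0) nU => y.
rewrite lt_min !ltr_norml => /andP[/andP[q1 _] /andP[_ q2]] Uy; split=> //.
by apply/andP; split; flra.
Qed.

Lemma G_near M m k x : adm M m -> U k x -> r1 k < rad k x < r2 k ->
  \forall y \near x, G M k y = bk k y * M k y.
Proof.
move=> /(_ k)[h1 _ _] Ux hx; apply: filterS (near_shell Ux hx) => y [Uy /andP[y1 y2]].
rewrite /G; case: asboolP => // ns; have hy := bx_dom H Uy.
have [Sy|/(h1 y hy) ->] := pselect (S (t k y)); last by rewrite mulr0.
have [q0 _ q1 _] := ss k.
rewrite /bk cutoff_dbar0 ?mul0r//.
have [l1|l1] := leP (s1 k) (rad k y); last by left; exact: ltW.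
have [l2|l2] := leP (rad k y) (s2 k); last by right; exact: ltW.
by exfalso; apply: ns; split; [split=> //; exact: ltW|rewrite l1].
Qed.

Lemma G_c1 M m k l x : adm M m -> U l x ->
  c1_at L (fun y => G M k y * th l y ^+ d * cj (jac (ch l) (ch k) y)) x.
Proof.
move=> hM Ulx; have [sx|nx] := pselect (in_supp k x); last first.
  apply: c1_near (c1_cst L 0 x); apply: filterS (near_notin (closed_supp (k := k)) nx) => y ny.
  by rewrite /G asboolF// !mul0r.
have [bx shx] := supp_shell sx; have Ukx := bx_boxU H bx.
have [_ hh _] := hM k; have hMk := hh x Ukx shx.
have [A' [B' db]] := cutoff_dbar_sder (a k) (let: And4 h _ _ _ := ss k in h) (let: And4 _ _ h _ := ss k in h) (z k x).
have c1b := c1_comp (hol_c1 (hol_zc (bx_L H k) (bx_dom H Ukx))) db.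
have hth := hol_atX d (bx_thh H (conj Ulx Ukx)).
have hj := jac_hol (bx_L H l) (bx_L H k) (conj (bx_dom H Ukx) (bx_dom H Ulx)).
have cj1 := c1_comp (hol_c1 hj) (sder_conj _).
apply: c1_near (c1M (c1M c1b (hol_c1 (hol_atM hMk hth))) cj1).
apply: filterS (G_near hM Ukx shx) => y ->.
congr (_ * _); rewrite expr_div_n /bk.
by have := expf_neq0 d (bx_th0 H k y) => n; field.
Qed.

Lemma Phi_c1 M m l x : adm M m -> U l x -> c1_at L (Phi M l) x.
Proof.
move=> hM Ulx; apply: c1M; first exact: (bx_eta_c1 H).
by apply: c1_sum => k; exact: G_c1 hM Ulx.
Qed.

Lemma Phi_supp M l x : Phi M l x != 0 -> in_core l x.
Proof.
move=> h; apply: (bx_eta_supp H); apply: contraNneq h => e0.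
by rewrite /Phi e0 mul0r.
Qed.

Lemma Phi_near0 M l x : ~ in_core l x -> \forall y \near x, Phi M l y = 0.
Proof.
move=> nx; apply: filterS (near_notin (closed_core (k := l)) nx) => y ny.
by apply/eqP; apply/negPn; apply/negP => /Phi_supp.
Qed.

(** The source on one plaque, extended by zero to the plane as the Cauchy transform requires. *)
Definition F M l (s : ch_tr (ch l)) (w : C) : C :=
  if nm w < 1 then Phi M l (pl (ch l) s w) else 0.

Lemma F_far M l (s : ch_tr (ch l)) w : r2 l < nm (w - a l) -> F M s w = 0.
Proof.
move=> h; rewrite /F; case: ifP => // w1; apply/eqP; apply/negPn; apply/negP => /Phi_supp[_].
rewrite zc_pl// => h'; have /andP[_ h1] := bx_r01 H l; have h2 := bx_r12 H l; flra.
Qed.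

Lemma F_out M l (s : ch_tr (ch l)) w : 1 <= nm w -> F M s w = 0.
Proof. by move=> h; rewrite /F ltNge h. Qed.

Lemma F_sder M m l (s : ch_tr (ch l)) w : adm M m -> exists A' B', sder (F M s) w A' B'.
Proof.
move=> hM; have [w1|w1] := ltP (nm w) 1; last first.
  exists 0, 0; apply: sder_near (sder_cst 0 w).
  have h : r2 l < nm (w - a l) by have := nm_split w (a l); have := bx_disc H l; flra.
  have k0 : 0 < nm (w - a l) - r2 l by rewrite subr_gt0.
  apply/nbhs_nm; exists (nm (w - a l) - r2 l) => // y hy; rewrite F_far//.
  by have := nm_tri w y (a l); rewrite (nmC w y); flra.
set x := pl (ch l) s w.
have E : \forall y \near w, Phi M l (pl (ch l) s y) = F M s y.
  by apply: filterS (near_disc w1) => y hy; rewrite /F hy.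
have [cx|nx] := pselect (in_core l x); last first.
  exists 0, 0; apply: sder_near (sder_cst 0 w).
  apply: filterS2 E (near_plaque w1 (Phi_near0 M nx)) => y <- [_ ->] //.
have [_ dP] := Phi_c1 hM (bx_boxU H cx.1).
have [A' [B']] := dP _ (bx_L H l) (pl_dom _ w1); rewrite /lwd tc_pl// zc_pl// => dP'.
by exists A', B'; exact: sder_near E dP'.
Qed.

Lemma F_cont M m l (s : ch_tr (ch l)) w (e : R) : adm M m -> nm w < 1 -> 0 < e ->
  \forall p \near (w, s), nm (F M p.2 p.1 - F M s w) < e.
Proof.
move=> hM w1 e0; set x := pl (ch l) s w.
have h : \forall y \near x, nm (Phi M l y - Phi M l x) < e.
  have [cx|nx] := pselect (in_core l x).
    exact: (c1_cont (Phi_c1 hM (bx_boxU H cx.1)) e0).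
  apply: filterS (Phi_near0 M nx) => y ->.
  by rewrite (nbhs_singleton (Phi_near0 M nx)) subrr nm0.
apply: filterS (near_inv w1 h) => -[w' s'] /= [hw' k].
by rewrite /F hw' w1.
Qed.

End Degree.

(** The bound does not involve the degree, so that a factor exponential in [d] can overcome it. *)
Lemma core_bound : exists2 B : R, 0 < B & forall k l x, in_core l x -> in_supp k x ->
  nm (bk k x * cj (jac (ch l) (ch k) x)) <= B.
Proof.
have h k l : exists B : R, 0 < B /\ forall x, in_core l x -> in_supp k x ->
    nm (bk k x * cj (jac (ch l) (ch k) x)) <= B.
  have [B1 B10 hB1] := cutoff_dbar_bounded (a k) (let: And4 h _ _ _ := ss k in h) (let: And4 _ _ h _ := ss k in h).
  have [||B2 B20 hB2] := @compact_cont_bounded R X ([set x | in_core l x] `&` [set x | in_supp k x]) (jac (ch l) (ch k)) (bx_compact H).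
  - by apply: closedI; [exact: closed_core|exact: closed_supp].
  - move=> x [[cx _] [sx _]].
    by have [] := jac_hol (bx_L H l) (bx_L H k) (conj (bx_dom H (bx_boxU H sx)) (bx_dom H (bx_boxU H cx))).
  exists (B1 * B2); split; first exact: mulr_gt0.
  by move=> x cx sx; rewrite nmM nm_cj ler_pM ?nm_ge0 ?hB1 ?hB2.
have /choice[B hB] kl := h (kl : K * K).1 kl.2.
exists (1 + \sum_kl B kl).
  by rewrite ltr_pwDl// sumr_ge0// => kl _; exact/ltW/(hB kl).1.
move=> k l x cx sx; apply: (le_trans ((hB (k, l)).2 x cx sx)).
rewrite (bigD1 (k, l))//= addrCA lerDl addr_ge0// sumr_ge0// => kl _.
exact/ltW/(hB kl).1.
Qed.

(** The factor [Q l ^ d] comes from [th l ^ d], because [eta l] lives in the core. *)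
Lemma Phi_close d B M M' m m' (dl : R) l x : 0 < B -> (forall k l x, in_core l x -> in_supp k x ->
    nm (bk k x * cj (jac (ch l) (ch k) x)) <= B) ->
  adm d M m -> adm d M' m' -> 0 <= dl ->
  (forall k x, in_shell k x -> nm (M k x - M' k x) <= dl) ->
  nm (Phi d M l x - Phi d M' l x) <= #|K|%:R * B * Q l ^+ d * dl.
Proof.
move=> B0 hB hM hM' dl0 hd; have /andP[Q0 _] := bx_QA H l.
have P0 : 0 <= #|K|%:R * B * Q l ^+ d * dl.
  by rewrite !mulr_ge0 ?ler0n ?exprn_ge0 ?(ltW B0) ?(ltW Q0).
have [e0|e0] := eqVneq (eta l x) 0; first by rewrite /Phi e0 !mul0r subrr nm0.
have cx := bx_eta_supp H e0.
rewrite /Phi -mulrBr nmM -sumrB (le_trans (ler_piMl (nm_ge0 _) (bx_eta_le H l x)))//.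
rewrite (le_trans (nm_sum _ _ _))//.
apply: (@le_trans _ _ (\sum_(k : K) B * Q l ^+ d * dl)); last first.
  by rewrite sumr_const -[leLHS]mulr_natl !mulrA.
apply: ler_sum => k _; rewrite /G; case: asboolP => sx; last first.
  by rewrite !mul0r subrr nm0 !mulr_ge0 ?exprn_ge0 ?(ltW B0) ?(ltW Q0).
rewrite (_ : _ - _ = (bk k x * cj (jac (ch l) (ch k) x)) * th l x ^+ d * (M k x - M' k x)); last by ring.
rewrite 2!nmM nmX ler_pM ?mulr_ge0 ?exprn_ge0 ?nm_ge0//; last exact/hd/supp_shell.
rewrite ler_pM ?exprn_ge0 ?nm_ge0//; first exact: hB.
rewrite lerXn2r ?nnegrE ?nm_ge0 ?(ltW Q0)//.
by case: cx => bx; exact: (bx_Q H).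
Qed.

Lemma Phi0 d l x : Phi d (fun _ _ => 0) l x = 0.
Proof.
rewrite /Phi big1 ?mulr0// => k _; rewrite /G mulr0.
by case: ifP => _; rewrite !mul0r.
Qed.

Lemma adm0 d : adm d (fun _ _ => 0) 0.
Proof.
move=> k; split; [by []|move=> x _ _|by move=> x _; rewrite nm0].
by apply: hol_at_near (hol_at_cst L 0 x); apply: nearW => y; rewrite mul0r.
Qed.

Section Solution.
Variables (d : nat) (B : R).
Hypothesis B0 : 0 < B.
Hypothesis hB : forall k l x, in_core l x -> in_supp k x ->
  nm (bk k x * cj (jac (ch l) (ch k) x)) <= B.

Let CB l := #|K|%:R * B * Q l ^+ d.

Let CB0 l : 0 <= CB l.
Proof. by have /andP[Q0 _] := bx_QA H l; rewrite /CB !mulr_ge0 ?ler0n ?exprn_ge0 ?(ltW B0) ?(ltW Q0). Qed.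

Lemma Phi_bound M m l x : adm d M m -> 0 <= m -> nm (Phi d M l x) <= CB l * m.
Proof.
move=> hM m0; have := @Phi_close d B M (fun _ _ => 0) m 0 m l x B0 hB hM (adm0 d) m0.
rewrite Phi0 subr0; apply=> k y sy; rewrite subr0.
by have [_ _ h] := hM k; exact: h.
Qed.

(** The dbar equation is solved plaque by plaque with an explicit kernel; no choice is made, hence
    the continuity from plaque to plaque. *)
Definition V M l x : C := ctransform (F d M (t l x)) (z l x).

Lemma F_bound M m l (s : ch_tr (ch l)) w : adm d M m -> 0 <= m -> nm (F d M s w) <= CB l * m.
Proof.
move=> hM m0; rewrite /F; case: ifP => _; first exact: Phi_bound.
by rewrite nm0 mulr_ge0.
Qed.

Lemma ct_sder M m l (s : ch_tr (ch l)) w : adm d M m -> 0 <= m -> nm w < 1 ->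
  exists a', sder (ctransform (F d M s)) w a' (F d M s w).
Proof.
move=> hM m0 w1; have /choice[A' hA] y : exists A', exists B', sder (F d M s) y A' B' by exact: F_sder hM.
have /choice[B' hAB] := hA.
have ab y : cnm A' y /\ cnm B' y.
  by apply: (@sder_coef_cnm _ (F d M s)); apply: (@filterE _ (nbhs y)); exact: hAB.
apply: (ctransform_dbar hAB _ _ (fun y => F_bound s y hM m0)) => //.
- by move=> y; have [] := ab y.
- by move=> y; have [] := ab y.
- by move=> y; exact: F_out.
Qed.

Lemma V_lwd M m l x : adm d M m -> 0 <= m -> ch_dom (ch l) x ->
  exists a', lwd (ch l) (V M l) x a' (Phi d M l x).
Proof.
move=> hM m0 hx; have [a' ha] := ct_sder (t l x) hM m0 (zc_lt hx).
exists a'; have -> : Phi d M l x = F d M (t l x) (z l x) by rewrite /F zc_lt// pl_id.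
apply: sder_near ha; apply: filterS (near_disc (zc_lt hx)) => w hw.
by rewrite /V (zc_pl _ hw) (tc_pl _ hw).
Qed.

(** The tube lemma makes the sources on neighbouring plaques uniformly close, and the Cauchy
    transform is bounded for the uniform norm. *)
Lemma V_cont M m l x : adm d M m -> 0 <= m -> ch_dom (ch l) x -> {for x, continuous (V M l)}.
Proof.
move=> hM m0 hx; apply/contP => e e0; have e1 : 0 < e / 36 by flra.
have ht : \forall s \near t l x, forall w, nm (w - a l) <= r2 l ->
    nm (F d M s w - F d M (t l x) w) <= e / 18.
  apply: (tube (P := fun w s => nm (F d M s w - F d M (t l x) w) <= e / 18)).
    exact: nm_ball_compact.
  move=> w hw; have w1 : nm w < 1 by have := nm_split w (a l); have := bx_disc H l; flra.
  have [r r00 hr] := near_prod_ball (F_cont (t l x) hM w1 e1).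
  have h0 := nbhs_singleton hr.
  exists ([set y | nm (y - w) < r], [set s | forall y, nm (y - w) < r -> nm (F d M s y - F d M (t l x) w) < e / 36]).
    by split; [exact: nbhs_nm_lt|exact: hr].
  move=> [y s] [/= hy hs]; have k1 := hs y hy; have k2 := h0 y hy; rewrite /= in k2.
  have := nm_tri (F d M s y) (F d M (t l x) w) (F d M (t l x) y).
  by rewrite (nmC (F d M (t l x) w)); flra.
have [a' ha] := ct_sder (t l x) hM m0 (zc_lt hx).
have e2 : 0 < e / 2 by flra.
have k' : 6 * (e / 18) <= e / 2 by flra.
have hz := cont_comp (zc_continuous hx) (sder_cnm ha).
have n1 := tc_continuous hx ht; have n2 := (contP _ _).1 hz _ e2.
have n1' : \forall y \near x, forall w, nm (w - a l) <= r2 l ->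
    nm (F d M (t l y) w - F d M (t l x) w) <= e / 18 by exact: n1.
apply: filterS2 n1' n2 => y h1 h2.
have k : nm (V M l y - ctransform (F d M (t l x)) (z l y)) <= 6 * (e / 18).
  apply: (ctransform_close _ (fun w => F_bound (t l y) w hM m0) (fun w => F_bound (t l x) w hM m0)) => w.
  have [hw|hw] := leP (nm (w - a l)) (r2 l); first exact: h1.
  by rewrite !F_far// subrr nm0; flra.
apply: (le_lt_trans (nm_tri _ (ctransform (F d M (t l x)) (z l y)) _)).
rewrite [ltRHS](splitr e); exact: ler_ltD (le_trans k k') h2.
Qed.

Lemma V_close M M' m m' (dl : R) l x : adm d M m -> adm d M' m' -> 0 <= m -> 0 <= m' ->
  0 <= dl -> (forall k x, in_shell k x -> nm (M k x - M' k x) <= dl) ->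
  nm (V M l x - V M' l x) <= 6 * (CB l * dl).
Proof.
move=> hM hM' m0 m0' dl0 h.
apply: (ctransform_close _ (fun w => F_bound (t l x) w hM m0) (fun w => F_bound (t l x) w hM' m0')) => w.
rewrite /F; case: ifP => _; first exact: (Phi_close _ _ B0 hB hM hM').
by rewrite subrr nm0 mulr_ge0.
Qed.

Lemma V_out M l x : ~ S (t l x) -> V M l x = 0.
Proof.
move=> nS; rewrite /V /ctransform (_ : mean _ = 0) ?mulr0//.
rewrite -[RHS](mean_cst (0 : C)); apply: mean_eq => s u _ _.
rewrite /F; case: ifP => w1; last by rewrite mul0r.
have [->|/Phi_supp[[_ _]]] := eqVneq (Phi d M l (pl (ch l) (t l x) (z l x - (3 * s)%:C * ee u))) 0; first by rewrite mul0r.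
by rewrite tc_pl.
Qed.

Lemma V_hol M m l x : adm d M m -> 0 <= m -> U l x -> r1 l < rad l x -> hol_at L (V M l) x.
Proof.
move=> hM m0 Ux h; have hx := bx_dom H Ux; have [a' ha] := V_lwd hM m0 hx.
apply: (hol_atI (V_cont hM m0 hx) (bx_L H l) hx (a := a')).
suff <- : Phi d M l x = 0 by exact: ha.
apply/eqP; apply/negPn; apply/negP => /Phi_supp[_].
by have /andP[_ h1] := bx_r01 H l; flra.
Qed.

(** The correction as a section in the unitary trivialisation. Over the shell, dividing by
    [th l ^ d] gains the factor [A l ^- d]. *)
Definition SS M l x : C := V M l x / th l x ^+ d.

(** The constant is twice the 6 of the Cauchy transform: under this hypothesis [SS] halves distances
    over the shells. It holds for large [d] because [Q < A]. *)
Hypothesis kappa : forall l, 12 * CB l <= A l ^+ d.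

Let A0 l : 0 < A l.
Proof. by have /andP[Q0 QA] := bx_QA H l; exact: lt_trans QA. Qed.

Lemma SS_close M M' m m' (dl : R) l x : adm d M m -> adm d M' m' -> 0 <= m -> 0 <= m' ->
  0 <= dl -> (forall k x, in_shell k x -> nm (M k x - M' k x) <= dl) -> in_shell l x ->
  nm (SS M l x - SS M' l x) <= dl / 2.
Proof.
move=> hM hM' m0 m0' dl0 h [bx /andP[sx _]].
rewrite /SS -mulrBl nmM nmV nmX.
have hA := bx_A H bx (ltW sx).
have T0 : 0 < nm (th l x) ^+ d by rewrite exprn_gt0// (lt_le_trans (A0 l)).
rewrite ler_pdivrMr//; apply: (le_trans (V_close l x hM hM' m0 m0' dl0 h)).
have kA : 12 * CB l <= nm (th l x) ^+ d.
  by rewrite (le_trans (kappa l))// lerXn2r ?nnegrE ?nm_ge0 ?(ltW (A0 l)).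
have := ler_wpM2l dl0 kA; lra.
Qed.

Lemma SS_adm M m : adm d M m -> 0 <= m -> adm d (SS M) (m / 2).
Proof.
move=> hM m0 l; split.
- by move=> x _ nS; rewrite /SS V_out// mul0r.
- move=> x Ux /andP[h1 _]; apply: hol_at_near (V_hol hM m0 Ux h1); apply: nearW => y.
  by rewrite /SS divfK// expf_neq0// (bx_th0 H).
move=> x sx; have := @SS_close M (fun _ _ => 0) m 0 m l x hM (adm0 d) m0 (lexx _) m0 _ sx.
have -> : SS (fun _ _ => 0) l x = 0.
  rewrite /SS /V /ctransform (_ : mean _ = 0) ?mulr0 ?mul0r//.
  rewrite -[RHS](mean_cst (0 : C)); apply: mean_eq => s u _ _.
  by rewrite /F; case: ifP => _; rewrite ?Phi0 mul0r.
by rewrite subr0; apply=> k y sy; rewrite subr0; have [_ _ h] := hM k; exact: h.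
Qed.

Lemma adm_sub M M' m m' : adm d M m -> adm d M' m' -> adm d (fun k x => M k x - M' k x) (m + m').
Proof.
move=> hM hM' k; have [a1 a2 a3] := hM k; have [b1 b2 b3] := hM' k; split.
- by move=> x hx nS; rewrite a1// b1// subrr.
- move=> x Ux hx; apply: hol_at_near (hol_atB (a2 x Ux hx) (b2 x Ux hx)).
  by apply: nearW => y; rewrite mulrBl.
by move=> x sx; rewrite (le_trans (nmB _ _))// lerD ?a3 ?b3.
Qed.

Lemma adm_le M m m' : m <= m' -> adm d M m -> adm d M m'.
Proof.
by move=> mm hM k; have [a1 a2 a3] := hM k; split=> // x /a3 h; exact: le_trans mm.
Qed.

Section FixedPoint.
Variables (P : K -> X -> C) (mP : R).
Hypotheses (mP0 : 0 <= mP) (hP : adm d P mP).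

Let Mn n : K -> X -> C := iter n (fun M k x => P k x - SS M k x) P.

Let Mn_adm n : adm d (Mn n) (2 * mP).
Proof.
have m2 : 0 <= 2 * mP by rewrite mulr_ge0.
elim: n => [|n IH] /=; first by apply: adm_le hP; lra.
by apply: adm_le (adm_sub hP (SS_adm IH m2)); lra.
Qed.

Let Mn_step n k x : in_shell k x -> nm (Mn n.+1 k x - Mn n k x) <= mP / 2 ^+ n.
Proof.
have m2 : 0 <= 2 * mP by rewrite mulr_ge0.
elim: n k x => [|n IH] k x sx.
  rewrite /= (_ : _ - _ = - SS P k x); last by ring.
  rewrite nmN expr0 divr1; have [_ _ h] := SS_adm hP mP0 k.
  by rewrite (le_trans (h x sx))//; lra.
have -> : Mn n.+2 k x - Mn n.+1 k x = - (SS (Mn n.+1) k x - SS (Mn n) k x).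
  have E i : Mn i.+1 k x = P k x - SS (Mn i) k x by [].
  have gen (p u v : C) : p - u - (p - v) = - (u - v) by ring.
  by rewrite (E n.+1) (E n) gen.
rewrite nmN exprS.
have := SS_close (Mn_adm n.+1) (Mn_adm n) m2 m2 _ IH sx.
rewrite (_ : mP / 2 ^+ n / 2 = mP / (2 * 2 ^+ n)); first by apply; rewrite divr_ge0 ?exprn_ge0.
by field; rewrite expf_neq0.
Qed.

Let Mn_far n j k x : in_shell k x -> nm (Mn (n + j)%N k x - Mn n k x) <= 2 * (mP / 2 ^+ n) - 2 * (mP / 2 ^+ (n + j)).
Proof.
move=> sx; elim: j => [|j IH]; first by rewrite addn0 !subrr nm0.
have := Mn_step (n + j)%N sx; rewrite -addnS => h.
have := nm_tri (Mn (n + j.+1)%N k x) (Mn (n + j)%N k x) (Mn n k x).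
have -> : mP / 2 ^+ (n + j.+1) = mP / 2 ^+ (n + j) / 2.
  by rewrite addnS exprS; field; rewrite expf_neq0.
by move: h IH; lra.
Qed.

(** A pointwise limit along [ultra_nat]. Its values are controlled over the shells only, which is
    the only place where [G] reads them. *)
Definition fixpt k x : C := lim ((fun n => Mn n k x) @ ultra_nat).

Let fix_close n k x : U k x -> r1 k < rad k x < r2 k -> nm (fixpt k x - Mn n k x) <= 2 * (mP / 2 ^+ n).
Proof.
move=> Ux hx; have [a1 _ a3] := Mn_adm n k; have dx := bx_dom H Ux.
have q0 i : 0 <= mP / 2 ^+ i by rewrite divr_ge0 ?exprn_ge0.
have [Sx|nS] := pselect (S (t k x)); last first.
  rewrite a1// subr0 /fixpt (_ : (fun n => Mn n k x) = fun=> 0).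
    rewrite (_ : lim _ = 0) ?nm0 ?mulr_ge0//.
    by apply/cvg_lim; [exact: norm_hausdorff|exact: cvg_cst].
  by apply/funext => i; have [b1 _ _] := Mn_adm i k; exact: b1.
have sx : in_shell k x by split=> //; split=> //; case/andP: hx => _ /ltW.
have cM : (fun i => Mn i k x) @ ultra_nat --> fixpt k x.
  have := @nm_ball_compact R 0 (2 * mP).
  rewrite compact_ultra => /(_ ((fun i => Mn i k x) @ ultra_nat) (fmap_ultra _ _))[].
    have : ultra_nat [set i | nm (Mn i k x - 0) <= 2 * mP].
      by apply: filterE => i /=; rewrite subr0; have [_ _ b3] := Mn_adm i k; exact: b3.
    by [].
  by move=> y [_ /cvgP].
apply/ler_addgt0Pl => e e0; have /cvgC /(_ _ e0) hn := cM.
have hk : \forall i \near ultra_nat, nm (Mn i k x - Mn n k x) <= 2 * (mP / 2 ^+ n).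
  apply: ultra_natP.2; exists n => // i /= ni.
  have := Mn_far n (i - n)%N sx; rewrite subnKC// => h.
  by rewrite (le_trans h)// gerBl mulr_ge0.
have [i [/= h1 h2]] := filter_ex (filterI hn hk).
have := nm_tri (fixpt k x) (Mn i k x) (Mn n k x); rewrite (nmC (fixpt k x) (Mn i k x)); lra.
Qed.

Let small e : 0 < e -> exists n, 2 * (mP / 2 ^+ n) <= e.
Proof.
move=> e0; have k0 : 0 < e / (2 * mP + 1) by rewrite divr_gt0// ltr_wpDl// mulr_ge0.
have [n hn] := pow2_small k0; exists n; have := hn n (leqnn _).
rewrite natrX ltr_pdivlMr ?ltr_wpDl ?mulr_ge0//; set i := (2 ^+ n)^-1 => h.
have i0 : 0 <= i by rewrite invr_ge0 exprn_ge0.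
by move: h; rewrite mulrDr mulr1; lra.
Qed.

Lemma fixpt_adm : adm d fixpt (2 * mP).
Proof.
move=> k; split.
- move=> x dx nS; rewrite /fixpt (_ : (fun n => Mn n k x) = fun=> 0).
    by apply/cvg_lim; [exact: norm_hausdorff|exact: cvg_cst].
  by apply/funext => i; have [b1 _ _] := Mn_adm i k; exact: b1.
- move=> x Ux hx.
  have Tn := (cvgR (nbhs_filter x) _ _).1 (bx_thc H Ux) _ ltr01.
  have : nbhs x [set y | `|nm (th k y) - nm (th k x)| < 1 /\ (U k y /\ r1 k < rad k y < r2 k)].
    by apply: filterS2 Tn (near_shell Ux hx) => y.
  rewrite nbhsE => -[W [oW Wx] WP].
  (* [T] bounds [th k ^ d] near [x], turning uniform convergence of the iterates into that of the
     holomorphic functions [Mn n k * th k ^ d]. *)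
  pose T := (nm (th k x) + 1) ^+ d.
  have T0 : 0 < T + 1 by rewrite ltr_wpDl// exprn_ge0// addr_ge0 ?nm_ge0.
  apply: (hol_at_limit oW Wx) => e e0; have [n hn] := small (divr_gt0 e0 T0).
  exists (fun y => Mn n k y * th k y ^+ d).
    by move=> y /WP[_ [Uy hy]]; have [_ b2 _] := Mn_adm n k; exact: b2.
  move=> y /WP[]; rewrite ltr_norml => /andP[_ ty] [Uy hy].
  rewrite -mulrBl nmM nmX.
  have h1 := le_trans (fix_close n Uy hy) hn.
  have h2 : nm (th k y) ^+ d <= T + 1.
    apply: (@le_trans _ _ T); last lra.
    by rewrite /T lerXn2r ?nnegrE ?addr_ge0 ?nm_ge0//; lra.
  apply: (le_trans (ler_pM (nm_ge0 _) _ h1 h2)); first by rewrite exprn_ge0 ?nm_ge0.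
  by rewrite divfK// gt_eqF.
move=> x [bx hx]; have Ux := bx_boxU H bx.
apply/ler_addgt0Pl => e e0; have [n hn] := small e0.
have [_ _ b3] := Mn_adm n k.
have := nm_split (fixpt k x) (Mn n k x); have := b3 x (conj bx hx); have := fix_close n Ux hx; lra.
Qed.

Lemma fixptE k x : in_shell k x -> fixpt k x = P k x - SS fixpt k x.
Proof.
move=> sx; apply/eqP; rewrite -subr_eq0 -nm_eq0 eq_le nm_ge0 andbT.
apply/ler_addgt0Pl => e e0; rewrite addr0; have e2 : 0 < e / 2 by lra.
have m2 : 0 <= 2 * mP by rewrite mulr_ge0.
have q0 i : 0 <= mP / 2 ^+ i by rewrite divr_ge0 ?exprn_ge0.
have [n hn] := small e2.
have h1 : nm (fixpt k x - Mn n.+1 k x) <= e / 2.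
  case: (sx) => bx hx; rewrite (le_trans (fix_close n.+1 (bx_boxU H bx) hx))//.
  rewrite (le_trans _ hn)// ler_wpM2l// (_ : mP / 2 ^+ n.+1 = mP / 2 ^+ n / 2).
    by rewrite ler_pdivrMr// ler_peMr// ler1n.
  by rewrite exprS; field; rewrite expf_neq0.
have cl k' x' : in_shell k' x' -> nm (fixpt k' x' - Mn n k' x') <= 2 * (mP / 2 ^+ n).
  by move=> [bx hx]; exact: fix_close (bx_boxU H bx) hx.
have h2 := SS_close fixpt_adm (Mn_adm n) m2 m2 (mulr_ge0 _ (q0 n)) cl sx.
have {}h2 := h2 (ler0n _ _).
have E : Mn n.+1 k x = P k x - SS (Mn n) k x by [].
have gen (f p u v : C) : f - (p - u) = f - (p - v) + (u - v) by ring.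
rewrite (gen _ _ _ (SS (Mn n) k x)) -E.
by rewrite (le_trans (nmD _ _))//; move: h1 h2 hn; lra.
Qed.

Hypothesis hPU : forall k x, U k x -> hol_at L (fun y => P k y * th k y ^+ d) x.

(** The cut-off is truncated abruptly at the transversal boundary of the box; its product with
    [approx] stays regular because [approx] vanishes off [S]. *)
Definition kapN k x : C := if `[< in_box k x >] then kap k x else 0.
Definition approx k x : C := P k x - SS fixpt k x.
Definition glued x : C := \sum_k kapN k x * approx k x.

Let m2 : 0 <= 2 * mP. Proof. by rewrite mulr_ge0. Qed.

Lemma approx_out k x : ch_dom (ch k) x -> ~ S (t k x) -> approx k x = 0.
Proof. by move=> dx nS; have [h _ _] := hP k; rewrite /approx h// /SS V_out// mul0r subrr. Qed.

Lemma approx_th k x : approx k x * th k x ^+ d = P k x * th k x ^+ d - V fixpt k x.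
Proof. by rewrite /approx mulrBl /SS divfK// expf_neq0// (bx_th0 H). Qed.

Lemma kapN_near k x : ~ (in_box k x /\ 0 <= rad k x <= s2 k) -> \forall y \near x, kapN k y = 0.
Proof.
move=> /(near_notin (closed_in_box (k := k) (lo := 0) (hi := s2 k))); apply: filterS => y ny.
rewrite /kapN; case: asboolP => // bx; have [q0 q1 q2 q3] := ss k.
rewrite /kap cutoff0//; rewrite leNgt; apply/negP => h; apply: ny.
by split=> //; rewrite nm_ge0 ltW.
Qed.

Lemma kapN_approx k x : in_box k x -> rad k x <= s2 k ->
  \forall y \near x, U k y /\ kapN k y * approx k y = kap k y * approx k y.
Proof.
move=> bx hs; have Ux := bx_boxU H bx; have dx := bx_dom H Ux; have [_ _ _ q] := ss k.
have k0 : 0 < r2 k - rad k x by rewrite subr_gt0; lra.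
have nU : nbhs x (U k) by apply: open_nbhs_nbhs; split=> //; exact: bx_open.
apply: filterS2 ((cvgR (nbhs_filter x) _ _).1 (rad_cont dx) _ k0) nU => y.
rewrite ltr_norml => /andP[_ hy] Uy; split=> //; rewrite /kapN; case: asboolP => // nb.
rewrite approx_out ?mulr0//; first exact: (bx_dom H).
by move=> Sy; apply: nb; split=> //; [exact: (bx_dom H)|lra].
Qed.

(** The dbar of the term [k] is [G k] minus its share [eta k] of the sum of all [G j]; summed over
    [k], these cancel since the [eta k] add up to 1. The first part is the dbar of the cut-off, the
    second that of the correction [V]. *)
Lemma glued_term V' theta c x k : open V' -> L c -> ch_dom c x -> V' x ->
  (forall k, hol_on L (V' `&` U k) (fun y => theta y / th k y)) ->
  {for x, continuous (fun y => kapN k y * approx k y * theta y ^+ d)} /\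
  exists a', lwd c (fun y => kapN k y * approx k y * theta y ^+ d) x a'
    (theta x ^+ d * (G fixpt k x * cj (jac c (ch k) x)) -
     theta x ^+ d * (eta k x * \sum_j G fixpt j x * cj (jac c (ch j) x))).
Proof.
move=> oV Lc dc Vx hth; have [q0 q1 q2 q3] := ss k.
have [[bx /andP[_ hs]]|nb] := pselect (in_box k x /\ 0 <= rad k x <= s2 k); last first.
  have E : \forall y \near x, 0 = kapN k y * approx k y * theta y ^+ d.
    by apply: filterS (kapN_near nb) => y ->; rewrite !mul0r.
  split; first exact: cont_near E (@cst_continuous _ _ (0 : C) x).
  exists 0; rewrite (_ : _ - _ = 0); first exact: lwd_near E (sder_cst 0 _).
  rewrite /G asboolF ?mul0r ?mulr0 ?sub0r; last first.
    by move=> [bx /andP[_ h]]; apply: nb; split=> //; rewrite nm_ge0.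
  have [->|e0] := eqVneq (eta k x) 0; first by rewrite mul0r mulr0 oppr0.
  have [bx h] := bx_eta_supp H e0; case: nb; split=> //; rewrite nm_ge0.
  by have /andP[_ h1] := bx_r01 H k; lra.
have Ux := bx_boxU H bx; have dx := bx_dom H Ux; have hM := fixpt_adm.
have E : \forall y \near x, kap k y * (P k y * th k y ^+ d - V fixpt k y) * (theta y / th k y) ^+ d
    = kapN k y * approx k y * theta y ^+ d.
  apply: filterS (kapN_approx bx hs) => y [_ ->]; rewrite -approx_th expr_div_n.
  by have := expf_neq0 d (bx_th0 H k y) => n; field.
have [cp dp] := hPU Ux; have [ct dt] := hol_atX d (hth k x (conj Vx Ux)).
have [a1 h1] := dp _ (bx_L H k) dx; have [a2 h2] := V_lwd hM m2 dx.
have [a3 h3] := dt _ (bx_L H k) dx.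
have [a4 h4] := @cutoff_sder _ (s1 k) (s2 k) (a k) q0 q2 (z k x).
have h5 : lwd (ch k) (kap k) x a4 (bk k x) := lwd_zc_comp dx h4.
have h7 := lwdM dx (lwdM dx h5 (lwdB h1 h2)) h3.
have h8 := lwd_near dc E (lwd_change Lc (bx_L H k) dc dx h7).
split.
  apply: cont_near E _; apply: contM ct; apply: contM.
    by apply: (cont_comp (zc_continuous dx)); exact: sder_cnm h4.
  exact: contB cp (V_cont hM m2 dx).
eexists; apply: sder_eq h8 (erefl _) _.
rewrite mulr0 sub0r addr0 -approx_th expr_div_n.
have t0 := expf_neq0 d (bx_th0 H k x).
(* On the support of the dbar of the cut-off, the fixed point equation identifies [approx] with the
   unknown inside [G]. *)
have -> : bk k x * (approx k x * th k x ^+ d) = G fixpt k x * th k x ^+ d.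
  rewrite mulrA; congr (_ * _); rewrite /G; case: asboolP => sx.
    by rewrite [in RHS]fixptE//; exact: supp_shell.
  by rewrite /bk cutoff_dbar0 ?mul0r//; left; rewrite leNgt; apply/negP => h; apply: sx; split=> //; rewrite (ltW h).
(* Where [eta k] is nonzero the cut-off equals 1, so the source of [V] enters in full; the cocycle
   relation for Jacobians brings it to the chart [c]. *)
have E2 : kap k x * - Phi d fixpt k x * (theta x ^+ d / th k x ^+ d) * cj (jac c (ch k) x)
    = - (theta x ^+ d * (eta k x * \sum_j G fixpt j x * cj (jac c (ch j) x))).
  have [e0|e0] := eqVneq (eta k x) 0; first by rewrite /Phi e0 !mul0r oppr0 !mulr0 !mul0r oppr0.
  have cx := bx_eta_supp H e0; have [k1 _] := core_nsupp cx; rewrite k1 mul1r /Phi.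
  have -> : \sum_j G fixpt j x * cj (jac c (ch j) x) =
      (\sum_j (G fixpt j x * th k x ^+ d * cj (jac (ch k) (ch j) x))) / th k x ^+ d * cj (jac c (ch k) x).
    rewrite !mulr_suml; apply: eq_bigr => j _.
    rewrite /G; case: asboolP => sx; last by rewrite !mul0r.
    rewrite (jac_comp Lc (bx_L H k) (bx_L H j) dc dx (bx_dom H (bx_boxU H sx.1))) cjM; field.
    exact: t0.
  ring.
rewrite mulrDl mulrDl E2; congr (_ + _); by field.
Qed.

Lemma glued_hol V' theta x : open V' -> V' x ->
  (forall k, hol_on L (V' `&` U k) (fun y => theta y / th k y)) ->
  hol_at L (fun y => glued y * theta y ^+ d) x.
Proof.
move=> oV Vx hth; have [c Lc dc] := chart_ex L x.
have h k := glued_term k oV Lc dc Vx hth.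
have E y : glued y * theta y ^+ d = \sum_k kapN k y * approx k y * theta y ^+ d by rewrite mulr_suml.
have /choice[a' ha] k := (h k).2.
have hs := sder_sum (index_enum K) (F := fun k w => (fun y => kapN k y * approx k y * theta y ^+ d) (pl c (tc c x) w))
   (A := fun k _ => a' k) (B := fun k _ => theta x ^+ d * (G fixpt k x * cj (jac c (ch k) x)) -
     theta x ^+ d * (eta k x * \sum_j G fixpt j x * cj (jac c (ch j) x))) ha.
apply: (hol_atI (a := \sum_k a' k) _ Lc dc); last first.
  apply: sder_ext (sder_eq hs (erefl _) _) => [w|]; first by rewrite E.
  rewrite sumrB -!mulr_sumr -mulr_suml (bx_eta_sum H) mul1r subrr//.
have cs (r : seq K) : {for x, continuous (fun y => \sum_(k <- r) kapN k y * approx k y * theta y ^+ d)}.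
  elim: r => [|k r IH].
    by apply: cont_near (@cst_continuous _ _ (0 : C) x); apply: nearW => y; rewrite big_nil.
  by apply: cont_near (contD (h k).1 IH); apply: nearW => y; rewrite big_cons.
by apply: cont_near (cs _); apply: nearW => y; rewrite E.
Qed.

(** A box with [eta k = 0] has no source, so its correction is zero. On the others [th] is at most
    [QQ] on the core and at least [QQ^-1] on the box, which costs [(QQ ^ 2) ^ d]. *)
Lemma glued_close (QQ : R) x : 0 < QQ ->
  (forall k, eta k = (fun=> 0) \/ Q k <= QQ /\ forall y, in_box k y -> QQ^-1 <= nm (th k y)) ->
  nm (glued x - \sum_k kapN k x * P k x) <= #|K|%:R * (12 * (#|K|%:R * B) * mP * (QQ ^+ 2) ^+ d).
Proof.
move=> QQ0 hQ; rewrite /glued -sumrB (le_trans (nm_sum _ _ _))//.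
have c0 : 0 <= 12 * (#|K|%:R * B) * mP * (QQ ^+ 2) ^+ d.
  by rewrite !mulr_ge0 ?exprn_ge0 ?(ltW B0) ?(ltW QQ0).
rewrite [leRHS]mulr_natl -sumr_const.
apply: ler_sum => k _; rewrite -mulrBr /approx addrAC subrr sub0r nmM.
rewrite nmN /kapN; case: asboolP => bx; last by rewrite nm0 mul0r.
rewrite (le_trans (ler_piMl (nm_ge0 _) _))//.
  by have [q0 q1 q2 q3] := ss k; exact: cutoff_le1.
have hM := fixpt_adm.
have [e0|[Qk hth]] := hQ k.
  suff -> : SS fixpt k x = 0 by rewrite nm0.
  rewrite /SS /V /ctransform (_ : mean _ = 0) ?mulr0 ?mul0r//.
  rewrite -[RHS](mean_cst (0 : C)); apply: mean_eq => s u _ _.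
  by rewrite /F /Phi e0; case: ifP => _; rewrite !mul0r.
have hV : nm (V fixpt k x) <= 6 * (CB k * (2 * mP)).
  apply: ctransform_le => w; exact: F_bound hM m2.
have /andP[Qk0 _] := bx_QA H k.
have t0 : 0 < nm (th k x) by rewrite nm_gt0 (bx_th0 H).
rewrite /SS nmM nmV nmX ler_pdivrMr ?exprn_gt0//.
apply: (le_trans hV); rewrite /CB.
have h1 : Q k ^+ d <= (QQ ^+ 2) ^+ d * nm (th k x) ^+ d.
  rewrite -exprMn lerXn2r ?nnegrE ?mulr_ge0 ?exprn_ge0 ?nm_ge0 ?(ltW QQ0) ?(ltW Qk0)//.
  apply: (le_trans Qk); have := hth x bx; rewrite -(ler_pM2l QQ0) divff ?gt_eqF// => h.
  by rewrite expr2 -mulrA ler_peMr// ltW.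
have w0 : 0 <= 12 * (#|K|%:R * B) * mP by rewrite !mulr_ge0 ?(ltW B0).
have := ler_wpM2l w0 h1; rewrite !mulrA; lra.
Qed.

End FixedPoint.

End Solution.

End Neumann.
(** * Sections with prescribed local behaviour *)

Section Compactness.
Context {R : realType}.

Lemma compact_pos (T : topologicalType) (K : set T) (f : T -> R) : compact K ->
  (forall x e, K x -> 0 < e -> \forall y \near x, `|f y - f x| < e) -> (forall x, K x -> 0 < f x) ->
  exists2 m : R, 0 < m & forall x, K x -> m <= f x.
Proof.
move=> /compact_near_coveringP cK cf f0.
have h : \forall m \near (0 : R)^'+, forall x, K x -> m <= f x.
  apply: cK => x Kx; have f2 : 0 < f x / 2 by rewrite divr_gt0// f0.
  exists ([set y | `|f y - f x| < f x / 2], [set m : R | m < f x / 2]) => /=.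
    by split; [exact: cf|exact: nbhs_right_lt].
  by move=> [y m] /= [/ltr_normlP[h1 h2] h3]; flra.
have [m [m0 hm]] := filter_ex (filterI (nbhs_right_gt (0 : R)) h).
by exists m.
Qed.

(** The filter fed to the covering form of compactness consists of the lists that contain a given
    one. *)
Lemma finite_cover (T : topologicalType) (A : set T) (O : T -> set T) : compact A ->
  (forall x, A x -> nbhs x (O x)) ->
  exists s : seq T, forall y, A y -> exists x, [/\ x \in s, A x & O x y].
Proof.
move=> /compact_near_coveringP cA hO.
pose F : set_system (seq T) := fun Q => exists s0 : seq T, forall s : seq T, {subset s0 <= s} -> Q s.
have FF : Filter F.
  split; first by exists [::].
  - move=> P Q [s hs] [s' hs']; exists (s ++ s') => u hu; split.
      by apply: hs => x xs; apply: hu; rewrite mem_cat xs.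
    by apply: hs' => x xs; apply: hu; rewrite mem_cat xs orbT.
  - by move=> P Q PQ [s hs]; exists s => u /hs /PQ.
have [|s hs] := cA _ F (fun s y => exists x, [/\ x \in s, A x & O x y]) FF.
  move=> x Ax; exists (O x, [set s : seq T | x \in s]) => /=.
    by split; [exact: hO|exists [:: x] => s; apply; rewrite inE].
  by move=> [y s] /= [Oy xs]; exists x.
by exists s; exact: (hs s).
Qed.

End Compactness.

(** * Cut-off functions on transversals *)

Section Transversals.
Context {R : realType} {X : topologicalType} (L : lamination R X).
Local Notation C := (Cplx R).
Hypotheses (cX : compact [set: X]) (hX : hausdorff_space X).

Lemma urysohn_at x (O : set X) : nbhs x O -> exists g : X -> R,
  [/\ continuous g, g x = 1, forall y, g y <= 1 & forall y, ~ O y -> g y = 0].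
Proof.
rewrite nbhsE => -[W [oW Wx] WO].
have cl1 : closed [set x] by exact: (accessible_closed_set1 (hausdorff_accessible hX)).
have cl2 : closed (~` W) by rewrite closedC.
have d0 : ~` W `&` [set x] = set0 by apply/seteqP; split=> // y [/= nW Ey]; apply: nW; rewrite Ey.
have [g [cg g1 g0 gr]] := urysohn_ext_itv (compact_normal hX cX) cl2 cl1 d0 (@ltr01 R).
exists g; split=> //; first by apply: g0; exists x.
  by move=> y; have := gr (g y) (ex_intro2 _ _ y I erefl); rewrite /= in_itv => /andP[].
by move=> y nO; apply: g1; exists y => // Wy; apply: nO; exact: WO.
Qed.

Lemma pl_cont (c : chart R X) t w : nm w < 1 ->
  {for (w, t), continuous (fun p : C * ch_tr c => pl c p.2 p.1)}.
Proof. by move=> hw P hP; apply: filterS (near_inv hw hP) => p []. Qed.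

Lemma closed_box (c : chart R X) (a : C) (r : R) (S : set (ch_tr c)) : nm a + r < 1 -> compact S ->
  closed [set x | [/\ ch_dom c x, nm (zc c x - a) <= r & S (tc c x)]].
Proof.
move=> ar cS; apply: compact_closed => //.
have hw w : nm (w - a) <= r -> nm w < 1 by have := nm_split w a; flra.
rewrite (_ : [set x | _] = (fun p : C * ch_tr c => pl c p.2 p.1) @` ([set w : C | nm (w - a) <= r] `*` S)).
  apply: continuous_compact; last by apply: compact_setX => //; exact: nm_ball_compact.
  apply: continuous_in_subspaceT => -[w t] /set_mem[/= h _]; apply: pl_cont; exact: hw.
apply/seteqP; split=> [x [dx rx Sx]|_ [[w t] [/= h St] <-]].
  by exists (zc c x, tc c x) => //=; exact: pl_id.
have w1 := hw w h; split; rewrite ?zc_pl ?tc_pl//; exact: pl_dom.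
Qed.

(** A transversal has no separation properties of its own. A Urysohn function [g] of the compact
    space [X] is restricted to the slice where the leaf coordinate equals that of [x]; [S] is
    compact as the image of the closed part [N] of [X]. *)
Lemma tr_bump (c : chart R X) x (W : set (ch_tr c)) : ch_dom c x -> nbhs (tc c x) W ->
  exists (tau : ch_tr c -> R) (S : set (ch_tr c)),
    [/\ continuous tau, tau (tc c x) = 1, forall t, 0 <= tau t <= 1, compact S &
        S `<=` W /\ forall t, tau t != 0 -> S t].
Proof.
move=> dx nW; pose a := zc c x; have a1 : nm a < 1 by exact: zc_lt.
have nO : nbhs x [set y | ch_dom c y /\ W (tc c y)].
  by apply: filterS2 (near_dom dx) (tc_continuous dx nW).
have [g [cg g1 gle g0]] := urysohn_at nO.
have gW y : 1 / 2 <= g y -> ch_dom c y /\ W (tc c y).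
  by move=> h; apply: contrapT => /g0 g00; move: h; rewrite g00; flra.
pose S : set (ch_tr c) := [set t | 1 / 2 <= g (pl c t a)].
pose N := [set y | 1 / 2 <= g y /\ zc c y = a].
have cN : closed N.
  rewrite -[N]setCK closedC openE => y nN.
  have [hy|hy] := ltP (g y) (1 / 2).
    have k0 : 0 < 1 / 2 - g y by rewrite subr_gt0.
    have := (cvgR (nbhs_filter y) _ _).1 (cg y) _ k0; apply: filterS => u.
    by move=> /ltr_normlP[h1 h2] [h3 _]; flra.
  have [dy _] := gW y hy; have ya : 0 < nm (zc c y - a).
    by rewrite nm_gt0 subr_eq0; apply/eqP => E; apply: nN.
  have /contP /(_ _ ya) := zc_continuous dy; apply: filterS => u hu [_ ua].
  by move: hu; rewrite ua nmC ltxx.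
(* Rescaling [g] by [2 g - 1] makes the function vanish as soon as [g <= 1 / 2], hence off [S]. *)
exists (fun t => Num.max 0 (2 * g (pl c t a) - 1)), S; split.
- move=> t; apply: (cvgR (nbhs_filter t) _ _).2 => e e0; have e2 : 0 < e / 2 by flra.
  have ca : {for t, continuous (fun s => pl c s a)}.
    by move=> P hP; have /near_prod_ball[r r0] := near_inv a1 hP;
       apply: filterS => s /(_ a); rewrite subrr nm0 => /(_ r0)[].
  have := ca _ ((cvgR (nbhs_filter _) _ _).1 (cg (pl c t a)) _ e2).
  move=> h; have {}h : \forall s \near t, `|g (pl c s a) - g (pl c t a)| < e / 2 by exact: h.
  apply: filterS h => s /ltr_normlP[h1 h2].
  have lip (u v : R) : `|Num.max 0 u - Num.max 0 v| <= `|u - v|.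
    rewrite /Num.max; have := ler_normr; case: (ltP 0 u) => hu; case: (ltP 0 v) => hv _ //.
    - by rewrite subr0 gtr0_norm// (le_trans _ (ler_norm _))//; flra.
    - by rewrite distrC subr0 gtr0_norm// distrC (le_trans _ (ler_norm _))//; flra.
    - by rewrite subrr normr0.
  apply: (le_lt_trans (lip _ _)).
  by apply/ltr_normlP; split; flra.
- by rewrite pl_id// g1 mulr1 /Num.max (_ : 0 < 2 - 1 = true); flra.
- by move=> t; rewrite le_max lexx ge_max ler01 /=; have := gle (pl c t a); flra.
- rewrite (_ : S = tc c @` N).
    apply: continuous_compact; last exact: subclosed_compact cN cX _.
    apply: continuous_in_subspaceT => y /set_mem[hy _]; apply: tc_continuous; exact: (gW y hy).1.
  apply/seteqP; split=> [t St|_ [y [hy za] <-]].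
    by exists (pl c t a); [split=> //; exact: zc_pl|exact: tc_pl].
  by rewrite /S /= -za pl_id//; exact: (gW y hy).1.
split=> t.
  by move=> /gW[_]; rewrite tc_pl.
rewrite /S /= /Num.max; case: (ltP 0 (2 * g (pl c t a) - 1)); [flra|by rewrite eqxx].
Qed.

End Transversals.

(** * Positive line bundles described by frames, and peak boxes *)

Section Frames.
Context {R : realType} {X : topologicalType} (L : lamination R X).
Local Notation C := (Cplx R).
Variable fr : set X -> (X -> C) -> Prop.

(* A hermitian line bundle on X, described by its local holomorphic frames: [fr V th]
   says that th is, in a discontinuous unitary trivialisation, a holomorphic frame of
   the dual bundle over V; [fx_peak] is the positivity of the curvature. *)
Record frame_axioms : Prop := FrameAxioms {
  fx_compact : compact [set: X];
  fx_haus : hausdorff_space X;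
  fx_open : forall V th, fr V th -> open V;
  fx_th0 : forall V th x, fr V th -> th x != 0;
  fx_cont : forall V th x, fr V th -> V x -> {for x, continuous (fun y => nm (th y))};
  fx_hol : forall V V' th th', fr V th -> fr V' th' ->
    hol_on L (V `&` V') (fun y => th y / th' y);
  fx_peak : forall x, exists c V th (r : R), [/\ L c /\ ch_dom c x, fr V th, 0 < r, nm (th x) = 1 &
    forall w, nm (w - zc c x) <= r -> [/\ nm w < 1, V (pl c (tc c x) w) &
      w != zc c x -> 1 < nm (th (pl c (tc c x) w))]] }.

Record box := Box {
  b_ch : chart R X; b_a : C; b_r0 : R; b_r1 : R; b_r2 : R; b_S : set (ch_tr b_ch);
  b_V : set X; b_th : X -> C; b_Q : R; b_A : R }.

Arguments b_S : clear implicits.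

Definition inb b x :=
  [/\ ch_dom (b_ch b) x, nm (zc (b_ch b) x - b_a b) <= b_r2 b & b_S b (tc (b_ch b) x)].

Record box_ok b : Prop := BoxOk {
  bo_L : L (b_ch b);
  bo_r01 : 0 <= b_r0 b <= b_r1 b;
  bo_r12 : b_r1 b < b_r2 b;
  bo_disc : nm (b_a b) + b_r2 b < 1;
  bo_fr : fr (b_V b) (b_th b);
  bo_V : forall x, inb b x -> b_V b x;
  bo_closed : closed [set x | inb b x];
  bo_Q : forall x, inb b x -> nm (zc (b_ch b) x - b_a b) <= b_r0 b -> nm (b_th b x) <= b_Q b;
  bo_A : forall x, inb b x -> b_r1 b <= nm (zc (b_ch b) x - b_a b) -> b_A b <= nm (b_th b x);
  bo_QA : 0 < b_Q b < b_A b }.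

(** Sections of the power [d] in the unitary trivialisation: [nm (s x)] is the norm, and pairing
    with the power of a dual frame gives a genuine function. *)
Definition is_section d (s : X -> C) :=
  forall V th, fr V th -> hol_on L V (fun x => s x * th x ^+ d).

Hypothesis H : frame_axioms.

Lemma plaque_theta V th (c : chart R X) t w (e : R) : fr V th -> nm w < 1 -> V (pl c t w) -> 0 < e ->
  \forall p \near (w, t), V (pl c p.2 p.1) /\ `|nm (th (pl c p.2 p.1)) - nm (th (pl c t w))| < e.
Proof.
move=> hf w1 Vw e0.
have h : \forall y \near pl c t w, V y /\ `|nm (th y) - nm (th (pl c t w))| < e.
  apply: filterI; first by apply: open_nbhs_nbhs; split=> //; exact: fx_open hf.
  exact: ((cvgR (nbhs_filter _) _ _).1 (fx_cont H hf Vw) _ e0).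
by apply: filterS (near_inv w1 h) => p [].
Qed.

(** On the plaque of [x] the frame has modulus 1 at [x] and more elsewhere, with a gap [m] on an
    annulus by compactness. The tube lemma carries these inequalities to neighbouring plaques, over
    a compact [S] given by [tr_bump]. *)
Lemma peak_box (QQ r : R) x (O : set X) : 1 < QQ -> 0 < r -> nbhs x O ->
  exists b (w : X -> C), [/\ box_ok b, b_Q b <= QQ /\ b_r2 b <= r,
    forall y, inb b y -> QQ^-1 <= nm (b_th b y) /\ O y,
    [/\ forall y, c1_at L w y, forall y, w y = (Re (w y))%:C /\ 0 <= Re (w y) &
      forall y, w y != 0 -> inb b y /\ nm (zc (b_ch b) y - b_a b) <= b_r0 b] &
    [/\ 0 < Re (w x), b_a b = zc (b_ch b) x, ch_dom (b_ch b) x /\ b_S b (tc (b_ch b) x), 0 < b_r0 b &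
       exists2 tau : ch_tr (b_ch b) -> R, [/\ continuous tau, tau (tc (b_ch b) x) = 1 & compact (b_S b)] &
       forall t, [/\ 0 <= tau t <= 1 & tau t != 0 -> b_S b t]]].
Proof.
move=> Q1 r_gt0 nO; have [c [V [th [r' [[Lc dx] hf r'0 th1 hr]]]]] := fx_peak H x.
pose a := zc c x; pose t0 := tc c x; have a1 : nm a < 1 by exact: zc_lt.
have [rO rO0 hO] : exists2 rO : R, 0 < rO & forall w, nm (w - a) <= rO -> nm w < 1 /\ nbhs (pl c t0 w) O.
  have nO' : nbhs x O^° by exact: nbhs_interior.
  have /nbhs_nm[e e0 he] := near_plaque_at dx nO'; exists (e / 2); first by flra.
  by move=> w hw; apply: he; flra.
have [r2 r20 [r2r r2r' r2O ar2]] : exists2 r2 : R, 0 < r2 & [/\ r2 <= r, r2 <= r', r2 <= rO & nm a + r2 < 1].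
  exists (Num.min (Num.min r r') (Num.min rO ((1 - nm a) / 2))).
    by rewrite !lt_min r_gt0 r'0 rO0 divr_gt0// subr_gt0.
  have h : Num.min (Num.min r r') (Num.min rO ((1 - nm a) / 2)) <= (1 - nm a) / 2 by rewrite !ge_min lexx !orbT.
  by split; rewrite ?ge_min ?lexx ?orbT//; flra.
have cT w (e : R) : nm (w - a) <= r2 -> 0 < e -> \forall u \near w, `|nm (th (pl c t0 u)) - nm (th (pl c t0 w))| < e.
  move=> hw e0; have [|w1 Vw _] := hr w; first exact: le_trans r2r'.
  have [d d0 hd] := near_prod_ball (plaque_theta hf w1 Vw e0).
  by apply/nbhs_nm; exists d => // u hu; have [] := nbhs_singleton hd u hu.
have [m m0 hm] : exists2 m : R, 0 < m & forall w, r2 / 2 <= nm (w - a) <= r2 -> m <= nm (th (pl c t0 w)) - 1.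
  have cAn : compact [set w : C | r2 / 2 <= nm (w - a) <= r2] by exact: annulus_compact.
  have [||m m0 hm] := @compact_pos R C _ (fun w => nm (th (pl c t0 w)) - 1) cAn.
  - move=> w e /andP[_ hw] e0; apply: filterS (cT w e hw e0) => u.
    by rewrite (_ : nm (th (pl c t0 u)) - 1 - _ = nm (th (pl c t0 u)) - nm (th (pl c t0 w))) //; ring.
  - move=> w /andP[h1 h2]; have [|_ _ hw] := hr w; first exact: le_trans r2r'.
    by rewrite subr_gt0 hw// -subr_eq0 -nm_gt0; flra.
  by exists m.
(* [Q] leaves room on both sides: more than [nm (th x) = 1], so that a core of positive radius
   exists, and less than [1 + m / 2], the lower bound kept on the shell. *)
have [Q [Q1' QQQ QA]] : exists Q : R, [/\ 1 < Q, Q <= QQ & Q < 1 + m / 2].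
  exists (Num.min QQ (1 + m / 4)); split; rewrite ?lt_min ?gt_min ?ge_min ?Q1 ?lexx//; first by flra.
  by apply/orP; right; flra.
have [r0 r00 [r0r2 hr0]] : exists2 r0 : R, 0 < r0 & r0 <= r2 / 2 /\
    forall w, nm (w - a) <= r0 -> nm (th (pl c t0 w)) < Q.
  have ha : nm (a - a) <= r2 by rewrite subrr nm0 ltW.
  have := cT a (Q - 1) ha; rewrite subr_gt0 => /(_ Q1').
  move=> /nbhs_nm[e e0 he]; exists (Num.min (e / 2) (r2 / 2)); first by rewrite lt_min !divr_gt0.
  split=> [|w]; first by rewrite ge_min lexx orbT.
  rewrite le_min => /andP[hw _]; have we : nm (w - a) < e by move: hw e0; clear; flra.
  by have /ltr_normlP[_] := he w we; rewrite /a /t0 pl_id// th1; clear; flra.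
have Qi : QQ^-1 < 1 by rewrite invf_lt1// (lt_trans ltr01).
have hT : \forall t \near t0, forall w, nm (w - a) <= r2 ->
    [/\ V (pl c t w), QQ^-1 <= nm (th (pl c t w)), O (pl c t w),
        nm (w - a) <= r0 -> nm (th (pl c t w)) <= Q &
        r2 / 2 <= nm (w - a) -> 1 + m / 2 <= nm (th (pl c t w))].
  have t1 w : nm (w - a) <= r2 -> 1 <= nm (th (pl c t0 w)).
    move=> hw; have [|_ _] := hr w; first exact: le_trans r2r'.
    by have [->|_ h] := eqVneq w a; [rewrite /a /t0 pl_id// th1|rewrite ltW// h].
  have tube1 K e (P : R -> Prop) : compact K -> (forall w, K w -> nm (w - a) <= r2) -> 0 < e ->
      (forall w u, K w -> `|u - nm (th (pl c t0 w))| < e -> P u) ->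
      \forall t \near t0, forall w, K w -> P (nm (th (pl c t w))).
    move=> cK Kr e0 hP; apply: (tube (P := fun w t => P (nm (th (pl c t w)))) cK) => w Kw.
    have [|w1 Vw _] := hr w; first exact: le_trans (Kr w Kw) r2r'.
    by apply: filterS (plaque_theta hf w1 Vw e0) => p [_]; exact: hP.
  have T1 : \forall t \near t0, forall w, nm (w - a) <= r2 -> V (pl c t w) /\ O (pl c t w).
    apply: (tube (P := fun w t => V (pl c t w) /\ O (pl c t w)) (K := [set w : C | nm (w - a) <= r2])) => [|w hw]; first exact: nm_ball_compact.
    have [|w1 Vw _] := hr w; first exact: le_trans r2r'.
    have [_ Ow] := hO w (le_trans hw r2O).
    have h1 := plaque_theta hf w1 Vw ltr01; have h2 := near_inv w1 Ow.
    by apply: filterS2 h1 h2 => p [? _] [_ ?].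
  have T2 : \forall t \near t0, forall w, nm (w - a) <= r2 -> QQ^-1 <= nm (th (pl c t w)).
    apply: (tube1 _ (1 - QQ^-1) (fun u => QQ^-1 <= u)) => //; first exact: nm_ball_compact.
      by rewrite subr_gt0.
    by move=> w u /= /t1 h1 /ltr_normlP[h2 h3]; move: h1 h2 h3; clear; flra.
  have [m3 m30 hm3] : exists2 m : R, 0 < m & forall w, nm (w - a) <= r0 -> m <= Q - nm (th (pl c t0 w)).
    have cB : compact [set w : C | nm (w - a) <= r0] by exact: nm_ball_compact.
    have [||m3 m30 hm3] := @compact_pos R C _ (fun w => Q - nm (th (pl c t0 w))) cB.
    - move=> w e /= hw e0; have hw2 : nm (w - a) <= r2 by move: hw r0r2 r20; clear; flra.
      apply: filterS (cT w e hw2 e0) => u; rewrite distrC.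
      by rewrite (_ : Q - nm (th (pl c t0 u)) - _ = nm (th (pl c t0 w)) - nm (th (pl c t0 u))) //; ring.
    - by move=> w hw; rewrite subr_gt0 hr0.
    by exists m3.
  have T3 : \forall t \near t0, forall w, nm (w - a) <= r0 -> nm (th (pl c t w)) <= Q.
    apply: (tube1 _ m3 (fun u => u <= Q)) => //; first exact: nm_ball_compact.
      by move=> w /= hw; move: hw r0r2 r20; clear; flra.
    by move=> w u /= /hm3 h1 /ltr_normlP[h2 h3]; move: h1 h2 h3; clear; flra.
  have T4 : \forall t \near t0, forall w, r2 / 2 <= nm (w - a) <= r2 -> 1 + m / 2 <= nm (th (pl c t w)).
    apply: (tube1 _ (m / 2) (fun u => 1 + m / 2 <= u)); first exact: annulus_compact.
    - by move=> w /andP[].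
    - by rewrite divr_gt0.
    by move=> w u /= /hm h1 /ltr_normlP[h2 h3]; move: h1 h2 h3; clear; flra.
  apply: filterS2 (filterI T1 T2) (filterI T3 T4) => t [k1 k2] [k3 k4] w hw.
  by have [? ?] := k1 w hw; split=> //; [exact: k2|exact: k3|move=> ?; apply: k4; apply/andP].
have [tau [S [ctau tau1 tau0 cS [SW tauS]]]] := tr_bump (fx_compact H) (fx_haus H) dx hT.
pose b := @Box c a r0 (r2 / 2) r2 S V th Q (1 + m / 2).
have inbE y : inb b y -> exists t w, [/\ y = pl c t w, S t & nm (w - a) <= r2].
  by move=> [dy ry Sy]; exists (tc c y), (zc c y); rewrite pl_id.
have bok : box_ok b.
  split=> //=.
  - by rewrite (ltW r00).
  - by flra.
  - by move=> y [dy ry Sy]; have [] := SW _ Sy _ ry; rewrite pl_id.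
  - exact: (closed_box (fx_haus H) ar2 cS).
  - by move=> y [dy ry Sy] h0; have [_ _ _ h _] := SW _ Sy _ ry; move: (h h0); rewrite pl_id.
  - by move=> y [dy ry Sy] h0; have [_ _ _ _ h] := SW _ Sy _ ry; move: (h h0); rewrite pl_id.
  - by rewrite QA (lt_trans ltr01).
pose w y : C := if `[< ch_dom c y >] then bump r0 a (zc c y) * (tau (tc c y))%:C else 0.
have wE y : ch_dom c y -> w y = bump r0 a (zc c y) * (tau (tc c y))%:C by move=> dy; rewrite /w asboolT.
have wS y : w y != 0 -> inb b y /\ nm (zc c y - a) <= r0.
  rewrite /w; case: asboolP => dy; last by rewrite eqxx.
  rewrite mulf_eq0 negb_or => /andP[n1 n2].
  have h : nm (zc c y - a) <= r0.
    by rewrite leNgt; apply: contraNN n1 => h; rewrite bump_eq0 ?(ltW h)// ltW.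
  split=> //; split=> //=; first by flra.
  by apply: tauS; apply: contraNN n2 => /eqP ->.
exists b, w; split=> //.
- by move=> y [dy ry Sy]; have [_ h1 h2 _ _] := SW _ Sy _ ry; rewrite -(pl_id dy).
- split=> // y.
    have [dy|ndy] := pselect (ch_dom c y); last first.
      apply: c1_near (c1_cst L 0 y).
      have cl := bo_closed bok; have nb : ~ inb b y by case.
      have oN : open (~` [set x | inb b x]) by rewrite openC.
      apply: filterS (open_nbhs_nbhs (conj oN nb)) => u nu.
      by apply/esym/eqP; apply: contra_notT nu => /wS[].
    have [A' [B' hb]] := bump_sder r0 a (zc c y).
    have h1 := c1_comp (hol_c1 (hol_zc Lc dy)) hb.
    have h2 : c1_at L (fun u => (tau (tc c u))%:C) y.
      apply: hol_c1; apply: (hol_atI _ Lc dy (a := 0)).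
        apply: (cvgC (nbhs_filter y) _ _).2 => e e0.
        have := tc_continuous dy ((cvgR (nbhs_filter _) _ _).1 (ctau (tc c y)) _ e0).
        move=> h; have {}h : \forall u \near y, `|tau (tc c u) - tau (tc c y)| < e by exact: h.
        by apply: filterS h => u; rewrite -rmorphB nm_real.
      apply: sder_near (sder_cst (tau (tc c y))%:C _).
      by apply: filterS (near_disc (zc_lt dy)) => u hu; rewrite tc_pl.
    apply: c1_near (c1M h1 h2); apply: filterS (near_dom dy) => u du.
    by rewrite wE.
  rewrite /w; case: asboolP => dy; last by rewrite /= lexx.
  have [b0 bE] := bump_ge0 r0 a (zc c y).
  by rewrite bE -rmorphM /= mulr_ge0//; have /andP[] := tau0 (tc c y).
split=> //.
- have [b0 bE] := bump_ge0 r0 a (zc c x).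
  rewrite wE// bE -rmorphM /= -/t0 tau1 mulr1 /bump -/(bump r0 a a).
  by apply: bump_gt0; rewrite subrr nm0.
- by split=> //; apply: tauS; rewrite tau1 oner_neq0.
by exists tau => // t; split; [exact: tau0|exact: tauS].
Qed.

End Frames.
Arguments b_S {R X} b.

(** * Existence of sections close to prescribed data *)

Section Existence.
Context {R : realType} {X : topologicalType} (L : lamination R X).
Local Notation C := (Cplx R).
Variable fr : set X -> (X -> C) -> Prop.
Hypothesis H : frame_axioms L fr.

(** The given boxes carry the data and no part of the partition of unity; further peak boxes, with
    zero data, cover [X] and absorb the errors. Over the shells the data have size [A0 ^- d], the
    corrections lose [(QQ ^ 2) ^ d], and [QQ ^ 2 <= q * A0] leaves [q ^ d]. *)
Lemma section_exists (J : finType) (b : J -> @box R X) (A0 q : R) :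
  (forall j, box_ok L fr (b j)) -> (forall j, A0 <= b_A (b j)) -> 0 < q -> 1 < q * A0 ->
  exists (C0 : R) d0, 0 < C0 /\ forall d phi, (d0 <= d)%N ->
    (forall j x, b_V (b j) x -> ch_dom (b_ch (b j)) x -> hol_at L (phi j) x) ->
    (forall j x, inb (b j) x -> nm (phi j x) <= 1) ->
    (forall j x, ch_dom (b_ch (b j)) x -> ~ b_S (b j) (tc (b_ch (b j)) x) -> phi j x = 0) ->
    exists s, [/\ is_section L fr d s,
      forall x, (forall j, ~ inb (b j) x) -> nm (s x) <= C0 * q ^+ d &
      forall i x, inb (b i) x -> nm (zc (b_ch (b i)) x - b_a (b i)) <= b_r1 (b i) ->
        (forall j, j != i -> ~ inb (b j) x) ->
        nm (s x - phi i x / b_th (b i) x ^+ d) <= C0 * q ^+ d].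
Proof.
move=> bok bA q0 qA.
have A0p : 0 < A0 by rewrite -(pmulr_rgt0 _ q0) (lt_trans ltr01).
have [QQ Q1 hQQ] : exists2 QQ : R, 1 < QQ & QQ ^+ 2 <= q * A0.
  (* With [e <= 1], [(1 + e) ^ 2 <= 1 + 3 * e <= q * A0]. *)
  pose e := Num.min 1 ((q * A0 - 1) / 3).
  have e0 : 0 < e by rewrite lt_min ltr01 divr_gt0// subr_gt0.
  have e1 : e <= 1 by rewrite ge_min lexx.
  have e2 : e <= (q * A0 - 1) / 3 by rewrite ge_min lexx orbT.
  exists (1 + e); first by flra.
  have : e * e <= 1 * e by rewrite ler_pM2r.
  by rewrite expr2; move: e2 e1; clearbody e; nra.
have QQ0 : 0 < QQ by exact: lt_trans Q1.
have hb0 x := @peak_box R X L fr H QQ 1 x setT Q1 (@ltr01 R) (@filterT _ _ (nbhs_filter x)).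
have /choice[bx hbx] := hb0.
have /choice[w hw] := hbx.
have hO x : setT x -> nbhs x [set y | w x y != 0].
  move=> _; have [_ _ _ [c1w _ _] [w0 _ _ _ _]] := hw x.
  have n0 : 0 < nm (w x x) by rewrite nm_gt0; apply: contraTneq w0 => ->; rewrite ltxx.
  apply: filterS (c1_cont (c1w x) n0) => y; rewrite /=; apply: contraTneq => ->.
  by rewrite sub0r nmN ltxx.
have [s hs] := finite_cover (fx_compact H) hO.
pose K : finType := (J + 'I_(size s))%type.
pose pt_ (i : 'I_(size s)) := tnth (in_tuple s) i.
pose bb (k : K) : @box R X := match k with inl j => b j | inr i => bx (pt_ i) end.
have bbok k : box_ok L fr (bb k) by case: k => [j|i]; [exact: bok|have [] := hw (pt_ i)].
pose W x : R := \sum_i Re (w (pt_ i) x).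
have wr i x : w (pt_ i) x = (Re (w (pt_ i) x))%:C by have [_ _ _ [_ h _] _] := hw (pt_ i); exact: (h x).1.
have w0 i x : 0 <= Re (w (pt_ i) x) by have [_ _ _ [_ h _] _] := hw (pt_ i); exact: (h x).2.
have W0 x : 0 < W x.
  have [y [ys _ wy]] := hs x I; have [i iy] := tnthP (in_tuple s) y ys.
  rewrite /W (bigD1 i)//= ltr_pwDl ?sumr_ge0// lt_neqAle w0 andbT eq_sym.
  by apply: contraNneq wy => wi; rewrite iy -/(pt_ i) wr wi.
have WE x : (W x)%:C = \sum_i w (pt_ i) x :> C.
  by rewrite /W rmorph_sum /=; apply: eq_bigr => i _; rewrite -wr.
have W0C x : (W x)%:C != 0 :> C by rewrite -nm_gt0 nm_real gtr0_norm.
(* The functions [w] add up to a positive function [W]; dividing by it gives the partition of unity,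
   supported in the covering boxes only. *)
pose eta (k : K) : X -> C := match k with inl _ => fun=> 0 | inr i => fun x => w (pt_ i) x / (W x)%:C end.
have HB : @box_axioms R X L K (fun k => b_ch (bb k)) (fun k => b_a (bb k)) (fun k => b_r0 (bb k))
    (fun k => b_r1 (bb k)) (fun k => b_r2 (bb k)) (fun k => b_S (bb k))
    (fun k => b_V (bb k) `&` ch_dom (b_ch (bb k))) (fun k => b_th (bb k)) eta
    (fun k => b_Q (bb k)) (fun k => b_A (bb k)).
  split.
  - exact: fx_compact H.
  - by move=> k; exact: bo_L (bbok k).
  - by move=> k; exact: bo_r01 (bbok k).
  - by move=> k; exact: bo_r12 (bbok k).
  - by move=> k; exact: bo_disc (bbok k).
  - by move=> k; apply: openI; [exact: fx_open H _ _ (bo_fr (bbok k))|exact: ch_dom_open].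
  - by move=> k x [].
  - by move=> k x h; split; [exact: bo_V (bbok k) _ h|case: h].
  - by move=> k; exact: bo_closed (bbok k).
  - by move=> k x; exact: fx_th0 H _ _ _ (bo_fr (bbok k)).
  - by move=> k l x [[h1 _] [h2 _]]; apply: (fx_hol H (bo_fr (bbok k)) (bo_fr (bbok l))).
  - by move=> k x [h1 _]; exact: (fx_cont H (bo_fr (bbok k)) h1).
  - move=> [j|i] x; first by rewrite /= eqxx.
    have [_ _ _ [_ _ h] _] := hw (pt_ i) => n0; apply: h.
    by apply: contraNneq n0 => /= ->; rewrite mul0r.
  - move=> x; rewrite big_sumType /= big1// add0r -mulr_suml -WE divff//.
  - move=> [j|i] x; first exact: c1_cst.
    have cw i' y : c1_at L (w (pt_ i')) y by have [_ _ _ [h _ _] _] := hw (pt_ i').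
    have cW : c1_at L (fun y => (W y)%:C) x.
      by apply: c1_near (c1_sum _ (fun i' => cw i' x)); apply: nearW => y; rewrite WE.
    by apply: c1M (cw i x) _; apply: c1_comp cW (sder_inv _).
  - move=> [j|i] x /=; first by rewrite nm0.
    rewrite nmM nmV nm_real gtr0_norm// ler_pdivrMr// mul1r wr nm_real ger0_norm//.
    by rewrite /W (bigD1 i)//= lerDl sumr_ge0.
  - by move=> k x; exact: bo_Q (bbok k) x.
  - by move=> k x; exact: bo_A (bbok k) x.
  by move=> k; exact: bo_QA (bbok k).
have [B B0 hB] := core_bound HB.
have /choice[dk hdk] (k : K) : exists d0, forall d, (d0 <= d)%N ->
    12 * (#|K|%:R * B * b_Q (bb k) ^+ d) <= b_A (bb k) ^+ d.
  have /andP[k0 kA] := bo_QA (bbok k); have kA0 := lt_trans k0 kA.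
  have r01 : 0 <= b_Q (bb k) / b_A (bb k) < 1 by rewrite divr_ge0 ?(ltW k0) ?(ltW kA0)//= ltr_pdivrMr// mul1r.
  have [n hn] := exprn_small (12 * (#|K|%:R * B)) r01 (@ltr01 R).
  exists n => d nd; have A0d : 0 < b_A (bb k) ^+ d by rewrite exprn_gt0.
  have /andP[r0 r1] := r01.
  have h : (b_Q (bb k) / b_A (bb k)) ^+ d * (12 * (#|K|%:R * B)) <= 1.
    rewrite (le_trans _ (ltW hn))// ler_wpM2r ?mulr_ge0 ?(ltW B0)//.
    by rewrite ler_wiXn2l ?(ltW r1).
  rewrite -(ler_pM2r A0d) mul1r in h; apply: le_trans h.
  rewrite le_eqVlt; apply/orP; left; apply/eqP; rewrite expr_div_n; field.
  by rewrite gt_eqF.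
pose C0 := #|K|%:R * (12 * (#|K|%:R * B)) + 1.
have C00 : 0 < C0 by rewrite /C0 ltr_wpDl// !mulr_ge0 ?(ltW B0).
exists C0, (\max_k dk k); split=> // d phi hd hphi phi1 phi0.
have kappa k : 12 * (#|K|%:R * B * b_Q (bb k) ^+ d) <= b_A (bb k) ^+ d.
  by apply: hdk; apply: leq_trans hd; exact: leq_bigmax.
pose P (k : K) : X -> C := match k with inl j => fun x => phi j x / b_th (b j) x ^+ d | inr _ => fun=> 0 end.
have hPU k x : (b_V (bb k) `&` ch_dom (b_ch (bb k))) x -> hol_at L (fun y => P k y * b_th (bb k) y ^+ d) x.
  case: k => [j|i] [h1 h2] /=.
    apply: hol_at_near (hphi j x h1 h2); apply: nearW => y.
    by rewrite divfK// expf_neq0// (fx_th0 H _ (bo_fr (bok j))).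
  by apply: hol_at_near (hol_at_cst L 0 x); apply: nearW => y; rewrite mul0r.
(* Over a shell the data are at most 1 and the frames at least [A0]. *)
pose mP := A0 ^- d.
have mP0 : 0 <= mP by rewrite invr_ge0 exprn_ge0 ?ltW.
have hP : adm L (fun k => b_a (bb k)) (fun k => b_r1 (bb k)) (fun k => b_r2 (bb k)) (fun k => b_S (bb k))
    (fun k => b_V (bb k) `&` ch_dom (b_ch (bb k))) (fun k => b_th (bb k)) d P mP.
  move=> k; split=> [x dx nS|x Ux _|x [bx' /andP[h1 _]]]; last 1 first.
  - case: k h1 bx' => [j|i] /= h1 bx'; last by rewrite nm0.
    rewrite nmM nmV nmX (le_trans (ler_piMl _ (phi1 j x bx')))//.
      by rewrite invr_ge0 exprn_ge0 ?nm_ge0.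
    have hA := le_trans (bA j) (bo_A (bok j) bx' (ltW h1)).
    have t0 := lt_le_trans A0p hA.
    by rewrite /mP lef_pV2 ?posrE ?exprn_gt0// lerXn2r ?nnegrE ?(ltW t0) ?(ltW A0p).
  - by case: k dx nS => [j|i] /= dx nS //; rewrite phi0// mul0r.
  exact: hPU.
pose s_ := glued (fun k => b_a (bb k)) (fun k => b_r1 (bb k)) (fun k => b_r2 (bb k)) (fun k => b_S (bb k))
   (fun k => b_th (bb k)) eta d P.
pose kp := kapN (fun k => b_a (bb k)) (fun k => b_r1 (bb k)) (fun k => b_r2 (bb k)) (fun k => b_S (bb k)).
have est x : nm (s_ x - \sum_j kp (inl j) x * P (inl j) x) <= C0 * q ^+ d.
  have hQ k : eta k = (fun=> 0) \/ b_Q (bb k) <= QQ /\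
      (forall y, in_box (fun k => b_a (bb k)) (fun k => b_r2 (bb k)) (fun k => b_S (bb k)) k y -> QQ^-1 <= nm (b_th (bb k) y)).
    case: k => [j|i]; [by left|right]; have [_ [h _] h2 _ _] := hw (pt_ i); split=> // y h3.
    exact: (h2 y h3).1.
  have := glued_close HB B0 hB kappa mP0 hP x QQ0 hQ.
  rewrite big_sumType /= [X in _ - (_ + X)]big1 ?addr0; last by move=> i _; rewrite mulr0.
  move=> h; apply: (le_trans h).
  have h2 : mP * (QQ ^+ 2) ^+ d <= q ^+ d.
    rewrite /mP mulrC ler_pdivrMr ?exprn_gt0// -exprMn lerXn2r ?nnegrE ?exprn_ge0 ?mulr_ge0 ?(ltW QQ0) ?(ltW q0) ?(ltW A0p)//.
  have c0 : 0 <= #|K|%:R * (12 * (#|K|%:R * B)) by rewrite !mulr_ge0 ?(ltW B0).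
  have q0d : 0 <= q ^+ d by rewrite exprn_ge0 ?ltW.
  by have := ler_wpM2l c0 h2; rewrite /C0 !mulrA; flra.
exists s_; split.
- move=> V th hf x Vx; apply: (glued_hol HB B0 hB kappa mP0 hP hPU (fx_open H hf) Vx) => k y [Vy [h1 _]].
  exact: (fx_hol H hf (bo_fr (bbok k))).
- move=> x nb; have := est x; rewrite big1 ?subr0// => j _.
  by rewrite /kp /kapN asboolF ?mul0r//; exact: nb.
move=> i x bi hi nb; have := est x; rewrite (bigD1 i)//= big1 ?addr0.
  suff -> : kp (inl i) x = 1 by rewrite mul1r.
  have /andP[r00 r01] := bo_r01 (bok i); have r12 := bo_r12 (bok i).
  by rewrite /kp /kapN asboolT// /kap cutoff1//=; move: hi r00 r01 r12; clear; flra.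
by move=> j /nb nj; rewrite /kp /kapN asboolF ?mul0r.
Qed.

End Existence.

(** * Peak sections with prescribed leafwise jets *)

Section PeakSections.
Context {R : realType} {X : topologicalType} (L : lamination R X).
Local Notation C := (Cplx R).
Variable fr : set X -> (X -> C) -> Prop.
Hypothesis H : frame_axioms L fr.

Record peak := Peak {
  k_ch : chart R X; k_a : C; k_V : set X; k_th : X -> C; k_tau : ch_tr k_ch -> R;
  k_r : R; k_Q : R; k_C : R; k_b : R; k_d : nat }.
Arguments k_tau : clear implicits.

(* Sections of degree [d] close to [tau p / th ^ d] on the box and, compared with it,
   exponentially small off [O]. *)
Definition is_peak (O : set X) (k : peak) :=
  [/\ [/\ L (k_ch k), fr (k_V k) (k_th k), 0 < k_r k, 0 < k_C k & 0 < k_Q k /\ 0 <= k_b k < 1],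
    [/\ continuous (k_tau k), forall t, 0 <= k_tau k t <= 1 & compact [set t | 1 / 2 <= k_tau k t]],
    exists2 r' : R, k_r k < r' & forall t w, k_tau k t != 0 -> nm (w - k_a k) <= r' ->
      nm w < 1 /\ k_V k (pl (k_ch k) t w),
    forall t w, k_tau k t != 0 -> nm (w - k_a k) <= k_r k -> nm (k_th k (pl (k_ch k) t w)) <= k_Q k &
    forall d (p : C -> C), (k_d k <= d)%N -> (forall w, exists a, sder p w a 0) ->
      (forall w, nm (w - k_a k) <= 1 -> nm (p w) <= 1) -> exists s, [/\ is_section L fr d s,
        forall y, ~ O y -> nm (s y) * k_Q k ^+ d <= k_C k * k_b k ^+ d &
        forall t w, k_tau k t != 0 -> nm (w - k_a k) <= k_r k ->
          nm (s (pl (k_ch k) t w) * k_th k (pl (k_ch k) t w) ^+ d - (k_tau k t)%:C * p w) <= k_C k * k_b k ^+ d]].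

Lemma peak_exists x O : nbhs x O ->
  exists k, [/\ is_peak O k, ch_dom (k_ch k) x, k_tau k (tc (k_ch k) x) = 1 & k_a k = zc (k_ch k) x].
Proof.
move=> nO; have Q2 : (1 : R) < 2 by flra.
have [b [w0 [bok _ bO _ [_ ba [dx _] r00 [tau [ctau tau1 cS] htau]]]]] := @peak_box R X L fr H 2 1 x O Q2 ltr01 nO.
have /andP[Q0 QA] := bo_QA bok; have A00 := lt_trans Q0 QA.
have AQ0 : 0 < b_A b + b_Q b by rewrite addr_gt0.
(* [q] lies strictly between [1 / A] and [1 / Q]: [q * A > 1] is what [section_exists] asks, and
   [q * Q < 1] makes the error small even relative to [Q ^- d]. *)
pose q := 2 / (b_A b + b_Q b); have q0 : 0 < q by rewrite divr_gt0.
have qA : 1 < q * b_A b by rewrite /q -mulrA (mulrC _ (b_A b)) mulrA ltr_pdivlMr//; flra.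
have qQ : q * b_Q b < 1 by rewrite /q -mulrA (mulrC _ (b_Q b)) mulrA ltr_pdivrMr//; flra.
have [C0 [d0 [C00 hs]]] := @section_exists R X L fr H unit (fun=> b) (b_A b) q (fun=> bok) (fun=> lexx _) q0 qA.
have /andP[_ r01] := bo_r01 bok; have r12 := bo_r12 bok; have ar := bo_disc bok.
have tauw t w : tau t != 0 -> nm (w - b_a b) <= b_r2 b -> [/\ nm w < 1, inb b (pl (b_ch b) t w) & b_V b (pl (b_ch b) t w)].
  move=> tn hw; have w1 : nm w < 1 by have := nm_split w (b_a b); flra.
  have hb : inb b (pl (b_ch b) t w).
    by split; rewrite ?tc_pl ?zc_pl//; [exact: pl_dom|exact: (htau t).2].
  by split=> //; exact: bo_V bok _ hb.
exists (@Peak (b_ch b) (b_a b) (b_V b) (b_th b) tau (b_r0 b) (b_Q b) C0 (q * b_Q b) d0).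
split=> //; split=> /=.
- split=> //; [exact: bo_L bok|exact: bo_fr bok|split=> //].
  by rewrite qQ mulr_ge0 ?(ltW q0) ?(ltW Q0).
- split=> //; first by move=> t; have [] := htau t.
  apply: subclosed_compact cS _; last first.
    by move=> t /= h; apply: (htau t).2; rewrite gt_eqF//; flra.
  exact: preimage_closed (fun t _ => ctau t) (@closed_ge _ _).
- exists (b_r2 b); first by flra.
  by move=> t w tn hw; have [] := tauw t w tn hw.
- move=> t w tn hw; have hw2 : nm (w - b_a b) <= b_r2 b by flra.
  have [w1 hb _] := tauw t w tn hw2; apply: (bo_Q bok hb).
  by rewrite zc_pl.
move=> d p dd hp p1; pose phi x : C := if `[< ch_dom (b_ch b) x >] then (tau (tc (b_ch b) x))%:C * p (zc (b_ch b) x) else 0.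
have phiE y : ch_dom (b_ch b) y -> phi y = (tau (tc (b_ch b) y))%:C * p (zc (b_ch b) y) by move=> dy; rewrite /phi asboolT.
have [|||s [hs1 hs2 hs3]] := hs d (fun=> phi) dd.
- move=> _ y _ dy.
  have h1 : hol_at L (fun u => (tau (tc (b_ch b) u))%:C) y.
    apply: (hol_atI _ (bo_L bok) dy (a := 0)).
      apply: (cvgC (nbhs_filter y) _ _).2 => e e0.
      have := tc_continuous dy ((cvgR (nbhs_filter _) _ _).1 (ctau (tc (b_ch b) y)) _ e0).
      move=> h; have {}h : \forall u \near y, `|tau (tc (b_ch b) u) - tau (tc (b_ch b) y)| < e by exact: h.
      by apply: filterS h => u; rewrite -rmorphB nm_real.
    apply: sder_near (sder_cst (tau (tc (b_ch b) y))%:C _).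
    by apply: filterS (near_disc (zc_lt dy)) => u hu; rewrite tc_pl.
  have [a' ha] := hp (zc (b_ch b) y).
  have h2 : hol_at L (fun u => p (zc (b_ch b) u)) y.
    apply: (hol_atI _ (bo_L bok) dy (lwd_zc_comp dy ha)).
    by apply: (cont_comp (zc_continuous dy)); exact: sder_cnm ha.
  apply: hol_at_near (hol_atM h1 h2); apply: filterS (near_dom dy) => u du.
  by rewrite phiE.
- move=> _ y [dy ry _]; rewrite phiE// nmM nm_real.
  have [/andP[t0 t1] _] := htau (tc (b_ch b) y); rewrite ger0_norm// mulr_ile1 ?nm_ge0//.
  by apply: p1; have := nm_ge0 (b_a b); flra.
- move=> _ y dy nS; rewrite phiE// (_ : tau _ = 0) ?mul0r//.
  by apply/eqP; apply: contra_notT nS; exact: (htau _).2.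
exists s; split=> //.
- move=> y nO'; rewrite exprMn mulrA ler_wpM2r ?exprn_ge0 ?(ltW Q0)//.
  by apply: hs2 => _ /bO[_].
move=> t w tn hw; have hw2 : nm (w - b_a b) <= b_r2 b by flra.
have [w1 hb _] := tauw t w tn hw2.
have h := hs3 tt _ hb; rewrite zc_pl// in h.
have hw1 : nm (w - b_a b) <= b_r1 b by flra.
have hj j : j != tt -> ~ inb b (pl (b_ch b) t w) by case: j.
have {h} := h hw1 hj; rewrite phiE ?tc_pl ?zc_pl//; last exact: pl_dom.
move=> h.
set T := b_th b (pl (b_ch b) t w) in h *.
have T0 : T ^+ d != 0 by rewrite expf_neq0// (fx_th0 H _ (bo_fr bok)).
have TQ : nm T <= b_Q b by apply: (bo_Q bok hb); rewrite zc_pl.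
set Y := s _ in h *; set P := _ * p w in h *.
rewrite (_ : Y * T ^+ d - P = (Y - P / T ^+ d) * T ^+ d); last by field.
rewrite nmM nmX exprMn mulrA ler_pM ?exprn_ge0 ?nm_ge0// lerXn2r ?nnegrE ?nm_ge0 ?(ltW Q0)//.
Qed.

End PeakSections.
(** * Orders of vanishing along the leaves *)

Section LeafOrder.
Context {R : realType} {X : topologicalType} (L : lamination R X).
Local Notation C := (Cplx R).
Implicit Types (c : chart R X) (x : X) (f : X -> C).

Lemma pl_leaf c t (z w : C) : L c -> nm z < 1 -> nm w < 1 -> leaf L (pl c t z) (pl c t w).
Proof.
move=> Lc hz hw; apply: plaque_conn => // s /andP[s0 s1]; split=> //.
have : nm (pt z w s) <= (1 - s) * nm z + s * nm w.
  rewrite (_ : pt z w s = (1 - s)%:C * z + s%:C * w); last first.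
    by rewrite /pt rmorphB rmorph1; ring.
  by rewrite (le_trans (nmD _ _))// !nmM !nm_real !ger0_norm ?subr_ge0.
have [->|s_n] := eqVneq s 0; first by rewrite subr0 mul1r mul0r addr0; move=> h; exact: le_lt_trans h hz.
have s0' : 0 < s by rewrite lt_neqAle eq_sym s_n.
have h1 : s * nm w < s by rewrite gtr_pMr.
have h2 : (1 - s) * nm z <= 1 - s by rewrite ler_piMr ?subr_ge0// ltW.
flra.
Qed.

Definition leaf_null f x := exists c, [/\ L c, ch_dom c x & \forall w \near zc c x, f (pl c (tc c x) w) = 0].

(** The value at [x] is unconstrained, so points where [f] does not vanish qualify as well. *)
Definition isolated_zero f x := exists c, [/\ L c, ch_dom c x &
  \forall w \near zc c x, w != zc c x -> f (pl c (tc c x) w) != 0].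

Lemma near_near (z : C) (P : C -> Prop) : (\forall w \near z, P w) ->
  exists2 r : R, 0 < r & forall w, nm (w - z) < r -> nm (w - z) < r /\ \forall u \near w, P u.
Proof.
by move=> /nbhs_nm[r r0 h]; exists r => // w wr; split=> //; apply: filterS (near_ball wr) => u /h.
Qed.

Lemma leaf_null_open f : leaf_open (L := L) [set x | leaf_null f x].
Proof.
apply: leaf_openP => x [c [Lc hx h]]; exists c; split; [exact: Lc|exact: hx|].
have [r r0 hr] := near_near h; have [r' r0' hr'] := near_near (near_disc (zc_lt hx)).
apply/nbhs_nm; exists (Num.min r r'); first by rewrite lt_min r0.
move=> w; rewrite lt_min => /andP[/hr[_ hw] /hr'[_ /nbhs_singleton w1]].
by exists c; split; [exact: Lc|exact: pl_dom|rewrite (tc_pl _ w1) (zc_pl _ w1)].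
Qed.

Lemma near_punctured (z : C) (P : C -> Prop) : (\forall w \near z, P w) ->
  exists2 w, w != z & P w.
Proof.
move=> /nbhs_nm[r r0 h]; exists (z + (r / 2)%:C).
  by rewrite -subr_eq0 addrAC subrr add0r -nm_eq0 nm_real gt_eqF// normr_gt0 gt_eqF// divr_gt0.
by apply: h; rewrite addrAC subrr add0r nm_real gtr0_norm; flra.
Qed.

Lemma isolated_not_null f x : isolated_zero f x -> ~ leaf_null f x.
Proof.
move=> [c [Lc hx h]] [c' [Lc' hx' h']].
have j := jac_lwd Lc Lc' hx hx'.
have nP : nbhs (zc c' (pl c (tc c x) (zc c x))) [set w | f (pl c' (tc c' x) w) = 0] by rewrite pl_id.
have cz := cnm_near (sder_cnm j) nP.
have h2 : \forall w \near zc c x, f (pl c (tc c x) w) = 0.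
  by apply: filterS2 cz (on_plaque Lc Lc' hx hx') => w /= h1 [_ _ _ ->].
have [w wz [h3 h4]] := near_punctured (filterI h h2).
by have := h3 wz; rewrite h4 eqxx.
Qed.

(** The identity principle along a whole leaf, by [leaf_ind]. It uses only the local dichotomy, and
    so applies to sections, which need not be continuous as functions. *)
Lemma leaf_null_leaf f x y : (forall x, leaf_null f x \/ isolated_zero f x) ->
  leaf_null f x -> leaf L x y -> leaf_null f y.
Proof.
move=> hf nx; apply: leaf_ind => //; first exact: leaf_null_open.
apply: leaf_openP => u nu; case: (hf u) => [/nu []|[c [Lc hu h]]].
exists c; split; [exact: Lc|exact: hu|].
have [r r0 hr] := near_near h; have [r' r0' hr'] := near_near (near_disc (zc_lt hu)).
apply/nbhs_nm; exists (Num.min r r'); first by rewrite lt_min r0.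
move=> w; rewrite lt_min => /andP[/hr[_ /nbhs_singleton hw] /hr'[_ /nbhs_singleton w1]].
have [->|wz] := eqVneq w (zc c u); first by rewrite pl_id.
move=> nw; have [c' [Lc' hx' h']] := nw.
have f0 : f (pl c (tc c u) w) = 0 by rewrite -[X in f X](pl_id hx'); exact: nbhs_singleton h'.
by have := hw wz; rewrite f0 eqxx.
Qed.

Lemma hol_null_or_isolated V f x : open V -> V x -> hol_on L V f -> leaf_null f x \/ isolated_zero f x.
Proof.
move=> oV Vx hf; have [c Lc hx] := chart_ex L x.
have nV : nbhs x V by exact: open_nbhs_nbhs.
have [r r0 hr] := (nbhs_nm _ _).1 (near_plaque_at hx nV).
have [h|[k [g [hg g0 fE]]]] := hol_order r0 (hol_on_holb hf Lc hr).
  by left; exists c; split=> //; apply/nbhs_nm; exists r.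
right; exists c; split=> //.
have z0 : nm (zc c x - zc c x) < r by rewrite subrr nm0.
have n0 : 0 < nm (g (zc c x)) by rewrite nm_gt0.
have [d d0 hd] := holb_cnm hg z0 n0.
apply/nbhs_nm; exists (Num.min d r); first by rewrite lt_min d0.
move=> w; rewrite lt_min => /andP[wd wr] wz; rewrite fE// mulf_neq0 ?expf_neq0 ?subr_eq0//.
by apply: contraTneq (hd w wd) => ->; rewrite sub0r nmN ltxx.
Qed.

Lemma isolated_near f g x : (\forall y \near x, f y = 0 <-> g y = 0) -> isolated_zero f x -> isolated_zero g x.
Proof.
move=> E [c [Lc hx h]]; exists c; split=> //.
apply: filterS2 h (near_plaque_at hx E) => w h1 [_ h2] /h1.
by apply: contra_neq => /h2.
Qed.

Lemma isolated_prod (I : finType) (F : I -> X -> C) x : (forall i, isolated_zero (F i) x) ->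
  isolated_zero (fun y => \prod_i F i y) x.
Proof.
move=> h; have [c Lc hx] := chart_ex L x.
have h' i : \forall w \near zc c x, w != zc c x -> F i (pl c (tc c x) w) != 0.
  have [c' [Lc' hx' hi]] := h i; have j := jac_lwd Lc Lc' hx hx'.
  have [r0 r00 hr] : exists2 r : R, 0 < r & forall w, nm (w - zc c x) < r -> w != zc c x ->
      zc c' (pl c (tc c x) w) != zc c' x.
    have j0 : 0 < nm (jac c c' x) / 2 by rewrite divr_gt0// nm_gt0 (jac_neq0 Lc Lc').
    have [d d0 hd] := j _ j0; exists d => // w wd wz; rewrite -subr_eq0 -nm_gt0.
    have z0 : nm (zc c x - zc c x) < d by rewrite subrr nm0.
    have := hd w _ wd z0; rewrite mul0r subr0 pl_id// => h1.
    have wz0 : 0 < nm (w - zc c x) by rewrite nm_gt0 subr_eq0.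
    have := nm_split (jac c c' x * (w - zc c x)) (zc c' (pl c (tc c x) w) - zc c' x).
    rewrite (nmC (jac c c' x * _)) nmM => h2.
    by have := mulr_gt0 j0 wz0; flra.
  have nP : nbhs (zc c' (pl c (tc c x) (zc c x))) [set w | w != zc c' x -> F i (pl c' (tc c' x) w) != 0] by rewrite pl_id.
  apply: filterS3 (cnm_near (sder_cnm j) nP) (on_plaque Lc Lc' hx hx') (nbhs_nm_lt _ r00) => w /= h1 [_ _ _ E] h2 wz.
  by rewrite E; apply: h1; exact: hr.
exists c; split=> //.
have : \forall w \near zc c x, forall i, w != zc c x -> F i (pl c (tc c x) w) != 0.
  exact: (@filter_forall _ _ (fun i w => w != zc c x -> F i (pl c (tc c x) w) != 0) _ (nbhs_filter (zc c x))).
by apply: filterS => w hw wz; apply/prodf_neq0 => i _; exact: hw.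
Qed.

Lemma order_unit (g u : C -> C) z k : order_of_vanishing g z k ->
  (\forall w \near z, exists a, pder u w a) -> u z != 0 -> order_of_vanishing (fun w => g w * u w) z k.
Proof.
move=> [h [dh h0 gE]] du u0; exists (fun w => h w * u w); split.
- apply: filterS2 dh du => w /derivable_pder[a ha] [b hb].
  by apply/derivable_pder; exists (a * u w + h w * b); exact: pderM.
- by rewrite mulf_neq0.
by apply: filterS gE => w ->; rewrite mulrA.
Qed.

Lemma order_near (g g' : C -> C) z k : (\forall w \near z, g w = g' w) ->
  order_of_vanishing g z k -> order_of_vanishing g' z k.
Proof.
by move=> E [h [dh h0 gE]]; exists h; split=> //; apply: filterS2 E gE => w ->.
Qed.

Lemma pder_comp (u v : C -> C) z a b : pder u z a -> pder v (u z) b ->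
  pder (fun w => v (u w)) z (b * a).
Proof.
move=> hu hv e e0; have [M [d0 [M0 d00 lu]]] := pder_lip hu.
have e1 : 0 < e / (2 * M) by rewrite divr_gt0// mulr_gt0.
have b0 : 0 < nm b + 1 by rewrite ltr_wpDl ?nm_ge0.
have e2 : 0 < e / (2 * (nm b + 1)) by rewrite divr_gt0// mulr_gt0.
have [d1 d10 h1] := hv _ e1; have [d2 d20 h2] := hu _ e2.
exists (Num.min d0 (Num.min d2 (d1 / M))); first by rewrite !lt_min d00 d20 divr_gt0.
move=> w; rewrite !lt_min => /and3P[w0 w2 w1].
have k1 := lu w w0; have k2 := h2 w w2.
have k3 : nm (u w - u z) < d1 by rewrite (le_lt_trans k1)// mulrC -ltr_pdivlMr.
have k4 := h1 _ k3.
rewrite (_ : _ - _ = (v (u w) - v (u z) - b * (u w - u z)) + b * (u w - u z - a * (w - z))); last by ring.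
rewrite (le_trans (nmD _ _))// nmM.
have k5 : e / (2 * M) * nm (u w - u z) <= e / 2 * nm (w - z).
  apply: (le_trans (ler_wpM2l (ltW e1) k1)).
  by rewrite (_ : e / (2 * M) * (M * nm (w - z)) = e / 2 * nm (w - z)) //; field; rewrite gt_eqF.
have k6 : nm b * nm (u w - u z - a * (w - z)) <= e / 2 * nm (w - z).
  apply: (@le_trans _ _ ((nm b + 1) * (e / (2 * (nm b + 1)) * nm (w - z)))).
    by apply: ler_pM; rewrite ?nm_ge0// lerDl.
  by rewrite (_ : (nm b + 1) * _ = e / 2 * nm (w - z)) //; field; rewrite gt_eqF.
by flra.
Qed.

Lemma pderX (u : C -> C) z a k : pder u z a -> exists b, pder (fun w => u w ^+ k) z b.
Proof.
move=> h; elim: k => [|k [b hb]].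
  by exists 0; apply: pder_near (sder_pder (sder_cst 1 z)); apply: (@filterE _ (nbhs z)) => w; rewrite expr0.
by eexists; apply: pder_near (pderM h hb); apply: (@filterE _ (nbhs z)) => w; rewrite exprS.
Qed.

(** The change of coordinate is [(w - z) * e w] with [e z] the Jacobian, hence nonzero: the local
    factor [h] is changed by a unit only. *)
Lemma order_chart c c' f x k : L c -> L c' -> ch_dom c x -> ch_dom c' x ->
  order_of_vanishing (fun w => f (pl c' (tc c' x) w)) (zc c' x) k ->
  order_of_vanishing (fun w => f (pl c (tc c x) w)) (zc c x) k.
Proof.
move=> Lc Lc' hx hx' [h [dh h0 fE]].
have j := jac_lwd Lc Lc' hx hx'; have cj_ := sder_cnm j.
pose u w := zc c' (pl c (tc c x) w); have uz : u (zc c x) = zc c' x by rewrite /u pl_id.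
have P := on_plaque Lc Lc' hx hx'.
have [r r0 hr] := (nbhs_nm _ _).1 P.
have hu : holb u (zc c x) r.
  apply: hol_on_holb (hol_zc Lc') Lc _ => w /hr[w1 dw _ _]; by split.
have [e he uE] := hol_factor r0 hu.
have z0 : nm (zc c x - zc c x) < r by rewrite subrr nm0.
have e0 : e (zc c x) != 0.
  have j2 := sderD (sder_cst (u (zc c x)) (zc c x)) (sderM (sderB (sder_id (zc c x)) (sder_cst (zc c x) (zc c x))) (hol_sder he z0)).
  have E2 : \forall w \near zc c x, u (zc c x) + (w - zc c x) * e w = u w.
    by apply/nbhs_nm; exists r => // w /uE.
  have j3 := sder_near E2 j2.
  have [E _] := sder_uniq j j3; have := jac_neq0 Lc Lc' hx hx'.
  by rewrite E add0r subr0 mul1r subrr mul0r addr0.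
exists (fun w => e w ^+ k * h (u w)); split.
- have dh' : nbhs (u (zc c x)) [set w | derivable h w 1] by rewrite uz.
  apply: filterS2 (cnm_near cj_ dh') (nbhs_nm_lt _ r0) => w /= /derivable_pder[b hb] wr.
  have [a ha] := he w wr; have [a' ha'] := hu w wr; have [b' hb'] := pderX k ha.
  by apply/derivable_pder; eexists; apply: pderM hb' (pder_comp ha' hb).
- by rewrite uz mulf_neq0// expf_neq0.
have nE : nbhs (u (zc c x)) [set w | f (pl c' (tc c' x) w) = (w - zc c' x) ^+ k * h w] by rewrite uz.
have cE := cnm_near cj_ nE.
apply: filterS3 cE P (nbhs_nm_lt _ r0) => w /= h1 [_ _ _ E] wr.
have uE' : zc c' (pl c (tc c x) w) - zc c' x = (w - zc c x) * e w.
  by rewrite -/(u w) -uz uE// addrC addKr.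
by rewrite E h1 uE' exprMn mulrA.
Qed.

End LeafOrder.

(** * Algebra of sections and their divisors *)

Section Sections.
Context {R : realType} {X : topologicalType} (L : lamination R X).
Local Notation C := (Cplx R).
Variable fr : set X -> (X -> C) -> Prop.
Hypothesis H : frame_axioms L fr.

Lemma frame_at x : exists V th, fr V th /\ V x.
Proof.
have [c [V [th [r [[Lc hx] hf r0 _ h]]]]] := fx_peak H x.
exists V, th; split=> //; have [] := h (zc c x); first by rewrite subrr nm0 ltW.
by move=> _; rewrite pl_id.
Qed.

(** In the unitary trivialisation only the norm of a section is continuous. *)
Lemma sec_cont d s x : is_section L fr d s -> {for x, continuous (fun y => nm (s y))}.
Proof.
move=> hs; have [V [th [hf Vx]]] := frame_at x.
have [cs _] := hs V th hf x Vx; have ct := fx_cont H hf Vx.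
have E y : nm (s y) = nm (s y * th y ^+ d) / nm (th y) ^+ d.
  by rewrite nmM nmX mulfK// expf_neq0// nm_eq0 (fx_th0 H _ hf).
have cn : {for x, continuous (fun y => nm (s y * th y ^+ d))}.
  apply: (cvgR (nbhs_filter x) _ _).2 => e e0; apply: filterS ((contP _ _).1 cs e e0) => y.
  by apply: le_lt_trans; exact: nm_dist.
rewrite (_ : (fun y => nm (s y)) = (fun y => nm (s y * th y ^+ d) / nm (th y) ^+ d)); last exact/funext.
apply: cvgM => //; apply: cvgV; first by rewrite expf_neq0// nm_eq0 (fx_th0 H _ hf).
exact: continuous_comp ct (@exprn_continuous _ d _).
Qed.

Lemma secM d e s t : is_section L fr d s -> is_section L fr e t ->
  is_section L fr (d + e) (fun x => s x * t x).
Proof.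
move=> hs ht V th hf x Vx; apply: hol_at_near (hol_atM (hs V th hf x Vx) (ht V th hf x Vx)).
by apply: nearW => y; rewrite exprD mulrACA.
Qed.

Lemma sec1 : is_section L fr 0 (fun=> 1).
Proof.
by move=> V th hf x Vx; apply: hol_at_near (hol_at_cst L 1 x); apply: nearW => y; rewrite expr0 mulr1.
Qed.

Lemma secX d s k : is_section L fr d s -> is_section L fr (k * d) (fun x => s x ^+ k).
Proof.
move=> hs V th hf x Vx; apply: hol_at_near (hol_atX k (hs V th hf x Vx)).
by apply: nearW => y; rewrite exprMn -exprM mulnC.
Qed.

Lemma secDZ d s t (a : C) : is_section L fr d s -> is_section L fr d t ->
  is_section L fr d (fun x => s x + a * t x).
Proof.
move=> hs ht V th hf x Vx.
apply: hol_at_near (hol_atD (hs V th hf x Vx) (hol_atM (hol_at_cst L a x) (ht V th hf x Vx))).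
by apply: nearW => y; ring.
Qed.

Lemma sec_prod (I : finType) (d : I -> nat) (s : I -> X -> C) :
  (forall i, is_section L fr (d i) (s i)) -> is_section L fr (\sum_i d i) (fun x => \prod_i s i x).
Proof.
move=> hs; elim: (index_enum I) => [|i r IH].
  rewrite big_nil (_ : (fun x => _) = (fun=> 1)); first exact: sec1.
  by apply/funext => x; rewrite big_nil.
rewrite big_cons (_ : (fun x => _) = (fun x => s i x * \prod_(j <- r) s j x)); first exact: secM.
by apply/funext => x; rewrite big_cons.
Qed.

Lemma sec_bounded d s : is_section L fr d s -> exists2 M : R, 0 < M & forall x, nm (s x) <= M.
Proof.
move=> hs; have [] := @compact_pos R X setT (fun x => (1 + nm (s x))^-1) (fx_compact H).
- move=> x e _; apply: (cvgR (nbhs_filter x) _ _).1; apply: cvgV.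
    by rewrite gt_eqF// ltr_pwDl ?nm_ge0.
  by apply: cvgD; [exact: cvg_cst|exact: sec_cont hs].
- by move=> x _; rewrite invr_gt0 ltr_pwDl ?nm_ge0.
move=> m m0 hm; exists m^-1; first by rewrite invr_gt0.
move=> x; have h := hm x I; have p : 0 < 1 + nm (s x) by rewrite ltr_pwDl ?nm_ge0.
have : 1 + nm (s x) <= m^-1 by rewrite -[leLHS]invrK lef_pV2 ?posrE ?invr_gt0.
flra.
Qed.

Lemma sec_null_or_isolated d s x : is_section L fr d s -> leaf_null L s x \/ isolated_zero L s x.
Proof.
move=> hs; have [V [th [hf Vx]]] := frame_at x.
have E y : s y * th y ^+ d = 0 <-> s y = 0.
  split=> [/eqP|->]; last by rewrite mul0r.
  by rewrite mulf_eq0 (negbTE (expf_neq0 d (fx_th0 H y hf))) orbF => /eqP.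
have [[c [Lc hx h]]|h] := hol_null_or_isolated (fx_open H hf) Vx (hs V th hf).
  by left; exists c; split=> //; apply: filterS h => w /E.
by right; apply: isolated_near h; apply: nearW => y; exact: E.
Qed.

(** Two frames differ by an invertible holomorphic factor, so a single order serves all of them. *)
Lemma sec_order d s x : is_section L fr d s -> isolated_zero L s x -> exists k, forall V th, fr V th -> V x ->
  leaf_multiplicity L (fun y => s y * th y ^+ d) x k.
Proof.
move=> hs iz; have [V [th [hf Vx]]] := frame_at x; have [c Lc hx] := chart_ex L x.
have nV : nbhs x V by exact: open_nbhs_nbhs (conj (fx_open H hf) Vx).
have [r r0 hr] := (nbhs_nm _ _).1 (near_plaque_at hx nV).
have [h|[k [g [hg g0 fE]]]] := hol_order r0 (hol_on_holb (hs V th hf) Lc hr).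
  exfalso; apply: isolated_not_null iz _; exists c; split; [exact: Lc|exact: hx|].
  apply/nbhs_nm; exists r => // w /h /eqP.
  by rewrite mulf_eq0 (negbTE (expf_neq0 d (fx_th0 H _ hf))) orbF => /eqP.
exists k => V' th' hf' Vx' c' Lc' hx'.
apply: (@order_chart R X L c' c (fun y => s y * th' y ^+ d) x k Lc' Lc hx' hx).
have o : order_of_vanishing (fun w => s (pl c (tc c x) w) * th (pl c (tc c x) w) ^+ d) (zc c x) k.
  exists g; split=> //; last by apply/nbhs_nm; exists r.
  by apply/nbhs_nm; exists r => // w /hg; exact: (derivable_pder _ _).2.
have nVV : nbhs x (V' `&` V).
  by apply: open_nbhs_nbhs; split=> //; apply: openI; [exact: (fx_open H hf')|exact: (fx_open H hf)].
have [r' r0' hr'] := (nbhs_nm _ _).1 (near_plaque_at hx nVV).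
have hq : hol_on L (V' `&` V) (fun y => (th' y / th y) ^+ d).
  by move=> y Vy; apply: hol_atX; exact: (fx_hol H hf' hf Vy).
have hu := hol_on_holb hq Lc hr'.
have hu' : \forall w \near zc c x, exists a, pder (fun w => (th' (pl c (tc c x) w) / th (pl c (tc c x) w)) ^+ d) w a.
  by apply/nbhs_nm; exists r'.
apply: order_near (order_unit o hu' _); last first.
  by rewrite expf_neq0// mulf_neq0 ?invr_eq0 ?(fx_th0 H _ hf) ?(fx_th0 H _ hf').
apply: (@filterE _ (nbhs (zc c x))) => w; rewrite expr_div_n; field.
by rewrite expf_neq0// (fx_th0 H _ hf).
Qed.

Lemma sec_divisor d s : is_section L fr d s -> (forall x, isolated_zero L s x) ->
  exists m, is_divisor L [set x | s x = 0] m.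
Proof.
move=> hs iz; have /choice[m hm] x := sec_order hs (iz x).
have th0 V th y : fr V th -> s y * th y ^+ d = 0 <-> s y = 0.
  move=> hf; split=> [/eqP|->]; last by rewrite mul0r.
  by rewrite mulf_eq0 (negbTE (expf_neq0 d (fx_th0 H y hf))) orbF => /eqP.
exists m; split.
- rewrite (_ : [set x | s x = 0] = (fun x => nm (s x)) @^-1` [set 0]).
    by apply: preimage_closed (@closed_eq _ _) => x _; exact: sec_cont hs.
  by apply/seteqP; split=> x /= => [->|/eqP]; [rewrite nm0|rewrite nm_eq0 => /eqP].
- move=> x /= sx; rewrite lt0n; apply/eqP => m0.
  have [V [th [hf Vx]]] := frame_at x; have [c Lc hx] := chart_ex L x.
  have [h [_ h0 /nbhs_singleton]] := hm x V th hf Vx c Lc hx.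
  rewrite -/(tc c x) -/(zc c x) -/(pl c (tc c x) (zc c x)) pl_id// sx mul0r m0 expr0 mul1r => E.
  by move: h0; rewrite -E eqxx.
move=> x _; have [V [th [hf Vx]]] := frame_at x.
exists V, (fun y => s y * th y ^+ d); split.
- by split=> //; exact: (fx_open H hf).
- exact: hol_on_holomorphic (hs V th hf).
- move=> y Vy sub; have [c [Lc hy h]] := iz y.
  have nV : nbhs y V by exact: open_nbhs_nbhs (conj (fx_open H hf) Vy).
  have [r r0 hr] := (nbhs_nm _ _).1 (near_plaque_at hy nV).
  have [w wz [h1 h2]] := near_punctured (filterI h (nbhs_nm_lt _ r0)).
  have lw : leaf_in L V y (pl c (tc c y) w).
    rewrite -[X in leaf_in L V X](pl_id hy); apply: plaque_conn => // u /andP[u0 u1].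
    have hu : nm (pt (zc c y) w u - zc c y) < r.
      rewrite /pt (_ : _ - _ = u%:C * (w - zc c y)); last by ring.
      rewrite nmM nm_real ger0_norm//; apply: le_lt_trans h2.
      by rewrite ler_piMl ?nm_ge0.
    by have [] := hr _ hu.
  have E := (th0 V th _ hf).1 (sub _ lw).
  by have := h1 wz; rewrite E eqxx.
- apply/seteqP; split=> y /= => [[sy Vy]|[Vy sy]]; first by split=> //; rewrite sy mul0r.
  by split=> //; exact: (th0 V th y hf).1.
by move=> y _ Vy; exact: (hm y V th hf Vy).
Qed.

End Sections.
(** * A positive line bundle has a divisor meeting all the leaves *)

Arguments k_tau {R X} p _ : rename.

Section PositiveDivisor.
Context {R : realType} {X : topologicalType} (L : lamination R X).
Local Notation C := (Cplx R).
Variable fr : set X -> (X -> C) -> Prop.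
Hypothesis H : frame_axioms L fr.
Implicit Types (k : @peak R X).

(** The Cauchy estimate for the difference with the affine function: the circle of radius [r] is at
    distance at least [r / 2] from [z], whence [e * r * (r / 2) ^- 2]. *)
Lemma cauchy_affine (g : C -> C) (a c0 c1 z : C) (r r' e : R) : 0 < r -> r < r' -> holb g a r' ->
  (forall w, nm (w - a) <= r -> nm (g w - (c0 + c1 * (w - a))) <= e) -> nm (z - a) <= r / 2 ->
  nm (cD g z - c1) <= 4 * e / r.
Proof.
move=> r0 rr hg gT zr; pose Eg w := g w - (c0 + c1 * (w - a)).
have sE w : nm (w - a) < r' -> sder Eg w (cD g w - c1) 0.
  move=> wr.
  have := sderB (hol_sder hg wr) (sderD (sder_cst c0 w) (sderZ c1 (sderB (sder_id w) (sder_cst a w)))).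
  by move=> q; apply: sder_eq q _ _; ring.
have hE : holb Eg a r' by move=> w /sE /sder_pder q; eexists; exact: q.
have z_r : nm (z - a) < r by flra.
have z_r' : nm (z - a) < r' by flra.
rewrite -(pder_cD (sder_pder (sE z z_r'))) (cauchy_D hE rr z_r).
apply: (@le_trans _ _ (e * r * (r - nm (z - a)) ^- 2)).
  by apply: ckernel_le => // t; apply: gT; rewrite nm_circ// ltW.
have e0 : 0 <= e by apply: le_trans (nm_ge0 _) (gT a _); rewrite subrr nm0 ltW.
have k1 : (r - nm (z - a)) ^- 2 <= (r / 2) ^- 2.
  by rewrite lef_pV2 ?posrE ?exprn_gt0//; [rewrite lerXn2r ?nnegrE; flra|flra..].
rewrite (_ : 4 * e / r = e * r * (r / 2) ^- 2); last by field; rewrite gt_eqF.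
by rewrite ler_wpM2l// mulr_ge0// ltW.
Qed.

(* [h ^ n] cannot cancel [c g] since [g] has a simple zero near [a]. *)
Lemma not_power (g h : C -> C) (a c : C) (r r' T e : R) n : 0 < r -> r < r' -> 1 / 2 <= T -> e < r / 16 ->
  holb g a r' -> holb h a r' -> c != 0 -> (1 < n)%N ->
  (forall w, nm (w - a) <= r -> nm (g w - T%:C * (w - a)) <= e) ->
  exists2 w, nm (w - a) <= r & h w ^+ n + c * g w != 0.
Proof.
move=> r0 rr T2 er hg hh c0 n1 gT; apply: contrapT => no.
have E w : nm (w - a) <= r -> h w ^+ n + c * g w = 0.
  by move=> wr; apply/eqP/negPn/negP => nz; apply: no; exists w.
have r20 : 0 < r / 2 by flra.
(* At the centre [g] is below [r / 16]; on the circle of radius [r / 2] it exceeds [T * r / 2 - e],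
   hence [r / 8]. *)
have [|||z zr gz] := @hol_zero_exists _ g a r' (r / 2) (r / 8) hg r20.
- flra.
- have := gT a; rewrite subrr nm0 mulr0 subr0 => /(_ (ltW r0)); flra.
- move=> t; have ct := @nm_circ _ a (r / 2) t (ltW r20).
  have := gT (circ a (r / 2) t); rewrite ct => h1.
  have h2 := nm_split (T%:C * (circ a (r / 2) t - a)) (g (circ a (r / 2) t)).
  rewrite nmC in h2; rewrite nmM nm_real ct ger0_norm in h2; last by flra.
  have : 1 / 2 * (r / 2) <= T * (r / 2) by rewrite ler_pM2r.
  have := h1 _; flra.
have zr' : nm (z - a) < r' by flra.
have hz : h z = 0.
  have := E z; rewrite gz mulr0 addr0 => /(_ _)/eqP; rewrite expf_eq0 => h1.
  by apply/eqP; have /andP[] := h1 ltac:(flra).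
have [b hb] := hh z zr'.
case: n n1 E {no} => [|[|n]] // _ E.
have [b' hb'] := pderX n.+1 hb.
have hp := pderM hb hb'; rewrite hz expr0n mul0r mulr0 addr0 in hp.
have hD := hol_sder hg zr'.
have E2 : \forall w \near z, (- c^-1) * (h w * h w ^+ n.+1) = g w.
  have z_r : nm (z - a) < r by flra.
  apply: filterS (near_ball z_r) => w /ltW /E; rewrite exprS => /eqP; rewrite addr_eq0 => /eqP ->.
  by rewrite mulrN mulNr opprK mulrA mulVf// mul1r.
have D0 : cD g z = 0.
  have hp2 := pder_near E2 (pderM (sder_pder (sder_cst (- c^-1) z)) hp).
  by rewrite (pder_cD hp2) mul0r mulr0 addr0.
have z_r2 : nm (z - a) <= r / 2 by exact: ltW.
have gT' w : nm (w - a) <= r -> nm (g w - (0 + T%:C * (w - a))) <= e by rewrite add0r; exact: gT.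
(* A zero of [h] has order at least 2 in [h ^ n], so the derivative of [g] vanishes at [z]; yet it
   is within [4 * e / r < 1 / 4] of [T >= 1 / 2]. *)
have := cauchy_affine r0 rr hg gT' z_r2; rewrite D0 sub0r nmN nm_real ger0_norm; last by flra.
have k4 : e / r < 1 / 16 by rewrite ltr_pdivrMr//; flra.
by rewrite -mulrA; flra.
Qed.

(** Uniform non-vanishing: [v] is null on no plaque of the box, and this survives a small
    perturbation. *)
Definition plaque_bound k (v : X -> C) := exists2 eta : R, 0 < eta & forall t, 1 / 2 <= k_tau k t ->
  exists2 w, nm (w - k_a k) <= k_r k & eta <= nm (v (pl (k_ch k) t w)).

(** The hypothesis of the minimum modulus principle, uniformly in the plaque: it forces a zero on
    each of them and survives a small perturbation. *)
Definition circle_bound k d (v : X -> C) := exists m0 m1 : R, 0 <= m0 < m1 /\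
  forall t, 1 / 2 <= k_tau k t -> nm (v (pl (k_ch k) t (k_a k)) * k_th k (pl (k_ch k) t (k_a k)) ^+ d) <= m0 /\
    forall w, nm (w - k_a k) = k_r k -> m1 <= nm (v (pl (k_ch k) t w) * k_th k (pl (k_ch k) t w) ^+ d).

Lemma pl_leaf_at (c : chart R X) x (w : C) : L c -> ch_dom c x -> nm w < 1 -> leaf L x (pl c (tc c x) w).
Proof. by move=> Lc hx w1; have := pl_leaf (tc c x) Lc (zc_lt hx) w1; rewrite pl_id. Qed.

Lemma half_le_neq0 (u : R) : 1 / 2 <= u -> u != 0.
Proof. by move=> h; rewrite gt_eqF//; flra. Qed.

Lemma plaque_bound_exists k d v : is_peak L fr setT k -> is_section L fr d v ->
  (forall t, 1 / 2 <= k_tau k t -> exists2 w, nm (w - k_a k) <= k_r k & v (pl (k_ch k) t w) != 0) ->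
  plaque_bound k v.
Proof.
move=> [_ [_ _ cK] [r' rr hV] _ _] hv h.
have hc : \forall eta \near (0 : R)^'+, forall t, 1 / 2 <= k_tau k t ->
    exists2 w, nm (w - k_a k) <= k_r k & eta <= nm (v (pl (k_ch k) t w)).
  move/compact_near_coveringP: cK; apply=> t /= ht.
  have [w wr vw] := h t ht; have [w1 _] := hV t w (half_le_neq0 ht) (le_trans wr (ltW rr)).
  have v0 : 0 < nm (v (pl (k_ch k) t w)) / 2 by rewrite divr_gt0// nm_gt0.
  have cv := (cvgR (nbhs_filter _) _ _).1 (sec_cont H hv (x := pl (k_ch k) t w)) _ v0.
  have [r0 r00 h0] := near_prod_ball (near_inv w1 cv).
  exists ([set t' | `|nm (v (pl (k_ch k) t' w)) - nm (v (pl (k_ch k) t w))| < nm (v (pl (k_ch k) t w)) / 2],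
          [set e : R | e < nm (v (pl (k_ch k) t w)) / 2]) => /=.
    split; last exact: nbhs_right_lt.
    by apply: filterS h0 => t' /(_ w); rewrite subrr nm0 => /(_ r00)[].
  by move=> [t' e] /= [/ltr_normlP[h1 h2] h3]; exists w => //; flra.
have [eta [eta0 he]] := filter_ex (filterI (nbhs_right_gt (0 : R)) hc).
by exists eta.
Qed.

Lemma peak_holb k d v t : is_peak L fr setT k -> is_section L fr d v -> 1 / 2 <= k_tau k t ->
  exists2 r', k_r k < r' &
    holb (fun w => v (pl (k_ch k) t w) * k_th k (pl (k_ch k) t w) ^+ d) (k_a k) r'.
Proof.
move=> [[Lk hf _ _ _] _ [r' rr hV] _ _] hv /half_le_neq0 ht; exists r' => //.
by apply: (hol_on_holb (hv _ _ hf) Lk) => w /ltW wr; exact: hV t w ht wr.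
Qed.

(** The peak datum [w - a] gives sections with a simple zero near the centre of each plaque; the
    error [r / 16] is the one tolerated by [not_power]. *)
Lemma zero_section k : is_peak L fr setT k -> exists d0, forall d, (d0 <= d)%N ->
  exists2 u, is_section L fr d u & exists2 e : R, 0 <= e < k_r k / 16 &
    forall t w, 1 / 2 <= k_tau k t -> nm (w - k_a k) <= k_r k ->
      nm (u (pl (k_ch k) t w) * k_th k (pl (k_ch k) t w) ^+ d - (k_tau k t)%:C * (w - k_a k)) <= e.
Proof.
move=> [[Lk hf r0 C0 [_ b01]] _ _ _ hs].
have r16 : 0 < k_r k / 16 by rewrite divr_gt0.
have [n hn] := exprn_small (k_C k) b01 r16; have /andP[b0 b1] := b01.
exists (maxn n (k_d k)) => d; rewrite geq_max => /andP[nd dd].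
have [||u [hu _ ue]] := hs d (fun w => w - k_a k) dd.
- by move=> w; exists (1 - 0); apply: sder_eq (sderB (sder_id w) (sder_cst _ w)) _ _; rewrite ?subr0.
- by [].
exists u => //; exists (k_C k * k_b k ^+ d); last by move=> t w /half_le_neq0 ht wr; exact: ue.
rewrite mulr_ge0 ?exprn_ge0 ?(ltW C0)//= (le_lt_trans _ hn)// mulrC ler_wpM2r ?(ltW C0)//.
by rewrite ler_wiXn2l ?(ltW b1).
Qed.

Lemma zero_section_circle k d u (e : R) : is_peak L fr setT k -> 0 <= e < k_r k / 16 ->
  (forall t w, 1 / 2 <= k_tau k t -> nm (w - k_a k) <= k_r k ->
      nm (u (pl (k_ch k) t w) * k_th k (pl (k_ch k) t w) ^+ d - (k_tau k t)%:C * (w - k_a k)) <= e) ->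
  circle_bound k d u.
Proof.
move=> [[_ _ r0 _ _] _ _ _ _] /andP[e0 er] hu; exists e, (k_r k / 2 - e); split; first by flra.
move=> t ht; split=> [|w wr].
  by have := hu t (k_a k) ht; rewrite subrr nm0 mulr0 subr0; apply; exact: ltW.
have := hu t w ht; rewrite wr lexx => /(_ isT) h1.
set g := u _ * _ in h1 *; have := nm_split ((k_tau k t)%:C * (w - k_a k)) g.
rewrite (nmC _ g) nmM nm_real wr ger0_norm; last by flra.
have : 1 / 2 * k_r k <= k_tau k t * k_r k by rewrite ler_pM2r.
flra.
Qed.

Lemma plaque_bound_unif (I : eqType) (ks : I -> @peak R X) (s : seq I) v :
  (forall i, i \in s -> plaque_bound (ks i) v) ->
  exists2 eta : R, 0 < eta & forall i t, i \in s -> 1 / 2 <= k_tau (ks i) t ->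
    exists2 w, nm (w - k_a (ks i)) <= k_r (ks i) & eta <= nm (v (pl (k_ch (ks i)) t w)).
Proof.
elim: s => [|i s IH] h; first by exists 1.
have [|e e0 he] := IH; first by move=> j js; apply: h; rewrite inE js orbT.
have [e' e0' he'] := h i (mem_head _ _).
exists (Num.min e e'); first by rewrite lt_min e0.
move=> j t; rewrite inE => /orP[/eqP Ej|js] ht; first subst j.
  by have [w wr hw] := he' t ht; exists w => //; rewrite ge_min hw orbT.
by have [w wr hw] := he j t js ht; exists w => //; rewrite ge_min hw.
Qed.

Lemma extend_bounds k0 (I : eqType) (ks : I -> @peak R X) (s : seq I) i d v :
  is_peak L fr setT k0 -> (forall i, is_peak L fr setT (ks i)) -> (0 < d)%N -> is_section L fr d v ->
  circle_bound k0 d v -> (forall j, j \in s -> plaque_bound (ks j) v) ->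
  exists d' v', [/\ (0 < d')%N, is_section L fr d' v', circle_bound k0 d' v' &
    forall j, j \in i :: s -> plaque_bound (ks j) v'].
Proof.
move=> p0 pk d0 hv [m0 [m1 [/andP[m00 m01] hm]]] /plaque_bound_unif[eta eta0 heta].
have [dk hdk] := zero_section (pk i).
(* The power must be at least 2 for [not_power] and bring the degree up to where [u] exists. *)
have [n n1 dn] : exists2 n, (1 < n)%N & (dk <= n * d)%N.
  by exists dk.+2 => //; apply: (@leq_trans dk.+2); [rewrite leqW|rewrite leq_pmulr].
have [u hu [e /andP[e0 er] ue]] := hdk _ dn.
have [M M0 uM] := sec_bounded H hu.
have Q0 : 0 < k_Q k0 by case: p0 => [[_ _ _ _ []]].
have mn : m0 ^+ n < m1 ^+ n by rewrite ltrXn2r ?nnegrE ?(ltW (le_lt_trans m00 m01)) ?m00// -lt0n ltnW.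
have n0 : (0 < n)%N by exact: ltnW.
have en0 : 0 < eta ^+ n by rewrite exprn_gt0.
pose M2 := M * k_Q k0 ^+ (n * d); have M20 : 0 < M2 by rewrite mulr_gt0// exprn_gt0.
(* Small enough to keep half of [eta ^ n] on the boxes already treated and to preserve the gap
   between [m0 ^ n] and [m1 ^ n]. *)
have [c c0 [cM cM2]] : exists2 c : R, 0 < c & c * M <= eta ^+ n / 2 /\ c * M2 < (m1 ^+ n - m0 ^+ n) / 2.
  exists (Num.min (eta ^+ n / 2 / M) ((m1 ^+ n - m0 ^+ n) / 4 / M2)).
    by rewrite lt_min !divr_gt0// subr_gt0.
  split; first by rewrite -ler_pdivlMr// ge_min lexx.
  rewrite -ltr_pdivlMr// gt_min; apply/orP; right; rewrite ltr_pM2r ?invr_gt0//.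
  by have : 0 < m1 ^+ n - m0 ^+ n; [rewrite subr_gt0|flra].
have cn : nm (c%:C : C) = c by rewrite nm_real gtr0_norm.
have hv' : is_section L fr (n * d) (fun x => v x ^+ n + c%:C * u x) by exact: secDZ (secX _ _) _.
have E th x : (v x ^+ n + c%:C * u x) * th x ^+ (n * d) = (v x * th x ^+ d) ^+ n + c%:C * (u x * th x ^+ (n * d)) :> C.
  by rewrite exprMn -exprM (mulnC d) mulrDl mulrA.
exists (n * d)%N, (fun x => v x ^+ n + c%:C * u x); split=> //.
- by rewrite muln_gt0 n0.
- exists (m0 ^+ n + c * M2), (m1 ^+ n - c * M2); split.
    have k1 : 0 <= c * M2 by rewrite mulr_ge0 ?(ltW c0) ?(ltW M20).
    have k2 : 0 <= m0 ^+ n by rewrite exprn_ge0.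
    by apply/andP; split; flra.
  have uQ t w : 1 / 2 <= k_tau k0 t -> nm (w - k_a k0) <= k_r k0 ->
      nm (c%:C * (u (pl (k_ch k0) t w) * k_th k0 (pl (k_ch k0) t w) ^+ (n * d))) <= c * M2.
    case: p0 => _ _ _ hQ _ /half_le_neq0 ht wr; rewrite nmM cn nmM nmX ler_wpM2l ?(ltW c0)//.
    rewrite /M2 ler_pM ?nm_ge0 ?exprn_ge0 ?nm_ge0// lerXn2r ?nnegrE ?nm_ge0 ?(ltW Q0)//.
    exact: hQ.
  have r0 : 0 <= k_r k0 by case: p0 => [[_ _ /ltW]].
  move=> t ht; have [h1 h2] := hm t ht; split=> [|w wr].
    rewrite E (le_trans (nmD _ _))// lerD//; last by apply: uQ => //; rewrite subrr nm0.
    by rewrite nmX lerXn2r ?nnegrE ?nm_ge0.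
  rewrite E; set f1 := (v _ * _) ^+ n; set f2 := c%:C * _.
  have h3 : nm f2 <= c * M2 by apply: uQ => //; rewrite wr.
  have h4 : m1 ^+ n <= nm f1.
    by rewrite nmX lerXn2r ?nnegrE ?nm_ge0 ?h2// ltW// (le_lt_trans m00).
  have := nm_split f1 (f1 + f2); rewrite opprD addNKr nmN; flra.
move=> j; rewrite inE => /orP[/eqP ->|js].
  apply: (plaque_bound_exists (pk i) hv') => t ht.
  have [r1 rr1 hg] := peak_holb (pk i) hu ht; have [r2 rr2 hh] := peak_holb (pk i) hv ht.
  have rr : k_r (ks i) < Num.min r1 r2 by rewrite lt_min rr1.
  have hg' := holb_le (_ : Num.min r1 r2 <= r1) hg; have hh' := holb_le (_ : Num.min r1 r2 <= r2) hh.
  have r0 : 0 < k_r (ks i) by case: (pk i) => [[_ _]].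
  have cC : c%:C != 0 :> C by rewrite -nm_gt0 cn.
  have [||w wr nz] := not_power r0 rr ht er (hg' _) (hh' _) cC n1 (fun w => ue t w ht).
  - by rewrite ge_min lexx.
  - by rewrite ge_min lexx orbT.
  exists w => //; apply: contraNneq nz => v0; rewrite -E v0 mul0r//.
exists (eta ^+ n / 2); first by rewrite divr_gt0.
move=> t ht; have [w wr hw] := heta j t js ht; exists w => //.
have h1 : eta ^+ n <= nm (v (pl (k_ch (ks j)) t w) ^+ n) by rewrite nmX lerXn2r ?nnegrE ?nm_ge0 ?(ltW eta0).
set x := pl _ t w in h1 *.
have h2 : nm (c%:C * u x) <= c * M by rewrite nmM cn ler_wpM2l ?(ltW c0).
have := nm_split (v x ^+ n) (v x ^+ n + c%:C * u x); rewrite opprD addNKr nmN; flra.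
Qed.

(** One section is built per box of a finite cover, with zeros on all plaques of that box and null
    on no leaf; their product vanishes somewhere on every leaf. Each factor is needed to be non-null
    everywhere for the product to have a divisor. *)
Theorem positive_divisor : exists (D : set X) (m : X -> nat),
  is_divisor L D m /\ forall x, leaf L x `&` D !=set0.
Proof.
have /choice[kx hk] x := peak_exists H (@filterT _ _ (nbhs_filter x)).
pose O x := [set y | ch_dom (k_ch (kx x)) y /\ 1 / 2 <= k_tau (kx x) (tc (k_ch (kx x)) y)].
have [x _|s hs] := @finite_cover X setT O (fx_compact H).
  have [[_ [ct _ _] _ _ _] dx tx _] := hk x.
  have e2 : (0 : R) < 1 / 2 by flra.
  have := tc_continuous dx ((cvgR (nbhs_filter _) _ _).1 (ct (tc (k_ch (kx x)) x)) _ e2).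
  rewrite tx => h; have {}h : \forall y \near x, `|k_tau (kx x) (tc (k_ch (kx x)) y) - 1| < 1 / 2 by exact: h.
  by apply: filterS2 h (near_dom dx) => y /ltr_normlP[h1 h2] dy; split=> //; flra.
pose ks (i : 'I_(size s)) := kx (tnth (in_tuple s) i).
have pk i : is_peak L fr setT (ks i) by have [] := hk (tnth (in_tuple s) i).
have cov y : exists i, ch_dom (k_ch (ks i)) y /\ 1 / 2 <= k_tau (ks i) (tc (k_ch (ks i)) y).
  have [x [xs _ Ox]] := hs y I; have [i ix] := tnthP (in_tuple s) x xs.
  by exists i; rewrite /ks -ix.
have hb i (l : seq 'I_(size s)) : exists d v, [/\ (0 < d)%N, is_section L fr d v, circle_bound (ks i) d v &
    forall j, j \in l -> plaque_bound (ks j) v].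
  elim: l => [|j l [d [v [d0 hv hc hp]]]].
    have [d0 h] := zero_section (pk i); have [u hu [e he ue]] := h d0.+1 (leqnSn _).
    exists d0.+1, u; split=> //; exact: zero_section_circle (pk i) he ue.
  exact: extend_bounds (pk i) pk d0 hv hc hp.
have /choice[d /choice[v hv]] i := hb i (index_enum _).
have hS := sec_prod (fun i => let: And4 _ h _ _ := hv i in h).
(* If [v i] were null near [x], it would be null on the leaf of [x], including a plaque where
   [plaque_bound] keeps it away from 0. *)
have iv i x : isolated_zero L (v i) x.
  have [_ hvi _ hp] := hv i.
  have [nx|//] := sec_null_or_isolated H x hvi.
  have [j [dx tx]] := cov x; have [e e0 /(_ _ tx)[w wr hw]] := hp j (mem_index_enum _).
  have [[Lk _ _ _ _] _ [r' rr hV] _ _] := pk j.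
  have [w1 _] := hV _ w (half_le_neq0 tx) (le_trans wr (ltW rr)).
  have [c [_ dc nc]] := leaf_null_leaf (fun y => sec_null_or_isolated H y hvi) nx (pl_leaf_at Lk dx w1).
  by have := nbhs_singleton nc; rewrite pl_id// => v0; move: hw; rewrite v0 nm0 leNgt e0.
have [m hm] := sec_divisor H hS (fun x => isolated_prod (iv^~ x)).
exists [set x | \prod_i v i x = 0], m; split=> // x.
have [i [dx tx]] := cov x; have [_ hvi [m0 [m1 [/andP[m00 m01] hc]]] _] := hv i.
have [r' rr hg] := peak_holb (pk i) hvi tx.
have [[Lk hf r0 _ _] _ [r2 rr2 hV] _ _] := pk i.
have [h1 h2] := hc _ tx.
have [|t|w wr] := hol_zero_exists hg r0 rr (m := m1).
- exact: le_lt_trans h1 m01.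
- by apply: h2; rewrite nm_circ// ltW.
move=> /eqP; rewrite mulf_eq0 (negbTE (expf_neq0 (d i) (fx_th0 H _ hf))) orbF => /eqP v0.
exists (pl (k_ch (ks i)) (tc (k_ch (ks i)) x) w); split.
  have [w1 _] := hV _ w (half_le_neq0 tx) (le_trans (ltW wr) (ltW rr2)).
  exact: pl_leaf_at.
by apply/eqP/prodf_eq0; exists i => //; rewrite v0.
Qed.

End PositiveDivisor.
(** * The positive line bundle of a divisor *)

Section DivisorBundle.
Context {R : realType} {X : topologicalType} (L : lamination R X).
Local Notation C := (Cplx R).
Variables (D : set X) (m : X -> nat).
Hypothesis cD_ : closed D.

Definition cx (x : X) : chart R X := projT1 (cid2 (chart_ex L x)).

Lemma cx_L x : L (cx x). Proof. by rewrite /cx; case: cid2. Qed.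
Lemma cx_dom x : ch_dom (cx x) x. Proof. by rewrite /cx; case: cid2. Qed.

Record local_eqn (V : set X) (f : X -> C) : Prop := LocalEqn {
  le_open : open V;
  le_hol : hol_on L V f;
  le_D : forall x, V x -> f x = 0 <-> D x;
  le_m : forall x, V x -> D x -> leaf_multiplicity L f x (m x) }.

Definition lc_spec (f : X -> C) x (v : C) := v != 0 /\ exists h, [/\ v = h (zc (cx x) x),
  \forall w \near zc (cx x) x, exists a, pder h w a &
  \forall w \near zc (cx x) x, f (pl (cx x) (tc (cx x) x) w) = (w - zc (cx x) x) ^+ m x * h w].

(* The leading coefficient of [f] at [x], in the coordinate chosen at [x] *)
Definition lc (f : X -> C) x : C :=
  if `[< D x >] then xget 1 [set v | lc_spec f x v] else if f x == 0 then 1 else f x.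

(** The default values of [lc] are 1 so that it vanishes nowhere, even where [f] is no local
    equation. *)
Lemma lc_neq0 f x : lc f x != 0.
Proof.
rewrite /lc; case: asboolP => _; last by case: ifPn => //; rewrite oner_neq0.
by case: xgetP => [v _ [v0 _]|_]; [exact: v0|exact: oner_neq0].
Qed.

Lemma lc_D V f x : local_eqn V f -> V x -> D x -> lc_spec f x (lc f x).
Proof.
move=> lf Vx Dx; rewrite /lc asboolT//.
have [h [dh h0 fE]] := le_m lf Vx Dx (cx_L x) (cx_dom x).
have : lc_spec f x (h (zc (cx x) x)).
  split=> //; exists h; split=> //.
  by apply: filterS dh => w; exact: (derivable_pder _ _).1.
by case: xgetP => [v _ //|/(_ _) nv hv]; exfalso; exact: nv hv.
Qed.

Lemma lcE V f x : local_eqn V f -> V x -> ~ D x -> lc f x = f x.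
Proof.
move=> lf Vx nD; rewrite /lc asboolF//; case: eqP => // f0.
by exfalso; apply: nD; apply/(le_D lf Vx).
Qed.

Lemma near_nD x : ~ D x -> \forall y \near x, ~ D y.
Proof. by move=> nD; apply: open_nbhs_nbhs; split=> //; rewrite openC. Qed.

Lemma near_V V f x : local_eqn V f -> V x -> \forall y \near x, V y.
Proof. by move=> lf Vx; apply: open_nbhs_nbhs; split=> //; exact: le_open lf. Qed.

Lemma local_eqn1 : local_eqn (~` D) (fun=> 1).
Proof.
split; first by rewrite openC.
- by move=> x _; exact: hol_at_cst.
- by move=> x nD; split=> [/eqP|/nD//]; rewrite oner_eq0.
by move=> x nD /nD.
Qed.

Section Ratio.
Variables (V V' : set X) (f f' : X -> C).
Hypotheses (lf : local_eqn V f) (lf' : local_eqn V' f').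
Local Notation u := (fun y => lc f y / lc f' y).

Lemma ratio_hol_nD x : V x -> V' x -> ~ D x -> hol_at L u x.
Proof.
move=> Vx V'x nD.
have f0 : f' x != 0 by apply/eqP => /(le_D lf' V'x).
apply: hol_at_near (hol_at_div f0 (le_hol lf Vx) (le_hol lf' V'x)).
apply: filterS3 (near_V lf Vx) (near_V lf' V'x) (near_nD nD) => y h1 h2 h3.
by rewrite (lcE lf)// (lcE lf').
Qed.

Lemma near_not_D x : V x -> D x -> \forall w \near zc (cx x) x, w != zc (cx x) x ->
  ~ D (pl (cx x) (tc (cx x) x) w).
Proof.
move=> Vx Dx; have [v0 [h [vE dh fE]]] := lc_D lf Vx Dx.
have hz : cnm h (zc (cx x) x) by have [a /pder_cnm] := nbhs_singleton dh.
have n0 : 0 < nm (h (zc (cx x) x)) by rewrite nm_gt0 -vE.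
have [d d0 hd] := hz _ n0.
have nd : \forall w \near zc (cx x) x, nm (w - zc (cx x) x) < d by exact: nbhs_nm_lt.
apply: filterS3 fE nd (near_plaque_at (cx_dom x) (near_V lf Vx)) => w fw wd [_ Vw] wz.
move=> /(le_D lf Vw); rewrite fw => /eqP; rewrite mulf_eq0 expf_eq0 subr_eq0 (negbTE wz) andbF /= => /eqP hw.
by have := hd w wd; rewrite hw sub0r nmN ltxx.
Qed.

Lemma ratio_lwd x c : V x -> V' x -> L c -> ch_dom c x -> exists a, lwd c u x a 0.
Proof.
move=> Vx V'x Lc hx; have [Dx|nD] := pselect (D x); last first.
  by have [_ h] := ratio_hol_nD Vx V'x nD; exact: h.
have [v0 [h [vE dh fE]]] := lc_D lf Vx Dx; have [v0' [h' [vE' dh' fE']]] := lc_D lf' V'x Dx.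
set z := zc (cx x) x in vE vE' dh dh' fE fE' *.
have h'0 : h' z != 0 by rewrite -vE'.
have sh := pder_near_sder dh; have sh' := pder_near_sder dh'.
have E : \forall w \near z, h w / h' w = u (pl (cx x) (tc (cx x) x) w).
  have nVV : \forall y \near x, V y /\ V' y by apply: filterI; [exact: near_V lf Vx|exact: near_V lf' V'x].
  have nV := near_plaque_at (cx_dom x) nVV.
  have fEE : \forall w \near z, f (pl (cx x) (tc (cx x) x) w) = (w - z) ^+ m x * h w /\
    f' (pl (cx x) (tc (cx x) x) w) = (w - z) ^+ m x * h' w by apply: filterI.
  apply: filterS3 fEE (near_not_D Vx Dx) nV => w [e1 e2] nDw [_ [Vw V'w]].
  have [->|wz] := eqVneq w z; first by rewrite pl_id ?vE ?vE'//; exact: cx_dom.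
  have nD := nDw wz; rewrite (lcE lf)// (lcE lf')// e1 e2.
  have f'0 : f' (pl (cx x) (tc (cx x) x) w) != 0 by apply/eqP => /(le_D lf' V'w).
  rewrite e2 in f'0; have wk : (w - z) ^+ m x != 0 by apply: contraNneq f'0 => ->; rewrite mul0r.
  have h'w : h' w != 0 by apply: contraNneq f'0 => ->; rewrite mulr0.
  by field; rewrite h'w.
have s : lwd (cx x) u x _ _ := sder_near E (sderM sh (sder_comp sh' (sder_inv h'0))).
have := lwd_change Lc (cx_L x) hx (cx_dom x) s.
move=> s'.
by eexists; apply: sder_eq s' (erefl _) _; rewrite !(mulr0, mul0r, addr0).
Qed.

(** These quotients are the transition functions of the line bundle of the divisor. At a point of
    [D] continuity is not direct, as the zeros move from plaque to plaque: the functions on two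
    plaques are compared on a circle that avoids [D], and Cauchy's formula for their difference
    gives the inside. *)
Lemma ratio_hol : hol_on L (V `&` V') u.
Proof.
move=> x [Vx V'x]; split; last by move=> c Lc hx; exact: ratio_lwd.
have [Dx|nD] := pselect (D x); last by have [] := ratio_hol_nD Vx V'x nD.
apply/contP => e e0.
pose c := cx x; have Lc : L c := cx_L x; have hx : ch_dom c x := cx_dom x.
pose z0 := zc c x; pose t0 := tc c x; have z1 : nm z0 < 1 by exact: zc_lt.
have oVV : \forall y \near pl c t0 z0, V y /\ V' y.
  by rewrite pl_id//; apply: filterI; [exact: near_V lf Vx|exact: near_V lf' V'x].
have [r r0 hr] := near_prod_ball (near_inv z1 oVV).
have [r1 r10 hr1] := (nbhs_nm _ _).1 (near_not_D Vx Dx).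
have hb : \forall t \near t0, holb (fun w => u (pl c t w)) z0 r.
  apply: filterS hr => t ht w /ht[w1 [Vw V'w]].
  have [a ha] := ratio_lwd Vw V'w Lc (pl_dom t w1).
  by exists a; move: ha; rewrite /lwd tc_pl// zc_pl// => /sder_pder.
have [rho rho0 [rr rr1]] : exists2 rho : R, 0 < rho & rho < r /\ rho < r1.
  exists (Num.min r r1 / 2); first by rewrite divr_gt0// lt_min r0.
  have h1 : Num.min r r1 <= r by rewrite ge_min lexx.
  have h2 : Num.min r r1 <= r1 by rewrite ge_min lexx orbT.
  by split; flra.
have e8 : 0 < e / 8 by flra.
have hT : \forall t \near t0, forall w, nm (w - z0) = rho -> nm (u (pl c t w) - u (pl c t0 w)) <= e / 8.
  have cA : compact [set w : C | rho <= nm (w - z0) <= rho] by exact: annulus_compact.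
  have : \forall t \near t0, forall w, rho <= nm (w - z0) <= rho -> nm (u (pl c t w) - u (pl c t0 w)) <= e / 8.
    apply: (tube (P := fun w t => nm (u (pl c t w) - u (pl c t0 w)) <= e / 8) cA) => w /=.
    rewrite -eq_le => /eqP wr; have wr' : nm (w - z0) < r by rewrite -wr.
    have [w1 [Vw V'w]] := nbhs_singleton hr w wr'.
    have nD : ~ D (pl c t0 w).
      by apply: hr1; rewrite -?wr// -subr_eq0 -nm_gt0 -wr.
    have [cu _] := ratio_hol_nD Vw V'w nD; have e16 : 0 < e / 16 by flra.
    have [r2 r20 hr2] := near_prod_ball (cont_plaque cu w1 e16).
    have h0 := nbhs_singleton hr2.
    exists ([set y | nm (y - w) < r2], [set t | forall y, nm (y - w) < r2 -> nm (u (pl c t y) - u (pl c t0 w)) < e / 16]).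
      by split; [exact: nbhs_nm_lt|exact: hr2].
    move=> [y t] [/= hy ht]; have k1 := ht y hy; have k2 := h0 y hy; rewrite /= in k2.
    have := nm_tri (u (pl c t y)) (u (pl c t0 w)) (u (pl c t0 y)).
    by rewrite (nmC (u (pl c t0 w))); move: k1 k2; clear; flra.
  by apply: filterS => t ht w wr; apply: ht; rewrite wr lexx.
have hb0 := nbhs_singleton hb.
have z00 : nm (z0 - z0) < r by rewrite subrr nm0.
have e2 : 0 < e / 2 by flra.
have [d d0 hd] := holb_cnm hb0 z00 e2.
have key : \forall y \near x, tc c y = tc c y /\ (holb (fun w => u (pl c (tc c y) w)) z0 r /\
    forall w, nm (w - z0) = rho -> nm (u (pl c (tc c y) w) - u (pl c t0 w)) <= e / 8).
  have := tc_continuous hx (filterI hb hT) => h.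
  have {}h : \forall y \near x, holb (fun w => u (pl c (tc c y) w)) z0 r /\
    forall w, nm (w - z0) = rho -> nm (u (pl c (tc c y) w) - u (pl c t0 w)) <= e / 8 by exact: h.
  by apply: filterS h.
have rd : 0 < Num.min (rho / 2) d by rewrite lt_min divr_gt0.
have zc_near := (contP _ _).1 (zc_continuous hx) _ rd.
apply: filterS3 key zc_near (near_dom hx) => y [_ [hy ty]] zy dy.
move: zy; rewrite lt_min => /andP[zy1 zy2]; set w := zc c y in zy1 zy2.
have wr : nm (w - z0) < rho by rewrite (lt_trans zy1)//; flra.
pose F w := u (pl c (tc c y) w) - u (pl c t0 w).
have hF : holb F z0 r.
  move=> v vr; have := sderB (hol_sder hy vr) (hol_sder hb0 vr) => s.
  by eexists; apply: sder_pder; apply: sder_eq s (erefl _) _; rewrite subr0.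
have b1 : nm (F w) <= e / 8 * rho * (rho - nm (w - z0)) ^- 1.
  rewrite (cauchy hF rr wr); apply: ckernel_le => // s.
  by apply: ty; rewrite nm_circ// ltW.
have b2 : nm (F w) <= e / 4.
  apply: (le_trans b1); rewrite expr1 ler_pdivrMr; last by rewrite subr_gt0.
  have h : rho / 2 <= rho - nm (w - z0) by flra.
  by have := ler_wpM2l (ltW e8) h; flra.
have := hd w zy2 => b3.
rewrite -[in X in nm X](pl_id dy) -/w.
have -> : u (pl c (tc c y) w) - u x = F w + (u (pl c t0 w) - u (pl c t0 z0)).
  by rewrite /F /z0 /t0 pl_id//; ring.
by rewrite (le_lt_trans (nmD _ _))//; move: b3; rewrite /=; flra.
Qed.

End Ratio.

End DivisorBundle.
Lemma pderD (R : realType) (u v : Cplx R -> Cplx R) z a b : pder u z a -> pder v z b ->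
  pder (fun w => u w + v w) z (a + b).
Proof.
move=> hu hv e e0; have e2 : 0 < e / 2 by flra.
have [d d0 hd] := hu _ e2; have [d' d'0 hd'] := hv _ e2.
exists (Num.min d d'); first by rewrite lt_min d0.
move=> w; rewrite lt_min => /andP[/hd h1 /hd' h2].
rewrite (_ : _ - _ = (u w - u z - a * (w - z)) + (v w - v z - b * (w - z))); last by ring.
by rewrite (le_trans (nmD _ _))//; flra.
Qed.

(** * Positive metrics on the line bundle of a divisor *)

Section Metric.
Context {R : realType} {X : topologicalType} (L : lamination R X).
Local Notation C := (Cplx R).
Variables (D : set X) (m : X -> nat).
Hypotheses (cX : compact [set: X]) (hX : hausdorff_space X) (cD_ : closed D).
Local Notation local_eqn := (local_eqn L D m).
Local Notation lc := (lc L D m).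
Hypothesis leq_ex : forall x, exists V f, local_eqn V f /\ V x.

(** The singular metric given by the divisor: for a local equation [f] the quantity
    [nm (lc f) ^ 2 * p0] is [nm f ^ 2], flat off [D] and degenerate on [D]. *)
Definition p0 (x : X) : R := if `[< D x >] then 0 else 1.

Lemma p0_ge0 x : 0 <= p0 x <= 1.
Proof. by rewrite /p0; case: ifP; rewrite ?lexx ?ler01. Qed.

Lemma p0_lc V f x : local_eqn V f -> V x -> nm (lc f x) ^+ 2 * p0 x = nm (f x) ^+ 2.
Proof.
move=> lf Vx; rewrite /p0; case: asboolP => Dx; last by rewrite mulr1 (lcE lf).
by rewrite mulr0 (_ : f x = 0) ?nm0 ?expr0n//; apply/(le_D lf).
Qed.

(* The local weight [- log (|lc f| ^ 2 * r)] is strictly subharmonic along the leaf at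
   [x]: it lies above the harmonic function [log |E| ^ 2] which agrees with it at [x]. *)
Definition strict (r : X -> R) x := exists c V f (E : C -> C),
  [/\ L c /\ ch_dom c x, local_eqn V f /\ V x, \forall w \near zc c x, exists a, pder E w a,
     E (zc c x) = 1 &
     \forall w \near zc c x, w != zc c x ->
       nm (lc f x) ^+ 2 * r x < nm (lc f (pl c (tc c x) w)) ^+ 2 * r (pl c (tc c x) w) * nm (E w) ^+ 2].

Definition norm_cont (r : X -> R) x := forall V f, local_eqn V f -> V x ->
  {for x, continuous (fun y => nm (lc f y) ^+ 2 * r y)}.

(** A metric that improves on [p0] and is strictly positive wherever it exceeds it; the goal is one
    that exceeds [p0] everywhere. *)
Record good (r : X -> R) : Prop := Good {
  gd_ge : forall x, p0 x <= r x;
  gd_cont : forall x, norm_cont r x;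
  gd_strict : forall x, p0 x < r x -> strict r x }.

Lemma lc2_gt0 f x : 0 < nm (lc f x) ^+ 2.
Proof. by rewrite exprn_gt0// nm_gt0 lc_neq0. Qed.

(** Raising the metric elsewhere preserves the inequality centred at [x]; this is what makes maxima
    of metrics work. *)
Lemma strict_ge r r' x : strict r x -> r' x = r x -> (forall y, r y <= r' y) -> strict r' x.
Proof.
move=> [c [V [f [E [h1 h2 h3 h4 h5]]]]] rE rr; exists c, V, f, E; split=> //.
apply: filterS h5 => w h wz; rewrite rE (lt_le_trans (h wz))//.
by rewrite ler_wpM2r ?exprn_ge0 ?nm_ge0// ler_wpM2l ?exprn_ge0 ?nm_ge0.
Qed.

Lemma norm_cont_near r r' x : (\forall y \near x, r y = r' y) -> norm_cont r x -> norm_cont r' x.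
Proof.
move=> E h V f lf Vx; apply: cont_near (h V f lf Vx).
by apply: filterS E => y ->.
Qed.

Lemma norm_cont_max r r' x : norm_cont r x -> norm_cont r' x -> norm_cont (fun y => Num.max (r y) (r' y)) x.
Proof.
move=> h h' V f lf Vx.
rewrite (_ : (fun y => _) = (fun y => Num.max (nm (lc f y) ^+ 2 * r y) (nm (lc f y) ^+ 2 * r' y))).
  exact: continuous_max (h V f lf Vx) (h' V f lf Vx).
by apply/funext => y; rewrite maxr_pMr// exprn_ge0// nm_ge0.
Qed.

Lemma good_p0 : good p0.
Proof.
split=> // [x V f lf Vx|x]; last by rewrite ltxx.
have [cf _] := le_hol lf Vx.
have E : \forall y \near x, nm (f y) ^+ 2 = nm (lc f y) ^+ 2 * p0 y.
  by apply: filterS (near_V lf Vx) => y Vy; rewrite (p0_lc lf).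
apply: cont_near E _; apply: (@continuous_comp _ _ _ (fun y => nm (f y)) (fun u => u ^+ 2)).
  by apply: continuous_comp cf _; exact: nm_continuous.
exact: exprn_continuous.
Qed.

Lemma good_max r q : good r ->
  (forall x, (\forall y \near x, q y <= r y) \/ norm_cont q x /\ (p0 x < q x -> strict q x)) ->
  good (fun x => Num.max (r x) (q x)).
Proof.
move=> gr hq; split.
- by move=> x; rewrite le_max gd_ge.
- move=> x; case: (hq x) => [h|[h _]]; last by apply: norm_cont_max => //; exact: gd_cont.
  apply: (@norm_cont_near r); last exact: gd_cont.
  by apply: filterS h => y /max_l ->.
move=> x; have [qr|rq] := leP (q x) (r x).
  move=> pr; apply: (strict_ge (gd_strict gr pr)); first by rewrite max_l.
  by move=> y; rewrite le_max lexx.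
move=> pq; case: (hq x) => [/nbhs_singleton|[_ /(_ pq) h]]; first by rewrite leNgt rq.
by apply: (strict_ge h) => [|y]; [rewrite max_r// ltW|rewrite le_max lexx orbT].
Qed.

Lemma good_max2 r r' : good r -> good r' -> good (fun x => Num.max (r x) (r' x)).
Proof.
by move=> gr gr'; apply: good_max => // x; right; split; [exact: gd_cont|exact: gd_strict].
Qed.

(* Cauchy-Schwarz: [(al + de |u|^2)(al + de |v|^2) - |al + de u (cj v)|^2 = al de |u - v|^2] *)
Lemma quad_strict (al de : R) (w : C -> C) z : 0 < al -> 0 < de ->
  (\forall x \near z, exists a, pder w x a) -> (\forall x \near z, x != z -> w x != w z) ->
  exists E : C -> C, [/\ \forall x \near z, exists a, pder E x a, E z = 1 &
    \forall x \near z, x != z ->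
      al + de * nm (w z) ^+ 2 < (al + de * nm (w x) ^+ 2) * nm (E x) ^+ 2].
Proof.
move=> al0 de0 dw iw; pose k := al + de * nm (w z) ^+ 2.
have k0 : 0 < k by rewrite /k ltr_pwDl// mulr_ge0 ?exprn_ge0 ?nm_ge0 ?ltW.
pose g x : C := al%:C + de%:C * (w x * cj (w z)).
have gz : g z = k%:C by rewrite /g -nm_sqr /k [in RHS]rmorphD [in RHS]rmorphM.
have k0C : k%:C != 0 :> C by rewrite -nm_gt0 nm_real gtr0_norm.
have cw : cnm w z by have [a /pder_cnm] := nbhs_singleton dw.
have sw := pder_near_sder dw.
have dg x a : pder w x a -> exists b, pder g x b.
  move=> h; have h1 := pderM h (sder_pder (sder_cst (cj (w z)) x)).
  have h2 := pderM (sder_pder (sder_cst de%:C x)) h1.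
  by exists (0 + (0 * (w x * cj (w z)) + de%:C * (a * cj (w z) + w x * 0))); exact: pderD (sder_pder (sder_cst _ _)) h2.
have cg : cnm g z by have [a /dg[b /pder_cnm]] := nbhs_singleton dw.
have gn : \forall x \near z, g x != 0.
  have kk : 0 < nm (g z) by rewrite gz nm_real gtr0_norm.
  have [d d0 hd] := cg _ kk; apply/nbhs_nm; exists d => // x /hd.
  by move=> h; apply: contraTneq h => ->; rewrite sub0r nmN ltxx.
exists (fun x => k%:C / g x : C); split.
- apply: filterS2 dw gn => x [a /dg[b hb]] gx.
  by eexists; apply: pderM (sder_pder (sder_cst k%:C x)) (pder_comp hb (sder_pder (sder_inv gx))).
- by rewrite gz divff.
apply: filterS2 iw gn => x hx gx xz; have {hx}wx := hx xz.
have E : nm (k%:C / g x) = k / nm (g x) by rewrite nmM nmV nm_real gtr0_norm.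
have g2 : 0 < nm (g x) ^+ 2 by rewrite exprn_gt0// nm_gt0.
rewrite E expr_div_n [ltRHS]mulrA ltr_pdivlMr// -/k.
have key : (al + de * nm (w z) ^+ 2) * (al + de * nm (w x) ^+ 2) - nm (g x) ^+ 2 = al * de * nm (w x - w z) ^+ 2.
  have := nm_sqr (w z); have := nm_sqr (w x); have := nm_sqr (g x); have := nm_sqr (w x - w z).
  move: (nm (w z) ^+ 2) (nm (w x) ^+ 2) (nm (g x) ^+ 2) (nm (w x - w z) ^+ 2) => A B G W hW hG hB hA.
  apply: (@complexI R); rewrite !(rmorphB, rmorphM, rmorphD) /= hA hB hG hW.
  rewrite /g !(cjD, cjM, cjB, cjK, cj_real); ring.
have : 0 < al * de * nm (w x - w z) ^+ 2 by rewrite !mulr_gt0 ?exprn_gt0 ?nm_gt0 ?subr_eq0.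
rewrite -key -/k subr_gt0 => h.
move: h; set B := al + de * nm (w x) ^+ 2; set G := nm (g x) ^+ 2 => h.
by rewrite (_ : B * k ^+ 2 = k * (k * B)) ?ltr_pM2l//; ring.
Qed.

Lemma strict_near r r' x : (\forall y \near x, r y = r' y) -> strict r x -> strict r' x.
Proof.
move=> E [c [V [f [e [[Lc hx] h2 h3 h4 h5]]]]]; exists c, V, f, e; split=> //.
apply: filterS2 h5 (near_plaque_at hx E) => w h [_ <-] wz.
by rewrite -(nbhs_singleton E); exact: h.
Qed.

(** One local equation suffices, since the quotient of two leading coefficients is continuous. *)
Lemma cst_norm_cont (g : X -> R) V f N x : local_eqn V f -> V x ->
  {for x, continuous g} -> (\forall y \near x, nm (lc f y) ^+ 2 * N y = g y) -> norm_cont N x.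
Proof.
move=> lf Vx cg E V' f' lf' V'x.
have [cu _] := ratio_hol cD_ lf' lf (conj V'x Vx).
have E2 : \forall y \near x, nm (lc f' y / lc f y) ^+ 2 * g y = nm (lc f' y) ^+ 2 * N y.
  apply: filterS E => y <-; rewrite nmM nmV; field.
  by rewrite nm_eq0 lc_neq0.
apply: cont_near E2 _; apply: cvgM => //.
apply: (@continuous_comp _ _ _ (fun y => nm (lc f' y / lc f y)) (fun u => u ^+ 2)); last exact: exprn_continuous.
by apply: continuous_comp cu _; exact: nm_continuous.
Qed.

Definition boxed (c : chart R X) (a : C) (hi : R) (S : set (ch_tr c)) y :=
  [/\ ch_dom c y, nm (zc c y - a) <= hi & S (tc c y)].

(* A local metric [tau N], defined between the radii [lo] and [hi], can be glued to [r]
   as soon as it is dominated by [r] close to these radii. *)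
Lemma good_glue r c a lo lo' hi' hi (S : set (ch_tr c)) (tau : ch_tr c -> R) (N : X -> R) :
  good r -> nm a + hi < 1 -> lo < lo' -> hi' < hi -> compact S ->
  (forall t, 0 <= tau t <= 1) -> (forall t, tau t != 0 -> S t) -> (forall y, 0 <= N y) ->
  (forall y, boxed a hi S y -> hi' <= nm (zc c y - a) -> N y <= r y) ->
  (forall y, boxed a hi S y -> lo <= nm (zc c y - a) <= lo' -> N y <= r y) ->
  (forall x, boxed a hi S x -> lo < nm (zc c x - a) < hi ->
    norm_cont (fun y => tau (tc c y) * N y) x /\
    (p0 x < tau (tc c x) * N x -> strict (fun y => tau (tc c y) * N y) x)) ->
  exists r', [/\ good r', forall x, r x <= r' x &
    forall x, boxed a hi S x -> lo <= nm (zc c x - a) -> tau (tc c x) * N x <= r' x].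
Proof.
move=> gr ahi ll hh cS tau01 tauS N0 h1 h2 h3.
pose q y := if `[< boxed a hi S y /\ lo <= nm (zc c y - a) >] then tau (tc c y) * N y else 0.
have r0 y : 0 <= r y by have /andP[h _] := p0_ge0 y; exact: le_trans h (gd_ge gr y).
have qN y : boxed a hi S y -> N y <= r y -> tau (tc c y) * N y <= r y.
  by move=> _ h; have /andP[t0 t1] := tau01 (tc c y); apply: le_trans h; rewrite ler_piMl.
have nrad x e : ch_dom c x -> 0 < e -> \forall y \near x, nm (zc c y - zc c x) < e /\ ch_dom c y.
  by move=> dx e0; apply: filterI; [exact: (contP _ _).1 (zc_continuous dx) e e0|exact: near_dom].
have gmax : good (fun x => Num.max (r x) (q x)).
  apply: good_max => // x.
  have [bx|nb] := pselect (boxed a hi S x); last first.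
    left; have cl := closed_box hX ahi cS.
    have oN : open (~` [set y | boxed a hi S y]) by rewrite openC.
    apply: filterS (open_nbhs_nbhs (conj oN nb)) => y nby.
    by rewrite /q asboolF// => -[].
  have [dx rx Sx] := bx.
  have [k1|k1] := ltP hi' (nm (zc c x - a)).
    left; have e0 : 0 < nm (zc c x - a) - hi' by rewrite subr_gt0.
    apply: filterS (nrad x _ dx e0) => y [ny dy]; rewrite /q; case: asboolP => // -[bY _].
    apply: qN => //; apply: h1 => //.
    by have := nm_tri (zc c x) (zc c y) a; rewrite (nmC (zc c x) (zc c y)); flra.
  have [k2|k2] := ltP (nm (zc c x - a)) lo'.
    left; have e0 : 0 < lo' - nm (zc c x - a) by rewrite subr_gt0.
    apply: filterS (nrad x _ dx e0) => y [ny dy]; rewrite /q; case: asboolP => // -[bY loy].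
    apply: qN => //; apply: h2 => //; rewrite loy /=.
    by have := nm_tri (zc c y) (zc c x) a; flra.
  right; have lohi : lo < nm (zc c x - a) < hi by apply/andP; split; flra.
  have [n1 n2] := h3 x bx lohi; have /andP[l1 l2] := lohi.
  have e0 : 0 < Num.min (nm (zc c x - a) - lo) (hi - nm (zc c x - a)) by rewrite lt_min !subr_gt0 l1.
  have E : \forall y \near x, tau (tc c y) * N y = q y.
    apply: filterS (nrad x _ dx e0) => y []; rewrite lt_min => /andP[y1 y2] dy.
    have t1 := nm_tri (zc c y) (zc c x) a; have t2 := nm_tri (zc c x) (zc c y) a.
    rewrite (nmC (zc c x) (zc c y)) in t2; rewrite /q; case: asboolP => // nby.
    rewrite (_ : tau _ = 0) ?mul0r//; apply/eqP; apply: contra_notT nby => /tauS Sy.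
    by split; [split=> //|]; flra.
  split; first exact: norm_cont_near E n1.
  by rewrite -(nbhs_singleton E) => /n2; exact: strict_near.
exists (fun x => Num.max (r x) (q x)); split=> // x; first by rewrite le_max lexx.
by move=> bx lx; rewrite le_max /q asboolT// lexx orbT.
Qed.

Lemma tau_cont (c : chart R X) (tau : ch_tr c -> R) x : continuous tau -> ch_dom c x ->
  {for x, continuous (fun y => tau (tc c y))}.
Proof. by move=> ct dx; apply: continuous_comp (tc_continuous dx) _; exact: ct. Qed.

Lemma rad2_cont (c : chart R X) (a : C) x : ch_dom c x ->
  {for x, continuous (fun y => nm (zc c y - a) ^+ 2)}.
Proof.
move=> dx; apply: (@continuous_comp _ _ _ (fun y => nm (zc c y - a)) (fun u => u ^+ 2)); last exact: exprn_continuous.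
apply: (@continuous_comp _ _ _ (fun y => zc c y - a : C) nm); last exact: nm_continuous.
by apply: contB; [exact: zc_continuous|exact: cst_continuous].
Qed.

(** The local metric is [B * (1 + nm (z - a) ^ 2)], divided by [nm (lc f) ^ 2]. At [x0] it is
    positive while [p0] is 0; towards the outer radius [f] is bounded below, so a small [B] puts it
    under [p0]. *)
Lemma divisor_piece x0 : D x0 -> exists2 r, good r & p0 x0 < r x0.
Proof.
move=> Dx0; have [V [f [lf Vx]]] := leq_ex x0.
pose c := cx L x0; have Lc : L c := cx_L L x0; have dx0 : ch_dom c x0 := cx_dom L x0.
pose a := zc c x0; pose t0 := tc c x0; have a1 : nm a < 1 := zc_lt dx0.
have [R1 R10 [aR hR]] : exists2 R1 : R, 0 < R1 & nm a + R1 < 1 /\ forall w, nm (w - a) <= R1 ->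
    [/\ nm w < 1, V (pl c t0 w) & w != a -> ~ D (pl c t0 w)].
  have [r1 r10 h1] := (nbhs_nm _ _).1 (near_plaque_at dx0 (near_V lf Vx)).
  have [r2 r20 h2] := (nbhs_nm _ _).1 (near_not_D lf Vx Dx0).
  pose r := Num.min (Num.min r1 r2) (1 - nm a).
  have r0 : 0 < r by rewrite !lt_min r10 r20 subr_gt0.
  have [l1 l2 l3] : [/\ r <= r1, r <= r2 & r <= 1 - nm a] by rewrite /r !ge_min !lexx !orbT.
  exists (r / 2); first by rewrite divr_gt0.
  split=> [|w hw]; first by move: l3 r0; clearbody r; flra.
  have [|w1 Vw] := h1 w; first by move: l1 r0 hw; clearbody r; rewrite -/a; flra.
  by split=> //; apply: h2; move: l2 r0 hw; clearbody r; rewrite -/a; flra.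
have cf t w : nm w < 1 -> V (pl c t w) -> forall e : R, 0 < e ->
    \forall p \near (w, t), `|nm (f (pl c p.2 p.1)) - nm (f (pl c t w))| < e.
  move=> w1 Vw e e0; have [cfw _] := le_hol lf Vw.
  apply: filterS (cont_plaque cfw w1 e0) => p; apply: le_lt_trans; exact: nm_dist.
have cAn : compact [set w : C | R1 / 2 <= nm (w - a) <= R1] by exact: annulus_compact.
have [||m1 m10 hm1] := @compact_pos R C _ (fun w => nm (f (pl c t0 w))) cAn.
- move=> w e /andP[_ hw] e0; have [w1 Vw _] := hR w hw.
  have [d d0 hd] := near_prod_ball (cf t0 w w1 Vw e e0).
  by apply/nbhs_nm; exists d => // u hu; exact: (nbhs_singleton hd u hu).
- move=> w /andP[hw1 hw]; have [w1 Vw nD] := hR w hw; rewrite nm_gt0.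
  apply/eqP => /(le_D lf Vw); apply: nD; rewrite -subr_eq0 -nm_gt0; flra.
have T1 : \forall t \near t0, forall w, nm (w - a) <= R1 -> V (pl c t w).
  apply: (tube (P := fun w t => V (pl c t w)) (K := [set w : C | nm (w - a) <= R1])) => [|w hw]; first exact: nm_ball_compact.
  have [w1 Vw _] := hR w hw.
  by apply: filterS (near_inv w1 (near_V lf Vw)) => p [].
have T2 : \forall t \near t0, forall w, R1 / 2 <= nm (w - a) <= R1 -> m1 / 2 <= nm (f (pl c t w)).
  apply: (tube (P := fun w t => m1 / 2 <= nm (f (pl c t w))) cAn) => w hw; have := hm1 w hw => hw'.
  have m2 : 0 < m1 / 2 by flra.
  have /andP[_ hw2] := hw; have [w1 Vw _] := hR w hw2.
  by apply: filterS (cf t0 w w1 Vw _ m2) => p /ltr_normlP[]; flra.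
have T12 : \forall t \near t0, (forall w, nm (w - a) <= R1 -> V (pl c t w)) /\
  forall w, R1 / 2 <= nm (w - a) <= R1 -> m1 / 2 <= nm (f (pl c t w)) by exact: filterI.
have [tau [S [ctau tau1 tau01 cS [SW tauS]]]] := tr_bump cX hX dx0 T12.
(* The factor [1 + nm (z - a) ^ 2] is at most 2, and [nm f >= m1 / 2] on the outer annulus. *)
pose B := (m1 / 2) ^+ 2 / 2; have B0 : 0 < B by rewrite divr_gt0// exprn_gt0// divr_gt0.
pose N y := B * (1 + nm (zc c y - a) ^+ 2) / nm (lc f y) ^+ 2.
(* There is no inner boundary to glue along: negative radii make that condition vacuous. *)
have l0 : (-1 : R) < - (1 / 2) by flra.
have hh : R1 / 2 < R1 by flra.
have q0 y : 0 <= nm (zc c y - a) ^+ 2 by rewrite exprn_ge0// nm_ge0.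
have BV x : boxed a R1 S x -> V x.
  by move=> [dx rx Sx]; have := (SW _ Sx).1 _ rx; rewrite pl_id.
have [] := good_glue (N := N) good_p0 aR l0 hh cS tau01 tauS.
- by move=> y; rewrite divr_ge0 ?exprn_ge0 ?nm_ge0// mulr_ge0 ?(ltW B0)// addr_ge0.
- move=> y bY hy; have [dy ry Sy] := bY; have Vy := BV y bY.
  have fy : m1 / 2 <= nm (f y) by have := (SW _ Sy).2 (zc c y); rewrite pl_id// hy ry; exact.
  have f0 : f y != 0 by rewrite -nm_gt0; flra.
  have nD : ~ D y by move=> /(le_D lf Vy) E; move: f0; rewrite E eqxx.
  rewrite /N (lcE lf)// /p0 asboolF// ler_pdivrMr ?exprn_gt0 ?nm_gt0// mul1r.
  have y1 : nm (zc c y - a) ^+ 2 <= 1.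
    by rewrite expr_le1// ?nm_ge0//; have := nm_ge0 a; move: ry aR; clear; flra.
  have h4 : (m1 / 2) ^+ 2 <= nm (f y) ^+ 2 by rewrite lerXn2r ?nnegrE ?nm_ge0// divr_ge0// ltW.
  have := ler_wpM2l (ltW B0) y1; have B2 : B * 2 = (m1 / 2) ^+ 2 by rewrite /B divfK.
  by rewrite mulr1 mulrDr mulr1; move: h4 B2; clear; flra.
- by move=> y _ /andP[_]; have := nm_ge0 (zc c y - a); flra.
- move=> x bx _; have Vx' := BV x bx; have [dx rx Sx] := bx.
  have E y : nm (lc f y) ^+ 2 * (tau (tc c y) * N y) = tau (tc c y) * (B * (1 + nm (zc c y - a) ^+ 2)).
    rewrite /N; field; by rewrite nm_eq0 lc_neq0.
  split.
    apply: (cst_norm_cont (g := fun y => tau (tc c y) * (B * (1 + nm (zc c y - a) ^+ 2))) lf Vx').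
      apply: cvgM; first exact: tau_cont.
      apply: cvgM; first exact: cvg_cst.
      by apply: cvgD; [exact: cvg_cst|exact: rad2_cont].
    by apply: nearW => y; exact: E.
  move=> px; have tx : 0 < tau (tc c x).
    have /andP[t_ge0 _] := tau01 (tc c x); rewrite lt_neqAle t_ge0 andbT eq_sym.
    by apply: contraTneq px => ->; rewrite mul0r -leNgt; case/andP: (p0_ge0 x).
  have k0 : 0 < tau (tc c x) * B by rewrite mulr_gt0.
  have dw : \forall w \near zc c x, exists b, pder (fun w => w - a) w b.
    apply: (@filterE _ (nbhs (zc c x))) => w; exists (1 - 0).
    by apply: sder_pder; apply: sder_eq (sderB (sder_id w) (sder_cst a w)) _ _; rewrite ?subr0.
  have iw : \forall w \near zc c x, w != zc c x -> w - a != zc c x - a.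
    apply: (@filterE _ (nbhs (zc c x))) => w wz; apply: contraNneq wz => h.
    by rewrite -[w](subrK a) h subrK.
  have [e [de e1 he]] := quad_strict k0 k0 dw iw.
  exists c, V, f, e; split=> //.
  apply: filterS2 he (near_disc (zc_lt dx)) => w h w1 wz.
  have hE u : tau (tc c x) * (B * (1 + u)) = tau (tc c x) * B + tau (tc c x) * B * u by ring.
  by rewrite !E tc_pl// zc_pl// !hE; exact: h.
move=> r [gr _ hr]; exists r => //.
have bx0 : boxed a R1 S x0.
  split=> //; first by rewrite subrr nm0 ltW.
  by apply: tauS; rewrite tau1 oner_neq0.
have := hr x0 bx0; rewrite subrr nm0 /N tau1 mul1r subrr nm0 expr0n /= addr0 mulr1 => h.
rewrite /p0 asboolT//; apply: lt_le_trans (h _); last by flra.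
by rewrite divr_gt0// lc2_gt0.
Qed.

(** Multiplied by [nm (lc f) ^ 2] both metrics become continuous, so a strict inequality at [x]
    persists nearby with a ratio [v > 1] to spare. *)
Lemma good_ratio r x : good r -> p0 x < r x -> exists2 v : R, 1 < v & \forall y \near x, v * p0 y <= r y.
Proof.
move=> gr px; have [V [f [lf Vx]]] := leq_ex x.
have cr := gd_cont gr lf Vx; have cp := gd_cont good_p0 lf Vx.
pose A := nm (lc f x) ^+ 2 * p0 x; pose A' := nm (lc f x) ^+ 2 * r x.
have AA : A < A' by rewrite ltr_pM2l// lc2_gt0.
have A0 : 0 <= A by rewrite mulr_ge0 ?exprn_ge0 ?nm_ge0//; case/andP: (p0_ge0 x).
pose M := (A + A') / 2.
have M0 : 0 < M by rewrite /M; flra.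
have MA : A < M < A' by rewrite /M; apply/andP; split; flra.
have /andP[MA1 MA2] := MA.
have [v v1 vA] : exists2 v : R, 1 < v & v * A < A'.
  have [->|An] := eqVneq A 0; first by exists 2; rewrite ?mulr0 ?(le_lt_trans A0)//; flra.
  have A1 : 0 < A by rewrite lt_neqAle eq_sym An.
  exists (M / A); first by rewrite ltr_pdivlMr// mul1r.
  by rewrite divfK ?gt_eqF.
exists v => //; have v0 : 0 < v by exact: lt_trans v1.
have e0 : 0 < (A' - v * A) / 2 / (1 + v) by rewrite !divr_gt0 ?subr_gt0// addr_gt0.
set e := _ / (1 + v) in e0.
have ve : e * (1 + v) = (A' - v * A) / 2 by rewrite /e divfK// gt_eqF// addr_gt0.
apply: filterS2 ((cvgR (nbhs_filter x) _ _).1 cr _ e0) ((cvgR (nbhs_filter x) _ _).1 cp _ e0) => y.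
rewrite -/A -/A' => /ltr_normlP[y1 y2] /ltr_normlP[y3 y4].
rewrite -(ler_pM2l (lc2_gt0 f y)) mulrCA.
set a1 := nm _ ^+ 2 * r y in y1 y2 *; set a2 := nm _ ^+ 2 * p0 y in y3 y4 *.
have h : v * a2 <= v * (A + e) by rewrite ler_pM2l//; flra.
move: ve h y1; rewrite !mulrDr mulr1 (mulrC e v); flra.
Qed.

(** The local metric is [p0 * (al + de / nm (z - a) ^ 2)], strictly positive off [a] and [D]. With
    [al + de / hi' ^ 2 = 1] it is below [p0] beyond radius [hi'] and above it inside; close to [a],
    where it blows up, [r] has the margin [v] over [p0] and takes over. *)
Lemma spread r c y0 (hi' hi : R) : good r -> p0 y0 < r y0 -> L c -> ch_dom c y0 ->
  0 < hi' -> hi' < hi -> nm (zc c y0) + hi < 1 ->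
  exists2 r', good r' & forall w, nm (w - zc c y0) < hi' -> ~ D (pl c (tc c y0) w) ->
    p0 (pl c (tc c y0) w) < r' (pl c (tc c y0) w).
Proof.
move=> gr py Lc dy h0 hh ahi; pose a := zc c y0; pose t0 := tc c y0; have a1 : nm a < 1 := zc_lt dy.
have [v v1 hv] := good_ratio gr py.
have hv' : \forall y \near pl c t0 a, v * p0 y <= r y by rewrite pl_id.
have [rr rr0 hr] := near_prod_ball (near_inv a1 hv').
have [lo' lo0 [lor lohi]] : exists2 lo' : R, 0 < lo' & lo' < rr /\ lo' < hi'.
  exists (Num.min rr hi' / 2); first by rewrite divr_gt0// lt_min rr0.
  have l1 : Num.min rr hi' <= rr by rewrite ge_min lexx.
  have l2 : Num.min rr hi' <= hi' by rewrite ge_min lexx orbT.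
  have l3 : 0 < Num.min rr hi' by rewrite lt_min rr0.
  by split; flra.
have [tau [S [ctau tau1 tau01 cS [SW tauS]]]] := tr_bump cX hX dy hr.
pose ih := hi' ^- 2; pose il := (lo' / 2) ^- 2.
have ih0 : 0 < ih by rewrite invr_gt0 exprn_gt0.
have il0 : 0 < il by rewrite invr_gt0 exprn_gt0 ?divr_gt0.
(* The first bound keeps [al] positive; the second gives [al + de * il <= v] on the inner ring,
   where [v * p0 <= r]. *)
have [de de0 [de1 de2]] : exists2 de : R, 0 < de & de * ih < 1 /\ de * il <= v - 1.
  have v10 : 0 < v - 1 by rewrite subr_gt0.
  exists (Num.min (2 * ih)^-1 ((v - 1) / il)); first by rewrite lt_min invr_gt0 mulr_gt0 ?divr_gt0.
  split; last by rewrite -ler_pdivlMr// ge_min lexx orbT.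
  rewrite -ltr_pdivlMr// gt_min; apply/orP; left.
  by rewrite mul1r ltf_pV2 ?posrE ?mulr_gt0//; flra.
pose al := 1 - de * ih; have al0 : 0 < al by rewrite subr_gt0.
pose N y := p0 y * (al + de * nm (zc c y - a) ^- 2).
have ll : lo' / 2 < lo' by flra.
have N0 y : 0 <= N y.
  have /andP[p_ge0 _] := p0_ge0 y; rewrite mulr_ge0// addr_ge0 ?(ltW al0)// mulr_ge0 ?(ltW de0)//.
  by rewrite invr_ge0 exprn_ge0// nm_ge0.
have loe : 0 < lo' / 2 by rewrite divr_gt0.
have b1 y : boxed a hi S y -> hi' <= nm (zc c y - a) -> N y <= r y.
  move=> _ hy; have /andP[p_ge0 _] := p0_ge0 y; apply: le_trans (gd_ge gr y).
  have h : nm (zc c y - a) ^- 2 <= ih.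
    have y0' := lt_le_trans h0 hy.
    by rewrite lef_pV2 ?posrE ?exprn_gt0// lerXn2r ?nnegrE ?(ltW h0) ?(ltW y0').
  by have := ler_wpM2l (ltW de0) h => h'; rewrite ler_piMr// /al; move: h'; clear; flra.
have b2 y : boxed a hi S y -> lo' / 2 <= nm (zc c y - a) <= lo' -> N y <= r y.
  move=> [dy' ry Sy] /andP[l1 l2]; have /andP[p_ge0 _] := p0_ge0 y.
  have yr := le_lt_trans l2 lor.
  have [_] := SW _ Sy _ yr; rewrite pl_id// => h; apply: le_trans h.
  rewrite /N mulrC ler_wpM2r//.
  have h : nm (zc c y - a) ^- 2 <= il.
    have y0' := lt_le_trans loe l1.
    by rewrite lef_pV2 ?posrE ?exprn_gt0// lerXn2r ?nnegrE ?(ltW loe) ?(ltW y0').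
  have h' := ler_wpM2l (ltW de0) h; have : 0 <= de * ih by rewrite mulr_ge0 ?ltW.
  by rewrite /al; move: h' de2; clear; flra.
have b3 x : boxed a hi S x -> lo' / 2 < nm (zc c x - a) < hi ->
    norm_cont (fun y => tau (tc c y) * N y) x /\
    (p0 x < tau (tc c x) * N x -> strict (fun y => tau (tc c y) * N y) x).
  move=> [dx rx Sx] /andP[l1 l2]; have n0 := lt_trans loe l1.
  split.
    move=> V f lf Vx; have cp := gd_cont good_p0 lf Vx.
    have E y : (nm (lc f y) ^+ 2 * p0 y) * (tau (tc c y) * (al + de * nm (zc c y - a) ^- 2)) =
        nm (lc f y) ^+ 2 * (tau (tc c y) * N y) by rewrite /N; ring.
    apply: cont_near (nearW _ E) _; apply: cvgM => //; apply: cvgM; first exact: tau_cont.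
    apply: cvgD; first exact: cvg_cst.
    apply: cvgM; first exact: cvg_cst.
    by apply: cvgV; [rewrite expf_neq0// gt_eqF|exact: rad2_cont].
  move=> px; have nD : ~ D x by move=> Dx; move: px; rewrite /N /p0 asboolT// mul0r mulr0 ltxx.
  have tx : 0 < tau (tc c x).
    have /andP[t_ge0 _] := tau01 (tc c x); rewrite lt_neqAle t_ge0 andbT eq_sym.
    by apply: contraTneq px => ->; rewrite mul0r -leNgt; case/andP: (p0_ge0 x).
  have zn : zc c x - a != 0 by rewrite -nm_gt0.
  have near_n : \forall w \near zc c x, w - a != 0.
    apply/nbhs_nm; exists (nm (zc c x - a)) => // w hw; apply: contraTneq hw => wa.
    by rewrite -leNgt (_ : w = a) 1?nmC//; apply/eqP; rewrite -subr_eq0 wa.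
  have dw : \forall w \near zc c x, exists b, pder (fun w => (w - a)^-1) w b.
    apply: filterS near_n => w wn; have hs := sderB (sder_id w) (sder_cst a w).
    by eexists; apply: (pder_comp (sder_pder (sder_eq hs (erefl _) (subrr _))) (sder_pder (sder_inv wn))).
  have iw : \forall w \near zc c x, w != zc c x -> (w - a)^-1 != (zc c x - a)^-1.
    apply: (@filterE _ (nbhs (zc c x))) => w wz; apply: contraNneq wz => /invr_inj h.
    by rewrite -[w](subrK a) h subrK.
  have k1 : 0 < tau (tc c x) * al by rewrite mulr_gt0.
  have k2 : 0 < tau (tc c x) * de by rewrite mulr_gt0.
  have [e [de' e1 he]] := quad_strict k1 k2 dw iw.
  (* Off [D] the constant 1 is a local equation, with leading coefficient 1, so positivity is read
     on the metric alone. *)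
  exists c, (~` D), (fun=> 1), e; split; [by []|split; [exact: local_eqn1|by []]|exact: de'|exact: e1|].
  have nnD := near_plaque_at dx (near_nD cD_ nD).
  apply: filterS2 he nnD => w h [w1 nDw] wz.
  have lc1 y : ~ D y -> lc (fun=> 1) y = 1 by move=> nDy; rewrite (lcE (local_eqn1 L m cD_)).
  rewrite !lc1// nm1 expr1n !mul1r tc_pl// /N zc_pl// /p0 !asboolF// !mul1r.
  have hE u : tau (tc c x) * (al + de / u ^+ 2) = tau (tc c x) * al + tau (tc c x) * de * u^-1 ^+ 2.
    by rewrite exprVn; ring.
  by rewrite !hE -!nmV; exact: h.
have [r' [gr' rr' hr']] := good_glue gr ahi ll hh cS tau01 tauS N0 b1 b2 b3.
exists r' => // w hw nD; have w1 : nm w < 1 by have := nm_split w a; rewrite -/a in ahi hw; flra.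
have p1 : p0 (pl c t0 w) = 1 by rewrite /p0 asboolF.
(* Inside the inner radius the old metric already exceeds [p0], by the factor [v]. *)
have [h|h] := leP (lo' / 2) (nm (w - a)); last first.
  apply: lt_le_trans (rr' _); rewrite -/t0 p1.
  have wr : nm (w - a) < rr by move: h lor lo0; clear; flra.
  have St0 : S t0 by apply: tauS; rewrite tau1 oner_neq0.
  have [_] := SW _ St0 _ wr; rewrite /=.
  by rewrite p1 mulr1; apply: lt_le_trans.
have bw : boxed a hi S (pl c t0 w).
  split; [exact: pl_dom|rewrite zc_pl//|rewrite tc_pl//; apply: tauS; rewrite tau1 oner_neq0//].
  by move: hw hh; rewrite -/a; clear; flra.
have := hr' _ bw; rewrite zc_pl// tc_pl// => /(_ h); rewrite tau1 mul1r /N p1 mul1r zc_pl// => h1.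
apply: lt_le_trans h1; rewrite /al.
have w0 : 0 < nm (w - a) by flra.
have : ih < nm (w - a) ^- 2 by rewrite ltf_pV2 ?posrE ?exprn_gt0// ltrXn2r ?nnegrE ?nm_ge0 ?(ltW h0).
by rewrite -(ltr_pM2l de0); flra.
Qed.

Hypothesis hD : forall x, leaf L x `&` D !=set0.

(** The points where some good metric exceeds [p0] contain [D] by [divisor_piece]; they form a
    leafwise open set by [good_ratio] and a leafwise closed one by [spread], hence whole leaves, and
    each leaf meets [D]. *)
Lemma good_everywhere x : exists2 r, good r & p0 x < r x.
Proof.
have [y [lxy Dy]] := hD x.
pose P y := exists2 r, good r & p0 y < r y.
have PD z : D z -> P z by exact: divisor_piece.
have oP : leaf_open (L := L) [set y | P y].
  apply: leaf_openP => z [r gr pz]; have [c Lc dz] := chart_ex L z; exists c; split; [exact: Lc|exact: dz|].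
  have [v v1 hv] := good_ratio gr pz.
  have : \forall u \near z, P u.
    apply: filterS hv => u hu; have [/PD//|nD] := pselect (D u).
    by exists r => //; move: hu; rewrite /p0 asboolF// mulr1; apply: lt_le_trans.
  by move=> /(near_plaque_at dz); apply: filterS => w [].
apply: contrapT => nPx.
suff : ~ P y by apply; exact: PD.
apply: (@leaf_ind _ _ L [set y | ~ P y] x y) => //.
  apply: leaf_openP => z nPz; have [c Lc dz] := chart_ex L z; exists c; split; [exact: Lc|exact: dz|].
  (* A quarter of the room: the disc of radius [2 * rho] about any [w] within [rho] of [z] stays in
     the unit disc, so the disc gained around [w] reaches back to [z]. *)
  have z1 := zc_lt dz; pose rho := (1 - nm (zc c z)) / 4.
  have rho0 : 0 < rho by rewrite divr_gt0// subr_gt0.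
  apply/nbhs_nm; exists rho => // w wr [r gr pr].
  have w1 : nm w < 1 by have := nm_split w (zc c z); rewrite /rho in wr; flra.
  have dw : ch_dom c (pl c (tc c z) w) by exact: pl_dom.
  have ahi : nm (zc c (pl c (tc c z) w)) + 2 * rho < 1.
    by rewrite zc_pl//; have := nm_split w (zc c z); move: wr; rewrite /rho; flra.
  have rr : rho < 2 * rho by flra.
  have [r' gr' hr'] := spread gr pr Lc dw rho0 rr ahi.
  apply: nPz; have [/PD//|nD] := pselect (D z); exists r' => //.
  have := hr' (zc c z); rewrite zc_pl// tc_pl// pl_id// nmC; exact.
by rewrite (_ : ~` _ = [set y | P y])//; apply/seteqP; split=> u /=; [exact: contrapT|move=> Pu nPu].
Qed.

Lemma good_positive : exists2 r, good r & forall x, p0 x < r x.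
Proof.
have h x : exists r, good r /\ p0 x < r x by have [r ? ?] := good_everywhere x; exists r.
have /choice[rx hrx] := h.
have [x _|s hs] := @finite_cover X setT (fun x => [set y | p0 y < rx x y]) cX.
  have [gr px] := hrx x; have [v v1 hv] := good_ratio gr px.
  have [V [f [lf Vx]]] := leq_ex x.
  have cr := gd_cont gr lf Vx; have cp := gd_cont good_p0 lf Vx.
  have e0 : 0 < nm (lc f x) ^+ 2 * rx x x - nm (lc f x) ^+ 2 * p0 x by rewrite subr_gt0 ltr_pM2l// lc2_gt0.
  have e2 := divr_gt0 e0 (ltr0n R 2).
  have h1 := (cvgR (nbhs_filter x) _ _).1 cr _ e2; have h2 := (cvgR (nbhs_filter x) _ _).1 cp _ e2.
  apply: filterS2 h1 h2 => y /ltr_normlP[y1 y2] /ltr_normlP[y3 y4] /=.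
  by rewrite -(ltr_pM2l (lc2_gt0 f y)); flra.
exists (foldr (fun x r y => Num.max (rx x y) (r y)) p0 s).
  elim: s {hs} => [|x s IH]; first exact: good_p0.
  exact: good_max2 (hrx x).1 IH.
move=> y; have [x [xs _ hx]] := hs y I.
elim: s xs {hs} => // z s IH; rewrite inE /= lt_max => /orP[/eqP <-|/IH ->]; last by rewrite orbT.
by rewrite hx.
Qed.

End Metric.
Lemma local_equation (R : realType) (X : topologicalType) (L : lamination R X) D m x :
  is_divisor L D m -> exists V f, local_eqn L D m V f /\ V x.
Proof.
move=> [cD_ _ h]; have [Dx|nD] := pselect (D x); last first.
  by exists (~` D), (fun=> 1); split; [exact: local_eqn1 cD_|exact: nD].
have [V [f [[oV Vx] hf _ E hm]]] := h x Dx; exists V, f; split=> //; split=> //.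
- exact: holomorphic_hol_on.
- move=> y Vy; split=> [fy|Dy].
    by have : [set y | V y /\ f y = 0] y by []; rewrite -E => -[].
  by have : (D `&` V) y by []; rewrite E => -[].
- by move=> y Vy Dy; exact: hm.
Qed.

(** * Frames of the line bundle of a divisor *)

Section DivisorFrames.
Context {R : realType} {X : topologicalType} (L : lamination R X).
Local Notation C := (Cplx R).
Variables (D : set X) (m : X -> nat).
Hypotheses (cX : compact [set: X]) (hX : hausdorff_space X).
Hypothesis hDm : is_divisor L D m.
Hypothesis hD : forall x, leaf L x `&` D !=set0.

Let cD_ : closed D. Proof. by case: hDm. Qed.

Let leq_ex x := @local_equation R X L D m x hDm.

Variable r : X -> R.
Hypotheses (gr : good L D m r) (rp : forall x, p0 D x < r x).

Let r0 x : 0 < r x. Proof. by have /andP[h _] := @p0_ge0 R X D x; exact: le_lt_trans h (rp x). Qed.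

Let rho x : R := Num.sqrt (r x).
Let rho0 x : 0 < rho x. Proof. by rewrite sqrtr_gt0. Qed.

(** The local frame attached to [f] in the unitary trivialisation of the metric [r]; its modulus is
    continuous, though neither factor need be. *)
Let G f x : C := lc L D m f x * (rho x)%:C.

Let G0 f x : G f x != 0.
Proof. by rewrite mulf_neq0 ?lc_neq0// -nm_gt0 nm_real gtr0_norm. Qed.

Let nmG f x : nm (G f x) = Num.sqrt (nm (lc L D m f x) ^+ 2 * r x).
Proof.
rewrite nmM nm_real gtr0_norm// sqrtrM ?exprn_ge0 ?nm_ge0// sqrtr_sqr ger0_norm ?nm_ge0//.
Qed.

Definition divisor_frame (V : set X) (th : X -> C) : Prop :=
  [/\ open V, forall x, th x != 0 &
     forall V' f, local_eqn L D m V' f -> hol_on L (V `&` V') (fun y => th y / G f y)].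

(** The peak frame at [x] is [G f] times the holomorphic function [E] from [strict], normalised to
    modulus 1 at [x]; the strict inequality of [strict] is its peak property. *)
Lemma divisor_frames : frame_axioms L divisor_frame.
Proof.
split; [exact: cX|exact: hX| | | | |].
- by move=> V th [].
- by move=> V th x [].
- move=> V th x [oV th0 hth] Vx; have [V' [f [lf V'x]]] := leq_ex x.
  have [cq _] := hth V' f lf x (conj Vx V'x).
  have E : forall y, nm (th y / G f y) * nm (G f y) = nm (th y).
    by move=> y; rewrite -nmM divfK.
  apply: cont_near (nearW _ E) _; apply: cvgM.
    exact: (@continuous_comp _ _ _ (fun y => th y / G f y) nm x cq (@nm_continuous _ _)).
  have E2 : forall y, Num.sqrt (nm (lc L D m f y) ^+ 2 * r y) = nm (G f y) by move=> y; rewrite nmG.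
  apply: cont_near (nearW _ E2) _.
  apply: (@continuous_comp _ _ _ (fun y => nm (lc L D m f y) ^+ 2 * r y) Num.sqrt); last exact: sqrt_continuous.
  exact: gd_cont gr x V' f lf V'x.
- move=> V V' th th' [oV th0 hth] [oV' th0' hth'] x [Vx V'x].
  have [W [f [lf Wx]]] := leq_ex x.
  have n0 : th' x / G f x != 0 by rewrite mulf_neq0 ?invr_eq0.
  have h := @hol_at_div _ _ L (fun y => th y / G f y) (fun y => th' y / G f y) x n0 (hth W f lf x (conj Vx Wx)) (hth' W f lf x (conj V'x Wx)).
  apply: (hol_at_near _ h).
  apply: nearW => y; have g0 := G0 f y; have t0 := th0' y.
  by field; rewrite t0 g0.
move=> x; have [c [V [f [E [[Lc dx] [lf Vx] hE E1 hs]]]]] := gd_strict gr (rp x).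
have [e1 e10 he1] := (nbhs_nm _ _).1 hE.
have En : \forall w \near zc c x, E w != 0.
  have [a /pder_cnm cE] := nbhs_singleton hE; have n1 : 0 < nm (E (zc c x)) by rewrite E1 nm1.
  have [d d0 hd] := cE _ n1; apply/nbhs_nm; exists d => // w /hd h.
  by apply: contraTneq h => ->; rewrite sub0r nmN ltxx.
have [e2 e20 he2] := (nbhs_nm _ _).1 En; have [e3 e30 he3] := (nbhs_nm _ _).1 hs.
have [e4 e40 he4] := (nbhs_nm _ _).1 (near_plaque_at dx (near_V lf Vx)).
pose e := Num.min (Num.min e1 e2) (Num.min e3 e4).
have e0 : 0 < e by rewrite !lt_min e10 e20 e30.
have [l1 l2 l3 l4] : [/\ e <= e1, e <= e2, e <= e3 & e <= e4] by rewrite /e !ge_min !lexx !orbT.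
move: e e0 l1 l2 l3 l4 => e e0 l1 l2 l3 l4.
pose W : set X := [set y | V y /\ (ch_dom c y /\ nm (zc c y - zc c x) < e)].
have oW : open W.
  rewrite openE => y [Vy [dy ye]].
  have k0 : 0 < e - nm (zc c y - zc c x) by rewrite subr_gt0.
  apply: filterS3 (near_V lf Vy) (near_dom dy) ((contP _ _).1 (zc_continuous dy) _ k0) => u Vu du hu.
  split=> //; split=> //; have := nm_tri (zc c u) (zc c y) (zc c x); flra.
pose k : C := (nm (G f x))%:C; have k0 : k != 0 by rewrite -nm_gt0 nm_real normr_gt0 gt_eqF// nm_gt0.
have WE y : W y -> E (zc c y) != 0 by move=> [_ [dy ye]]; apply: he2; exact: lt_le_trans l2.
pose th y : C := if `[< W y >] then G f y * E (zc c y) / k else 1.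
have thE y : W y -> th y = G f y * E (zc c y) / k by move=> Wy; rewrite /th asboolT.
have Wx : W x by split=> //; split=> //; rewrite subrr nm0.
have Wpl w : nm (w - zc c x) < e -> nm w < 1 /\ W (pl c (tc c x) w).
  move=> we; have [w1 Vw] := he4 w (lt_le_trans we l4).
  by split=> //; split=> //; split; [exact: pl_dom|rewrite zc_pl].
exists c, W, th, (e / 2); split.
- by [].
- split=> //.
    move=> y; rewrite /th; case: asboolP => Wy; last by rewrite oner_neq0.
    by apply: mulf_neq0; [apply: mulf_neq0; [exact: G0|exact: WE]|rewrite invr_eq0].
  move=> V' f' lf' y [Wy V'y]; have [Vy [dy ye]] := Wy.
  have hr := ratio_hol cD_ lf lf' (conj Vy V'y).
  have [a ha] : exists a, sder E (zc c y) a 0.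
    have hb : holb E (zc c x) e1 by move=> w /he1.
    by exists (cD E (zc c y)); apply: (hol_sder hb); exact: lt_le_trans l1.
  have hEz : hol_at L (fun u => E (zc c u)) y.
    apply: (hol_atI _ Lc dy (lwd_zc_comp dy ha)).
    by apply: (cont_comp (zc_continuous dy)); exact: sder_cnm ha.
  apply: hol_at_near (hol_atM (hol_atM hr hEz) (hol_at_cst L k^-1 y)).
  have : nbhs y W by exact: open_nbhs_nbhs.
  apply: filterS => u Wu; rewrite thE// /G.
  have g1 := lc_neq0 L D m f' u; have g2 : (rho u)%:C != 0 :> C by rewrite -nm_gt0 nm_real gtr0_norm.
  by field; rewrite k0 g2 g1.
- by rewrite divr_gt0.
- by rewrite thE// E1 mulr1 nmM nmV nm_real ger0_norm ?nm_ge0// divff// nm_eq0.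
move=> w we; have we' : nm (w - zc c x) < e by flra.
have [w1 Ww] := Wpl w we'; split=> // wz; rewrite thE// zc_pl//.
have hw := he3 w (lt_le_trans we' l3) wz.
have nE (a b : C) : nm (a * b / k) = nm a * nm b / nm (G f x) by rewrite 2!nmM nmV /k nm_real ger0_norm ?nm_ge0.
rewrite nE ltr_pdivlMr ?mul1r ?nm_gt0//.
rewrite -(@ltr_pXn2r _ 2) ?nnegrE ?mulr_ge0 ?nm_ge0//.
by rewrite exprMn !nmG !sqr_sqrtr ?mulr_ge0 ?exprn_ge0 ?nm_ge0 ?(ltW (r0 _)).
Qed.

End DivisorFrames.

Lemma divisor_positive (R : realType) (X : topologicalType) (L : lamination R X) D m :
  compact [set: X] -> hausdorff_space X -> is_divisor L D m -> (forall x, leaf L x `&` D !=set0) ->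
  exists fr : set X -> (X -> Cplx R) -> Prop, frame_axioms L fr.
Proof.
move=> cX hX hDm hD.
have cD_ : closed D by case: hDm.
have [r gr rp] := good_positive cX hX cD_ (fun x => local_equation x hDm) hD.
exists (divisor_frame L D m r); exact: divisor_frames.
Qed.
(** * Projective laminations *)

Section ProjectiveCoordinates.
Context {R : realType}.
Local Notation C := (Cplx R).

Lemma cvg_row (T : Type) (F : set_system T) (FF : Filter F) n (g : T -> 'rV[C]_n) (l : 'rV[C]_n) :
  g @ F --> l <-> forall j, (fun t => g t 0 j : C) @ F --> (l 0 j : C).
Proof.
split=> [h j A hA|h A [P hP PA]].
  have : nbhs l [set M : 'rV[C]_n | A (M 0 j)].
    exists (fun _ j' => if j' == j then A else setT).
      move=> i' j'; case: eqP => [->|_]; last exact: filterT.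
      by rewrite (ord1 i').
    by move=> M /(_ 0 j); rewrite eqxx.
  by move=> /h.
have : \forall t \near F, forall j, P 0 j (g t 0 j).
  by apply: filter_forall => j; apply: h; exact: hP.
apply: filterS => t ht; apply: PA => i j; rewrite (ord1 i); exact: ht.
Qed.

Lemma hcoord_neq0 N (p : CP R N) : exists i, hcoord p 0 i != 0.
Proof.
have : hcoord p != 0 by exact: (set_valP (repr p)).
move=> /eqP h; apply: contrapT => no; apply: h; apply/rowP => i; rewrite mxE.
by apply/eqP/negPn/negP => hi; apply: no; exists i.
Qed.

Lemma hcoord_pi N (v : nzvec R N) : exists2 a : C, a != 0 & hcoord (\pi_(CP R N)%qT v) = a *: val v.
Proof.
have : colinear (repr (\pi_(CP R N)%qT v)) v.
  by rewrite -[colinear _ _]/(equiv (colinear_equiv R N) _ _) -eqmodE reprK.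
by move=> /asboolP[a a0 E]; exists a.
Qed.

Lemma nzvec_coord N (i : 'I_N.+1) : continuous (fun v : nzvec R N => val v 0 i : C).
Proof.
move=> v A hA; have h1 : (id : 'rV[C]_N.+1 -> 'rV[C]_N.+1) @ nbhs (val v) --> val v by exact: cvg_id.
have h2 := (cvg_row (nbhs_filter _) _ _).1 h1 i A hA.
exact: (@initial_continuous _ _ (set_val : nzvec R N -> 'rV[C]_N.+1) v _ h2).
Qed.

(** Homogeneous coordinates are read on an arbitrary representative and need not be continuous;
    their quotients are, which is checked by pulling back to nonzero vectors. *)
Lemma ratio_near N (i j : 'I_N.+1) (p : CP R N) (e : R) : hcoord p 0 i != 0 -> 0 < e ->
  \forall q \near p, hcoord q 0 i != 0 /\
    nm (hcoord q 0 j / hcoord q 0 i - hcoord p 0 j / hcoord p 0 i) < e.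
Proof.
move=> pi0 e0; set l := hcoord p 0 j / _.
apply: open_nbhs_nbhs; split; last by rewrite /= subrr nm0.
rewrite /open /= /quotient_open.
have -> : (\pi_(CP R N)%qT @^-1` [set q | hcoord q 0 i != 0 /\ nm (hcoord q 0 j / hcoord q 0 i - l) < e]) =
    [set v : nzvec R N | val v 0 i != 0 /\ nm (val v 0 j / val v 0 i - l) < e].
  apply/seteqP; split=> v /=; have [a a0 ->] := hcoord_pi v; rewrite !mxE mulf_eq0 (negbTE a0) /=.
    by rewrite -mulf_div divff// mul1r.
  by rewrite -mulf_div divff// mul1r.
rewrite openE => v [vi hv].
have ci := nzvec_coord (i := i) (x := v); have cj_ := nzvec_coord (i := j) (x := v).
have n0 : 0 < nm (val v 0 i) by rewrite nm_gt0.
have near_n := (cvgC (nbhs_filter v) _ _).1 ci _ n0.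
have k0 : 0 < e - nm (val v 0 j / val v 0 i - l) by rewrite subr_gt0.
have cr : {for v, continuous (fun v : nzvec R N => val v 0 j / val v 0 i)}.
  have cV : {for v, continuous (fun v : nzvec R N => (val v 0 i)^-1)}.
    by apply: (cont_comp (x := v) ci); exact: sder_cnm (sder_inv vi).
  exact: contM cj_ cV.
apply: filterS2 near_n ((contP _ _).1 cr _ k0) => u h1 h2; split.
  by apply: contraTneq h1 => ->; rewrite sub0r nmN ltxx.
by have := nm_tri (val u 0 j / val u 0 i) (val v 0 j / val v 0 i) l; move: h2; clear; flra.
Qed.

Lemma quot_pder (u : C -> C) z a :
  (fun h : C => h^-1 *: ((u \o shift z) (h *: (1 : C)) - u z)) @ (0 : C)^' --> a -> pder u z a.
Proof.
move=> /(cvgC (dnbhs_filter (0 : C)) _ _).1 k e e0.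
have := k _ e0; rewrite near_withinE => /nbhs_nm[d d0 hd]; exists d => // w hw.
have [->|wz] := eqVneq w z; first by rewrite !subrr mulr0 subr0 nm0 mulr0.
have wz0 : w - z != 0 by rewrite subr_eq0.
have := hd (w - z); rewrite subr0 => /(_ hw wz0).
rewrite /= [(w - z) *: 1](_ : _ = w - z); last exact: mulr1.
rewrite subrK => /ltW {}k.
rewrite -ler_pdivrMr ?nm_gt0// -nmV -nmM; move: k; congr (nm _ <= _).
by rewrite /GRing.scale /=; field.
Qed.

Lemma derivable_coord n (u : C -> 'rV[C]_n) z j : derivable u z 1 ->
  pder (fun w => u w 0 j) z ('D_1 u z 0 j).
Proof.
move=> du.
have : (fun h : C => h^-1 *: ((u \o shift z) (h *: (1 : C)) - u z)) @ (0 : C)^' --> 'D_1 u z by exact: du.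
move: ('D_1 u z) => a /(cvg_row (dnbhs_filter (0 : C)) _ _).1 /(_ j) h.
apply: quot_pder; apply: cvg_trans h; apply: near_eq_cvg.
by apply: filterE => t; rewrite !mxE.
Qed.

Lemma coord_derivable n (u : C -> 'rV[C]_n) z (a : 'rV[C]_n) :
  (forall j, pder (fun w => u w 0 j) z (a 0 j)) -> derivable u z 1 /\ 'D_1 u z = a.
Proof.
move=> h.
have h1 : (fun h : C => h^-1 *: ((u \o shift z) (h *: (1 : C)) - u z)) @ (0 : C)^' --> a.
  apply/(cvg_row (dnbhs_filter (0 : C))) => j.
  have [du dE] := pder_derive (h j).
  have : (fun h : C => h^-1 *: (((fun w => u w 0 j) \o shift z) (h *: (1 : C)) - u z 0 j)) @ (0 : C)^' --> 'D_1 (fun w => u w 0 j : C) z by exact: du.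
  rewrite dE => h2; apply: cvg_trans h2; apply: near_eq_cvg.
  by apply: filterE => t; rewrite !mxE.
have du : derivable u z 1 by apply/cvg_ex; exists a.
split=> //; apply/rowP => j; exact: pder_uniq (derivable_coord j du) (h j).
Qed.

End ProjectiveCoordinates.

(** * The pull-back of the hyperplane bundle by a leafwise immersion *)

Section ProjectiveFrames.
Context {R : realType} {X : topologicalType} (L : lamination R X).
Local Notation C := (Cplx R).
Variables (N : nat) (f : X -> CP R N).
Hypotheses (cX : compact [set: X]) (hX : hausdorff_space X).
Hypotheses (cf : continuous f) (imf : leafwise_immersion L f).

Let F x (i : 'I_N.+1) : C := hcoord (f x) 0 i.

Lemma F_near x i j (e : R) : F x i != 0 -> 0 < e -> \forall y \near x, F y i != 0 /\
  nm (F y j / F y i - F x j / F x i) < e.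
Proof. by move=> Fi e0; have := cf (ratio_near j Fi e0). Qed.

Lemma F_pder c t w i j : L c -> nm w < 1 -> F (pl c t w) i != 0 ->
  exists a, pder (fun w => F (pl c t w) j / F (pl c t w) i) w a.
Proof.
move=> Lc w1 Fi; have [du _] := imf Lc ((disc_nm w).2 w1) (Fi : affine_dom i (f (ch_inv c (w, t)))).
have [j' ->|->] := unliftP i j.
  eexists; apply: pder_near (derivable_coord j' du).
  by apply: (@filterE _ (nbhs w)) => v; rewrite mxE.
exists 0; apply: pder_near (sder_pder (sder_cst 1 w)).
have := near_inv w1 (F_near i Fi ltr01) => h; have [r r0 hr] := near_prod_ball h.
by apply/nbhs_nm; exists r => // v /(nbhs_singleton hr)[_ [Fv _]]; rewrite divff.
Qed.

Lemma F_hol i j : hol_on L [set x | F x i != 0] (fun x => F x j / F x i).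
Proof.
move=> x Fi; have [c Lc hx] := chart_ex L x.
have cF : {for x, continuous (fun x => F x j / F x i)}.
  by apply/contP => e e0; apply: filterS (F_near j Fi e0) => y [].
apply: (hol_atI cF Lc hx (pder_near_sder _)).
have := near_plaque_at hx (F_near j Fi ltr01); apply: filterS => w [w1 [Fw _]].
exact: F_pder.
Qed.

Lemma F_immersion c x i : L c -> ch_dom c x -> F x i != 0 ->
  exists j a, a != 0 /\ pder (fun w => F (pl c (tc c x) w) j / F (pl c (tc c x) w) i) (zc c x) a.
Proof.
move=> Lc hx Fi.
have Fi' : F (pl c (tc c x) (zc c x)) i != 0 by rewrite pl_id.
have [du dn] := imf Lc ((disc_nm _).2 (zc_lt hx)) (Fi' : affine_dom i (f (ch_inv c (zc c x, tc c x)))).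
have [j' hj] : exists j', 'D_1 (fun w => affine i (f (ch_inv c (w, tc c x)))) (zc c x) 0 j' != 0.
  apply: contrapT => no; move/eqP: dn; apply; apply/rowP => j; rewrite [RHS]mxE.
  by apply/eqP/negPn/negP => h; apply: no; exists j.
exists (lift i j'); eexists; split; first exact: hj.
apply: pder_near (derivable_coord j' du).
by apply: (@filterE _ (nbhs (zc c x))) => v; rewrite mxE.
Qed.

Let nr x : R := Num.sqrt (\sum_i nm (F x i) ^+ 2).

Let nr_gt0 x : 0 < nr x.
Proof.
have [i Fi] := hcoord_neq0 (f x); rewrite sqrtr_gt0 (bigD1 i)//= ltr_pwDl//.
  by rewrite exprn_gt0// nm_gt0.
by apply: sumr_ge0 => j _; rewrite exprn_ge0// nm_ge0.
Qed.

(** The coordinates of a unit vector on the line [f x]: a discontinuous unitary trivialisation of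
    the tautological bundle. *)
Let FF x i : C := F x i / (nr x)%:C.

Let nrC x : (nr x)%:C != 0 :> C. Proof. by rewrite -nm_gt0 nm_real gtr0_norm. Qed.

Let FF_ratio x i j : FF x j / FF x i = F x j / F x i.
Proof.
have [Fi|Fi] := eqVneq (F x i) 0; first by rewrite /FF Fi mul0r invr0 !mulr0.
by rewrite /FF; have := nrC x => n; field; rewrite Fi n.
Qed.

Let FF_neq0 x i : (FF x i != 0) = (F x i != 0).
Proof. by rewrite /FF mulf_eq0 invr_eq0 (negbTE (nrC x)) orbF. Qed.

Let FF1 x : \sum_i FF x i * cj (FF x i) = 1.
Proof.
have E : \sum_i FF x i * cj (FF x i) = ((nr x ^+ 2)^-1 * \sum_i nm (F x i) ^+ 2)%:C.
  rewrite rmorphM rmorph_sum /= mulr_sumr; apply: eq_bigr => i _.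
  rewrite -nm_sqr /FF nmM nmV nm_real gtr0_norm// exprMn exprVn mulrC.
  by rewrite -rmorphM.
rewrite E /nr sqr_sqrtr ?mulVf ?rmorph1//; last by apply: sumr_ge0 => i _; rewrite exprn_ge0// nm_ge0.
by have := nr_gt0 x; rewrite /nr sqrtr_gt0 => /gt_eqF ->.
Qed.

(** [th] makes [th * FF] a holomorphic lift of [f]: it is a frame of the tautological bundle, dual
    to the hyperplane bundle, and [nm th] is the length of the lift. *)
Definition projective_frame (V : set X) (th : X -> C) : Prop :=
  [/\ open V, forall x, th x != 0 & forall i, hol_on L V (fun y => th y * FF y i)].

Let FFi x : exists i, FF x i != 0.
Proof. by have [i Fi] := hcoord_neq0 (f x); exists i; rewrite FF_neq0. Qed.

Let FFn x : \sum_i nm (FF x i) ^+ 2 = 1.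
Proof.
apply: (@complexI R); rewrite rmorph_sum rmorph1 /= -[RHS](FF1 x).
by apply: eq_bigr => i _; rewrite nm_sqr.
Qed.

(** At [x] the lift is scaled to have hermitian product 1 with the unit vector [FF x]. Its length is
    then at least 1 by Cauchy-Schwarz, with equality only on the line of [FF x], which the immersion
    excludes at other points nearby on the plaque. *)
Lemma projective_frames : frame_axioms L projective_frame.
Proof.
split; [exact: cX|exact: hX| | | | |].
- by move=> V th [].
- by move=> V th x [].
- move=> V th x [oV th0 hth] Vx.
  have E y : Num.sqrt (\sum_i nm (th y * FF y i) ^+ 2) = nm (th y).
    rewrite (eq_bigr (fun i => nm (th y) ^+ 2 * nm (FF y i) ^+ 2)); last by move=> i _; rewrite nmM exprMn.
    by rewrite -mulr_sumr FFn mulr1 sqrtr_sqr ger0_norm ?nm_ge0.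
  apply: cont_near (nearW _ E) _.
  apply: (@continuous_comp _ _ _ (fun y => \sum_i nm (th y * FF y i) ^+ 2) Num.sqrt); last exact: sqrt_continuous.
  have cs (s : seq 'I_N.+1) : {for x, continuous (fun y => \sum_(i <- s) nm (th y * FF y i) ^+ 2)}.
    elim: s => [|i s IH].
      by apply: cont_near (@cst_continuous _ _ (0 : R) x); apply: nearW => y; rewrite big_nil.
    have Ec : forall y, nm (th y * FF y i) ^+ 2 + \sum_(i <- s) nm (th y * FF y i) ^+ 2 =
      \sum_(i <- i :: s) nm (th y * FF y i) ^+ 2 by move=> y; rewrite big_cons.
    apply: cont_near (nearW _ Ec) _; apply: cvgD => //.
    apply: (@continuous_comp _ _ _ (fun y => nm (th y * FF y i)) (fun u => u ^+ 2)); last exact: exprn_continuous.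
    have [ci _] := hth i x Vx.
    exact: (@continuous_comp _ _ _ (fun y => th y * FF y i) nm x ci (@nm_continuous _ _)).
  exact: cs.
- move=> V V' th th' [oV th0 hth] [oV' th0' hth'] x [Vx V'x].
  have [i Fi] := FFi x.
  have n0 : th' x * FF x i != 0 by rewrite mulf_neq0.
  have h := @hol_at_div _ _ L (fun y => th y * FF y i) (fun y => th' y * FF y i) x n0 (hth i x Vx) (hth' i x V'x).
  apply: (hol_at_near _ h).
  have Fx : F x i != 0 by rewrite -FF_neq0.
  apply: filterS (F_near i Fx ltr01) => y [Fy _]; have t0 := th0' y.
  have g0 : FF y i != 0 by rewrite FF_neq0.
  by field; rewrite t0 g0.
move=> x; have [c Lc hx] := chart_ex L x; have [i0 Fi0] := FFi x.
have F0 : F x i0 != 0 by rewrite -FF_neq0.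
pose la y : C := \sum_i FF y i * cj (FF x i).
have la1 : la x = 1 by exact: FF1.
(* Pythagoras: the part of [FF y] orthogonal to [FF x]. *)
have key y : \sum_i nm (FF y i - la y * FF x i) ^+ 2 = 1 - nm (la y) ^+ 2.
  apply: (@complexI R); rewrite rmorphB rmorph1 rmorph_sum /= nm_sqr.
  have cla : cj (la y) = \sum_i FF x i * cj (FF y i).
    rewrite /la; elim/big_rec2: _ => [|i a b _ <-]; first exact: cj0.
    by rewrite cjD cjM cjK mulrC.
  have E i : (nm (FF y i - la y * FF x i) ^+ 2)%:C = FF y i * cj (FF y i) - cj (la y) * (FF y i * cj (FF x i))
      - la y * (FF x i * cj (FF y i)) + la y * cj (la y) * (FF x i * cj (FF x i)) :> C.
    by rewrite nm_sqr cjB cjM; ring.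
  rewrite (eq_bigr _ (fun i _ => E i)) big_split /= !sumrB -!mulr_sumr !FF1 -/(la y) -cla; ring.
have la_hol j y : F y j != 0 -> hol_at L (fun u => la u / FF u j) y.
  move=> Fj; apply: hol_at_near (hol_at_sum (index_enum _) (F := fun i u => F u i / F u j * cj (FF x i)) _).
    by apply: nearW => u; rewrite /la mulr_suml; apply: eq_bigr => i _; rewrite -FF_ratio mulrAC.
  by move=> i; apply: hol_atM; [exact: F_hol|exact: hol_at_cst].
pose V := [set y | la y != 0].
have oV : open V.
  rewrite openE => y ly; have [j Fj] := FFi y; have Fj' : F y j != 0 by rewrite -FF_neq0.
  have n0 : 0 < nm (la y / FF y j) by rewrite nm_gt0 mulf_neq0 ?invr_eq0.
  have [cl _] := la_hol j y Fj'.
  apply: filterS ((contP _ _).1 cl _ n0) => u; apply: contraTneq => ->.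
  by rewrite mul0r sub0r nmN ltxx.
pose th y : C := if la y == 0 then 1 else (la y)^-1.
have thE y : V y -> th y = (la y)^-1 by rewrite /V /th /= => /negbTE ->.
have Vx : V x by rewrite /V /= la1 oner_neq0.
have [j [a [a0 da]]] := F_immersion Lc hx F0.
have a2 : 0 < nm a / 2 by rewrite divr_gt0// nm_gt0.
have [d d0 hd] := da _ a2.
have nV : nbhs x V by exact: open_nbhs_nbhs.
have [d' d'0 hd'] := (nbhs_nm _ _).1 (near_plaque_at hx nV).
have [d2 d20 hd2] := (nbhs_nm _ _).1 (near_plaque_at hx (F_near i0 F0 ltr01)).
pose e := Num.min d (Num.min d' d2).
have e0 : 0 < e by rewrite !lt_min d0 d'0.
have [l1 l2 l3] : [/\ e <= d, e <= d' & e <= d2] by rewrite /e !ge_min !lexx !orbT.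
move: e e0 l1 l2 l3 => e e0 l1 l2 l3.
exists c, V, th, (e / 2); split.
- by [].
- split=> [|y|i y ly]; first exact: oV.
    by rewrite /th; case: ifPn => h; rewrite ?oner_neq0 ?invr_eq0.
  have [k Fk] := FFi y; have Fk' : F y k != 0 by rewrite -FF_neq0.
  have n0 : la y / FF y k != 0 by rewrite mulf_neq0 ?invr_eq0.
  have h := @hol_at_div _ _ L (fun u => F u i / F u k) (fun u => la u / FF u k) y n0 (F_hol i Fk') (la_hol k y Fk').
  apply: (hol_at_near _ h).
  have nVy : nbhs y V by exact: open_nbhs_nbhs.
  apply: filterS2 nVy (F_near i Fk' ltr01) => u lu [Fu _]; rewrite thE// -FF_ratio.
  have g0 : FF u k != 0 by rewrite FF_neq0.
  by field; rewrite g0 lu.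
- by rewrite divr_gt0.
- by rewrite thE// la1 invr1 nm1.
move=> w we; have we' : nm (w - zc c x) < e by flra.
have [w1 Vw] := hd' w (lt_le_trans we' l2); split=> // wz.
rewrite thE// nmV invf_gt1 ?nm_gt0// ltNge; apply/negP => la_ge.
set y := pl c (tc c x) w in Vw la_ge *.
have s0 : \sum_i nm (FF y i - la y * FF x i) ^+ 2 <= 0.
  by rewrite key subr_le0 expr_ge1 ?nm_ge0.
have par i : FF y i = la y * FF x i.
  apply/eqP; rewrite -subr_eq0 -nm_eq0 -sqrf_eq0 eq_le exprn_ge0 ?nm_ge0// andbT.
  apply: le_trans s0; rewrite (bigD1 i)//= lerDl sumr_ge0// => k _.
  by rewrite exprn_ge0// nm_ge0.
have E : F y j / F y i0 = F x j / F x i0.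
  rewrite -!FF_ratio !par; have x0 : FF x i0 != 0 by rewrite FF_neq0.
  by field; rewrite x0 Vw.
have := hd w (lt_le_trans we' l1); rewrite pl_id// -/y E subrr sub0r nmN nmM.
have n0 : 0 < nm (w - zc c x) by rewrite nm_gt0 subr_eq0.
have := mulr_gt0 a2 n0; flra.
Qed.

End ProjectiveFrames.
(** * A positive line bundle makes the lamination projective *)

Section PositiveProjective.
Context {R : realType} {X : topologicalType} (L : lamination R X).
Local Notation C := (Cplx R).
Variable fr : set X -> (X -> C) -> Prop.
Hypothesis H : frame_axioms L fr.

Lemma sec_ratio_hol d s t x : is_section L fr d s -> is_section L fr d t -> t x != 0 ->
  hol_at L (fun y => s y / t y) x.
Proof.
move=> hs ht tx; have [V [th [hf Vx]]] := frame_at H x.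
have n0 : t x * th x ^+ d != 0 by rewrite mulf_neq0// expf_neq0// (fx_th0 H _ hf).
have h := @hol_at_div _ _ L (fun y => s y * th y ^+ d) (fun y => t y * th y ^+ d) x n0 (hs V th hf x Vx) (ht V th hf x Vx).
apply: (hol_at_near _ h); apply: nearW => y.
have td := expf_neq0 d (fx_th0 H y hf); have [->|ty] := eqVneq (t y) 0; first by rewrite mul0r invr0 !mulr0.
by field; rewrite ty td.
Qed.

Lemma sec_neq0_near d s x : is_section L fr d s -> s x != 0 -> \forall y \near x, s y != 0.
Proof.
move=> hs sx; have [ci _] := sec_ratio_hol hs hs sx; have E1 : s x / s x = 1 by rewrite divff.
have h := (contP _ _).1 ci _ ltr01; rewrite E1 in h.
by apply: filterS h => y; apply: contraTneq => ->; rewrite mul0r sub0r nmN nm1 ltxx.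
Qed.

Definition leaf_coordinate (s t : X -> C) x := t x != 0 /\ exists c a,
  [/\ L c, ch_dom c x, a != 0 & lwd c (fun y => s y / t y) x a 0].

Definition nzv N (v : 'rV[C]_N.+1) (h : v != 0) : nzvec R N :=
  exist _ v (mem_set (h : [set v : 'rV[C]_N.+1 | v != 0] v)).

Section Map.
Variables (d N : nat) (s : 'I_N.+1 -> X -> C).
Hypothesis hs : forall i, is_section L fr d (s i).
Hypothesis s_imm : forall x, exists i j, leaf_coordinate (s i) (s j) x.

Let row x : 'rV[C]_N.+1 := \row_i s i x.

Let row0 x : row x != 0.
Proof.
have [i [j [sj _]]] := s_imm x; apply: contraNneq sj => r0.
have : row x 0 j = 0 by rewrite r0 mxE.
by rewrite mxE => ->.
Qed.

Definition section_map x : CP R N := \pi_(CP R N)%qT (nzv (row0 x)).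

Lemma section_mapE x : exists2 a : C, a != 0 & forall i, hcoord (section_map x) 0 i = a * s i x.
Proof.
have [a a0 E] := hcoord_pi (nzv (row0 x)); exists a => // i.
by rewrite E /= !mxE.
Qed.

Lemma section_map_ratio x i j : hcoord (section_map x) 0 j / hcoord (section_map x) 0 i = s j x / s i x.
Proof.
have [a a0 E] := section_mapE x; rewrite !E.
have [->|si] := eqVneq (s i x) 0; first by rewrite mulr0 invr0 !mulr0.
by field; rewrite si a0.
Qed.

(** The row of sections need not be continuous; multiplied by [th ^ d] it becomes a continuous lift
    of the same map. *)
Lemma section_map_continuous : continuous section_map.
Proof.
move=> x; have [V [th [hf Vx]]] := frame_at H x.
pose g y : 'rV[C]_N.+1 := \row_i (s i y * th y ^+ d).
have thd y : th y ^+ d != 0 by rewrite expf_neq0// (fx_th0 H _ hf).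
have g0 y : g y != 0.
  apply: contraNneq (row0 y) => gy; apply/eqP/rowP => i; rewrite [RHS]mxE mxE.
  have : g y 0 i = 0 by rewrite gy mxE.
  by rewrite mxE => /eqP; rewrite mulf_eq0 (negbTE (thd y)) orbF => /eqP.
pose G y : nzvec R N := nzv (g0 y).
have E y : \pi_(CP R N)%qT (G y) = section_map y.
  have cG : colinear (G y) (nzv (row0 y)).
    apply/asboolP; exists (th y ^+ d) => //=.
    by apply/rowP => i; rewrite !mxE mulrC.
  move: cG; rewrite -[colinear _ _]/(equiv (colinear_equiv R N) _ _) -eqmodE.
  by move=> /eqP.
have cg : g @ x --> g x.
  apply/(cvg_row (nbhs_filter x)) => j.
  rewrite mxE; have [cj_ _] := hs j hf Vx.
  have E2 : (fun y => g y 0 j) = (fun y => s j y * th y ^+ d) by apply/funext => y; rewrite mxE.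
  by rewrite E2.
have cG : {for x, continuous G}.
  move=> P; rewrite nbhsE; case=> O [[B oB EO] Bx] OP; rewrite -EO in Bx OP.
  have : \forall y \near x, B (g y) by apply: cg; exact: open_nbhs_nbhs.
  by apply: filterS => y By; apply: OP.
apply: cont_near (nearW _ E) _.
exact: continuous_comp cG (@pi_continuous _ _ _).
Qed.

(** If all the quotients [s j / s i] had zero derivative at the point, so would their quotients
    [s k / s l], contrary to the presence of a leaf coordinate among these. *)
Lemma section_map_immersion : leafwise_immersion L section_map.
Proof.
move=> c Lc t z i /disc_nm z1 Ai /=; set x := pl c t z.
have dx : ch_dom c x by exact: pl_dom.
have si : s i x != 0.
  have [a a0 E] := section_mapE x; apply: contraNneq Ai => s0.
  by rewrite -/(pl c t z) -/x E s0 mulr0.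
have hd j : exists a, lwd c (fun y => s j y / s i y) x a 0.
  by have [_ h] := sec_ratio_hol (hs j) (hs i) si; exact: h.
have /choice[a ha] := hd.
have hp j : pder (fun w => affine i (section_map (ch_inv c (w, t))) 0 j) z ((\row_j a (lift i j)) 0 j).
  rewrite mxE; have := ha (lift i j); rewrite /lwd tc_pl// zc_pl// => /sder_pder.
  apply: pder_near; apply: (@filterE _ (nbhs z)) => w.
  by rewrite mxE section_map_ratio.
have [du ->] := coord_derivable hp; split=> //.
apply/eqP => a0.
have aj j : a j = 0.
  have [j' ->|->] := unliftP i j.
    by have : (\row_j a (lift i j)) 0 j' = 0 by [rewrite a0 mxE]; rewrite mxE.
  have hc : lwd c (fun y => s i y / s i y) x 0 0.
    apply: lwd_near dx _ (sder_cst 1 _ : lwd c (fun=> 1) x 0 0).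
    by apply: filterS (sec_neq0_near (hs i) si) => y siy; rewrite divff.
  by have [] := sder_uniq (ha i) hc.
have [k [l [sl [c' [b [Lc' dx' b0 hb]]]]]] := s_imm x.
have hk := ha k; have hl := ha l; rewrite !aj in hk hl.
have n0 : s l x / s i x != 0 by rewrite mulf_neq0 ?invr_eq0.
have n0' : (fun w => s l (pl c (tc c x) w) / s i (pl c (tc c x) w)) (zc c x) != 0 by rewrite /= pl_id.
have hi : lwd c (fun y => (s l y / s i y)^-1) x _ _ := sder_comp hl (sder_inv n0').
have hm := lwdM dx hk hi.
have nsi : \forall y \near x, s k y / s i y * (s l y / s i y)^-1 = s k y / s l y.
  apply: filterS (sec_neq0_near (hs i) si) => y siy.
  have [->|sly] := eqVneq (s l y) 0; first by rewrite mul0r !invr0 !mulr0.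
  by field; rewrite siy sly.
have hq := lwd_change Lc' Lc dx' dx (lwd_near dx nsi hm).
have [E _] := sder_uniq hb hq.
by move: b0; rewrite E !(mul0r, mulr0, addr0, add0r, cj0) eqxx.
Qed.

End Map.

Lemma near_real_neq0 (T : R) (a : C) : 1 / 2 <= T -> nm (a - T%:C) <= 1 / 100 -> a != 0.
Proof.
move=> T2 ha; have nT : nm (T%:C : C) = T by rewrite nm_real ger0_norm//; flra.
by rewrite -nm_gt0; have := nm_split (T%:C : C) a; rewrite nT nmC; flra.
Qed.

(** The values and derivatives are those of perturbations of [T] and [T * u], whose Wronskian is
    [T ^ 2 >= 1 / 4]; the error is at most [1 / 100 + 2 / 25 + 2 / 25]. *)
Lemma wronskian_neq0 (T : R) (a b a' b' u : C) : 1 / 2 <= T -> T <= 1 ->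
  nm (a - T%:C) <= 1 / 100 -> nm (b - T%:C * u) <= 1 / 100 -> nm a' <= 1 / 25 -> nm (b' - T%:C) <= 1 / 25 ->
  nm u <= 1 -> b' * a - b * a' != 0.
Proof.
move=> T2 T1 ha hb ha' hb' u1.
have nT : nm (T%:C : C) = T by rewrite nm_real ger0_norm//; flra.
have TT : 1 / 4 <= T * T by nra.
have nTT : nm ((T * T)%:C : C) = T * T by rewrite nm_real ger0_norm//; flra.
have nA : nm a <= 2 by have := nm_split a T%:C; rewrite nT; flra.
have nB : nm b <= 2.
  have hT : nm (T%:C * u) <= 1 by rewrite nmM nT mulr_ile1 ?nm_ge0//; flra.
  have := nm_split b (T%:C * u); flra.
have h1 : nm (T%:C * (a - T%:C)) <= 1 / 100.
  by rewrite nmM nT -[leRHS]mul1r ler_pM ?nm_ge0//; flra.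
have h2 : nm ((b' - T%:C) * a) <= 1 / 25 * 2 by rewrite nmM ler_pM ?nm_ge0.
have h3 : nm (b * a') <= 2 * (1 / 25) by rewrite nmM ler_pM ?nm_ge0.
set E := T%:C * (a - T%:C) + (b' - T%:C) * a - b * a'.
have hE : nm E <= 1 / 100 + 1 / 25 * 2 + 2 * (1 / 25).
  by rewrite /E (le_trans (nmB _ _))// lerD// (le_trans (nmD _ _))// lerD.
have -> : b' * a - b * a' = (T * T)%:C + E by rewrite /E rmorphM; ring.
rewrite -nm_gt0.
have := nm_split ((T * T)%:C : C) ((T * T)%:C + E); rewrite opprD addNKr nmN nTT; flra.
Qed.

(** The peak data 1 and [w - a] give sections [e] and [z] whose quotient approximates the leaf
    coordinate; on the half disc Cauchy estimates control the derivatives as well. *)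
Lemma peak_coordinate k : is_peak L fr setT k -> exists d0, forall d, (d0 <= d)%N ->
  exists e z, [/\ is_section L fr d e, is_section L fr d z &
    forall t w, 1 / 2 <= k_tau k t -> nm (w - k_a k) <= k_r k / 2 ->
      leaf_coordinate z e (pl (k_ch k) t w)].
Proof.
move=> pk; have [[Lk hf r0 C0 [_ b01]] [_ tau01 _] [r' rr hV] _ hs] := pk.
have hrk : k_r k / 2 <= k_r k by flra.
have hr2 t : k_tau k t != 0 -> k_r k / 2 <= 1.
  move=> tn; have E1 : nm (k_a k - k_a k) <= r' by rewrite subrr nm0 ltW// (lt_trans r0).
  have [ha _] := hV t (k_a k) tn E1.
  have E2 : nm (k_a k + (k_r k)%:C - k_a k) = k_r k by rewrite addrC addKr nm_real gtr0_norm.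
  have E3 : nm (k_a k + (k_r k)%:C - k_a k) <= r' by rewrite E2 ltW.
  have [hb _] := hV t (k_a k + (k_r k)%:C) tn E3.
  by have := nmB (k_a k + (k_r k)%:C) (k_a k); rewrite E2; flra.
(* This makes both the error [ep] and [ep / k_r k] at most [1 / 100], hence the Cauchy bound
   [4 * ep / k_r k] at most [1 / 25]. *)
have m0 : 0 < Num.min 1 (k_r k) / 100 by rewrite divr_gt0// lt_min ltr01.
have [n hn] := exprn_small (k_C k) b01 m0; have /andP[b0 b1] := b01.
exists (maxn n (k_d k)) => d; rewrite geq_max => /andP[nd dd].
have [ep [ep0 ep1 epr hep]] : exists ep : R, [/\ 0 <= ep, ep <= 1 / 100, ep / k_r k <= 1 / 100 & k_C k * k_b k ^+ d <= ep].
  exists (k_C k * k_b k ^+ d).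
  have h : k_C k * k_b k ^+ d <= Num.min 1 (k_r k) / 100.
    rewrite mulrC; apply: le_trans (ltW hn); rewrite ler_wpM2r ?(ltW C0)//.
    by rewrite ler_wiXn2l ?(ltW b1).
  have h1 : Num.min 1 (k_r k) <= 1 by rewrite ge_min lexx.
  have h2 : Num.min 1 (k_r k) <= k_r k by rewrite ge_min lexx orbT.
  split=> //; first by rewrite mulr_ge0 ?(ltW C0) ?exprn_ge0.
    by flra.
  by rewrite ler_pdivrMr//; flra.
have q25 : 4 * ep / k_r k <= 1 / 25 by move: epr; rewrite -mulrA; flra.
have [||e [he _ ee]] := hs d (fun=> 1) dd.
- by move=> w; exists 0; exact: sder_cst.
- by move=> w _; rewrite nm1.
have [||z [hz _ ze]] := hs d (fun w => w - k_a k) dd.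
- by move=> w; exists (1 - 0); apply: sder_eq (sderB (sder_id w) (sder_cst _ w)) _ _; rewrite ?subr0.
- by [].
exists e, z; split=> // t w ht wr; have /andP[_ t1] := tau01 t.
have tn := half_le_neq0 ht; pose T := k_tau k t.
have [r1 rr1 hA] := peak_holb pk he ht; have [r2 rr2 hB] := peak_holb pk hz ht.
set A := (fun w => e _ * _) in hA; set B := (fun w => z _ * _) in hB.
have wr1 := le_trans wr hrk; have w_r1 := le_lt_trans wr1 rr1; have w_r2 := le_lt_trans wr1 rr2.
have [w1 Vw] := hV t w tn (le_trans wr1 (ltW rr)).
have eA u : nm (u - k_a k) <= k_r k -> nm (A u - (T%:C + 0 * (u - k_a k))) <= ep.
  by move=> ur; rewrite mul0r addr0 -[T%:C]mulr1; apply: le_trans hep; exact: ee.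
have eB u : nm (u - k_a k) <= k_r k -> nm (B u - (0 + T%:C * (u - k_a k))) <= ep.
  by move=> ur; rewrite add0r; apply: le_trans hep; exact: ze.
have dA := cauchy_affine r0 rr1 hA eA wr; have dB := cauchy_affine r0 rr2 hB eB wr.
rewrite subr0 in dA.
have dA' := le_trans dA q25; have dB' := le_trans dB q25; have ur := le_trans wr (hr2 t tn).
have Aw := eA w wr1; rewrite mul0r addr0 in Aw.
have Bw := eB w wr1; rewrite add0r in Bw.
have A0 : A w != 0 := near_real_neq0 ht (le_trans Aw ep1).
have ew : e (pl (k_ch k) t w) != 0 by apply: contraNneq A0 => h; rewrite /A h mul0r.
split=> //.
have dAs := hol_sder hA w_r1; have dBs := hol_sder hB w_r2.
have hq := sderM dBs (sder_comp dAs (sder_inv A0)).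
pose b := (cD B w * A w - B w * cD A w) / A w ^+ 2.
have bE : cD B w * (A w)^-1 + B w * (- A w ^- 2 * cD A w + 0 * cj 0) = b.
  by rewrite mul0r addr0 /b; field.
exists (k_ch k), b; split=> //; first exact: pl_dom.
  rewrite /b mulf_neq0 ?invr_eq0 ?expf_neq0//.
  by apply: (wronskian_neq0 (T := T) (u := w - k_a k) ht t1 (le_trans Aw ep1) (le_trans Bw ep1) dA' dB' ur).
rewrite /lwd tc_pl// zc_pl//.
have Eq : \forall u \near w, B u * (A u)^-1 = z (pl (k_ch k) t u) / e (pl (k_ch k) t u).
  apply: (@filterE _ (nbhs w)) => u; rewrite /B /A.
  have td := expf_neq0 d (fx_th0 H (pl (k_ch k) t u) hf).
  have [->|eu] := eqVneq (e (pl (k_ch k) t u)) 0; first by rewrite mul0r invr0 !mulr0.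
  by field; rewrite eu td.
apply: sder_near Eq (sder_eq hq bE _).
by rewrite !(mul0r, mulr0, addr0, add0r).
Qed.

End PositiveProjective.

(** * Separation of points *)

Section PositiveEmbedding.
Context {R : realType} {X : topologicalType} {L : lamination R X}.
Local Notation C := (Cplx R).
Context {fr : set X -> (X -> C) -> Prop}.
Hypothesis H : frame_axioms L fr.

(** After multiplication by [Q ^ d], the norm is at least [3 / 4] at [x], where the peak datum is 1,
    and at most [1 / 4] at [y]. *)
Lemma peak_separates x y (O : set X) : nbhs x O -> ~ O y ->
  exists d0, forall d, (d0 <= d)%N -> exists2 s, is_section L fr d s & nm (s y) < nm (s x).
Proof.
move=> nO nOy; have [k [[[_ _ r0 C0 [Q0 b01]] [_ _ _] _ hQ hs] dx tx ax]] := peak_exists H nO.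
have e0 : 0 < 1 / 4 :> R by rewrite divr_gt0.
have [n hn] := exprn_small (k_C k) b01 e0; have /andP[b0 b1] := b01.
exists (maxn n (k_d k)) => d; rewrite geq_max => /andP[nd dd].
have hd : k_C k * k_b k ^+ d <= 1 / 4.
  rewrite mulrC; apply: le_trans (ltW hn); rewrite ler_wpM2r ?(ltW C0)//.
  by rewrite ler_wiXn2l ?(ltW b1).
have [||s [hsec sO sx]] := hs d (fun=> 1) dd.
- by move=> w; exists 0; exact: sder_cst.
- by move=> w _; rewrite nm1.
have t0 : k_tau k (tc (k_ch k) x) != 0 by rewrite tx oner_neq0.
have zr : nm (zc (k_ch k) x - k_a k) <= k_r k by rewrite ax subrr nm0 ltW.
have := hQ _ _ t0 zr; have := sx _ _ t0 zr; rewrite pl_id// tx mulr1 => sx1 Qx.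
exists s => //; have sy := le_trans (sO y nOy) hd.
have Qd : 0 < k_Q k ^+ d by rewrite exprn_gt0.
rewrite -(ltr_pM2r Qd); apply: (le_lt_trans sy).
have h1 : nm (s x * k_th k x ^+ d) <= nm (s x) * k_Q k ^+ d.
  by rewrite nmM nmX ler_wpM2l ?nm_ge0// lerXn2r ?nnegrE ?nm_ge0 ?(ltW Q0).
apply: lt_le_trans h1; move: (le_trans sx1 hd) => {}sx1.
have := nm_split (1 : C) (s x * k_th k x ^+ d); rewrite nm1 nmC; flra.
Qed.

Lemma local_coordinates (x : X) : exists p : nat * set X, nbhs x p.2 /\ forall d, (p.1 <= d)%N ->
  exists q : (X -> C) * (X -> C), [/\ is_section L fr d q.1, is_section L fr d q.2 &
    forall y, p.2 y -> leaf_coordinate L q.1 q.2 y].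
Proof.
have [k [pk dx tx ax]] := peak_exists H (@filterT _ (nbhs x) _ : nbhs x setT).
have [d0 h] := peak_coordinate H pk.
exists (d0, [set y | [/\ ch_dom (k_ch k) y, 1 / 2 <= k_tau k (tc (k_ch k) y) & nm (zc (k_ch k) y - k_a k) <= k_r k / 2]]).
split=> /= [|d /h[e [z [he hz hl]]]]; last first.
  by exists (z, e); split=> //= y [dy ty zy]; rewrite -(pl_id dy); exact: hl.
have [[_ _ r0 _ _] [ct _ _] _ _ _] := pk.
have r2 : 0 < k_r k / 2 by rewrite divr_gt0.
have hz' := (contP _ _).1 (zc_continuous dx) _ r2.
have ht' : \forall y \near x, `|k_tau k (tc (k_ch k) y) - 1| < 1 / 2.
  have c1 : {for x, continuous (k_tau k \o tc (k_ch k))} := continuous_comp (tc_continuous dx) (ct _).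
  have l2 : 0 < 1 / 2 :> R by rewrite divr_gt0.
  by have := (cvgR (nbhs_filter x) _ _).1 c1 _ l2; rewrite /= tx.
apply: filterS3 (near_dom dx) hz' ht' => y dy zy ty; split=> //; last by rewrite ax ltW.
by move: ty; rewrite ltr_norml => /andP[? _]; flra.
Qed.

(** Only norms of sections compare between two points. With [s1] larger at [x] and [s2] larger at
    [y], proportional coordinates would make the ratio of the two scaling factors both less and
    greater than 1 in modulus. *)
Lemma positive_projective : projective L.
Proof.
move=> x y xy.
have [Ox [Oy [[nx ny] dxy]]] : exists A B : set X, [/\ nbhs x A /\ nbhs y B & A `&` B = set0].
  have := fx_haus H; rewrite open_hausdorff => hX; have /hX[[A B] /= [Ax By] [oA oB AB]] : x != y by exact/eqP.
  exists A, B; split; last exact/eqP.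
  by split; apply: open_nbhs_nbhs; split=> //; exact/set_mem.
have nOxy : ~ Ox y by move=> h; have : (Ox `&` Oy) y by [split=> //; exact: nbhs_singleton]; rewrite dxy.
have nOyx : ~ Oy x by move=> h; have : (Ox `&` Oy) x by [split=> //; exact: nbhs_singleton]; rewrite dxy.
have [dx hdx] := peak_separates nx nOxy; have [dy hdy] := peak_separates ny nOyx.
have /choice[u hu] := local_coordinates.
have [ps hps] := finite_cover (fx_compact H) (fun p _ => (hu p).1).
pose d := maxn (maxn dx dy) (\max_(p <- ps) (u p).1).
have [|s1 hs1 lt1] := hdx d; first by rewrite /d -maxnA leq_maxl.
have [|s2 hs2 lt2] := hdy d; first by rewrite /d (maxnC dx) -maxnA leq_maxl.
have hq p : exists q : (X -> C) * (X -> C), p \in ps -> [/\ is_section L fr d q.1, is_section L fr d q.2 &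
    forall y, (u p).2 y -> leaf_coordinate L q.1 q.2 y].
  have [pps|_] := boolP (p \in ps); last by exists (s1, s1).
  have dp : ((u p).1 <= d)%N by rewrite /d leq_max (leq_bigmax_seq (F := fun p => (u p).1))// orbT.
  by have [q Hq] := (hu p).2 d dp; exists q.
have /choice[q {}hq] := hq.
pose N := ((size ps).*2).+1.
(* The coordinates 0 and 1 separate [x] from [y]; then come the pairs of local coordinates of the
   finite cover, numerators at even and denominators at odd places. *)
pose s n : X -> C := if n is n'.+2 then
    if odd n' then (q (nth x ps n'./2)).2 else (q (nth x ps n'./2)).1
  else if n == 0 then s1 else s2.
have hs (i : 'I_N.+1) : is_section L fr d (s i).
  case: i => -[|[|n]] //= hn; have nps : nth x ps n./2 \in ps.
    by apply: mem_nth; rewrite ltn_half_double.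
  by have [] := hq _ nps; case: ifP.
have s_imm z : exists i j : 'I_N.+1, leaf_coordinate L (s i) (s j) z.
  have [p [pps _ zp]] := hps z I.
  have l1 : ((index p ps).*2.+2 < N.+1)%N by rewrite /N !ltnS ltn_double index_mem.
  have l2 : ((index p ps).*2.+3 < N.+1)%N by rewrite /N !ltnS -doubleS leq_double index_mem.
  exists (Ordinal l1), (Ordinal l2); rewrite /s /= odd_double /= doubleK uphalf_double nth_index//.
  by have [_ _] := hq p pps; exact.
exists N, (section_map (s := fun i : 'I_N.+1 => s i) s_imm); split.
- exact: (@section_map_continuous R X L fr H d N (fun i => s i) hs s_imm).
- exact: (@section_map_immersion R X L fr H d N (fun i => s i) hs s_imm).
move=> E; have [a a0 Ea] := section_mapE s_imm x; have [b b0 Eb] := section_mapE s_imm y.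
have lN : (1 < N.+1)%N by [].
have := Ea ord0; have := Ea (Ordinal lN); rewrite E Eb Eb /= => E2 E1.
have na : 0 < nm a by rewrite nm_gt0.
have nb : 0 < nm b by rewrite nm_gt0.
have e1 : nm b * nm (s1 y) = nm a * nm (s1 x) by rewrite -!nmM E1.
have e2 : nm b * nm (s2 y) = nm a * nm (s2 x) by rewrite -!nmM E2.
have ba : nm a < nm b.
  have s1x : 0 < nm (s1 y).
    rewrite lt_def nm_ge0 andbT; apply/eqP => z0; move: e1 lt1; rewrite z0 mulr0 => /esym/eqP.
    by rewrite mulf_eq0 gt_eqF//= => /eqP ->; rewrite ltxx.
  by rewrite -(ltr_pM2r s1x) e1 ltr_pM2l.
have ab : nm b < nm a.
  have s2y : 0 < nm (s2 x).
    rewrite lt_def nm_ge0 andbT; apply/eqP => z0; move: e2 lt2; rewrite z0 mulr0 => /eqP.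
    by rewrite mulf_eq0 gt_eqF//= => /eqP ->; rewrite ltxx.
  by rewrite -(ltr_pM2r s2y) -e2 ltr_pM2l.
by have := lt_trans ab ba; rewrite ltxx.
Qed.

End PositiveEmbedding.
(** Projectivity delivers a map only from a pair of distinct points; a plaque supplies one. *)
Lemma two_points {R : realType} {X : topologicalType} (L : lamination R X) (x : X) :
  exists y z : X, y <> z.
Proof.
have [c Lc dx] := chart_ex L x.
have h0 : nm (0 : Cplx R) < 1 by rewrite nm0.
have h2 : nm ((1 / 2)%:C : Cplx R) < 1 by rewrite nm_real ger0_norm; flra.
exists (pl c (tc c x) 0), (pl c (tc c x) (1 / 2)%:C) => /(congr1 (zc c)).
by rewrite (zc_pl _ h0) (zc_pl _ h2) => -[]; flra.
Qed.

Theorem mainTheorem5 (R : realType) (X : topologicalType)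
    (L : lamination R X) :
  compact [set: X] -> hausdorff_space X ->
  ~ (exists g : R -> X, vanishing_cycle L g) ->
  projective L <->
  exists (D : set X) (m : X -> nat),
    is_divisor L D m /\ forall x : X, leaf L x `&` D !=set0.
Proof.
move=> cX hX _; split=> [pL|[D [m [hD DL]]]]; last first.
  by have [fr H] := divisor_positive cX hX hD DL; exact: positive_projective H.
(* On an empty space the empty divisor does. *)
have [[x _]|X0] := pselect ([set: X] !=set0); last first.
  have nX (x : X) : False by apply: X0; exists x.
  exists set0, (fun=> 0%N); split; last by move=> x; have := nX x.
  by split=> // x; have := nX x.
have [y [z yz]] := two_points L x; have [N [f [cf imf _]]] := pL y z yz.
exact: positive_divisor (projective_frames cX hX cf imf).
Qed.
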